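(* Let $d\ge2$ and let $\underline{\mathcal V}$ be an unscaled wave profile with $\underline{\mathcal V}\cdot\underline{\mathcal V}_x\not\equiv0$. Assume that $\delta_{(4,0,0)}\neq0$ and $\delta_{(3,0,1)}^2=4\,\delta_{(4,0,0)}\,\delta_{(2,0,2)}$. If $$\delta_{(2,1,1)}\,\delta_{(4,0,0)}-\frac12\,\delta_{(3,1,0)}\,\delta_{(3,0,1)}\neq0,$$ then the corresponding wave is spectrally unstable.
   Context: Let $\kappa,W:[0,\infty)\to\mathbb R$ be smooth with $\kappa$ positive and bounded away from $0$, and $J=\begin{pmatrix}0&1\\-1&0\end{pmatrix}$. For $U=U(t,x,y)\in\mathbb R^2$, $(x,y)\in\mathbb R\times\mathbb R^{d-1}$, consider $\partial_tU=J\,\delta\mathscr H_0[U]$ with $\mathscr H_0[U]=\frac12\kappa(\|U\|^2)\|\nabla U\|^2+W(\|U\|^2)$. For a functional density $\mathcal A(U,\nabla U)$, $\delta\mathcal A=\nabla_U\mathcal A-\mathrm{div}(\nabla_{\nabla U}\mathcal A)$ and $\mathrm{Hess}\,\mathcal A$ is the linearization of $\delta\mathcal A$. Set $\mathscr M[U]=\frac12\|U\|^2$, $\mathscr Q_1[U]=\frac12JU\cdot\partial_xU$. Unscaled wave profiles: given $(\omega_\phi,c_x)$, a smooth $\mathcal V:\mathbb R\to\mathbb R^2$, function of $x$, with $\delta(\mathscr H_0-\omega_\phi\mathscr M+c_x\mathscr Q_1)[\mathcal V]=0$ and $\mathcal V(\cdot+X_x)=e^{\xi_\phi J}\mathcal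 V$; when $\mathcal V\cdot\mathcal V_x\not\equiv0$, $X_x$ is the fundamental period of $\|\mathcal V\|^2$ and $\xi_\phi=\int_0^{X_x}\|\mathcal V\|^{-2}J\mathcal V\cdot\mathcal V_x$. Constants of integration: $\mu_\phi=\kappa(\|\mathcal V\|^2)J\mathcal V\cdot\mathcal V_x+\frac{c_x}2\|\mathcal V\|^2$, $\mu_x=\frac12\kappa(\|\mathcal V\|^2)\|\mathcal V_x\|^2-W(\|\mathcal V\|^2)+\frac{\omega_\phi}2\|\mathcal V\|^2$. Up to rotations and translations, nearby profiles are smoothly parametrized by $(\omega_\phi,c_x,\mu_\phi,\mu_x)$. With $k_x=1/X_x$, $k_\phi=\xi_\phi/X_x$, the scaled $1$-periodic profile $\mathcal U$ is given by $\mathcal V(x)=e^{k_\phi xJ}\mathcal U(k_xx)$. With $\mathscr H[V]=\mathscr H_0(V,(\underline k_x\partial_x+\underline k_\phi J)V,\nabla_yV)-\underline\omega_\phi\mathscr M[V]+\underline c_x\mathscr Q_1(V,(\underline k_x\partial_x+\underline k_\phi J)V)$, let $\mathcal L=J\,\mathrm{Hess}\,\mathscr H[\underline{\mathcal U}]$ on $L^2(\mathbb R^d;\mathbb C^2)$; the wave is spectrally unstable if the spectrum of $\mathcal L$ contains points of positive real part. Polynomial $\Delta_0$: $\Delta_0(\lambda,z,\zeta)=\det\big(\lambda\Sigma_t-z\,\mathrm I_4+\frac{\zeta^2}{\lambda}\Sigma_y\big)$, a real homogeneous polynomial of degree $4$ (extended by continuity to $\lambda=0$), where, with evaluation at the parameters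 of $\underline{\mathcal V}$, $\Sigma_t$ is the Jacobian matrix with respect to $(\omega_\phi,c_x,\mu_\phi,\mu_x)$ of $\big(\xi_\phi,\;X_x,\;\int_0^{X_x}\mathscr M[\mathcal V],\;\int_0^{X_x}\mathscr Q_1[\mathcal V]\big)^{\sf T}$ and $$\Sigma_y=\begin{pmatrix}0&0&0&0\\ 0&0&0&0\\ \sigma_1&-\sigma_2&0&0\\ \sigma_2&-\sigma_3&0&0\end{pmatrix},\quad\sigma_1=\int_0^{\underline X_x}\kappa(\|\underline{\mathcal V}\|^2)\|\underline{\mathcal V}\|^2,\ \sigma_2=\int_0^{\underline X_x}\kappa(\|\underline{\mathcal V}\|^2)J\underline{\mathcal V}\cdot\underline{\mathcal V}_x,\ \sigma_3=\int_0^{\underline X_x}\kappa(\|\underline{\mathcal V}\|^2)\|\underline{\mathcal V}_x\|^2 .$$ The coefficients $\delta_{(m,n,p)}$ are defined by $$\Delta_0(\lambda,z,\zeta)=\sum_{0\le m,n,p\le4,\ m+n+p=4,\ p\le m}\delta_{(m,n,p)}\,\lambda^{m-p}z^n\zeta^{2p}.$$ *)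

(* Defs.v *)
From HB Require Import structures.
From mathcomp Require Import all_boot all_order all_algebra.
From mathcomp Require Import complex.
From mathcomp Require Import all_classical all_reals all_analysis.
Set Implicit Arguments.
Unset Strict Implicit.
Unset Printing Implicit Defensive.
Import Order.TTheory GRing.Theory Num.Theory.
Import numFieldNormedType.Exports.

Local Open Scope classical_set_scope.
Local Open Scope ring_scope.

Section Smooth.
Context {R : realType} {E F : normedModType R}.

(* All iterated directional derivatives: for finite-dimensional [E] and open [D]
   this is C^k on [D] in the usual sense. *)
Fixpoint Ck_on (D : set E) (k : nat) (f : E -> F) : Prop :=
  (forall x, D x -> {for x, continuous f}) /\
  if k is k'.+1 then
    forall v : E, (forall x, D x -> derivable f x v) /\ Ck_on D k' ('D_v f)
  else True.

Definition smooth_on (D : set E) (f : E -> F) : Prop := forall k, Ck_on D k f.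

End Smooth.

(* Smoothness on [0, +oo[ up to the boundary; by Seeley's extension theorem this
   is the same as having one-sided derivatives of all orders at 0. *)
Definition smooth_half_line (R : realType) (f : R -> R) : Prop :=
  exists2 g : R -> R, smooth_on setT g & forall s, 0 <= s -> f s = g s.

Lemma sigma_finite_product (R : realType) d1 d2 (T1 : measurableType d1)
    (T2 : measurableType d2) (m1 : {sigma_finite_measure set T1 -> \bar R})
    (m2 : {sigma_finite_measure set T2 -> \bar R}) :
  sigma_finite setT (m1 \x m2)%E.
Proof.
have /sigma_finiteP[F [TF ndF Foo]] := sigma_finiteT m1.
have /sigma_finiteP[G [TG ndG Goo]] := sigma_finiteT m2.
exists (fun n => F n `*` G n).
  rewrite -setXTT TF TG predeqE => -[x y]; split.
    move=> [/= [n _ Fnx] [k _ Gky]]; exists (maxn n k) => //; split.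
    - by move: x Fnx; exact/subsetPset/ndF/leq_maxl.
    - by move: y Gky; exact/subsetPset/ndG/leq_maxr.
  by move=> [n _ []/= ? ?]; split; exists n.
move=> k; have [? ?] := Foo k; have [? ?] := Goo k.
split; first exact: measurableX.
by rewrite product_measure1E// lte_mul_pinfty// ge0_fin_numE.
Qed.

Section PowerMeasure.
Context (R : realType) d (T : measurableType d).
Variable m1 : {sigma_finite_measure set T -> \bar R}.

Definition tuple_cons n (p : T * n.-tuple T) : n.+1.-tuple T :=
  [tuple of p.1 :: p.2].

Lemma measurable_tuple_cons n : measurable_fun setT (@tuple_cons n).
Proof. exact: measurable_cons. Qed.

Section Step.
Context (n : nat) (mu : {sigma_finite_measure set (n.-tuple T) -> \bar R}).

Definition power_step : set (n.+1.-tuple T) -> \bar R :=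
  pushforward (m1 \x mu)%E (@tuple_cons n).

Let measurable_preimage_cons (A : set (n.+1.-tuple T)) :
  measurable A -> measurable (@tuple_cons n @^-1` A).
Proof.
by move=> mA; rewrite -[X in measurable X]setTI; exact: measurable_tuple_cons.
Qed.

Let power_step0 : power_step set0 = 0%E.
Proof. by rewrite /power_step /pushforward preimage_set0 measure0. Qed.

Let power_step_ge0 A : (0 <= power_step A)%E.
Proof. by rewrite /power_step /pushforward; exact: measure_ge0. Qed.

Let power_step_additive : semi_sigma_additive power_step.
Proof.
move=> F mF tF mUF; rewrite /power_step /pushforward preimage_bigcup.
apply: measure_semi_sigma_additive.
- by move=> k; exact: measurable_preimage_cons.
- apply/trivIsetP => /= i j _ _ ij; rewrite -preimage_setI.
  by move/trivIsetP : tF => /(_ _ _ _ _ ij) ->//; rewrite preimage_set0.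
- by rewrite -preimage_bigcup; exact: measurable_preimage_cons.
Qed.

HB.instance Definition _ := isMeasure.Build _ _ _ power_step
  power_step0 power_step_ge0 power_step_additive.

Let power_step_sigma_finite : sigma_finite setT power_step.
Proof.
have [F TF Foo] := sigma_finite_product m1 mu.
pose un (t : n.+1.-tuple T) : T * n.-tuple T :=
  (tnth t ord0, [tuple of behead t]).
have consK : cancel (@tuple_cons n) un.
  by move=> [x t]; rewrite /un /tuple_cons /=; congr (_, _); apply/val_inj.
have mun : measurable_fun setT un.
  apply/measurable_fun_pairP; split => /=.
    exact: measurable_tnth.
  exact: measurable_behead.
exists (fun k => un @^-1` F k).
  by rewrite -preimage_bigcup -TF preimage_setT.
move=> k; have [mF Fk] := Foo k; split.
  by rewrite -[X in measurable X]setTI; exact: mun.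
rewrite /power_step /pushforward -comp_preimage.
by rewrite (_ : un \o _ = id)// funeqE => p /=; rewrite consK.
Qed.

HB.instance Definition _ := Measure_isSigmaFinite.Build _ _ _ power_step
  power_step_sigma_finite.

End Step.

Fixpoint power_measure n : {sigma_finite_measure set (n.-tuple T) -> \bar R} :=
  if n is n'.+1 then power_step (power_measure n')
  else dirac ([tuple] : 0.-tuple T).

End PowerMeasure.

(* The factors carry the Borel sigma-algebra of [R]. *)
Definition lebesgue_Rn (R : realType) (n : nat) :
    {sigma_finite_measure set (n.-tuple (measurableTypeR R)) -> \bar R} :=
  power_measure (@lebesgue_measure R) n.

Definition row_of (R : realType) n (t : n.-tuple R) : 'rV[R]_n :=
  \row_i tnth t i.

Section Densities.
Context {R : realType}.

Definition Jmx : 'M[R]_2 :=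
  \matrix_(i < 2, j < 2) (((i == 0) && (j == 1))%:R - ((i == 1) && (j == 0))%:R).

(* e^{tJ}, in closed form since J^2 = -1. *)
Definition expJ (t : R) : 'M[R]_2 := (cos t)%:M + sin t *: Jmx.

Definition dotp (u v : 'cV[R]_2) : R := \sum_i u i 0 * v i 0.
(* Squared Euclidean norms; the library's norm on matrices is the sup norm. *)
Definition sqn (u : 'cV[R]_2) : R := dotp u u.

Section Dim.
Context {n : nat}.

(* The space variable is a row vector (x, y) in R^(1+n), x being the coordinate
   of index 0. A density is a function A(U, P), where column j of P stands for
   the partial derivative of U with respect to the j-th space variable. *)
Definition density := 'cV[R]_2 -> 'M[R]_(2, n.+1) -> R.

Definition field := 'rV[R]_n.+1 -> 'cV[R]_2.

Definition sqn_grad (P : 'M[R]_(2, n.+1)) : R := \sum_i \sum_j P i j ^+ 2.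

Definition H0 (kappa W : R -> R) : density := fun U P =>
  2^-1 * kappa (sqn U) * sqn_grad P + W (sqn U).
Definition Mass : density := fun U _ => 2^-1 * sqn U.
Definition Q1 : density := fun U P => 2^-1 * dotp (Jmx *m U) (col ord0 P).

Definition grad (U : field) (x : 'rV[R]_n.+1) : 'M[R]_(2, n.+1) :=
  \matrix_(i, j) ('D_(delta_mx 0 j) U x) i 0.

Definition div (G : 'rV[R]_n.+1 -> 'M[R]_(2, n.+1)) (x : 'rV[R]_n.+1) :
  'cV[R]_2 := \col_i \sum_j ('D_(delta_mx 0 j) G x) i j.

Definition dU (A : density) (U : 'cV[R]_2) (P : 'M[R]_(2, n.+1)) : 'cV[R]_2 :=
  \col_i 'D_(delta_mx i 0) (A ^~ P) U.
Definition dP (A : density) (U : 'cV[R]_2) (P : 'M[R]_(2, n.+1)) :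
  'M[R]_(2, n.+1) := \matrix_(i, j) 'D_(delta_mx i j) (A U) P.

Definition variational_derivative (A : density) (U : field) : field := fun x =>
  dU A (U x) (grad U x) - div (fun y => dP A (U y) (grad U y)) x.

Definition Hess (A : density) (U v : field) : field := fun x =>
  derive1 (fun s : R => variational_derivative A (fun y => U y + s *: v y) x) 0.

Definition plane (V : R -> 'cV[R]_2) : field := fun x => V (x 0 ord0).

End Dim.

Definition nonconstant_modulus (V : R -> 'cV[R]_2) : Prop :=
  exists x, dotp (V x) (derive1 V x) != 0.

Definition fundamental_period (f : R -> R) (X : R) : Prop :=
  [/\ 0 < X, forall x, f (x + X) = f x
    & forall T, 0 < T -> (forall x, f (x + T) = f x) -> X <= T].

Definition period_integral (X : R) (f : R -> R) : R :=
  \int[lebesgue_measure]_(x in `[0, X]) f x.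

Definition is_profile (kappa W : R -> R) (omega c : R) (V : R -> 'cV[R]_2)
    (X xi : R) : Prop :=
  [/\ smooth_on setT V,
      forall x, variational_derivative (n := 0)
        (fun U P => H0 kappa W U P - omega * Mass U P + c * Q1 U P)
        (plane V) x = 0,
      0 < X,
      forall x, V (x + X) = expJ xi *m V x
    & nonconstant_modulus V ->
        fundamental_period (fun x => sqn (V x)) X /\
        xi = period_integral X
               (fun x => (sqn (V x))^-1 * dotp (Jmx *m V x) (derive1 V x))].

Definition has_constants (kappa W : R -> R) (omega c muphi mux : R)
    (V : R -> 'cV[R]_2) : Prop :=
  forall x,
    muphi = kappa (sqn (V x)) * dotp (Jmx *m V x) (derive1 V x)
            + c / 2 * sqn (V x) /\
    mux = 2^-1 * kappa (sqn (V x)) * sqn (derive1 V x) - W (sqn (V x))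
          + omega / 2 * sqn (V x).

Definition params (omega c muphi mux : R) : 'rV[R]_4 :=
  \row_j nth 0 [:: omega; c; muphi; mux] j.

(* A smooth local section of the set of profiles modulo rotations and
   translations. Period, phase shift and the integrals of M and Q_1 over a period
   are invariant under these symmetries, so that their derivatives at a point of
   D depend only on the profile at that point and not on the section. *)
Definition smooth_profile_family (kappa W : R -> R) (D : set 'rV[R]_4)
    (V : 'rV[R]_4 -> R -> 'cV[R]_2) (X xi : 'rV[R]_4 -> R) : Prop :=
  [/\ open D,
      smooth_on (D `*` setT) (fun q : 'rV[R]_4 * R => V q.1 q.2),
      smooth_on D X, smooth_on D xi
    & forall omega c muphi mux, D (params omega c muphi mux) ->
        let p := params omega c muphi mux in
        is_profile kappa W omega c (V p) (X p) (xi p) /\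
        has_constants kappa W omega c muphi mux (V p)].

Definition mass_integral (V : R -> 'cV[R]_2) (X : R) : R :=
  period_integral X (fun x => 2^-1 * sqn (V x)).
Definition momentum_integral (V : R -> 'cV[R]_2) (X : R) : R :=
  period_integral X (fun x => 2^-1 * dotp (Jmx *m V x) (derive1 V x)).

Definition Sigma_t (V : 'rV[R]_4 -> R -> 'cV[R]_2) (X xi : 'rV[R]_4 -> R)
    (p : 'rV[R]_4) : 'M[R]_4 :=
  \matrix_(i < 4, j < 4)
    'D_(delta_mx 0 j)
      (nth (fun=> 0) [:: xi; X; (fun q => mass_integral (V q) (X q));
                         (fun q => momentum_integral (V q) (X q))] i
        : 'rV[R]_4 -> R) p.

Definition Sigma_y (kappa : R -> R) (V : R -> 'cV[R]_2) (X : R) : 'M[R]_4 :=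
  let s1 := period_integral X (fun x => kappa (sqn (V x)) * sqn (V x)) in
  let s2 := period_integral X (fun x =>
              kappa (sqn (V x)) * dotp (Jmx *m V x) (derive1 V x)) in
  let s3 := period_integral X (fun x =>
              kappa (sqn (V x)) * sqn (derive1 V x)) in
  \matrix_(i < 4, j < 4)
    nth 0 (nth [::] [:: [:: 0; 0; 0; 0];
                        [:: 0; 0; 0; 0];
                        [:: s1; - s2; 0; 0];
                        [:: s2; - s3; 0; 0]] i) j.

Definition Delta0 (St Sy : 'M[R]_4) (lambda z zeta : R) : R :=
  \det (lambda *: St - z%:M + (zeta ^+ 2 / lambda) *: Sy).

(* The identity for lambda != 0 determines the coefficients with m + k + q = 4
   and q <= m; the other values of [delta] are irrelevant. *)
Definition Delta0_coefficients (St Sy : 'M[R]_4) (delta : nat -> nat -> nat -> R)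
    : Prop :=
  forall lambda z zeta : R, lambda != 0 ->
    Delta0 St Sy lambda z zeta =
    \sum_(m < 5) \sum_(k < 5) \sum_(q < 5 | (m + k + q == 4)%N && (q <= m)%N)
      delta m k q * lambda ^+ (m - q) * z ^+ k * zeta ^+ (2 * q).

(* The 1-periodic profile U with V(x) = e^{k_phi x J} U(k_x x). *)
Definition scaled_profile (V : R -> 'cV[R]_2) (kx kphi : R) : R -> 'cV[R]_2 :=
  fun theta => expJ (- (kphi * (theta / kx))) *m V (theta / kx).

Section Linearization.
Context (n : nat).

Definition scaled_density (kappa W : R -> R) (omega c kx kphi : R) :
    @density n := fun U P =>
  let P' : 'M[R]_(2, n.+1) := \matrix_(i, j)
    if j == ord0 then kx * P i j + kphi * (Jmx *m U) i 0 else P i j in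
  H0 kappa W U P' - omega * Mass U P' + c * Q1 U P'.

Local Notation C2 := 'cV[R[i]]_2.
Definition cfield := 'rV[R]_n.+1 -> C2.

Definition re_field (u : cfield) : field := fun x => map_mx (@complex.Re R) (u x).
Definition im_field (u : cfield) : field := fun x => map_mx (@complex.Im R) (u x).

(* Complex-linear extension to C^2-valued functions. *)
Definition complexify (T : @field n -> @field n) (u : cfield) : cfield :=
  fun x => \col_i (Complex (T (re_field u) x i 0) (T (im_field u) x i 0)).

Definition lin_op (kappa W : R -> R) (omega c kx kphi : R)
    (U : R -> 'cV[R]_2) : cfield -> cfield :=
  complexify (fun v x =>
    Jmx *m Hess (scaled_density kappa W omega c kx kphi) (plane U) v x).

Definition measurable_cfield (u : cfield) : Prop := forall i,
  measurable_fun setT (fun t : n.+1.-tuple (measurableTypeR R) =>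
                         complex.Re (u (row_of t) i 0)) /\
  measurable_fun setT (fun t : n.+1.-tuple (measurableTypeR R) =>
                         complex.Im (u (row_of t) i 0)).

Definition L2sq (u : cfield) : \bar R :=
  (\int[lebesgue_Rn R n.+1]_t
     (\sum_i (complex.Re (u (row_of t) i 0) ^+ 2 +
              complex.Im (u (row_of t) i 0) ^+ 2))%R%:E)%E.

Definition in_L2 (u : cfield) : Prop :=
  measurable_cfield u /\ (L2sq u < +oo)%E.

Definition test_cfield (u : cfield) : Prop :=
  [/\ smooth_on setT (re_field u), smooth_on setT (im_field u)
    & exists r : R, forall x, r < `|x| -> u x = 0].

(* Graph of the closed operator on L^2(R^(1+n); C^2) defined by the differential
   operator T, that is of the closure of T on smooth compactly supported
   functions. For an elliptic T of order 2 with smooth periodic coefficients the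
   domain of this closure is H^2. Elements of L^2 are represented by functions;
   all the notions below are invariant under a.e. equality. *)
Definition closed_graph (T : cfield -> cfield) (u f : cfield) : Prop :=
  [/\ in_L2 u, in_L2 f
    & exists v : nat -> cfield,
      [/\ forall k, test_cfield (v k),
          (fun k => L2sq (fun x => v k x - u x)) @ \oo --> 0%E
        & (fun k => L2sq (fun x => T (v k) x - f x)) @ \oo --> 0%E]].

(* lambda - T has a bounded everywhere defined inverse. *)
Definition in_resolvent_set (T : cfield -> cfield) (lambda : R[i]) : Prop :=
  (forall u, closed_graph T u (fun x => lambda *: u x) -> L2sq u = 0%E) /\
  exists C : R, forall f, in_L2 f ->
    exists2 u, closed_graph T u (fun x => lambda *: u x - f x)
             & (L2sq u <= C%:E * L2sq f)%E.

Definition in_spectrum (T : cfield -> cfield) (lambda : R[i]) : Prop :=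
  ~ in_resolvent_set T lambda.

Definition spectrally_unstable (kappa W : R -> R) (omega c : R)
    (V : R -> 'cV[R]_2) (X xi : R) : Prop :=
  let kx := X^-1 in
  let kphi := xi / X in
  exists lambda : R[i], 0 < complex.Re lambda /\
    in_spectrum (lin_op kappa W omega c kx kphi (scaled_profile V kx kphi))
                lambda.

End Linearization.
End Densities.

(* Main.v *)
(** The spectral problem at transverse frequency [e] and spectral parameter
    [e z] is a linear system of four equations whose coefficients are periodic
    up to a rotation; it has a bounded solution as soon as one of its Floquet
    multipliers (after undoing the rotation) is [1 + e s] with
    [|1 + e s| = 1]. For [e = 0] a basis of solutions comes from the rotation and
    translation symmetries and from the derivatives of the profile with respect
    to the constants of integration; the derivatives with respect to the frequency
    and the speed give its first-order corrections. The increments over a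
    period of these solutions and of the linearized constants of integration are
    the entries of [Sigma_t] and [Sigma_y], so that after rescaling rows and columns
    the characteristic determinant tends to [Delta0 z s 1] as [e] tends to [0].
    By the discriminant condition the constant term [c0] of [Delta0] in [s] is
    [delta400 (z^2 + a)^2] with [a = delta301 / (2 delta400)], and by the
    nondegeneracy condition the coefficient [c1] of [s] is [z] times a factor which
    does not vanish where [z^2 = - a]; hence near such a [z] there is a small root
    [s], equivalent to [- c0 / c1]. Since the zero of [c0] is multiple, [Re (c0 / c1)]
    changes sign along a segment contained in [Re z > 0], and the intermediate value theorem gives a
    unimodular multiplier, that is an eigenvalue with a bounded eigenfunction.
    Cutting off this function at scale [N] gives a Weyl sequence. *)
Require Import Defs.
From mathcomp Require Import all_boot all_order all_algebra.
From mathcomp Require Import perm complex ring lra.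
From mathcomp Require Import all_classical all_reals all_analysis.
From mathcomp Require Import measurable_realfun.
Set Implicit Arguments.
Unset Strict Implicit.
Unset Printing Implicit Defensive.
Import Order.TTheory GRing.Theory Num.Theory.
Import numFieldNormedType.Exports.
Local Open Scope classical_set_scope.
Local Open Scope ring_scope.

(** * Linear differential equations *)

(** The sign change rests on the multiplicity of the zero of [c0]. Beside a zero [l] with
    [Re l >= 0] put [z = l + r w] with [Re w = 1]. To leading order [c0 / c1] is a constant times
    [w^2] ([w^3] if [l = 0]). On a segment where the argument of [w] sweeps more than a right angle,
    that of [w^2] sweeps more than a half turn, whatever the constant is. At a simple zero on the
    imaginary axis only the argument of [w] itself would be available, and the real part could keep
    one sign. There are two small parameters and their order matters: [r] is fixed first, from the
    limit polynomial alone, so that all inequalities are strict; [e] is then taken small and errors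
    of order [e] change nothing. For the roots a Lipschitz bound suffices, no smooth dependence is
    used. The smallest entries of the characteristic matrix would be lost in a direct expansion in
    [e]. They are increments of linearized first integrals, whose derivatives along solutions are
    themselves small: this is why the adjoint rows [lfun] are carried along with the basis of
    solutions. *)

Section Derivatives.
Context {R : realType} {V : normedModType R}.
Implicit Types (f g : V -> R) (x v : V).

(** Both sides have the same difference quotients. Directional derivatives thereby inherit the
    one-variable rules, in particular the chain rule. *)
Lemma is_derive_lineE (W : normedModType R) (f : V -> W) x v a :
  is_derive x v f a <-> is_derive (0 : R) 1 (fun h : R => f (h *: v + x)) a.
Proof.
have E : (fun h : R => h^-1 *: (((fun h : R => f (h *: v + x)) \o shift 0) (h *: 1)
             - f (0 *: v + x))) = (fun h : R => h^-1 *: ((f \o shift x) (h *: v) - f x)).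
  by apply/funext => h /=; rewrite scale0r add0r addr0 /GRing.scale /= mulr1.
split=> -[d e]; split.
- by rewrite /derivable E.
- by rewrite /derive E.
- by move: d; rewrite /derivable E.
- by move: e; rewrite /derive E.
Qed.

(** These rules are restated for functions written pointwise, the form matched by [der_step]; scalar
    multiplication becomes a product, so that [ring] can compare derivatives. *)
Lemma derD f g x v a b : is_derive x v f a -> is_derive x v g b ->
  is_derive x v (fun t => f t + g t) (a + b).
Proof. exact: is_deriveD. Qed.

Lemma derN f x v a : is_derive x v f a -> is_derive x v (fun t => - f t) (- a).
Proof. exact: is_deriveN. Qed.

Lemma derB f g x v a b : is_derive x v f a -> is_derive x v g b ->
  is_derive x v (fun t => f t - g t) (a - b).
Proof. exact: is_deriveB. Qed.

Lemma derM f g x v a b : is_derive x v f a -> is_derive x v g b ->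
  is_derive x v (fun t => f t * g t) (a * g x + f x * b).
Proof.
move=> df dg; apply: is_derive_eq (is_deriveM df dg) _.
by rewrite /GRing.scale /=; ring.
Qed.

Lemma der_cst (c : R) x v : is_derive x v (fun _ : V => c) 0.
Proof. exact: is_derive_cst. Qed.

Lemma derX f x v a n : is_derive x v f a ->
  is_derive x v (fun t => f t ^+ n.+1) (n.+1%:R * f x ^+ n * a).
Proof.
move=> df; elim: n => [|n IH].
  by apply: is_derive_eq df _; rewrite expr0; ring.
have := derM df IH; under eq_fun do rewrite -exprS.
move=> h; apply: is_derive_eq h _; rewrite -[in RHS]natr1 !exprS; ring.
Qed.

Lemma der_sum (I : finType) (P : pred I) (F : I -> V -> R) x v (dF : I -> R) :
  (forall i, P i -> is_derive x v (F i) (dF i)) ->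
  is_derive x v (fun t => \sum_(i | P i) F i t) (\sum_(i | P i) dF i).
Proof.
move=> h; rewrite -big_filter; under eq_fun do rewrite -big_filter.
have {}h i : i \in [seq i <- index_enum I | P i] -> is_derive x v (F i) (dF i).
  by rewrite mem_filter => /andP[/h].
elim: [seq i <- index_enum I | P i] h => [|i s IH] h.
  rewrite big_nil; under eq_fun do rewrite big_nil; exact: der_cst.
rewrite big_cons; under eq_fun do rewrite big_cons.
apply: derD; first by apply: h; rewrite mem_head.
by apply: IH => j js; apply: h; rewrite inE js orbT.
Qed.

Lemma der_comp (k : R -> R) g x v a b : is_derive (g x) 1 k a -> is_derive x v g b ->
  is_derive x v (fun t => k (g t)) (a * b).
Proof.
move=> dk /is_derive_lineE dg; apply/is_derive_lineE.
have := @is_derive1_comp R k (fun h : R => g (h *: v + x)) 0 a b.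
by apply => //; rewrite scale0r add0r.
Qed.

End Derivatives.

Lemma der_id (R : realType) (x : R) : is_derive x 1 (fun t : R => t) 1.
Proof. exact: is_derive_id. Qed.

(* [apply:] would let the type class resolution for [is_derive] solve the
   premises, with values that [ring] does not understand. *)
Ltac der_step :=
  first
  [ match goal with H : is_derive ?x ?v ?f _ |- is_derive ?x ?v ?f _ => exact: H end
  | match goal with H : forall y : _, is_derive y ?v ?f _ |- is_derive ?x ?v ?f _ => exact: H end
  | match goal with H : forall y : _, is_derive _ ?v _ _ |- is_derive ?x ?v ?f _ => exact: H end
  | notypeclasses refine (der_cst _ _ _)
  | notypeclasses refine (der_id _)
  | match goal with |- is_derive _ _ (fun t => @?f t - @?g t) _ => notypeclasses refine (derB _ _)
    | |- is_derive _ _ (fun t => @?f t + @?g t) _ => notypeclasses refine (derD _ _)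
    | |- is_derive _ _ (fun t => - @?f t) _ => notypeclasses refine (derN _)
    | |- is_derive _ _ (fun t => @?f t * @?g t) _ => notypeclasses refine (derM _ _)
    | |- is_derive _ _ (fun t => @?f t ^+ _) _ => notypeclasses refine (derX _ _) end
  | match goal with H : forall y : _, is_derive y 1 ?k _ |- is_derive _ _ (fun t => ?k (@?g t)) _ =>
      notypeclasses refine (der_comp (k := k) (g := g) _ _); [exact: H |] end
  ].
Ltac der := repeat der_step.
Ltac der_eq := notypeclasses refine (is_derive_eq _ _); [der |].
Ltac der_ring := der_eq; rewrite /=; ring.

Section RealLine.
Context {R : realType}.
Implicit Types (f g F : R -> R) (x a : R).

Lemma is_derive1_continuous f x a : is_derive x 1 f a -> {for x, continuous f}.
Proof. by move=> [d _]; apply/differentiable_continuous/derivable1_diffP. Qed.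

Lemma mean_value f df (a b : R) : a < b ->
  (forall x, a <= x <= b -> is_derive x 1 f (df x)) ->
  exists2 c, a < c < b & f b - f a = df c * (b - a).
Proof.
move=> ab h; have := @MVT R f df a b ab.
case=> [x|| c].
- by rewrite in_itv /= => /andP[ax xb]; apply: h; rewrite !ltW.
- apply: continuous_in_subspaceT => x; rewrite inE /= in_itv /= => xab.
  exact: is_derive1_continuous (h _ xab).
- by rewrite in_itv /= => ? ->; exists c.
Qed.

Lemma monotone_of_derive f df (a b : R) : a <= b ->
  (forall x, a <= x <= b -> is_derive x 1 f (df x)) ->
  (forall x, a <= x <= b -> 0 <= df x) -> f a <= f b.
Proof.
rewrite le_eqVlt => /orP[/eqP->//|ab] h h0.
have [c /andP[ac cb] e] := mean_value ab h.
by rewrite -subr_ge0 e mulr_ge0 ?subr_ge0 ?(ltW ab)// h0 ?ltW.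
Qed.

Lemma constant_of_derive f (a b : R) : a <= b ->
  (forall x, a <= x <= b -> is_derive x 1 f 0) -> f a = f b.
Proof.
rewrite le_eqVlt => /orP[/eqP->//|ab] h.
by have [c _ /eqP] := mean_value ab h; rewrite mul0r subr_eq0 => /eqP.
Qed.

Lemma is_derive_opp_arg f x a : is_derive (- x) 1 f a ->
  is_derive x 1 (fun t => f (- t)) (- a).
Proof.
move=> h; have := der_comp (g := fun t : R => - t) (x := x) (v := 1) h (derN (der_id x)).
by rewrite mulrN1.
Qed.

Lemma is_derive_near f g x a : (\forall t \near x, f t = g t) ->
  is_derive x 1 f a -> is_derive x 1 g a.
Proof.
move=> fg df; exact: near_eq_is_derive fg df.
Qed.

Lemma bounded_on_segment f (L : R) : continuous f ->
  exists2 K, 0 <= K & forall x, `|x| <= L -> `|f x| <= K.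
Proof.
move=> cf; have [L0|L0] := leP 0 L; last first.
  by exists 0 => // x xL; have := le_lt_trans (le_trans (normr_ge0 x) xL) L0; rewrite ltxx.
have := @EVT_max R (fun x => `|f x|) (- L) L.
case=> [||c _ h]; first by lra.
  apply: continuous_in_subspaceT => x _; apply: continuous_comp; first exact: cf.
  exact: norm_continuous.
exists `|f c| => // x xL; apply: h; by rewrite in_itv /= -ler_norml.
Qed.

Lemma bounded_family (I : finType) (f : I -> R -> R) (L : R) :
  (forall i, continuous (f i)) ->
  exists2 K, 0 <= K & forall i x, `|x| <= L -> `|f i x| <= K.
Proof.
move=> cf; have h i : exists K, 0 <= K /\ forall x, `|x| <= L -> `|f i x| <= K.
  by have [K] := bounded_on_segment L (cf i); exists K.
have [K hK] := choice h; exists (\sum_i K i).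
  by apply: sumr_ge0 => i _; have [] := hK i.
move=> i x xL; apply: (le_trans ((hK i).2 _ xL)).
by rewrite (bigD1 i) //= lerDl sumr_ge0 // => j _; have [] := hK j.
Qed.

(** An integral with a fixed lower end is differentiated only to the right of that end. The value
    [-1] leaves an overlap around 0 with the reflected construction used for negative arguments. *)
Lemma half_primitive f : continuous f ->
  exists F, forall x, -1 < x -> is_derive x 1 F (f x).
Proof.
move=> cf; exists (fun x => \int[lebesgue_measure]_(t in [set` Interval (BLeft (-1)) (BRight x)]) f t).
move=> x x1.
have xx1 : x < x + 1 by rewrite ltrDl.
have intf : lebesgue_measure.-integrable [set` Interval (BLeft (-1)) (BRight (x + 1))]
    (EFin \o f).
  apply: continuous_compact_integrable; first exact: segment_compact.
  exact: continuous_subspaceT.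
have [d e] := continuous_FTC1_closed xx1 intf x1 (cf x).
by rewrite -e; split; [exact: d | rewrite derive1E].
Qed.

Lemma exists_primitive f : continuous f ->
  exists F, F 0 = 0 /\ forall x, is_derive x 1 F (f x).
Proof.
move=> cf; have [P dP] := half_primitive cf.
have [|Q dQ] := @half_primitive (fun t => f (- t)).
  by move=> x; apply: continuous_comp; [exact: opp_continuous | exact: cf].
have dQ' x : x < 1 -> is_derive x 1 (fun t => - Q (- t)) (f x).
  move=> x1; have := derN (is_derive_opp_arg (dQ (- x) _)).
  by rewrite opprK opprK; apply; rewrite ltrN2.
(* On the overlap the two half primitives differ by a constant, so that the gluing at 0 is
   differentiable. *)
have PQ x : -1 < x -> x < 0 -> - Q (- x) + Q 0 = P x - P 0.
  move=> x1 x0.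
  have : - Q (- x) - P x = - Q (- 0) - P 0.
    apply: (@constant_of_derive (fun t => - Q (- t) - P t) x 0 (ltW x0)).
    move=> y /andP[xy y0]; rewrite -(subrr (f y)); apply: derB.
      by apply: dQ'; exact: le_lt_trans y0 _.
    by apply: dP; exact: lt_le_trans xy.
  by rewrite oppr0 => e; lra.
exists (fun x => if x < 0 then - Q (- x) + Q 0 else P x - P 0); split.
  by rewrite ltxx subrr.
move=> x; have [x0|x0] := ltP x 0.
  apply: (@is_derive_near (fun x => - Q (- x) + Q 0)).
    near=> t; rewrite ifT //; near: t; exact: lt_nbhsl.
  have := derD (dQ' x (lt_trans x0 ltr01)) (der_cst (Q 0) x 1).
  by rewrite addr0.
apply: (@is_derive_near (fun x => P x - P 0)).
  near=> t; case: ifPn => // t0; rewrite PQ //; near: t; apply: lt_nbhsr.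
  exact: lt_le_trans x0.
have := derB (dP x (lt_le_trans (ltrN10 _) x0)) (der_cst (P 0) x 1).
by rewrite subr0.
Unshelve. all: by end_near.
Qed.

(** A total choice of the primitive normalized at 0; the default value is taken only when [f] has no
    primitive. Derivatives of period integrals are computed through it rather than through the
    Lebesgue integral. *)
Definition prim f : R -> R :=
  xget (fun=> 0) [set F | F 0 = 0 /\ forall x, is_derive x 1 F (f x)].

Lemma primP f : continuous f ->
  prim f 0 = 0 /\ forall x, is_derive x 1 (prim f) (f x).
Proof. by move=> /exists_primitive[F hF]; rewrite /prim; case: xgetP => // /(_ F). Qed.

Lemma period_integral_prim f F (X : R) : 0 < X -> continuous f ->
  (forall x, is_derive x 1 F (f x)) -> period_integral X f = F X - F 0.
Proof.
move=> X0 cf dF; rewrite /period_integral /Rintegral.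
rewrite (@continuous_FTC2 R f F 0 X X0) //.
- exact: continuous_subspaceT.
- have cF x : {for x, continuous F} by exact: is_derive1_continuous (dF x).
  split; first by move=> x _; have [] := dF x.
  + by apply: cvg_at_right_filter; exact: cF.
  + by apply: cvg_at_left_filter; exact: cF.
- by move=> x _; rewrite derive1E; by case: (dF x).
Qed.

End RealLine.

Lemma sumr_cst (R : realType) (I : finType) (c : R) : \sum_(i : I) c = #|I|%:R * c.
Proof. by rewrite sumr_const mulr_natl. Qed.

(** * Gronwall estimates and uniqueness for linear systems *)

Section ODE.
Context {R : realType}.
Implicit Types (x L : R).

(** The function [(E + B / k) e^{- k x}] is nonincreasing: the shift by [B / k] makes the
    differential inequality homogeneous. *)
Lemma gronwall_pos (E dE : R -> R) (k B L : R) : 0 < k ->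
  (forall x, 0 <= x <= L -> is_derive x 1 E (dE x)) ->
  (forall x, 0 <= x <= L -> dE x <= k * E x + B) ->
  forall x, 0 <= x <= L -> E x + B / k <= (E 0 + B / k) * expR (k * x).
Proof.
move=> k0 dEE hE x /andP[x0 xL].
have dexp (t : R) : is_derive t 1 (expR : R -> R) (expR t) by exact: is_derive_expR.
have : - ((E 0 + B / k) * expR (- k * 0)) <= - ((E x + B / k) * expR (- k * x)).
  pose g t := - ((E t + B / k) * expR (- k * t)).
  apply: (@monotone_of_derive R g
    (fun t => - (dE t - k * E t - B) * expR (- k * t)) 0 x x0) => t /andP[t0 tx].
    have dEt : is_derive t 1 E (dE t) by apply: dEE; rewrite t0 (le_trans tx).
    rewrite /g; der_eq.
    rewrite /=; field; exact: lt0r_neq0.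
  rewrite mulr_ge0 ?expR_ge0// oppr_ge0 subr_le0 lerBlDl hE // t0 (le_trans tx) //.
rewrite mulr0 expR0 mulr1 lerN2 -ler_pdivlMr ?expR_gt0// -expRN.
by rewrite mulNr opprK.
Qed.

Lemma gronwall (E dE : R -> R) (k B L : R) : 0 < k ->
  (forall x, `|x| <= L -> is_derive x 1 E (dE x)) ->
  (forall x, `|x| <= L -> `|dE x| <= k * E x + B) ->
  forall x, `|x| <= L -> E x + B / k <= (E 0 + B / k) * expR (k * `|x|).
Proof.
move=> k0 dEE hE x xL; have [x0|x0] := leP 0 x.
  rewrite ger0_norm //; apply: (@gronwall_pos E dE k B L) => //.
  - by move=> t /andP[t0 tL]; apply: dEE; rewrite ger0_norm.
  - move=> t /andP[t0 tL]; apply: le_trans (ler_norm _) _; apply: hE; by rewrite ger0_norm.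
  - by rewrite x0 -(ger0_norm x0).
rewrite ltr0_norm // -[x in E x]opprK -[E 0](_ : E (- 0) = _); last by rewrite oppr0.
apply: (@gronwall_pos (fun t => E (- t)) (fun t => - dE (- t)) k B L) => //.
- by move=> t /andP[t0 tL]; apply: is_derive_opp_arg; apply: dEE; rewrite normrN ger0_norm.
- move=> t /andP[t0 tL]; apply: le_trans (ler_norm _) _; rewrite normrN; apply: hE.
  by rewrite normrN ger0_norm.
- by rewrite oppr_ge0 ltW //= -(ltr0_norm x0).
Qed.

Variable I : finType.
Implicit Types (A : I -> I -> R -> R) (y f : I -> R -> R).

(* Energy estimate for [y' = A y + f]. *)
Lemma linear_ode_bound A y f (K F L : R) :
  0 <= K ->
  (forall i x, `|x| <= L -> is_derive x 1 (y i) (\sum_j A i j x * y j x + f i x)) ->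
  (forall i j x, `|x| <= L -> `|A i j x| <= K) ->
  (forall i x, `|x| <= L -> `|f i x| <= F) ->
  forall x, `|x| <= L ->
  \sum_i y i x ^+ 2 <=
    (\sum_i y i 0 ^+ 2 + #|I|%:R * F ^+ 2) * expR ((2 * #|I|%:R * K + 1) * L).
Proof.
move=> K0 dy hA hf x xL.
have L0 : 0 <= L by apply: le_trans xL.
set m := #|I|%:R; set k := 2 * m * K + 1.
have m0 : 0 <= m by rewrite /m ler0n.
have k1 : 1 <= k by rewrite /k lerDr !mulr_ge0.
have k0 : 0 < k by apply: lt_le_trans k1.
pose E x := \sum_i y i x ^+ 2; pose dE x := \sum_i 2 * y i x * (\sum_j A i j x * y j x + f i x).
have dEE (t : R) : `|t| <= L -> is_derive t 1 E (dE t).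
  move=> tL; apply: der_sum => i _; have := dy i t tL => dyt.
  have := derX 1 dyt; rewrite expr1; exact.
have E0 t : 0 <= E t by apply: sumr_ge0 => i _; exact: sqr_ge0.
have hE t : `|t| <= L -> `|dE t| <= k * E t + m * F ^+ 2.
  move=> tL; apply: le_trans (ler_norm_sum _ _ _) _.
  have : \sum_i `|2 * y i t * (\sum_j A i j t * y j t + f i t)| <=
      \sum_i (\sum_j K * (y i t ^+ 2 + y j t ^+ 2) + (y i t ^+ 2 + F ^+ 2)).
    apply: ler_sum => i _; rewrite mulrDr; apply: le_trans (ler_normD _ _) _.
    apply: lerD.
      rewrite mulr_sumr; apply: le_trans (ler_norm_sum _ _ _) _.
      apply: ler_sum => j _; rewrite !normrM (ger0_norm (ler0n R 2)).
      have -> : 2 * `|y i t| * (`|A i j t| * `|y j t|) = `|A i j t| * (2 * `|y i t| * `|y j t|).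
        by ring.
      apply: ler_pM => //; first exact: hA.
      rewrite -(real_normK (num_real (y i t))) -(real_normK (num_real (y j t))).
      by have := sqr_ge0 (`|y i t| - `|y j t|); nra.
    rewrite !normrM (ger0_norm (ler0n R 2)).
    have fF := hf i t tL.
    have : `|f i t| ^+ 2 <= F ^+ 2 by rewrite lerXn2r ?nnegrE ?(le_trans _ fF).
    rewrite -(real_normK (num_real (y i t))).
    by have := sqr_ge0 (`|y i t| - `|f i t|); nra.
  move=> /le_trans; apply.
  rewrite big_split /= big_split /= sumr_cst -/(E t) -/m.
  have -> : \sum_i \sum_j K * (y i t ^+ 2 + y j t ^+ 2) = 2 * m * K * E t.
    under eq_bigr do rewrite -mulr_sumr big_split /= sumr_cst.
    by rewrite -mulr_sumr big_split /= sumr_cst -mulr_sumr -/(E t) /m; ring.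
  by rewrite /k; lra.
have := gronwall k0 dEE hE xL => h.
have mF : 0 <= m * F ^+ 2 by rewrite mulr_ge0 // sqr_ge0.
apply: (@le_trans _ _ (E x + m * F ^+ 2 / k)).
  by rewrite lerDl divr_ge0 // ltW.
apply: le_trans h _; apply: ler_pM; rewrite ?expR_ge0 //.
- by rewrite addr_ge0 // divr_ge0 // ltW.
- by rewrite lerD2l ler_pdivrMr // ler_peMr.
- by rewrite ler_expR ler_pM2l.
Qed.

Lemma linear_ode_unique A y : (forall i j, continuous (A i j)) ->
  (forall i x, is_derive x 1 (y i) (\sum_j A i j x * y j x)) ->
  (forall i, y i 0 = 0) -> forall i x, y i x = 0.
Proof.
move=> cA dy y0 i x.
have [K K0 hK] := bounded_family (f := fun ij : I * I => A ij.1 ij.2) `|x| (fun ij => cA ij.1 ij.2).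
have : \sum_i y i x ^+ 2 <= (\sum_i y i 0 ^+ 2 + #|I|%:R * 0 ^+ 2)
    * expR ((2 * #|I|%:R * K + 1) * `|x|).
  apply: (@linear_ode_bound A y (fun _ _ => 0)) => //.
  - by move=> j t _; rewrite addr0; exact: dy.
  - by move=> j l t tx; exact: (hK (j, l)).
  - by move=> j t _; rewrite normr0.
rewrite expr0n mulr0 addr0 [X in X * _]big1 ?mul0r; last by move=> j _; rewrite y0 expr0n.
move=> h; have : \sum_i y i x ^+ 2 == 0.
  by rewrite eq_le h sumr_ge0 // => j _; exact: sqr_ge0.
rewrite psumr_eq0; last by move=> j _; exact: sqr_ge0.
by move=> /allP/(_ i); rewrite mem_index_enum /= sqrf_eq0 => /(_ isT)/eqP.
Qed.

End ODE.

(** * Existence for linear systems by Picard iteration *)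

Section Picard.
Context {R : realType}.

Lemma continuous_sumr (J : Type) (T : topologicalType) (s : seq J) (F : J -> T -> R) :
  (forall j, continuous (F j)) -> continuous (fun t => \sum_(j <- s) F j t).
Proof.
move=> cF; elim: s => [|j s IH].
  by under eq_fun do rewrite big_nil; exact: cst_continuous.
under eq_fun do rewrite big_cons.
by move=> x; apply: continuousD; [exact: cF | exact: IH].
Qed.

(** The sequences [u n - 2 c 2^-n] and [u n + 2 c 2^-n] are monotone in opposite directions and
    enclose the limit, taken as the supremum of the former; the rate of convergence comes with
    it. *)
Lemma geometric_limit (u : nat -> R) (c : R) :
  (forall n, `|u n.+1 - u n| <= c * 2^-1 ^+ n) ->
  exists l, forall n, `|l - u n| <= 2 * c * 2^-1 ^+ n.
Proof.
move=> h.
pose v n := u n - 2 * c * 2^-1 ^+ n; pose w n := u n + 2 * c * 2^-1 ^+ n.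
have c0 : 0 <= c by have := h 0%N; rewrite expr0 mulr1; apply: le_trans.
have p0 n : 0 <= c * 2^-1 ^+ n :> R by rewrite mulr_ge0 // exprn_ge0 // invr_ge0.
have v1 n : v n <= v n.+1.
  have := h n; rewrite ler_norml /v exprS => /andP[]; lra.
have w1 n : w n.+1 <= w n.
  have := h n; rewrite ler_norml /w exprS => /andP[]; lra.
have vm m n : (m <= n)%N -> v m <= v n.
  elim: n => [|n IH]; first by rewrite leqn0 => /eqP->.
  by rewrite leq_eqVlt => /orP[/eqP->//|]; rewrite ltnS => /IH /le_trans; apply.
have wm m n : (m <= n)%N -> w n <= w m.
  elim: n => [|n IH]; first by rewrite leqn0 => /eqP->.
  by rewrite leq_eqVlt => /orP[/eqP->//|]; rewrite ltnS => /IH; apply: le_trans.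
have vw m n : v m <= w n.
  apply: le_trans (vm _ _ (leq_maxl m n)) (le_trans _ (wm _ _ (leq_maxr m n))).
  by rewrite /v /w; have := p0 (maxn m n); lra.
have hs : has_sup (range v).
  by split; [exists (v 0%N), 0%N | exists (w 0%N) => _ [m _ <-]].
exists (sup (range v)) => n.
have l1 : v n <= sup (range v) by apply: ub_le_sup; [exact: hs.2 | exists n].
have l2 : sup (range v) <= w n by apply: ge_sup; [exact: hs.1 | move=> _ [m _ <-]].
by rewrite ler_norml; move: l1 l2; rewrite /v /w; lra.
Qed.

Lemma exp_bound_pos (F dF : R -> R) (c k L : R) : F 0 = 0 ->
  (forall t, 0 <= t <= L -> is_derive t 1 F (dF t)) ->
  (forall t, 0 <= t <= L -> dF t <= c * k * expR (k * t)) ->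
  forall x, 0 <= x <= L -> F x <= c * expR (k * x) - c.
Proof.
move=> F0 dFF h x /andP[x0 xL].
have dexp (t : R) : is_derive t 1 (expR : R -> R) (expR t) by exact: is_derive_expR.
have : c * expR (k * 0) - F 0 <= c * expR (k * x) - F x.
  apply: (@monotone_of_derive R (fun t => c * expR (k * t) - F t)
     (fun t => c * k * expR (k * t) - dF t) 0 x x0) => t /andP[t0 tx].
    have dFt : is_derive t 1 F (dF t) by apply: dFF; rewrite t0 (le_trans tx).
    by der_ring.
  by rewrite subr_ge0 h // t0 (le_trans tx).
by rewrite mulr0 expR0 F0; lra.
Qed.

(** In the norm weighted by [e^{- k |x|}] integration gains a factor [1 / k], which makes the Picard
    map a contraction on an interval of any length. *)
Lemma exp_bound (F dF : R -> R) (c k L : R) : F 0 = 0 -> 0 <= c ->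
  (forall t : R, `|t| <= L -> is_derive t 1 F (dF t)) ->
  (forall t, `|t| <= L -> `|dF t| <= c * k * expR (k * `|t|)) ->
  forall x, `|x| <= L -> `|F x| <= c * expR (k * `|x|).
Proof.
move=> F0 c0 dFF h.
have pos (G dG : R -> R) x : G 0 = 0 ->
    (forall t : R, `|t| <= L -> is_derive t 1 G (dG t)) ->
    (forall t, `|t| <= L -> `|dG t| <= c * k * expR (k * `|t|)) -> 0 <= x <= L ->
    `|G x| <= c * expR (k * x).
  move=> G0 dGG hG xL.
  have t0L t : 0 <= t <= L -> `|t| <= L by move=> /andP[t0 tL]; rewrite ger0_norm.
  have A1 : G x <= c * expR (k * x) - c.
    apply: (@exp_bound_pos G dG c k L) => // [t /t0L|t /[dup] /andP[t0 _] /t0L]; first exact: dGG.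
    by move=> /hG; rewrite (ger0_norm t0); apply: le_trans; exact: ler_norm.
  have A2 : - G x <= c * expR (k * x) - c.
    apply: (@exp_bound_pos (fun t => - G t) (fun t => - dG t) c k L) => //.
    - by rewrite G0 oppr0.
    - by move=> t /t0L tL; apply: derN; exact: dGG.
    - move=> t /[dup] /andP[t0 _] /t0L /hG; rewrite (ger0_norm t0) -normrN.
      by apply: le_trans; exact: ler_norm.
  by rewrite ler_norml; lra.
move=> x xL; have [x0|x0] := leP 0 x.
  by rewrite (ger0_norm x0); apply: (pos F dF) => //; rewrite x0 -(ger0_norm x0).
rewrite (ltr0_norm x0) -[x in F x]opprK; apply: (pos (fun t => F (- t)) (fun t => - dF (- t))).
- by rewrite oppr0.
- by move=> t tL; apply: is_derive_opp_arg; apply: dFF; rewrite normrN.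
- by move=> t tL; rewrite normrN -(normrN t); apply: h; rewrite normrN.
- by rewrite oppr_ge0 ltW //= -(ltr0_norm x0).
Qed.

Variables (I : finType) (A : I -> I -> R -> R) (y0 : I -> R).
Hypothesis cA : forall i j, continuous (A i j).

Fixpoint picard n (i : I) : R -> R :=
  if n is n'.+1 then fun x => y0 i + prim (fun t => \sum_j A i j t * picard n' j t) x
  else fun=> y0 i.

Lemma picard_continuous n i : continuous (picard n i).
Proof.
elim: n i => [|n IH] i /=; first exact: cst_continuous.
have c1 : continuous (fun t => \sum_j A i j t * picard n j t).
  by apply: continuous_sumr => j x; apply: continuousM; [exact: cA | exact: IH].
move=> x; apply: continuousD; first exact: cst_continuous.
exact: is_derive1_continuous ((primP c1).2 x).
Qed.

Lemma picard_rhs_continuous n i : continuous (fun t => \sum_j A i j t * picard n j t).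
Proof.
by apply: continuous_sumr => j x; apply: continuousM; [exact: cA | exact: picard_continuous].
Qed.

Lemma picard_cauchy (L : R) : exists2 c, 0 <= c &
  forall n i x, `|x| <= L -> `|picard n.+1 i x - picard n i x| <= c * 2^-1 ^+ n.
Proof.
have [K K0 hK] := bounded_family (f := fun ij : I * I => A ij.1 ij.2) L
  (fun ij => cA (i:=ij.1) (j:=ij.2)).
have [D D0 hD] := bounded_family (f := fun i x => picard 1 i x - picard 0 i x) L
  (fun i x => @continuousB _ _ _ _ _ x (@picard_continuous 1 i x) (@picard_continuous 0 i x)).
(* With this weight the Picard map contracts by the factor 1/2: [#|I| K] bounds the system and
   [exp_bound] divides by [k]. *)
pose k := 2 * (#|I|%:R * K).
have k0 : 0 <= k by rewrite /k !mulr_ge0.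
have h n i x : `|x| <= L -> `|picard n.+1 i x - picard n i x| <= D * 2^-1 ^+ n * expR (k * `|x|).
  elim: n i x => [|n IH] i x xL.
    rewrite expr0 mulr1; apply: le_trans (hD i x xL) _.
    by rewrite ler_peMr // -expR0 ler_expR mulr_ge0.
  have [P0 dP] := primP (@picard_rhs_continuous n.+1 i).
  have [Q0 dQ] := primP (@picard_rhs_continuous n i).
  rewrite [picard n.+2 i x]/= [picard n.+1 i x]/= opprD addrACA subrr add0r.
  apply: (@exp_bound (fun x => prim (fun t => \sum_j A i j t * picard n.+1 j t) x
      - prim (fun t => \sum_j A i j t * picard n j t) x)
    (fun t => \sum_j A i j t * picard n.+1 j t - \sum_j A i j t * picard n j t) _ k L) => //.
  - by rewrite P0 Q0 subrr.
  - by rewrite mulr_ge0 // exprn_ge0 // invr_ge0.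
  move=> t tL; rewrite -sumrB; apply: le_trans (ler_norm_sum _ _ _) _.
  have -> : D * 2^-1 ^+ n.+1 * k * expR (k * `|t|) =
      \sum_(j : I) (K * (D * 2^-1 ^+ n * expR (k * `|t|))).
    by rewrite sumr_cst exprS {1}/k; field.
  apply: ler_sum => j _; rewrite -mulrBr normrM; apply: ler_pM => //; last exact: IH.
  exact: (hK (i, j)).
exists (D * expR (k * L)); first by rewrite mulr_ge0 // expR_ge0.
move=> n i x xL; apply: le_trans (h n i x xL) _; rewrite -mulrA [X in _ <= X]mulrAC -mulrA.
apply: ler_wpM2l => //; rewrite ler_wpM2l // ?exprn_ge0 ?invr_ge0 // ler_expR.
exact: ler_wpM2l.
Qed.

Lemma linear_ode_exists : exists y : I -> R -> R,
  (forall i, y i 0 = y0 i) /\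
  forall i (x : R), is_derive x 1 (y i) (\sum_j A i j x * y j x).
Proof.
have hl i x : exists l, exists2 c, 0 <= c & forall n, `|l - picard n i x| <= 2 * c * 2^-1 ^+ n.
  have [c c0 hc] := picard_cauchy `|x|.
  have [l hl] := @geometric_limit (fun n => picard n i x) c (fun n => hc n i x (lexx _)).
  by exists l, c.
have [y hy] := choice (fun ix : I * R => hl ix.1 ix.2).
have half0 (e c : R) : 0 < e -> 0 <= c -> exists n, c * 2^-1 ^+ n < e.
  move=> e0 c0; have : (c * 2^-1 ^+ n @[n --> \oo] --> (0 : R)).
    by apply: cvg_geometric; rewrite ger0_norm ?invr_ge0 // invf_lt1 // ltr1n.
  move=> /cvgrPdist_lt/(_ e e0) [n _ /(_ n (leqnn n))] /= hn; exists n.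
  by move: hn; rewrite sub0r normrN; apply: le_lt_trans; exact: ler_norm.
(* The value [y (i, x)] was chosen separately for each [x], with a constant depending on [x].
   Uniqueness of limits makes the rate uniform for [|x| <= L], as continuity requires. *)
have hu (L : R) : exists2 c, 0 <= c & forall i x, `|x| <= L -> forall n,
    `|y (i, x) - picard n i x| <= 2 * c * 2^-1 ^+ n.
  have [c c0 hc] := picard_cauchy L; exists c => // i x xL n.
  have [l hl'] := @geometric_limit (fun n => picard n i x) c (fun n => hc n i x xL).
  suff -> : y (i, x) = l by exact: hl'.
  have [c' c'0 hc'] := hy (i, x).
  apply/eqP; rewrite -subr_eq0 -normr_le0; apply/ler_addgt0Pl => e e0; rewrite addr0.
  have [||m hm] := half0 e (2 * c' + 2 * c) => //; first by rewrite addr_ge0 // mulr_ge0.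
  have -> : y (i, x) - l = (y (i, x) - picard m i x) - (l - picard m i x) by ring.
  apply: le_trans (ler_normB _ _) _; apply: ltW; apply: le_lt_trans hm; rewrite mulrDl.
  exact: lerD (hc' m) (hl' m).
have cy i : continuous (fun x => y (i, x)).
  move=> x; apply/cvgrPdist_lt => e e0.
  have [c c0 hc] := hu (`|x| + 1).
  have [||m hm] := half0 (e / 3) (2 * c) => //; [by rewrite divr_gt0|by rewrite mulr_ge0|].
  have := @picard_continuous m i x => /cvgrPdist_lt/(_ (e / 3)) hp.
  near=> t.
  have t1 : `|t| <= `|x| + 1.
    have : `|x - t| < 1 by near: t; apply: cvgr_dist_lt.
    move=> xt; have -> : t = x - (x - t) by ring.
    by apply: le_trans (ler_normB _ _) _; rewrite lerD2l ltW.
  have -> : y (i, x) - y (i, t) = (y (i, x) - picard m i x) - (y (i, t) - picard m i t)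
      + (picard m i x - picard m i t) by ring.
  have A1 := hc i x ltac:(by rewrite lerDl) m; have A2 := hc i t t1 m.
  have A3 : `|picard m i x - picard m i t| < e / 3 by near: t; apply: hp; rewrite divr_gt0.
  apply: le_lt_trans (ler_normD _ _) _; have := ler_normB (y (i, x) - picard m i x) (y (i, t) - picard m i t).
  by lra.
have crhs i : continuous (fun t => \sum_j A i j t * y (j, t)).
  by apply: continuous_sumr => j x; apply: continuousM; [exact: cA | exact: cy].
(* The limit satisfies the integral equation, since the primitives converge as well, by [exp_bound]
   with weight [k = 1]. *)
have key i x : y (i, x) = y0 i + prim (fun t => \sum_j A i j t * y (j, t)) x.
  have [P0 dP] := primP (crhs i).
  have [c c0 hc] := hu `|x|.
  have [K K0 hK] := bounded_family (f := fun ij : I * I => A ij.1 ij.2) `|x|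
    (fun ij => cA (i:=ij.1) (j:=ij.2)).
  have B n : `|picard n.+1 i x - (y0 i + prim (fun t => \sum_j A i j t * y (j, t)) x)| <=
      (#|I|%:R * K * (2 * c) * expR `|x|) * 2^-1 ^+ n.
    have [Q0 dQ] := primP (@picard_rhs_continuous n i).
    rewrite [picard n.+1 i x]/= opprD addrACA subrr add0r.
    have -> : #|I|%:R * K * (2 * c) * expR `|x| * 2^-1 ^+ n =
       (#|I|%:R * (K * (2 * c * 2^-1 ^+ n))) * expR (1 * `|x|) by rewrite mul1r; ring.
    apply: (@exp_bound (fun x => prim (fun t => \sum_j A i j t * picard n j t) x
        - prim (fun t => \sum_j A i j t * y (j, t)) x)
      (fun t => \sum_j A i j t * picard n j t - \sum_j A i j t * y (j, t)) _ 1 `|x|) => //.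
    - by rewrite P0 Q0 subrr.
    - by rewrite !mulr_ge0 // exprn_ge0 // invr_ge0.
      move=> t tL; rewrite -sumrB; apply: le_trans (ler_norm_sum _ _ _) _.
    rewrite mulr1; apply: (@le_trans _ _ (#|I|%:R * (K * (2 * c * 2^-1 ^+ n)))); last first.
      rewrite ler_peMr // ?(le_trans _ (expR_ge1Dx _)) ?mul1r ?lerDl //.
      by rewrite !mulr_ge0 // exprn_ge0 // invr_ge0.
    rewrite -sumr_cst; apply: ler_sum => j _; rewrite -mulrBr normrM.
    by apply: ler_pM => //; [exact: (hK (i, j)) | rewrite distrC; exact: hc].
  apply/eqP; rewrite -subr_eq0 -normr_le0; apply/ler_addgt0Pl => e e0; rewrite addr0.
  set T := y0 i + _; set b := _ * expR `|x| in B.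
  have b0 : 0 <= b by rewrite /b !mulr_ge0 // expR_ge0.
  have [||m hm] := half0 e (2 * c + b) => //; first by rewrite addr_ge0 // mulr_ge0.
  have -> : y (i, x) - T = (y (i, x) - picard m.+1 i x) + (picard m.+1 i x - T) by ring.
  apply: le_trans (ler_normD _ _) _; apply: ltW; apply: le_lt_trans hm; rewrite mulrDl.
  apply: lerD; last exact: B.
  apply: le_trans (hc i x (lexx _) m.+1) _; rewrite ler_wpM2l ?mulr_ge0 //.
  by rewrite exprS ler_piMl ?exprn_ge0 ?invr_ge0 // invf_le1 // ler1n.
exists (fun i x => y (i, x)); split.
  by move=> i; rewrite key (primP (crhs i)).1 addr0.
move=> i x; have -> : (fun t => y (i, t)) =
    (fun t => y0 i + prim (fun t => \sum_j A i j t * y (j, t)) t).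
  by apply/funext => t; exact: key.
have := derD (der_cst (y0 i) x 1) ((primP (crhs i)).2 x).
by rewrite add0r.
Unshelve. all: by end_near.
Qed.

End Picard.

(** * Functions of class C^k *)

Section Smooth.
Context {R : realType} {E : normedModType R}.
Implicit Types (D : set E) (f g : E -> R) (x v : E) (k : nat).

Lemma derivable_is_derive (W : normedModType R) (f : E -> W) x v :
  derivable f x v -> is_derive x v f ('D_v f x).
Proof. by move=> d; split. Qed.

Lemma Ck_on_continuous (W : normedModType R) D k (f : E -> W) :
  Ck_on D k f -> forall x, D x -> {for x, continuous f}.
Proof. by case: k => [|k] []. Qed.

Lemma Ck_onS (W : normedModType R) D k (f : E -> W) : Ck_on D k.+1 f -> Ck_on D k f.
Proof.
elim: k f => [|k IH] f [cf h]; split => // v.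
by have [d c] := h v; split => //; exact: IH.
Qed.

Lemma Ck_on_derive (W : normedModType R) D k (f : E -> W) v :
  Ck_on D k.+1 f -> Ck_on D k ('D_v f).
Proof. by move=> [_ /(_ v)[]]. Qed.

Lemma Ck_on_is_derive (W : normedModType R) D k (f : E -> W) x v :
  Ck_on D k.+1 f -> D x -> is_derive x v f ('D_v f x).
Proof. by move=> [_ /(_ v)[d _]] /d; exact: derivable_is_derive. Qed.

End Smooth.
Arguments Ck_on_is_derive {R E W D k f x v}.

Section Smooth2.
Context {R : realType} {E : normedModType R}.
Implicit Types (D : set E) (f g : E -> R) (x v : E) (k : nat).

(** The derivatives in [Ck_on] are those of functions defined on the whole space; on an open set
    they are determined by the values inside. *)
Lemma Ck_on_eq (W : normedModType R) D k (f g : E -> W) : open D ->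
  (forall x, D x -> f x = g x) -> Ck_on D k f -> Ck_on D k g.
Proof.
move=> oD; elim: k f g => [|k IH] f g fg [cf h].
  split => // x Dx; change (g @ x --> g x); rewrite -fg //.
  apply: cvg_trans (cf x Dx); apply: near_eq_cvg; near=> y; apply: fg.
  by near: y; exact: open_nbhs_nbhs.
have nfg x : D x -> \forall y \near x, f y = g y.
  by move=> Dx; near=> y; apply: fg; near: y; exact: open_nbhs_nbhs.
split.
  move=> x Dx; change (g @ x --> g x); rewrite -fg //.
  by apply: cvg_trans (cf x Dx); apply: near_eq_cvg; exact: nfg.
move=> v; have [d c] := h v; split.
  move=> x Dx; exact: near_eq_derivable (nfg _ Dx) (d _ Dx).
apply: (IH ('D_v f)) => // x Dx; exact: near_eq_derive (nfg _ Dx).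
Unshelve. all: by end_near.
Qed.

(** Calculus rules give a formula for the derivative only on [D]; through [Ck_on_eq] it can replace
    the globally defined ['D_v f] in inductions on the order. *)
Lemma Ck_on_intro (W : normedModType R) D k (f : E -> W) (df : E -> E -> W) : open D ->
  (forall x, D x -> {for x, continuous f}) ->
  (forall x v, D x -> is_derive x v f (df v x)) ->
  (forall v, Ck_on D k (df v)) -> Ck_on D k.+1 f.
Proof.
move=> oD cf dff h; split => // v; split; first by move=> x Dx; have [] := dff x v Dx.
apply: (Ck_on_eq oD _ (h v)) => x Dx; by have [_ ->] := dff x v Dx.
Qed.

Lemma Ck_on_cst D k (c : R) : open D -> Ck_on D k (fun _ : E => c).
Proof.
move=> oD; elim: k c => [|k IH] c; first by split => // x _; exact: cst_continuous.
apply: (@Ck_on_intro _ D k _ (fun _ _ => 0)) => //; first by move=> x _; exact: cst_continuous.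
Qed.

Lemma Ck_onD D k f g : open D -> Ck_on D k f -> Ck_on D k g ->
  Ck_on D k (fun x => f x + g x).
Proof.
move=> oD; elim: k f g => [|k IH] f g cf cg.
  by split => // x Dx; apply: continuousD; [exact: cf.1 | exact: cg.1].
apply: (@Ck_on_intro _ D k _ (fun v x => 'D_v f x + 'D_v g x)) => //.
- by move=> x Dx; apply: continuousD; [exact: cf.1 | exact: cg.1].
- by move=> x v Dx; apply: derD; [exact: Ck_on_is_derive cf Dx|exact: Ck_on_is_derive cg Dx].
- by move=> v; apply: IH; exact: Ck_on_derive.
Qed.

Lemma Ck_onM D k f g : open D -> Ck_on D k f -> Ck_on D k g ->
  Ck_on D k (fun x => f x * g x).
Proof.
move=> oD; elim: k f g => [|k IH] f g cf cg.
  by split => // x Dx; apply: continuousM; [exact: cf.1 | exact: cg.1].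
apply: (@Ck_on_intro _ D k _ (fun v x => 'D_v f x * g x + f x * 'D_v g x)) => //.
- by move=> x Dx; apply: continuousM; [exact: cf.1 | exact: cg.1].
- by move=> x v Dx; apply: derM; [exact: Ck_on_is_derive cf Dx|exact: Ck_on_is_derive cg Dx].
- move=> v; apply: Ck_onD => //; apply: IH; rewrite /=;
    by [exact: Ck_on_derive | exact: Ck_onS].
Qed.

Lemma Ck_onN D k f : open D -> Ck_on D k f -> Ck_on D k (fun x => - f x).
Proof.
move=> oD cf; apply: (@Ck_on_eq _ _ _ (fun x => (-1) * f x)) => //.
  by move=> x _; rewrite mulN1r.
by apply: Ck_onM => //; exact: Ck_on_cst.
Qed.

Lemma Ck_onB D k f g : open D -> Ck_on D k f -> Ck_on D k g ->
  Ck_on D k (fun x => f x - g x).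
Proof. by move=> oD cf cg; apply: Ck_onD => //; exact: Ck_onN. Qed.

Lemma Ck_on_sum D k (I : Type) (s : seq I) (F : I -> E -> R) : open D ->
  (forall i, Ck_on D k (F i)) -> Ck_on D k (fun x => \sum_(i <- s) F i x).
Proof.
move=> oD h; elim: s => [|i s IH].
  by under eq_fun do rewrite big_nil; exact: Ck_on_cst.
by under eq_fun do rewrite big_cons; exact: Ck_onD.
Qed.

Lemma Ck_on_prod D k (I : Type) (s : seq I) (F : I -> E -> R) : open D ->
  (forall i, Ck_on D k (F i)) -> Ck_on D k (fun x => \prod_(i <- s) F i x).
Proof.
move=> oD h; elim: s => [|i s IH].
  by under eq_fun do rewrite big_nil; exact: Ck_on_cst.
by under eq_fun do rewrite big_cons; exact: Ck_onM.
Qed.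

Lemma derive_scale_dir (h : R -> R) (x v a : R) : is_derive x 1 h a ->
  is_derive x v h (v * a).
Proof.
move=> dh; apply/is_derive_lineE.
have := @der_comp R R h (fun t : R => t * v + x) 0 1 a v.
rewrite mul0r add0r => /(_ dh); rewrite mulrC; apply.
by der_ring.
Qed.

Lemma Ck_on_comp D k (h : R -> R) f : open D -> Ck_on setT k h -> Ck_on D k f ->
  Ck_on D k (fun x => h (f x)).
Proof.
move=> oD; elim: k h f => [|k IH] h f ch cf.
  split => // x Dx; apply: continuous_comp; [exact: cf.1 | exact: ch.1].
apply: (@Ck_on_intro _ D k _ (fun v x => 'D_1 h (f x) * 'D_v f x)) => //.
- move=> x Dx; apply: continuous_comp; [exact: cf.1 | exact: ch.1].
- move=> x v Dx; apply: der_comp; last exact: Ck_on_is_derive cf Dx.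
  exact: Ck_on_is_derive ch _.
- move=> v; apply: Ck_onM => //; last exact: Ck_on_derive.
  by apply: (IH ('D_1 h) f); [exact: Ck_on_derive | exact: Ck_onS].
Qed.

Lemma derV f x v a : f x != 0 -> is_derive x v f a ->
  is_derive x v (fun t => (f t)^-1) (- a * (f x)^-1 * (f x)^-1).
Proof.
move=> fx0 df.
have dV : is_derive (f x) 1 (fun t : R => t^-1) (- (f x)^-1 * (f x)^-1).
  apply: is_derive_eq (is_deriveV (f := id) fx0 (der_id _)) _.
  by rewrite /GRing.scale /= mulr1 mulNr expr2 invfM.
by apply: is_derive_eq (der_comp dV df) _; ring.
Qed.

Lemma Ck_onV D k f : open D -> (forall x, D x -> f x != 0) -> Ck_on D k f ->
  Ck_on D k (fun x => (f x)^-1).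
Proof.
move=> oD f0; elim: k => [|k IH] cf.
  by split => // x Dx; apply: continuousV; [exact: f0 | exact: cf.1].
apply: (@Ck_on_intro _ D k _ (fun v x => - 'D_v f x * (f x)^-1 * (f x)^-1)) => //.
- by move=> x Dx; apply: continuousV; [exact: f0 | exact: cf.1].
- by move=> x v Dx; apply: derV; [exact: f0 | exact: Ck_on_is_derive cf Dx].
- move=> v; have cV : Ck_on D k (fun x => (f x)^-1) by apply: IH; exact: Ck_onS.
  by apply: Ck_onM => //; apply: Ck_onM => //; apply: Ck_onN => //; exact: Ck_on_derive.
Qed.

Lemma Ck_on_mxP D k m n (F : E -> 'M[R]_(m, n)) : open D ->
  Ck_on D k F <-> forall i j, Ck_on D k (fun x => F x i j).
Proof.
move=> oD.
have cc (G : E -> 'M[R]_(m, n)) x : {for x, continuous G} <->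
    forall i j, {for x, continuous (fun y => G y i j)}.
  split=> [cG i j|cG].
    by apply: (@continuous_comp _ _ _ G (fun M : 'M[R]_(m, n) => M i j)) => //; exact: coord_continuous.
  apply/cvgrPdist_lt => e e0.
  have h i j : \forall y \near x, `|G x i j - G y i j| < e.
    by have /cvgrPdist_lt := cG i j; exact.
  near=> y; rewrite /Num.norm /= mx_normrE; apply/bigmax_ltP; split => // -[i j] _ /=.
  rewrite !mxE; move: i j; near: y.
  apply: filter_forall => i; apply: filter_forall => j; exact: h.
elim: k F => [|k IH] F; split.
- by move=> [cF _] i j; split => // x Dx; exact: (cc F x).1 (cF x Dx) i j.
- by move=> h; split => // x Dx; apply/cc => i j; exact: (h i j).1.
- move=> cF i j; apply: (@Ck_on_intro _ D k _ (fun v x => 'D_v F x i j)) => //.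
  + by move=> x Dx; exact: (cc F x).1 (cF.1 x Dx) i j.
  + move=> x v Dx; have dF := (cF.2 v).1 x Dx; rewrite (derive_mx dF) mxE.
    by apply: derivable_is_derive; exact: (derivable_mxP _ _ _).1.
  + by move=> v; exact: (IH _).1 (Ck_on_derive v cF) i j.
- move=> h; have dF v x : D x -> derivable F x v.
    by move=> Dx; apply/derivable_mxP => i j; exact: ((h i j).2 v).1.
  apply: (@Ck_on_intro _ D k _ (fun v x => \matrix_(i, j) 'D_v (fun y => F y i j) x)) => //.
  + by move=> x Dx; apply/cc => i j; exact: (h i j).1.
  + by move=> x v Dx; rewrite -(derive_mx (dF v x Dx)); exact: derivable_is_derive (dF v x Dx).
  + move=> v; apply/IH => i j; apply: (Ck_on_eq oD _ (Ck_on_derive v (h i j))) => x Dx.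
    by rewrite mxE.
Unshelve. all: by end_near.
Qed.

End Smooth2.

Section Smooth1.
Context {R : realType}.
Implicit Types (f g : R -> R) (x : R).

Lemma Ck_on1_intro k f g : (forall x, is_derive x 1 f (g x)) -> Ck_on setT k g ->
  Ck_on setT k.+1 f.
Proof.
move=> df cg; apply: (@Ck_on_intro R _ _ _ k f (fun v x => v * g x)).
- exact: openT.
- by move=> x _; exact: is_derive1_continuous (df x).
- by move=> x v _; exact: derive_scale_dir.
- by move=> v; apply: Ck_onM; [exact: openT|apply: Ck_on_cst; exact: openT|].
Qed.

Lemma smooth_derive1 f : smooth_on setT f -> exists2 f1 : R -> R, smooth_on setT f1 &
  forall x, is_derive x 1 f (f1 x).
Proof.
move=> sf; exists ('D_1 f); first by move=> k; exact: Ck_on_derive (sf k.+1).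
by move=> x; exact: Ck_on_is_derive (sf 1%N) _.
Qed.

Lemma Ck_on_coord n (j : 'I_n) k (h : R -> R) : Ck_on setT k h ->
  Ck_on setT k (fun x : 'rV[R]_n => h (x 0 j)).
Proof.
move=> ch; apply: Ck_on_comp => //; first exact: openT.
have d (x v : 'rV[R]_n) : is_derive x v (fun y : 'rV[R]_n => y 0 j : R) (v 0 j).
  apply/is_derive_lineE.
  have -> : (fun h : R => (h *: v + x) 0 j) = (fun h : R => h * v 0 j + x 0 j).
    by apply/funext => t; rewrite !mxE.
  by der_ring.
case: k {ch} => [|k]; first by split => // x _; exact: coord_continuous.
apply: (@Ck_on_intro R 'rV[R]_n R _ k _ (fun v _ => v 0 j)).
- exact: openT.
- by move=> x _; exact: coord_continuous.
- by move=> v; apply: Ck_on_cst; exact: openT.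
Qed.

Lemma Ck_on_id k : Ck_on setT k (fun x : R => x).
Proof.
case: k => [|k]; first by split => // x _; exact: cvg_id.
by apply: (@Ck_on1_intro k _ (fun=> 1)); apply: Ck_on_cst; exact: openT.
Qed.

End Smooth1.

(** * Symmetry of mixed second derivatives *)

Section Schwarz.
Context {R : realType} {E : normedModType R}.
Implicit Types (D : set E) (x u v : E).

Lemma is_derive_shift (W : normedModType R) (f : E -> W) (x v : E) (s : R) a :
  is_derive (s *: v + x) v f a -> is_derive s 1 (fun h : R => f (h *: v + x)) a.
Proof.
move=> /is_derive_lineE h; apply/is_derive_lineE.
suff -> : (fun h0 : R => f ((h0 *: (1 : R) + s) *: v + x)) =
  (fun h0 : R => f (h0 *: v + (s *: v + x))) by [].
by apply/funext => t; rewrite -[t%:A]/(t * 1) mulr1 scalerDl addrA.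
Qed.

Lemma near0_plane D x u v : open D -> D x ->
  exists2 d : R, 0 < d & forall s t, `|s| < d -> `|t| < d -> D (s *: u + (t *: v + x)).
Proof.
move=> oD Dx; have /nbhs_ballP[e /= e0 he] : nbhs x D by exact: open_nbhs_nbhs.
exists (e / (`|u| + `|v| + 1)); first by rewrite divr_gt0 // addr_ge0_gt0 ?addr_ge0.
have p0 : 0 < `|u| + `|v| + 1 by rewrite ltr_pwDr // addr_ge0.
move=> s t sd td; apply: he; rewrite -ball_normE /ball_ /=.
have -> : x - (s *: u + (t *: v + x)) = - (s *: u + t *: v).
  by rewrite addrA opprD addrCA subrr addr0.
rewrite normrN; apply: le_lt_trans (ler_normD _ _) _; rewrite !normrZ.
have h (r n : R) : 0 <= n -> `|r| < e / (`|u| + `|v| + 1) -> `|r| * n <= e / (`|u| + `|v| + 1) * n.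
  by move=> n0 /ltW rd; exact: ler_wpM2r.
apply: le_lt_trans (lerD (h _ _ (normr_ge0 u) sd) (h _ _ (normr_ge0 v) td)) _.
by rewrite -mulrDr mulrAC ltr_pdivrMr // ltr_pM2l // ltrDl.
Qed.

Lemma half_dist_triangle (p q r e : R) :
  `|p - r| < e / 2 -> `|q - r| < e / 2 -> `|p - q| <= e.
Proof.
move=> pr qr; have -> : p - q = (p - r) - (q - r) by ring.
by apply: le_trans (ler_normB _ _) _; lra.
Qed.

Lemma second_difference_unique (h p q r s a b : R) : 0 < h ->
  p - q - (r - s) = a * h * h -> p - r - (q - s) = b * h * h -> a = b.
Proof.
move=> h0 e1 e2; have hn : h * h != 0 by rewrite mulf_neq0 // gt_eqF.
by apply: (mulIf hn); rewrite !mulrA -e1 -e2; ring.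
Qed.

Lemma derive_comm D (f : E -> R) x u v : open D -> D x -> Ck_on D 2 f ->
  'D_u ('D_v f) x = 'D_v ('D_u f) x.
Proof.
move=> oD Dx cf; have [d d0 hd] := near0_plane u v oD Dx.
(* The second difference over a parallelogram is a value of either mixed
   derivative times the product of the sides. *)
have mixed (a b : E) (h : R) : 0 < h -> (forall s t, 0 <= s <= h -> 0 <= t <= h ->
     D (s *: a + (t *: b + x))) ->
   exists s t, [/\ 0 <= s <= h, 0 <= t <= h &
     f (h *: a + (h *: b + x)) - f (h *: b + x) - (f (h *: a + x) - f x) =
     'D_b ('D_a f) (s *: a + (t *: b + x)) * h * h].
  move=> h0 hD.
  have [|s /andP[s0 sh] es] := @mean_value R
    (fun s => f (s *: a + (h *: b + x)) - f (s *: a + x))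
    (fun s => 'D_a f (s *: a + (h *: b + x)) - 'D_a f (s *: a + x)) 0 h h0.
    move=> s shh; apply: derB; apply: is_derive_shift; apply: (Ck_on_is_derive cf).
      by apply: hD => //; rewrite lexx ltW.
    by have := hD s 0 shh; rewrite scale0r add0r; apply; rewrite lexx ltW.
  move: es; rewrite !scale0r !add0r subr0 => es.
  have [|t /andP[t0 th] et] := @mean_value R
    (fun t => 'D_a f (t *: b + (s *: a + x)))
    (fun t => 'D_b ('D_a f) (t *: b + (s *: a + x))) 0 h h0.
    move=> t thh; apply: (is_derive_shift (f := 'D_a f)); apply: (Ck_on_is_derive (Ck_on_derive a cf)).
    by rewrite addrCA; apply: hD => //; rewrite !ltW.
  move: et; rewrite !scale0r !add0r subr0 => et.
  exists s, t; rewrite !ltW //; split => //.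
  rewrite [s *: a + _]addrCA -et [t in f t - _ - _]addrC.
  have -> : 'D_a f (h *: b + (s *: a + x)) = 'D_a f (s *: a + (h *: b + x)) by rewrite addrCA.
  by rewrite -es [_ + h *: a]addrC; ring.
have cont (a b : E) : {for x, continuous ('D_b ('D_a f))}.
  by apply: (Ck_on_continuous (Ck_on_derive b (Ck_on_derive a cf))).
have small (a b : E) (e : R) : 0 < e -> exists2 h, 0 < h & forall s t, 0 <= s <= h -> 0 <= t <= h ->
    D (s *: a + (t *: b + x)) /\
    `|'D_b ('D_a f) x - 'D_b ('D_a f) (s *: a + (t *: b + x))| < e.
  move=> e0; have /cvgrPdist_lt/(_ e e0) /= := cont a b => hn.
  have : nbhs x (D `&` [set y | `|'D_b ('D_a f) x - 'D_b ('D_a f) y| < e]).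
    by apply: filterI => //; exact: open_nbhs_nbhs.
  rewrite nbhsE /= => -[B [oB Bx] hB].
  have [h h0 hh] := near0_plane a b oB Bx.
  exists (h / 2); first by rewrite divr_gt0.
  move=> s t /andP[s0 sh] /andP[t0 th]; apply: hB; apply: hh; rewrite ger0_norm //.
    by apply: le_lt_trans sh _; rewrite gtr_pMr // invf_lt1 // ltr1n.
  by apply: le_lt_trans th _; rewrite gtr_pMr // invf_lt1 // ltr1n.
apply/eqP; rewrite -subr_eq0 -normr_le0; apply/ler_addgt0Pl => e e0; rewrite addr0.
have e20 : 0 < e / 2 by rewrite divr_gt0.
have [h1 h10 H1] := small u v _ e20; have [h2 h20 H2] := small v u _ e20.
set h := Num.min h1 h2; have h0 : 0 < h by rewrite lt_min h10.
have lh s : 0 <= s <= h -> 0 <= s <= h1 /\ 0 <= s <= h2.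
  by move=> /andP[-> sh]; split; apply: le_trans sh _; rewrite ge_min lexx ?orbT.
have [s1 [t1 [hs1 ht1 e1]]] := mixed u v h h0 (fun s t hs ht => (H1 s t (lh _ hs).1 (lh _ ht).1).1).
have [s2 [t2 [hs2 ht2 e2]]] := mixed v u h h0 (fun s t hs ht => (H2 s t (lh _ hs).2 (lh _ ht).2).1).
have A1 := (H1 s1 t1 (lh _ hs1).1 (lh _ ht1).1).2.
have A2 := (H2 s2 t2 (lh _ hs2).2 (lh _ ht2).2).2.
have eq : 'D_v ('D_u f) (s1 *: u + (t1 *: v + x)) = 'D_u ('D_v f) (s2 *: v + (t2 *: u + x)).
  rewrite (addrCA (h *: v)) in e2; exact: (second_difference_unique h0 e1 e2).
rewrite eq in A1.
exact: half_dist_triangle A2 A1.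
Qed.

End Schwarz.

(** * Chain rule along a moving point and differentiation under the integral sign *)

Section TwoVariables.
Context {R : realType}.

Lemma is_derive1_cvg (f : R -> R) (x l : R) :
  is_derive x 1 f l <-> (h^-1 * (f (h + x) - f x) @[h --> 0^'] --> l).
Proof.
have E : (fun h : R => h^-1 *: ((f \o shift x) (h *: (1 : R)) - f x)) =
    (fun h => h^-1 * (f (h + x) - f x)).
  by apply/funext => h /=; rewrite -[h%:A]/(h * 1) mulr1.
split=> [[d e]|h].
  by move: d; rewrite /derivable E => d; rewrite -e /derive E.
split; first by rewrite /derivable E; apply/cvg_ex; exists l.
by rewrite /derive E; apply/cvg_lim.
Qed.

Lemma mean_value_abs (f df : R -> R) (x y : R) :
  (forall z, `|z - x| <= `|y - x| -> is_derive z 1 f (df z)) ->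
  exists2 c, `|c - x| <= `|y - x| & f y - f x = df c * (y - x).
Proof.
move=> h; have [xy|yx|->] := ltgtP x y; last by exists y => //; rewrite !subrr mulr0.
- have [|c /andP[xc cy] e] := @mean_value R f df x y xy.
    by move=> z /andP[xz zy]; apply: h; rewrite !ger0_norm ?subr_ge0 ?lerB // ltW.
  by exists c => //; rewrite !ger0_norm ?subr_ge0 ?lerB // ltW.
- have [|c /andP[xc cy] e] := @mean_value R f df y x yx.
    move=> z /andP[yz zx]; apply: h; rewrite !ler0_norm ?subr_le0 // ?(ltW yx) //.
    by rewrite !opprB lerB.
  exists c; last by rewrite -[f y - _]opprB e; ring.
  by rewrite !ler0_norm ?subr_le0 ?(ltW yx) ?(ltW cy) // !opprB lerB // ltW.
Qed.

Lemma continuous_pair_near (g : R -> R -> R) (a b e : R) : 0 < e ->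
  {for (a, b), continuous (fun z : R * R => g z.1 z.2)} ->
  exists2 d, 0 < d & forall t y, `|t - a| < d -> `|y - b| < d -> `|g t y - g a b| < e.
Proof.
move=> e0 /cvgrPdist_lt/(_ e e0) /nbhs_ballP[d /= d0 hd]; exists d => // t y ta yb.
by rewrite distrC; apply: (hd (t, y)); split; rewrite -ball_normE /ball_ /= distrC.
Qed.

(** Only one-variable derivatives are assumed: the increment splits into a change of [t] at fixed
    [y0], differentiable by hypothesis, and a change of [y] at the moved [t], where the mean value
    theorem and the joint continuity of [fy] give the limit. *)
Lemma chain2 (f fy : R -> R -> R) (ft y0 Y1 : R) (Y : R -> R) (d : R) : 0 < d ->
  (forall t y : R, `|t| < d -> is_derive y 1 (f t) (fy t y)) ->
  {for (0, y0), continuous (fun z : R * R => fy z.1 z.2)} ->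
  is_derive (0 : R) 1 (fun t => f t y0) ft -> Y 0 = y0 -> is_derive (0 : R) 1 Y Y1 ->
  is_derive (0 : R) 1 (fun t => f t (Y t)) (ft + fy 0 y0 * Y1).
Proof.
move=> d0 hf cfy dft Y0 dY.
suff dS : is_derive (0 : R) 1 (fun t => f t (Y t) - f t y0) (fy 0 y0 * Y1).
  have := derD dft dS; congr (is_derive _ _ _ _); apply/funext => t; ring.
(* The divided difference in the second variable, completed by its limit where [Y h = y0]. *)
pose q h := if Y h == y0 then fy 0 y0 else (f h (Y h) - f h y0) / (Y h - y0).
apply/is_derive1_cvg.
have -> : (fun h => h^-1 * (f (h + 0) (Y (h + 0)) - f (h + 0) y0 - (f 0 (Y 0) - f 0 y0))) =
    (fun h => q h * (h^-1 * (Y (h + 0) - Y 0))).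
  apply/funext => h; rewrite Y0 subrr subr0 !addr0 /q; case: eqVneq => [->|hy].
    by rewrite !subrr !mulr0.
  have : Y h - y0 != 0 by rewrite subr_eq0.
  by move=> ?; rewrite mulrCA -mulrA mulVf // mulr1.
apply: cvgM; last exact/is_derive1_cvg.
apply/cvgrPdist_lt => e e0; have [r r0 hr] := continuous_pair_near e0 cfy.
have cY : {for 0, continuous Y} by exact: is_derive1_continuous dY.
have : \forall h \near (0 : R), [/\ `|h| < d, `|h| < r & `|Y h - y0| < r].
  near=> h; split; near: h.
  - by near=> h; rewrite -[h]subr0 distrC; near: h; apply: cvgr_dist_lt.
  - by near=> h; rewrite -[h]subr0 distrC; near: h; apply: cvgr_dist_lt.
  - by near=> h; rewrite distrC -Y0; near: h; move/cvgrPdist_lt : cY; apply.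
rewrite /= => H; apply: (@nbhs_dnbhs R (0 : R)).
near=> h.
have [hd hr' hY] : [/\ `|h| < d, `|h| < r & `|Y h - y0| < r] by near: h.
rewrite /q; case: eqVneq => hy; first by rewrite subrr normr0.
have [z _|c hc ->] := @mean_value_abs (f h) (fy h) y0 (Y h); first exact: hf.
rewrite -mulrA mulfV ?subr_eq0 // mulr1 distrC; apply: hr; first by rewrite subr0.
exact: le_lt_trans hc hY.
Unshelve. all: by end_near.
Qed.

(** Continuity of [gt] at the points [(0, y)] becomes uniform over the compact interval, so that the
    error of the difference quotient is small at every [y] at once. *)
Lemma prim_under (g gt : R -> R -> R) (d X : R) : 0 < d -> 0 < X ->
  (forall t y : R, `|t| < d -> is_derive t 1 (fun s => g s y) (gt t y)) ->
  (forall t, `|t| < d -> continuous (g t)) ->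
  (forall y, {for (0, y), continuous (fun z : R * R => gt z.1 z.2)}) ->
  is_derive (0 : R) 1 (fun t => prim (g t) X) (prim (gt 0) X).
Proof.
move=> d0 X0 hg cg cgt.
have cgt0 : continuous (gt 0).
  move=> y; apply/cvgrPdist_lt => e e0.
  have [r r0 hr] := continuous_pair_near e0 (cgt y).
  near=> z; rewrite distrC; apply: hr; first by rewrite subr0 normr0.
  by rewrite distrC; near: z; apply: cvgr_dist_lt.
apply/is_derive1_cvg; apply/cvgrPdist_lt => e e0.
have e20 : 0 < e / (2 * X) by rewrite divr_gt0 // mulr_gt0.
have tube : \forall t \near (0 : R), `[0, X]%classic `<=`
    [set y | `|gt t y - gt 0 y| < e / (2 * X)].
  have /compact_near_coveringP := @segment_compact R 0 X.
  move=> /(_ R (nbhs (0 : R)) (fun t y => `|gt t y - gt 0 y| < e / (2 * X))).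
  apply => y _.
  have [r r0 hr] := continuous_pair_near (divr_gt0 e20 (ltr0n R 2)) (cgt y).
  have h0 : `|(0 : R) - 0| < r by rewrite subr0 normr0.
  near=> z t => /=.
  have hz : `|z - y| < r.
    by rewrite distrC; near: z; apply: cvgr_dist_lt.
  have ht : `|t - 0| < r by rewrite distrC; near: t; apply: cvgr_dist_lt.
  have A1 := hr _ _ ht hz; have A2 := hr _ _ h0 hz.
  have -> : gt t z - gt 0 z = (gt t z - gt 0 y) - (gt 0 z - gt 0 y) by ring.
  by apply: le_lt_trans (ler_normB _ _) _; lra.
have [r /= r0 hr] : exists2 r, 0 < r & forall t, `|t| < r -> `[0, X]%classic `<=`
    [set y | `|gt t y - gt 0 y| < e / (2 * X)].
  have /nbhs_ballP[r /= r0 hr] := tube; exists r => // t tr; apply: hr.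
  by rewrite -ball_normE /ball_ /= sub0r normrN.
near=> h; rewrite addr0.
have hn0 : h != 0 by near: h; exact: nbhs_dnbhs_neq.
have hr' : `|h| < r by near: h; exact: dnbhs0_lt.
have hd' : `|h| < d by near: h; exact: dnbhs0_lt.
have d00 : `|(0 : R)| < d by rewrite normr0.
have [P0 dP] := primP (cg h hd'); have [Q0 dQ] := primP (cg 0 d00).
have [S0 dS] := primP cgt0.
(* The error is itself the increment of a function with known derivative: a mean value in [y]
   followed by one in [t] replaces an estimate of integrals. *)
have hF (y : R) : 0 <= y <= X ->
    is_derive y 1 (fun y => prim (gt 0) y - h^-1 * (prim (g h) y - prim (g 0) y))
      (gt 0 y - h^-1 * (g h y - g 0 y)).
  by move=> _; der_ring.
have [c /andP[c0 cX]] := mean_value X0 hF.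
rewrite P0 Q0 S0 !subrr mulr0 !subr0 => ->.
have [z hz|b hb ->] := @mean_value_abs (fun s => g s c) (fun s => gt s c) 0 h.
  by apply: hg; move: hz; rewrite !subr0 => /le_lt_trans; apply.
rewrite subr0 [h^-1 * _]mulrC -mulrA mulfV // mulr1.
rewrite normrM (ger0_norm (ltW X0)) -ltr_pdivlMr //.
have br : `|b| < r by move: hb; rewrite !subr0 => /le_lt_trans; apply.
have := hr b br c; rewrite /= in_itv /= !ltW // => /(_ isT); rewrite distrC.
move=> /lt_le_trans; apply; rewrite ler_pM2l // lef_pV2 ?posrE ?mulr_gt0 //; lra.
Unshelve. all: by end_near.
Qed.

End TwoVariables.

(** * A smooth function with compact support *)

Section Bump.
Context {R : realType}.
Implicit Types (x h : R) (m k : nat).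

(** The powers of [1 / x] make the family stable under differentiation, up to linear combinations,
    so that smoothness is an induction over all [m] at once. *)
Definition flat m x : R := if 0 < x then x^-1 ^+ m * expR (- x^-1) else 0.

(** With [y = 1 / x], one has [e^y >= (y / (m + 2))^(m + 2)]. The two powers of [x] to spare give
    the derivative 0 at the origin. *)
Lemma flat_bound m : exists2 C : R, 0 <= C & forall x, 0 < x -> flat m x <= C * x ^+ 2.
Proof.
exists (m.+2%:R ^+ m.+2); first by rewrite exprn_ge0.
move=> x x0; rewrite /flat x0.
have m0 : 0 < m.+2%:R :> R by rewrite ltr0n.
have h : (x^-1 / m.+2%:R) ^+ m.+2 <= expR (x^-1).
  have -> : expR x^-1 = expR (x^-1 / m.+2%:R) ^+ m.+2.
    by rewrite -expRM_natl; congr expR; rewrite mulrC mulfVK // gt_eqF.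
  rewrite lerXn2r ?nnegrE ?expR_ge0 ?divr_ge0 ?invr_ge0 ?(ltW x0) //.
  by apply: le_trans (expR_ge1Dx _); rewrite lerDr.
rewrite expRN ler_pdivrMr ?expR_gt0 //.
apply: (@le_trans _ _ (m.+2%:R ^+ m.+2 * x ^+ 2 * (x^-1 / m.+2%:R) ^+ m.+2)); last first.
  by rewrite ler_wpM2l // mulr_ge0 ?exprn_ge0 // ltW.
rewrite exprMn [m.+2%:R^-1 ^+ _]exprVn [x^-1 ^+ m.+2]exprSr [x^-1 ^+ m.+1]exprSr.
have N0 : m.+2%:R ^+ m.+2 != 0 :> R by rewrite expf_neq0 // gt_eqF.
move: (m.+2%:R ^+ m.+2) N0 => N N0; move: (x^-1 ^+ m) => z.
suff -> : N * x ^+ 2 * (z / x / x / N) = z by [].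
by field; rewrite N0 gt_eqF.
Qed.

Lemma flat_derive m x :
  is_derive x 1 (flat m) (- m%:R * flat m.+1 x + flat m.+2 x).
Proof.
have dexp (t : R) : is_derive t 1 (expR : R -> R) (expR t) by exact: is_derive_expR.
have [x0|x0|->] := ltgtP x 0.
- apply: (@is_derive_near _ (fun=> 0)).
    near=> t; rewrite /flat ifF //; apply/negbTE; rewrite -leNgt ltW //.
    by near: t; exact: lt_nbhsl.
  rewrite /flat !ifF ?mulr0 ?addr0; first exact: der_cst.
  + by apply/negbTE; rewrite -leNgt ltW.
  + by apply/negbTE; rewrite -leNgt ltW.
- apply: (@is_derive_near _ (fun x => x^-1 ^+ m * expR (- x^-1))).
    by near=> t; rewrite /flat ifT //; near: t; exact: lt_nbhsr.
  have dV : is_derive x 1 (fun t : R => t^-1) (- 1 * x^-1 * x^-1).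
    have xn : x != 0 by rewrite gt_eqF.
    exact: (derV (f := fun t : R => t) xn (der_id x)).
  rewrite /flat x0; case: m => [|m].
    under eq_fun do rewrite expr0.
    by der_eq; rewrite /= !expr2 mulr0n; ring.
  by der_eq; rewrite /= !exprS; ring.
- rewrite /flat ltxx mulr0 addr0.
  have [C C0 hC] := flat_bound m.
  apply/is_derive1_cvg; apply/cvgrPdist_lt => e e0; rewrite ltxx.
  near=> h; rewrite addr0 subr0 sub0r normrN.
  case: ifPn => [h1|_]; last by rewrite mulr0 normr0.
  have f0 : 0 <= flat m h by rewrite /flat h1 mulr_ge0 ?expR_ge0 // exprn_ge0 // invr_ge0 ltW.
  have := hC h h1; move: f0; rewrite {1 2}/flat h1 => f0 f1.
  have hi : 0 <= h^-1 by rewrite invr_ge0 ltW.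
  rewrite ger0_norm; last exact: mulr_ge0.
  rewrite mulrC ltr_pdivrMr //.
  apply: le_lt_trans f1 _; rewrite expr2 mulrA ltr_pM2r //.
  have hh : `|h| < e / (C + 1).
    by near: h; apply: dnbhs0_lt; rewrite divr_gt0 // ltr_wpDl.
  move: hh; rewrite gtr0_norm // ltr_pdivlMr ?ltr_wpDl // => hh.
  by apply: le_lt_trans hh; rewrite mulrC ler_pM2l // lerDl.
Unshelve. all: by end_near.
Qed.

Lemma flat_smooth m : smooth_on setT (flat m).
Proof.
move=> k; elim: k m => [|k IH] m.
  by split => // x _; exact: is_derive1_continuous (flat_derive m x).
apply: (Ck_on1_intro (flat_derive m)); apply: Ck_onD; [exact: openT| |exact: IH].
by apply: Ck_onM; [exact: openT | apply: Ck_on_cst; exact: openT | exact: IH].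
Qed.

Lemma exists_bump : exists chi : R -> R, [/\ smooth_on setT chi,
  forall x, 0 <= x <= 1 -> chi x = 1, forall x, 0 <= chi x <= 1 &
  forall x, 2 <= `|x| -> chi x = 0].
Proof.
have f0 x : 0 <= flat 0 x.
  by rewrite /flat; case: ifP => // x0; rewrite expr0 mul1r expR_ge0.
have fp x : 0 < x -> 0 < flat 0 x by move=> x0; rewrite /flat x0 expr0 mul1r expR_gt0.
have fn x : x <= 0 -> flat 0 x = 0 by move=> x0; rewrite /flat ltNge x0.
have dp x : 0 < flat 0 x + flat 0 (1 - x).
  have [x0|x0] := ltP 0 x; first by rewrite ltr_pwDl // fp.
  by rewrite ltr_wpDl // fp // subr_gt0 (le_lt_trans x0).
pose psi x := flat 0 x * (flat 0 x + flat 0 (1 - x))^-1.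
have sB (a : R) : smooth_on setT (fun x : R => a - x).
  by move=> k; apply: Ck_onB; [exact: openT | apply: Ck_on_cst; exact: openT | exact: Ck_on_id].
have spsi : smooth_on setT psi.
  move=> k; apply: Ck_onM; [exact: openT | exact: flat_smooth |].
  apply: Ck_onV; [exact: openT | by move=> x _; rewrite gt_eqF |].
  apply: Ck_onD; [exact: openT | exact: flat_smooth |].
  by apply: (@Ck_on_comp _ _ _ _ (flat 0)); [exact: openT | exact: flat_smooth | exact: sB].
have psi01 x : 0 <= psi x <= 1.
  rewrite /psi divr_ge0 ?f0 ?(ltW (dp x)) //= ler_pdivrMr // mul1r lerDl; exact: f0.
(* [psi] is 0 on the left of 0 and 1 on the right of 1: the first factor is 1 for [x >= 0], the
   second for [x <= 1]. *)
exists (fun x => psi (x + 1) * psi (2 - x)); split.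
- move=> k; apply: Ck_onM; first exact: openT.
    apply: (@Ck_on_comp _ _ _ _ psi); [exact: openT | exact: spsi |].
    by apply: Ck_onD; [exact: openT | exact: Ck_on_id | apply: Ck_on_cst; exact: openT].
  by apply: (@Ck_on_comp _ _ _ _ psi); [exact: openT | exact: spsi | exact: sB].
- have p1 y : 1 <= y -> psi y = 1.
    move=> y1; rewrite /psi (fn (1 - y)) ?subr_le0 // addr0 mulfV // gt_eqF // fp //.
    exact: lt_le_trans y1.
  by move=> x /andP[x0 x1]; rewrite !p1 ?mulr1 //; lra.
- move=> x; have /andP[a1 a2] := psi01 (x + 1); have /andP[b1 b2] := psi01 (2 - x).
  by rewrite mulr_ge0 //= mulr_ile1.
- have p0 y : y <= 0 -> psi y = 0 by move=> y0; rewrite /psi fn // mul0r.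
  move=> x; rewrite ler_normr => /orP[x2|x2]; first by rewrite [psi (2 - x)]p0 ?mulr0 //; lra.
  by rewrite [psi (x + 1)]p0 ?mul0r //; lra.
Qed.

End Bump.

(** * The variational derivative and its linearization *)

Section TwoComponents.
Context {R : realType}.

Lemma sum2 (V : nmodType) (F : 'I_2 -> V) : \sum_i F i = F 0 + F 1.
Proof. by rewrite !big_ord_recl big_ord0 addr0; congr (_ + F _); apply/val_inj. Qed.

Lemma ord2P (i : 'I_2) : i = 0 \/ i = 1.
Proof. by case: i => -[|[|//]] h; [left | right]; apply/val_inj. Qed.

Lemma JmxE0 (u : 'cV[R]_2) : (Jmx *m u) 0 0 = u 1 0.
Proof. by rewrite mxE sum2 !mxE /=; ring. Qed.

Lemma JmxE1 (u : 'cV[R]_2) : (Jmx *m u) 1 0 = - u 0 0.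
Proof. by rewrite mxE sum2 !mxE /=; ring. Qed.

Definition JmxE := (JmxE0, JmxE1).

Lemma sqnE (u : 'cV[R]_2) : sqn u = u 0 0 * u 0 0 + u 1 0 * u 1 0.
Proof. by rewrite /sqn /dotp sum2. Qed.

Lemma sqn_ge0 (u : 'cV[R]_2) : 0 <= sqn u.
Proof. by rewrite sqnE addr_ge0 // -expr2 sqr_ge0. Qed.

Lemma der_mx_entry m n (U v : 'M[R]_(m, n)) i j :
  is_derive U v (fun M : 'M[R]_(m, n) => M i j : R) (v i j).
Proof.
apply/is_derive_lineE.
have -> : (fun h : R => (h *: v + U) i j) = (fun h : R => h * v i j + U i j).
  by apply/funext => t; rewrite !mxE.
by der_ring.
Qed.

End TwoComponents.

Lemma variational_derivative_entry (R : realType) n (A : @density R n) Y x i :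
  variational_derivative A Y x i 0 = dU A (Y x) (grad Y x) i 0 -
    \sum_j ('D_(delta_mx 0 j) (fun y => dP A (Y y) (grad Y y)) x) i j.
Proof. by rewrite /variational_derivative /div mxE [X in _ + X]mxE [X in - X]mxE. Qed.

Section Density.
Context {R : realType}.
Variables (k k1 k2 W W1 W2 : R -> R) (om c : R).
Hypothesis dk : forall s : R, is_derive s 1 k (k1 s).
Hypothesis dk1 : forall s : R, is_derive s 1 k1 (k2 s).
Hypothesis dW : forall s : R, is_derive s 1 W (W1 s).
Hypothesis dW1 : forall s : R, is_derive s 1 W1 (W2 s).

(* The density at [U = (u0, u1)], where [a] is the [x]-derivative of [U] and [T]
   the squared norm of the derivatives in the transverse variables. *)
Definition hdens kx kp u0 u1 a0 a1 T : R :=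
  2^-1 * k (u0 * u0 + u1 * u1) * ((kx * a0 + kp * u1) * (kx * a0 + kp * u1)
     + (kx * a1 - kp * u0) * (kx * a1 - kp * u0) + T)
  + W (u0 * u0 + u1 * u1) - om * (2^-1 * (u0 * u0 + u1 * u1))
  + c * (2^-1 * (u1 * (kx * a0 + kp * u1) - u0 * (kx * a1 - kp * u0))).

(* One component, of index [a], of the variational derivative at [U = u],
   [D U = p], [D^2 U = q]; [jpa] is the component of [J p]. *)
Definition vform (u0 u1 p0 p1 ua pa qa jpa : R) : R :=
  let s := u0 * u0 + u1 * u1 in let up := u0 * p0 + u1 * p1 in
  let pp := p0 * p0 + p1 * p1 in
  k1 s * pp * ua + 2 * W1 s * ua - om * ua - c * jpa - k s * qa - 2 * k1 s * up * pa.

Definition lform (u0 u1 p0 p1 ua pa qa w0 w1 r0 r1 wa ra ta jra : R) : R :=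
  let s := u0 * u0 + u1 * u1 in let up := u0 * p0 + u1 * p1 in
  let pp := p0 * p0 + p1 * p1 in
  let ds := 2 * (u0 * w0 + u1 * w1) in
  let dup := w0 * p0 + w1 * p1 + u0 * r0 + u1 * r1 in
  let dpp := 2 * (p0 * r0 + p1 * r1) in
  k2 s * ds * pp * ua + k1 s * dpp * ua + k1 s * pp * wa
  + 2 * (W2 s * ds * ua + W1 s * wa) - om * wa - c * jra - k1 s * ds * qa - k s * ta
  - 2 * (k2 s * ds * up * pa + k1 s * dup * pa + k1 s * up * ra).

Lemma der_vform (u0 u1 p0 p1 ua pa qa jpa : R -> R) (t w0 w1 r0 r1 wa ra ta jra : R) :
  is_derive t 1 u0 w0 -> is_derive t 1 u1 w1 -> is_derive t 1 p0 r0 ->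
  is_derive t 1 p1 r1 -> is_derive t 1 ua wa -> is_derive t 1 pa ra ->
  is_derive t 1 qa ta -> is_derive t 1 jpa jra ->
  is_derive t 1
    (fun t => vform (u0 t) (u1 t) (p0 t) (p1 t) (ua t) (pa t) (qa t) (jpa t))
    (lform (u0 t) (u1 t) (p0 t) (p1 t) (ua t) (pa t) (qa t) w0 w1 r0 r1 wa ra ta jra).
Proof. by move=> *; rewrite /vform /lform /=; der_ring. Qed.

Section Field.
Variables (n : nat) (kx kp : R).
Local Notation E := 'rV[R]_n.+1.
Local Notation e0 := (delta_mx 0 ord0 : E).
Local Notation A := (@scaled_density R n k W om c kx kp).

Definition trans_sq (P : 'M[R]_(2, n.+1)) : R :=
  \sum_(j < n) (P 0 (lift ord0 j) * P 0 (lift ord0 j)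
                + P 1 (lift ord0 j) * P 1 (lift ord0 j)).

Lemma scaled_densityE U P : A U P =
  hdens kx kp (U 0 0) (U 1 0) (P 0 ord0) (P 1 ord0) (trans_sq P).
Proof.
rewrite /scaled_density; set P' := \matrix_(i, j) _.
have hP i j : P' i j = if j == ord0 then kx * P i j + kp * (Jmx *m U) i 0 else P i j.
  by rewrite mxE.
rewrite /H0 /Mass /Q1 /hdens sqnE /sqn_grad sum2 /dotp sum2 ![col _ _ _ _]mxE.
rewrite !big_ord_recl !hP eqxx !JmxE /trans_sq big_split /=.
have h i : \sum_(j < n) P' i (lift ord0 j) ^+ 2 =
    \sum_(j < n) P i (lift ord0 j) * P i (lift ord0 j).
  by apply: eq_bigr => j _; rewrite hP /= expr2.
rewrite !h !expr2; ring.
Qed.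

Lemma dUE U P i : dU A U P i 0 =
  let s := U 0 0 * U 0 0 + U 1 0 * U 1 0 in
  let p0 := kx * P 0 ord0 + kp * U 1 0 in let p1 := kx * P 1 ord0 - kp * U 0 0 in
  k1 s * (p0 * p0 + p1 * p1 + trans_sq P) * U i 0
  + k s * kp * (if i == 0 then - p1 else p0) + 2 * W1 s * U i 0 - om * U i 0
  + c / 2 * (if i == 0 then - p1 else p0) + c / 2 * kp * U i 0.
Proof.
rewrite /dU mxE.
have -> : A^~ P = (fun U => hdens kx kp (U 0 0) (U 1 0) (P 0 ord0) (P 1 ord0) (trans_sq P)).
  by apply/funext => M; exact: scaled_densityE.
have := fun v => der_mx_entry U v 0 0; have := fun v => der_mx_entry U v 1 0.
move=> /(_ (delta_mx i 0)) d1 /(_ (delta_mx i 0)) d0.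
apply: derive_val; rewrite /hdens /=; der_eq.
by case: (ord2P i) => ->; rewrite !mxE /=; field.
Qed.

Lemma der_trans_sq P i j : is_derive P (delta_mx i j) trans_sq
  (if j == ord0 then 0 else 2 * P i j).
Proof.
pose d l : R := 2 * P 0 (lift ord0 l) * (delta_mx i j : 'M[R]_(2, n.+1)) 0 (lift ord0 l)
   + 2 * P 1 (lift ord0 l) * (delta_mx i j : 'M[R]_(2, n.+1)) 1 (lift ord0 l).
have : is_derive P (delta_mx i j) trans_sq (\sum_(l < n) d l).
  apply: der_sum => l _.
  have d0 := der_mx_entry P (delta_mx i j) 0 (lift ord0 l).
  have d1 := der_mx_entry P (delta_mx i j) 1 (lift ord0 l).
  by rewrite /d; der_ring.
move=> /is_derive_eq; apply; rewrite /d; case: (unliftP ord0 j) => [l|] ->.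
  have -> : (lift ord0 l == ord0) = false by [].
  rewrite (bigD1 l) //= big1 ?addr0.
    by case: (ord2P i) => ->; rewrite !mxE /= !eqxx /= ?mulr1n ?mulr0n; ring.
  move=> l' l'l; rewrite !mxE !(inj_eq (lift_inj)) (negbTE l'l) !andbF /= ?mulr0n; ring.
by rewrite eqxx big1 // => l _; rewrite !mxE /= !andbF /= ?mulr0n; ring.
Qed.

Lemma dPE U P i j : dP A U P i j =
  let s := U 0 0 * U 0 0 + U 1 0 * U 1 0 in
  if j == ord0 then kx * (k s * (kx * P i ord0 + kp * (if i == 0 then U 1 0 else - U 0 0))
     + c / 2 * (if i == 0 then U 1 0 else - U 0 0))
  else k s * P i j.
Proof.
rewrite /dP mxE.
have -> : A U = (fun P => hdens kx kp (U 0 0) (U 1 0) (P 0 ord0) (P 1 ord0) (trans_sq P)).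
  by apply/funext => M; exact: scaled_densityE.
have d0 := der_mx_entry P (delta_mx i j) 0 ord0.
have d1 := der_mx_entry P (delta_mx i j) 1 ord0.
have dT := der_trans_sq P i j.
apply: derive_val; rewrite /hdens /=; der_eq.
case: (unliftP ord0 j) => [l|] ->; last first.
  by case: (ord2P i) => ->; rewrite !mxE /= ?eqxx /=; field.
have -> : (lift ord0 l == ord0) = false by [].
by rewrite /= !mxE /= !andbF /= ?mulr0n; case: (ord2P i) => ->; field.
Qed.

Local Notation pd j f := ('D_(delta_mx 0 j : E) f).
Local Notation comp Y i := (fun y : E => Y y i 0).

Definition sel (i : 'I_2) (a0 a1 : R) : R := if i == 0 then a0 else a1.

(* A component of the variational derivative at [U = u], where [a] and [b] are the
   first and second [x]-derivatives of [U], [e0], [e1], [ei] the transverse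
   gradients of [u0], [u1] and of the component, and [f] its transverse second
   derivatives. *)
Definition vd_expr (i : 'I_2) (u0 u1 a0 a1 b0 b1 : R) (e0 e1 ei f : 'I_n -> R) : R :=
  let p0 := kx * a0 + kp * u1 in let p1 := kx * a1 - kp * u0 in
  let q0 := kx * (kx * b0 + kp * a1) + kp * p1 in
  let q1 := kx * (kx * b1 - kp * a0) - kp * p0 in
  let s := u0 * u0 + u1 * u1 in
  vform u0 u1 p0 p1 (sel i u0 u1) (sel i p0 p1) (sel i q0 q1) (sel i p1 (- p0))
  + k1 s * (\sum_(j < n) (e0 j * e0 j + e1 j * e1 j)) * sel i u0 u1
  - \sum_(j < n) (k1 s * (2 * (u0 * e0 j + u1 * e1 j)) * ei j + k s * f j).

(** The form [lform] with [d_x] replaced by [kx d_x + kp J]: [r] and [t] are this operator applied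
    once and twice to [w], whose first and second [x]-derivatives are [c] and [d]. *)
Definition hess_expr (i : 'I_2) (u0 u1 a0 a1 b0 b1 w0 w1 c0 c1 d0 d1 : R) : R :=
  let p0 := kx * a0 + kp * u1 in let p1 := kx * a1 - kp * u0 in
  let q0 := kx * (kx * b0 + kp * a1) + kp * p1 in
  let q1 := kx * (kx * b1 - kp * a0) - kp * p0 in
  let r0 := kx * c0 + kp * w1 in let r1 := kx * c1 - kp * w0 in
  let t0 := kx * (kx * d0 + kp * c1) + kp * r1 in
  let t1 := kx * (kx * d1 - kp * c0) - kp * r0 in
  lform u0 u1 p0 p1 (sel i u0 u1) (sel i p0 p1) (sel i q0 q1)
    w0 w1 r0 r1 (sel i w0 w1) (sel i r0 r1) (sel i t0 t1) (sel i r1 (- r0)).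

Lemma der_flux_x (y0 y1 a ja : E -> R) (x v : E) (d0 d1 da dja : R) :
  is_derive x v y0 d0 -> is_derive x v y1 d1 -> is_derive x v a da -> is_derive x v ja dja ->
  is_derive x v (fun y => kx * (k (y0 y * y0 y + y1 y * y1 y) * (kx * a y + kp * ja y)
    + c / 2 * ja y))
    (kx * (k1 (y0 x * y0 x + y1 x * y1 x) * (2 * (y0 x * d0 + y1 x * d1))
       * (kx * a x + kp * ja x) + k (y0 x * y0 x + y1 x * y1 x) * (kx * da + kp * dja)
       + c / 2 * dja)).
Proof. by move=> *; der_ring. Qed.

Lemma der_flux_y (y0 y1 b : E -> R) (x v : E) (d0 d1 db : R) :
  is_derive x v y0 d0 -> is_derive x v y1 d1 -> is_derive x v b db ->
  is_derive x v (fun y => k (y0 y * y0 y + y1 y * y1 y) * b y)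
    (k1 (y0 x * y0 x + y1 x * y1 x) * (2 * (y0 x * d0 + y1 x * d1)) * b x
     + k (y0 x * y0 x + y1 x * y1 x) * db).
Proof. by move=> *; der_ring. Qed.

Lemma gradE (Y : E -> 'cV[R]_2) x i j : Ck_on setT 1 Y ->
  grad Y x i j = pd j (comp Y i) x.
Proof.
by move=> cY; rewrite /grad mxE (derive_mx ((cY.2 _).1 x I)) mxE.
Qed.

(** As [J] is skew, the factors [kp] in the [U]-derivative and in the flux recombine into
    [kx d_x + kp J] applied to the flux. What results is the unscaled formula with twisted
    derivatives, plus the transverse terms. *)
Lemma var_derE (Y : E -> 'cV[R]_2) x i : Ck_on setT 2 Y ->
  variational_derivative A Y x i 0 =
  vd_expr i (Y x 0 0) (Y x 1 0) (pd ord0 (comp Y 0) x) (pd ord0 (comp Y 1) x)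
    (pd ord0 (pd ord0 (comp Y 0)) x) (pd ord0 (pd ord0 (comp Y 1)) x)
    (fun j => pd (lift ord0 j) (comp Y 0) x) (fun j => pd (lift ord0 j) (comp Y 1) x)
    (fun j => pd (lift ord0 j) (comp Y i) x)
    (fun j => pd (lift ord0 j) (pd (lift ord0 j) (comp Y i)) x).
Proof.
move=> cY; have cY1 := Ck_onS cY.
have cC a : Ck_on setT 2 (comp Y a).
  by apply: (Ck_on_mxP _ _ _).1 cY a 0; exact: openT.
have d1 a (v y : E) : is_derive y v (comp Y a) ('D_v (comp Y a) y).
  by apply: (Ck_on_is_derive (cC a)).
have d2 a (v w y : E) : is_derive y v ('D_w (comp Y a)) ('D_v ('D_w (comp Y a)) y).
  by apply: (Ck_on_is_derive (Ck_on_derive w (cC a))).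
pose ja a y := sel a (Y y 1 0) (- Y y 0 0).
have dja a (v y : E) : is_derive y v (ja a)
    (sel a ('D_v (comp Y 1) y) (- 'D_v (comp Y 0) y)).
  by rewrite /ja /sel; case: ifP => _; [exact: d1 | apply: derN; exact: d1].
pose G a j y := if j == ord0 then kx * (k (Y y 0 0 * Y y 0 0 + Y y 1 0 * Y y 1 0)
    * (kx * pd ord0 (comp Y a) y + kp * ja a y) + c / 2 * ja a y)
  else k (Y y 0 0 * Y y 0 0 + Y y 1 0 * Y y 1 0) * pd j (comp Y a) y.
have GE y a j : dP A (Y y) (grad Y y) a j = G a j y.
  by rewrite dPE !gradE.
pose dG (v : E) a j := if j == ord0 then
   kx * (k1 (Y x 0 0 * Y x 0 0 + Y x 1 0 * Y x 1 0) * (2 * (Y x 0 0 * 'D_v (comp Y 0) x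
      + Y x 1 0 * 'D_v (comp Y 1) x)) * (kx * pd ord0 (comp Y a) x + kp * ja a x)
      + k (Y x 0 0 * Y x 0 0 + Y x 1 0 * Y x 1 0) * (kx * 'D_v (pd ord0 (comp Y a)) x
         + kp * sel a ('D_v (comp Y 1) x) (- 'D_v (comp Y 0) x))
      + c / 2 * sel a ('D_v (comp Y 1) x) (- 'D_v (comp Y 0) x))
  else k1 (Y x 0 0 * Y x 0 0 + Y x 1 0 * Y x 1 0) * (2 * (Y x 0 0 * 'D_v (comp Y 0) x
      + Y x 1 0 * 'D_v (comp Y 1) x)) * pd j (comp Y a) x
      + k (Y x 0 0 * Y x 0 0 + Y x 1 0 * Y x 1 0) * 'D_v (pd j (comp Y a)) x.
have dGv (v : E) a j : is_derive x v (G a j) (dG v a j).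
  rewrite /G /dG; case: ifP => _.
    by apply: (der_flux_x (y0 := comp Y 0) (y1 := comp Y 1)).
  by apply: (der_flux_y (y0 := comp Y 0) (y1 := comp Y 1)).
have divE a j : ('D_(delta_mx 0 j : E) (fun y => dP A (Y y) (grad Y y)) x) a j =
    dG (delta_mx 0 j) a j.
  have E1 a' j' : (fun y => dP A (Y y) (grad Y y) a' j') = G a' j'.
    by apply/funext => y; exact: GE.
  rewrite derive_mx; last first.
    by apply/derivable_mxP => a' j'; rewrite E1; case: (dGv (delta_mx 0 j) a' j').
  by rewrite mxE E1; case: (dGv (delta_mx 0 j) a j).
have -> : variational_derivative A Y x i 0 =
    dU A (Y x) (grad Y x) i 0 - \sum_j dG (delta_mx 0 j) i j.
  by rewrite variational_derivative_entry; congr (_ - _); apply: eq_bigr => j _; exact: divE.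
have -> : \sum_j dG (delta_mx 0 j) i j = dG (delta_mx 0 ord0) i ord0 +
    \sum_(j < n) (k1 (Y x 0 0 * Y x 0 0 + Y x 1 0 * Y x 1 0)
      * (2 * (Y x 0 0 * pd (lift ord0 j) (comp Y 0) x
        + Y x 1 0 * pd (lift ord0 j) (comp Y 1) x)) * pd (lift ord0 j) (comp Y i) x
      + k (Y x 0 0 * Y x 0 0 + Y x 1 0 * Y x 1 0)
        * pd (lift ord0 j) (pd (lift ord0 j) (comp Y i)) x).
  by rewrite big_ord_recl; congr (_ + _); apply: eq_bigr => j _; rewrite /dG.
rewrite dUE (gradE _ 0 ord0 cY1) (gradE _ 1 ord0 cY1).
have -> : trans_sq (grad Y x) = \sum_(j < n)
    (pd (lift ord0 j) (comp Y 0) x * pd (lift ord0 j) (comp Y 0) x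
      + pd (lift ord0 j) (comp Y 1) x * pd (lift ord0 j) (comp Y 1) x).
  by rewrite /trans_sq; apply: eq_bigr => j _; rewrite !gradE.
rewrite /vd_expr /dG eqxx /ja /vform {dG dGv divE GE G dja ja d1 d2}; cbv zeta.
move: (\sum_(j < n) _) (\sum_(j < n) _) => S1 S2.
case: (ord2P i) => ->; rewrite /sel /=.
  move: ('D_(delta_mx 0 ord0) ('D_(delta_mx 0 ord0) (comp Y 0)) x)
    ('D_(delta_mx 0 ord0) (comp Y 0) x) ('D_(delta_mx 0 ord0) (comp Y 1) x)
    (Y x 0 0) (Y x 1 0) => b0 a0 a1 u0 u1.
  by field.
move: ('D_(delta_mx 0 ord0) ('D_(delta_mx 0 ord0) (comp Y 1)) x)
  ('D_(delta_mx 0 ord0) (comp Y 0) x) ('D_(delta_mx 0 ord0) (comp Y 1) x)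
  (Y x 0 0) (Y x 1 0) => b0 a0 a1 u0 u1.
by field.
Qed.

(** Congruence for [vd_expr], whose ten arguments after the index are all replaced by functions
    affine in [s] in [hessE]. *)
Lemma f_equal10 (A1 A2 A3 A4 A5 A6 A7 A8 A9 A10 B : Type)
    (h : A1 -> A2 -> A3 -> A4 -> A5 -> A6 -> A7 -> A8 -> A9 -> A10 -> B)
    x1 y1 x2 y2 x3 y3 x4 y4 x5 y5 x6 y6 x7 y7 x8 y8 x9 y9 x10 y10 :
  x1 = y1 -> x2 = y2 -> x3 = y3 -> x4 = y4 -> x5 = y5 -> x6 = y6 -> x7 = y7 ->
  x8 = y8 -> x9 = y9 -> x10 = y10 ->
  h x1 x2 x3 x4 x5 x6 x7 x8 x9 x10 = h y1 y2 y3 y4 y5 y6 y7 y8 y9 y10.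
Proof. by do 10!move=> ->. Qed.

Lemma is_derive_ext (V : normedModType R) (f g : V -> R) (y w : V) (a : R) :
  (forall t, f t = g t) -> is_derive y w g a -> is_derive y w f a.
Proof. by move=> /funext ->. Qed.

Lemma der_affine (f g : E -> R) (y w : E) (a b z s : R) :
  is_derive y w f a -> is_derive y w g b ->
  is_derive y w (fun t => f t * z + s * g t) (a * z + s * b).
Proof. by move=> df dg; der_ring. Qed.

(** The base state has no transverse derivatives, so that products of two of them are quadratic in
    [s]; of the transverse terms only [- k] times the Laplacian survives at first order. *)
Lemma der_vform_affine (u0 u1 a0 a1 b0 b1 w0 w1 c0 c1 d0 d1 : R) (i : 'I_2)
    (e0 e1 ei f : 'I_n -> R) :
  is_derive (0 : R) 1 (fun s => vd_expr i (u0 + s * w0) (u1 + s * w1)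
    (a0 + s * c0) (a1 + s * c1) (b0 + s * d0) (b1 + s * d1)
    (fun j => s * e0 j) (fun j => s * e1 j) (fun j => s * ei j) (fun j => s * f j))
  (hess_expr i u0 u1 a0 a1 b0 b1 w0 w1 c0 c1 d0 d1
   - k (u0 * u0 + u1 * u1) * \sum_(j < n) f j).
Proof.
rewrite /vd_expr /hess_expr; cbv zeta.
have dsel (f0 f1 : R -> R) (x0 x1 : R) : is_derive (0 : R) 1 f0 x0 -> is_derive (0 : R) 1 f1 x1 ->
    is_derive (0 : R) 1 (fun s => sel i (f0 s) (f1 s)) (sel i x0 x1).
  by rewrite /sel; case: ifP.
pose U0 s := u0 + s * w0; pose U1 s := u1 + s * w1.
pose A0 s := a0 + s * c0; pose A1 s := a1 + s * c1.
have dU0 : is_derive (0 : R) 1 U0 w0 by rewrite /U0; der_ring.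
have dU1 : is_derive (0 : R) 1 U1 w1 by rewrite /U1; der_ring.
have dA0 : is_derive (0 : R) 1 A0 c0 by rewrite /A0; der_ring.
have dA1 : is_derive (0 : R) 1 A1 c1 by rewrite /A1; der_ring.
pose P0 s := kx * A0 s + kp * U1 s; pose P1 s := kx * A1 s - kp * U0 s.
have dP0 : is_derive (0 : R) 1 P0 (kx * c0 + kp * w1) by rewrite /P0; der_ring.
have dP1 : is_derive (0 : R) 1 P1 (kx * c1 - kp * w0) by rewrite /P1; der_ring.
pose Q0 s := kx * (kx * (b0 + s * d0) + kp * A1 s) + kp * P1 s.
pose Q1 s := kx * (kx * (b1 + s * d1) - kp * A0 s) - kp * P0 s.
have dQ0 : is_derive (0 : R) 1 Q0 (kx * (kx * d0 + kp * c1) + kp * (kx * c1 - kp * w0)).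
  by rewrite /Q0; der_ring.
have dQ1 : is_derive (0 : R) 1 Q1 (kx * (kx * d1 - kp * c0) - kp * (kx * c0 + kp * w1)).
  by rewrite /Q1; der_ring.
have := der_vform dU0 dU1 dP0 dP1 (dsel _ _ _ _ dU0 dU1) (dsel _ _ _ _ dP0 dP1)
  (dsel _ _ _ _ dQ0 dQ1) (dsel _ _ _ _ dP1 (derN dP0)).
have U00 : U0 0 = u0 by rewrite /U0 mul0r addr0.
have U10 : U1 0 = u1 by rewrite /U1 mul0r addr0.
have A00 : A0 0 = a0 by rewrite /A0 mul0r addr0.
have A10 : A1 0 = a1 by rewrite /A1 mul0r addr0.
have P00 : P0 0 = kx * a0 + kp * u1 by rewrite /P0 A00 U10.
have P10 : P1 0 = kx * a1 - kp * u0 by rewrite /P1 A10 U00.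
have Q00 : Q0 0 = kx * (kx * b0 + kp * a1) + kp * (kx * a1 - kp * u0).
  by rewrite /Q0 A10 P10 mul0r addr0.
have Q10 : Q1 0 = kx * (kx * b1 - kp * a0) - kp * (kx * a0 + kp * u1).
  by rewrite /Q1 A00 P00 mul0r addr0.
rewrite U00 U10 P00 P10 Q00 Q10 => H1.
pose S s := U0 s * U0 s + U1 s * U1 s.
have dS : is_derive (0 : R) 1 S (2 * (u0 * w0 + u1 * w1)).
  by rewrite /S; der_eq; rewrite U00 U10; ring.
have dk1S : is_derive (0 : R) 1 (fun s => k1 (S s)) (k2 (S 0) * (2 * (u0 * w0 + u1 * w1))).
  exact: der_comp.
have dkS : is_derive (0 : R) 1 (fun s => k (S s)) (k1 (S 0) * (2 * (u0 * w0 + u1 * w1))).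
  exact: der_comp.
have dself := dsel _ _ _ _ dU0 dU1.
have H2 : is_derive (0 : R) 1 (fun s => k1 (S s) *
    (\sum_(j < n) (s * e0 j * (s * e0 j) + s * e1 j * (s * e1 j))) * sel i (U0 s) (U1 s)) 0.
  have -> : (fun s => k1 (S s) * (\sum_(j < n) (s * e0 j * (s * e0 j) + s * e1 j * (s * e1 j)))
        * sel i (U0 s) (U1 s)) =
      (fun s => k1 (S s) * (s * s * \sum_(j < n) (e0 j * e0 j + e1 j * e1 j))
        * sel i (U0 s) (U1 s)).
    apply/funext => s; congr (_ * _ * _); rewrite mulr_sumr; apply: eq_bigr => j _; ring.
  by move: (\sum_(j < n) _) => T; der_ring.
have H3 : is_derive (0 : R) 1 (fun s => \sum_(j < n)
    (k1 (S s) * (2 * (U0 s * (s * e0 j) + U1 s * (s * e1 j))) * (s * ei j)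
        + k (S s) * (s * f j))) (k (u0 * u0 + u1 * u1) * \sum_(j < n) f j).
  have -> : (fun s => \sum_(j < n)
      (k1 (S s) * (2 * (U0 s * (s * e0 j) + U1 s * (s * e1 j))) * (s * ei j)
        + k (S s) * (s * f j))) =
     (fun s => (\sum_(j < n) e0 j * ei j) * (k1 (S s) * 2 * U0 s * (s * s))
        + (\sum_(j < n) e1 j * ei j) * (k1 (S s) * 2 * U1 s * (s * s))
        + (\sum_(j < n) f j) * (k (S s) * s)).
    apply/funext => s; rewrite !mulr_suml -!big_split; apply: eq_bigr => j _ /=; ring.
  move: (\sum_(j < n) f j) (\sum_(j < n) _) (\sum_(j < n) _) => T0 T1 T2.
  by der_eq; rewrite /S U00 U10; ring.
by apply: is_derive_eq (derB (derD H1 H2) H3) _; rewrite addr0.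
Qed.

Section Hessian.
Variables (U : R -> 'cV[R]_2) (v : E -> 'cV[R]_2).
Hypothesis cU : forall i, Ck_on setT 2 (fun t => U t i 0).
Hypothesis cv : Ck_on setT 2 v.
Local Notation Uc i := (fun t : R => U t i 0).

Lemma plane_derive (f : R -> R) (x w : E) a : is_derive (x 0 ord0) 1 f a ->
  is_derive x w (fun y : E => f (y 0 ord0)) (a * w 0 ord0).
Proof. by move=> df; apply: der_comp df _; exact: der_mx_entry. Qed.

Let Y (s : R) (y : E) : 'cV[R]_2 := plane U y + s *: v y.

Let compY s i : comp (Y s) i = (fun y => U (y 0 ord0) i 0 + s * v y i 0).
Proof. by apply/funext => y; rewrite /Y /plane !mxE. Qed.

Let cvc i : Ck_on setT 2 (comp v i).
Proof. by apply: (Ck_on_mxP _ _ _).1 cv i 0; exact: openT. Qed.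

Let cY s : Ck_on setT 2 (Y s).
Proof.
apply/Ck_on_mxP; first exact: openT.
move=> i j; rewrite (ord1 j) compY; apply: Ck_onD; first exact: openT.
  exact: (Ck_on_coord ord0 (cU i)).
apply: Ck_onM; [exact: openT | apply: Ck_on_cst; exact: openT | exact: cvc].
Qed.

Let dY s i (w : E) : 'D_w (comp (Y s) i) =
  (fun y => 'D_1 (Uc i) (y 0 ord0) * w 0 ord0 + s * 'D_w (comp v i) y).
Proof.
apply/funext => y; rewrite compY; apply: derive_val.
have h1 : is_derive y w (fun y : E => U (y 0 ord0) i 0) ('D_1 (Uc i) (y 0 ord0) * w 0 ord0).
  by apply: (@plane_derive (Uc i)); exact: Ck_on_is_derive (cU i) _.
have h2 : is_derive y w (comp v i) ('D_w (comp v i) y) by exact: Ck_on_is_derive (cvc i) _.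
by der_ring.
Qed.

Let ddY s i (w : E) y : 'D_w ('D_w (comp (Y s) i)) y =
  'D_1 ('D_1 (Uc i)) (y 0 ord0) * w 0 ord0 * w 0 ord0 + s * 'D_w ('D_w (comp v i)) y.
Proof.
rewrite dY; apply: derive_val.
have h1 : is_derive y w (fun y : E => 'D_1 (Uc i) (y 0 ord0))
    ('D_1 ('D_1 (Uc i)) (y 0 ord0) * w 0 ord0).
  by apply: (@plane_derive ('D_1 (Uc i))); exact: Ck_on_is_derive (Ck_on_derive _ (cU i)) _.
have h2 : is_derive y w ('D_w (comp v i)) ('D_w ('D_w (comp v i)) y).
  exact: Ck_on_is_derive (Ck_on_derive _ (cvc i)) _.
exact: der_affine.
Qed.

Let dYx s i (w y : E) : 'D_w (comp (Y s) i) y =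
  'D_1 (Uc i) (y 0 ord0) * w 0 ord0 + s * 'D_w (comp v i) y.
Proof. exact: (congr1 (fun f => f y) (dY s i w)). Qed.

Let delta00 : (delta_mx 0 ord0 : E) 0 ord0 = 1.
Proof. by rewrite mxE !eqxx. Qed.

Let delta0S j : (delta_mx 0 (lift ord0 j) : E) 0 ord0 = 0.
Proof. by rewrite mxE. Qed.

Lemma hessE x i : Hess A (plane U) v x i 0 =
  hess_expr i (U (x 0 ord0) 0 0) (U (x 0 ord0) 1 0) ('D_1 (Uc 0) (x 0 ord0))
    ('D_1 (Uc 1) (x 0 ord0)) ('D_1 ('D_1 (Uc 0)) (x 0 ord0)) ('D_1 ('D_1 (Uc 1)) (x 0 ord0))
    (v x 0 0) (v x 1 0) (pd ord0 (comp v 0) x) (pd ord0 (comp v 1) x)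
    (pd ord0 (pd ord0 (comp v 0)) x) (pd ord0 (pd ord0 (comp v 1)) x)
  - k (U (x 0 ord0) 0 0 * U (x 0 ord0) 0 0 + U (x 0 ord0) 1 0 * U (x 0 ord0) 1 0)
    * \sum_(j < n) pd (lift ord0 j) (pd (lift ord0 j) (comp v i)) x.
Proof.
have eY s a : Y s x a 0 = U (x 0 ord0) a 0 + s * v x a 0 by rewrite /Y /plane !mxE.
have e1 s a : pd ord0 (comp (Y s) a) x =
    'D_1 (Uc a) (x 0 ord0) + s * pd ord0 (comp v a) x by rewrite dYx delta00 mulr1.
have e2 s a : pd ord0 (pd ord0 (comp (Y s) a)) x =
    'D_1 ('D_1 (Uc a)) (x 0 ord0) + s * pd ord0 (pd ord0 (comp v a)) x.
  by rewrite ddY delta00 !mulr1.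
have e3 s a j : pd (lift ord0 j) (comp (Y s) a) x = s * pd (lift ord0 j) (comp v a) x.
  by rewrite dYx delta0S mulr0 add0r.
have e4 s a j : pd (lift ord0 j) (pd (lift ord0 j) (comp (Y s) a)) x =
    s * pd (lift ord0 j) (pd (lift ord0 j) (comp v a)) x.
  by rewrite ddY delta0S !mulr0 add0r.
have key a := der_vform_affine
  (U (x 0 ord0) 0 0) (U (x 0 ord0) 1 0) ('D_1 (Uc 0) (x 0 ord0)) ('D_1 (Uc 1) (x 0 ord0))
  ('D_1 ('D_1 (Uc 0)) (x 0 ord0)) ('D_1 ('D_1 (Uc 1)) (x 0 ord0)) (v x 0 0) (v x 1 0)
  (pd ord0 (comp v 0) x) (pd ord0 (comp v 1) x) (pd ord0 (pd ord0 (comp v 0)) x)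
  (pd ord0 (pd ord0 (comp v 1)) x) a (fun j => pd (lift ord0 j) (comp v 0) x)
  (fun j => pd (lift ord0 j) (comp v 1) x) (fun j => pd (lift ord0 j) (comp v a) x)
  (fun j => pd (lift ord0 j) (pd (lift ord0 j) (comp v a)) x).
have dV a := is_derive_ext (fun s => etrans (var_derE x a (cY s))
  (f_equal10 (vd_expr a) (eY s 0) (eY s 1) (e1 s 0) (e1 s 1) (e2 s 0) (e2 s 1)
    (funext (e3 s 0)) (funext (e3 s 1)) (funext (e3 s a)) (funext (e4 s a)))) (key a).
rewrite /Hess derive1E derive_mx.
  by rewrite mxE; case: (dV i).
by apply/derivable_mxP => a b; rewrite (ord1 b); case: (dV a).
Qed.

End Hessian.

End Field.
End Density.
(** * Small roots of perturbed polynomials *)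

Section ComplexNorm.
Context {R : realType}.
Local Notation C := R[i].
Implicit Types (x y z : C).

(** A modulus with real values, so that estimates are inequalities between reals, accessible to
    [lra] and [nra]. *)
Definition cabs x : R := Normc.normc x.

Lemma cabsM x y : cabs (x * y) = cabs x * cabs y.
Proof. exact: Normc.normcM. Qed.

Lemma cabsD x y : cabs (x + y) <= cabs x + cabs y.
Proof. exact: (@le_normcD R x y). Qed.

Lemma cabsN x : cabs (- x) = cabs x.
Proof. exact: (@normcN R x). Qed.

Lemma cabsB x y : cabs (x - y) <= cabs x + cabs y.
Proof. by rewrite -(cabsN y); exact: cabsD. Qed.

Lemma cabs0 : cabs 0 = 0.
Proof. exact: Normc.normc0. Qed.

Lemma cabs1 : cabs 1 = 1.
Proof. exact: Normc.normc1. Qed.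

Lemma cabs_ge0 x : 0 <= cabs x.
Proof. by case: x => a b; exact: sqrtr_ge0. Qed.

Lemma cabs_eq0 x : cabs x = 0 -> x = 0.
Proof. exact: Normc.eq0_normc. Qed.

Lemma cabs_gt0 x : x != 0 -> 0 < cabs x.
Proof.
by move=> x0; rewrite lt_def cabs_ge0 andbT; apply: contra_neq x0; exact: cabs_eq0.
Qed.

Lemma sqr_cabs x : cabs x ^+ 2 = complex.Re x ^+ 2 + complex.Im x ^+ 2.
Proof. by case: x => a b; rewrite /cabs /= sqr_sqrtr // addr_ge0 // sqr_ge0. Qed.

Lemma ler_Re_cabs x : `|complex.Re x| <= cabs x.
Proof.
by rewrite -ler_sqr ?nnegrE ?cabs_ge0 // real_normK ?num_real // sqr_cabs lerDl sqr_ge0.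
Qed.

Lemma ler_Im_cabs x : `|complex.Im x| <= cabs x.
Proof.
by rewrite -ler_sqr ?nnegrE ?cabs_ge0 // real_normK ?num_real // sqr_cabs lerDr sqr_ge0.
Qed.

Lemma cabs_le x : cabs x <= `|complex.Re x| + `|complex.Im x|.
Proof.
rewrite -ler_sqr ?nnegrE ?cabs_ge0 ?addr_ge0 // sqr_cabs.
rewrite -(real_normK (num_real (complex.Re x))) -(real_normK (num_real (complex.Im x))).
by rewrite sqrrD -addrA lerD2l lerDr mulrn_wge0 // mulr_ge0.
Qed.

Lemma cabs_real (a : R) : cabs a%:C%C = `|a|.
Proof. by rewrite /cabs /= expr0n /= addr0 sqrtr_sqr. Qed.

Lemma cabs_sum (I : Type) (s : seq I) (F : I -> C) :
  cabs (\sum_(i <- s) F i) <= \sum_(i <- s) cabs (F i).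
Proof.
elim: s => [|i s IH]; first by rewrite !big_nil cabs0.
by rewrite !big_cons; apply: le_trans (cabsD _ _) _; rewrite lerD2l.
Qed.

Lemma cabsX x n : cabs (x ^+ n) = cabs x ^+ n.
Proof. by elim: n => [|n IH]; rewrite ?expr0 ?cabs1 // !exprS cabsM IH. Qed.

End ComplexNorm.

(** * Lipschitz bounds for determinants *)

Section Perturbation.
Context {R : realType} (S : comNzRingType) (nu : S -> R).
Hypothesis nu_ge0 : forall a, 0 <= nu a.
Hypothesis nuD : forall a b, nu (a + b) <= nu a + nu b.
Hypothesis nuM : forall a b, nu (a * b) <= nu a * nu b.
Hypothesis nuN : forall a, nu (- a) = nu a.
Hypothesis nu0 : nu 0 = 0.
Hypothesis nu1 : nu 1 <= 1.

Lemma nu_sum (I : Type) (s : seq I) (F : I -> S) :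
  nu (\sum_(i <- s) F i) <= \sum_(i <- s) nu (F i).
Proof.
elim: s => [|i s IH]; first by rewrite !big_nil nu0.
by rewrite !big_cons; apply: le_trans (nuD _ _) _; rewrite lerD2l.
Qed.

(** Telescoping: the factors are exchanged one at a time. Since [1 <= K], all intermediate products
    are controlled by the same power of [K]. *)
Lemma prod_perturb (I : Type) (s : seq I) (F G : I -> S) (K d : R) : 1 <= K -> 0 <= d ->
  (forall i, nu (F i) <= K) -> (forall i, nu (G i) <= K) ->
  (forall i, nu (F i - G i) <= d) ->
  nu (\prod_(i <- s) F i) <= K ^+ size s /\
  nu (\prod_(i <- s) F i - \prod_(i <- s) G i) <= (size s)%:R * K ^+ size s * d.
Proof.
move=> K1 d0 hF hG hd; have K0 : 0 <= K by apply: le_trans K1.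
elim: s => [|i s [IH1 IH2]].
  by rewrite !big_nil subrr nu0 mul0r mul0r expr0.
rewrite !big_cons /=; split.
  by apply: le_trans (nuM _ _) _; rewrite exprS; apply: ler_pM.
set P := \prod_(j <- s) F j; set Q := \prod_(j <- s) G j.
have -> : F i * P - G i * Q = (F i - G i) * P + G i * (P - Q) by ring.
apply: le_trans (nuD _ _) _.
have h1 : nu ((F i - G i) * P) <= d * K ^+ size s.
  by apply: le_trans (nuM _ _) _; apply: ler_pM.
have h2 : nu (G i * (P - Q)) <= K * ((size s)%:R * K ^+ size s * d).
  by apply: le_trans (nuM _ _) _; apply: ler_pM.
apply: le_trans (lerD h1 h2) _; rewrite -[(size s).+1%:R]natr1 exprS.
have : d * K ^+ size s <= K * K ^+ size s * d.
  rewrite [leRHS]mulrC mulrA [d * K]mulrC -mulrA ler_peMl //.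
    by rewrite mulr_ge0 // exprn_ge0.
by move=> h; nra.
Qed.

(** The size [nu] is left abstract because two instances are needed: the modulus of complex numbers,
    and [pnorm] on polynomials, which controls all coefficients of a characteristic polynomial
    together. *)
Lemma det_perturb n (A B : 'M[S]_n) (K d : R) : 1 <= K -> 0 <= d ->
  (forall i j, nu (A i j) <= K) -> (forall i j, nu (B i j) <= K) ->
  (forall i j, nu (A i j - B i j) <= d) ->
  nu (\det A - \det B) <= #|{perm 'I_n}|%:R * (n%:R * K ^+ n) * d.
Proof.
move=> K1 d0 hA hB hd; rewrite /determinant -sumrB.
apply: le_trans (nu_sum _ _) _.
rewrite -mulrA -sumr_cst; apply: ler_sum => s _; rewrite -mulrBr.
have [_ h] := @prod_perturb _ (index_enum 'I_n) (fun i => A i (s i)) (fun i => B i (s i))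
   K d K1 d0 (fun i => hA i _) (fun i => hB i _) (fun i => hd i _).
have sz : size (index_enum 'I_n) = n by rewrite -[index_enum _]enumT size_enum_ord.
rewrite sz in h; apply: le_trans h.
by case: (odd_perm s); rewrite ?expr0 ?expr1 ?mul1r // mulN1r nuN.
Qed.

End Perturbation.

(** Its roots are the generalized eigenvalues of the pair [(A, B)]. The Floquet problem is not
    normalized to [B = 1], which avoids inverting a matrix that is only close to the identity. *)
Definition pencil (K : comNzRingType) n (A B : 'M[K]_n) : {poly K} :=
  \det (\matrix_(i, j) ((A i j)%:P - 'X * (B i j)%:P)).

Lemma pencil_map (K K' : comNzRingType) (f : {rmorphism K -> K'}) n (A B : 'M[K]_n) :
  pencil (map_mx f A) (map_mx f B) = map_poly f (pencil A B).
Proof.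
rewrite /pencil -det_map_mx; congr (\det _); apply/matrixP => i j; rewrite !mxE /=.
by rewrite rmorphB rmorphM /= !map_polyC map_polyX.
Qed.

(** * A submultiplicative norm on polynomials *)

Section PolyNorm.
Context {R : realType}.
Local Notation C := R[i].
Implicit Types (p q : {poly C}).

Definition pnorm p : R := \sum_(i < size p) cabs p`_i.

Lemma pnormE p m : (size p <= m)%N -> pnorm p = \sum_(i < m) cabs p`_i.
Proof.
move=> pm; rewrite /pnorm (big_ord_widen m (fun i => cabs p`_i)) // big_mkcond /=.
by apply: eq_bigr => i _; case: ltnP => // ip; rewrite nth_default // cabs0.
Qed.

Lemma pnorm_ge0 p : 0 <= pnorm p.
Proof. by apply: sumr_ge0 => i _; exact: cabs_ge0. Qed.

Lemma coef_pnorm p k : cabs p`_k <= pnorm p.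
Proof.
have [kp|kp] := ltnP k (size p); last by rewrite nth_default // cabs0 pnorm_ge0.
rewrite /pnorm (bigD1 (Ordinal kp)) //= lerDl sumr_ge0 // => i _; exact: cabs_ge0.
Qed.

Lemma pnormD p q : pnorm (p + q) <= pnorm p + pnorm q.
Proof.
set m := maxn (size p) (size q).
rewrite (@pnormE (p + q) m) ?size_polyD // (@pnormE p m) ?leq_maxl // (@pnormE q m) ?leq_maxr //.
by rewrite -big_split; apply: ler_sum => i _; rewrite coefD cabsD.
Qed.

Lemma pnormN p : pnorm (- p) = pnorm p.
Proof. by rewrite /pnorm size_polyN; apply: eq_bigr => i _; rewrite coefN cabsN. Qed.

Lemma pnorm0 : pnorm 0 = 0.
Proof. by rewrite /pnorm size_poly0 big_ord0. Qed.

Lemma pnormC c : pnorm c%:P = cabs c.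
Proof.
by rewrite (@pnormE _ 1) ?size_polyC ?leq_b1 // big_ord1 coefC.
Qed.

Lemma pnormMX p : pnorm (p * 'X) = pnorm p.
Proof.
rewrite (@pnormE _ (size p).+1); last first.
  by apply: leq_trans (size_polyMleq _ _) _; rewrite size_polyX addn2.
by rewrite big_ord_recl coefMX cabs0 add0r /pnorm; apply: eq_bigr => i _; rewrite coefMX.
Qed.

Lemma pnormMXaddC p c : pnorm (p * 'X + c%:P) = pnorm p + cabs c.
Proof.
rewrite (@pnormE _ (size p).+1); last first.
  apply: leq_trans (size_polyD _ _) _; rewrite geq_max.
  rewrite (leq_trans (size_polyMleq _ _)) ?size_polyX ?addn2 //=.
  by rewrite size_polyC; case: (c == 0).
rewrite big_ord_recl coefD coefMX coefC add0r addrC; congr (_ + _).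
by rewrite /pnorm; apply: eq_bigr => i _; rewrite coefD coefMX coefC addr0.
Qed.

Lemma pnormCM c p : pnorm (c%:P * p) <= cabs c * pnorm p.
Proof.
rewrite (@pnormE _ (size p)); last first.
  by rewrite mul_polyC size_scale_leq.
by rewrite /pnorm mulr_sumr; apply: ler_sum => i _; rewrite coefCM cabsM.
Qed.

Lemma pnormM p q : pnorm (p * q) <= pnorm p * pnorm q.
Proof.
elim/poly_ind: p => [|p c IH]; first by rewrite mul0r pnorm0 mul0r.
rewrite pnormMXaddC mulrDl -mulrA ['X * q]mulrC mulrA.
apply: le_trans (pnormD _ _) _; rewrite pnormMX mulrDl; apply: lerD => //.
exact: pnormCM.
Qed.

Lemma pnorm1 : pnorm 1 = 1.
Proof. by rewrite (pnormC 1) cabs1. Qed.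

Lemma pencil_horner n (A B : 'M[C]_n) s : (pencil A B).[s] = \det (A - s *: B).
Proof.
rewrite /pencil -horner_evalE -det_map_mx; congr (\det _); apply/matrixP => i j.
by rewrite !mxE /= horner_evalE !hornerE.
Qed.

Lemma pencil_size (A B : 'M[C]_4) : (size (pencil A B) <= 5)%N.
Proof.
rewrite /pencil /determinant; apply: (leq_trans (size_sum _ _ _)); apply/bigmax_leqP => s _.
have -> : (-1) ^+ s * \prod_(i < 4) (\matrix_(i0, j) ((A i0 j)%:P - 'X * (B i0 j)%:P)) i (s i)
    = ((-1) ^+ s)%:P * \prod_(i < 4) ((A i (s i))%:P - 'X * (B i (s i))%:P).
  by rewrite rmorphXn rmorphN1; congr (_ * _); apply: eq_bigr => i _; rewrite mxE.
rewrite mul_polyC; apply: leq_trans (size_scale_leq _ _) _.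
apply: leq_trans (size_prod_leq _ _) _.
have h i : (size ((A i (s i))%:P - 'X * (B i (s i))%:P)%R <= 2)%N.
  apply: leq_trans (size_polyD _ _) _; rewrite size_polyN geq_max size_polyC.
  rewrite (leq_trans (leq_b1 _)) //= mulrC mul_polyC.
  by apply: leq_trans (size_scale_leq _ _) _; rewrite size_polyX.
have h8 : (\sum_(i < 4) size ((A i (s i))%:P - 'X * (B i (s i))%:P)%R <= 8)%N.
  by apply: leq_trans (leq_sum _ (fun i _ => h i)) _; rewrite sum_nat_const card_ord.
rewrite leq_subLR; apply: leq_ltn_trans h8 _.
by rewrite cardT size_enum_ord.
Qed.

(** An entry [a - X b] has norm at most [2 K], and two such entries differ by at most [2 d]. *)
Lemma pencil_perturb (K : R) : 1 <= K -> exists2 c : R, 0 <= c &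
  forall (d : R) (A B A' B' : 'M[C]_4), 0 <= d ->
   (forall i j, cabs (A i j) <= K) -> (forall i j, cabs (B i j) <= K) ->
   (forall i j, cabs (A' i j) <= K) -> (forall i j, cabs (B' i j) <= K) ->
   (forall i j, cabs (A i j - A' i j) <= d) -> (forall i j, cabs (B i j - B' i j) <= d) ->
   forall k, cabs ((pencil A B)`_k - (pencil A' B')`_k) <= c * d.
Proof.
move=> K1; have K0 : 0 <= K by apply: le_trans K1.
exists (#|{perm 'I_4}|%:R * (4%:R * (2 * K) ^+ 4) * 2).
  by rewrite !mulr_ge0 // exprn_ge0 // mulr_ge0.
move=> d A B A' B' d0 hA hB hA' hB' hdA hdB k.
have lin a b : pnorm (a%:P - 'X * b%:P) <= cabs a + cabs b.
  by apply: le_trans (pnormD _ _) _; rewrite pnormN pnormC lerD2l mulrC pnormMX pnormC.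
rewrite -coefB; apply: le_trans (coef_pnorm _ _) _; rewrite -mulrA.
have dd : 2 * d = 2 * d by [].
apply: (@det_perturb R _ pnorm pnorm_ge0 pnormD pnormM pnormN pnorm0 _ 4 _ _ (2 * K) (2 * d)).
- by rewrite pnorm1.
- lra.
- lra.
- by move=> i j; rewrite !mxE; apply: le_trans (lin _ _) _; have := hA i j; have := hB i j; lra.
- by move=> i j; rewrite !mxE; apply: le_trans (lin _ _) _; have := hA' i j; have := hB' i j; lra.
- move=> i j; rewrite !mxE.
  have -> : (A i j)%:P - 'X * (B i j)%:P - ((A' i j)%:P - 'X * (B' i j)%:P) =
     (A i j - A' i j)%:P - 'X * (B i j - B' i j)%:P by rewrite !polyCB; ring.
  by apply: le_trans (lin _ _) _; have := hdA i j; have := hdB i j; lra.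
Qed.

End PolyNorm.

(** * Existence, uniqueness and continuity of a small root *)

Section SmallRoot.
Context {R : realType}.
Local Notation C := R[i].
Implicit Types (p q : {poly C}) (s z : C).

(** The sum of the inverses of the roots is [- p_1 / p_0]. If all the roots, at most four, had
    modulus greater than [r], then [r |p_1| <= 4 |p_0|]. *)
Lemma small_root_exists p (a b r : R) : 0 < r -> 0 < b -> (size p <= 5)%N ->
  b <= cabs p`_1 -> cabs p`_0 <= a -> 4 * a < r * b ->
  exists2 s, p.[s] = 0 & cabs s <= r.
Proof.
move=> r0 b0 sp hb ha hab.
have p1 : p`_1 != 0.
  by apply: contraTneq hb => ->; rewrite cabs0 -ltNge.
have p0 : p != 0 by apply: contra_neq p1 => ->; rewrite coef0.
have [rs hrs] := closed_field_poly_normal p.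
have l0 : lead_coef p != 0 by rewrite lead_coef_eq0.
have srs : (size rs <= 4)%N.
  by move: sp; rewrite hrs size_scale // size_prod_XsubC ltnS.
have [/hasP[z zr zs]|/hasPn big] := boolP (has (fun z => cabs z <= r) rs).
  exists z => //; rewrite hrs hornerZ; apply/eqP; rewrite mulf_eq0 (negbTE l0) /=.
  by have := root_prod_XsubC rs z; rewrite zr /root => /eqP ->.
exfalso.
have key (l : seq C) : (forall z, z \in l -> r <= cabs z) ->
    r * cabs (\prod_(z <- l) ('X - z%:P))`_1 <=
    (size l)%:R * cabs (\prod_(z <- l) ('X - z%:P))`_0.
  elim: l => [|z l IH] hl; first by rewrite big_nil coef1 cabs0 mulr0 mul0r.
  rewrite big_cons /=; set q := \prod_(j <- l) _.
  have rz : r <= cabs z by apply: hl; rewrite mem_head.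
  have {}IH : r * cabs q`_1 <= (size l)%:R * cabs q`_0.
    by apply: IH => y yl; apply: hl; rewrite inE yl orbT.
  rewrite mulrBl !coefB !coefXM !coefCM /= sub0r cabsN !cabsM.
  have h1 : cabs (q`_0 - z * q`_1) <= cabs q`_0 + cabs z * cabs q`_1.
    by rewrite -cabsM; exact: cabsB.
  rewrite -natr1; have := cabs_ge0 q`_0; have := cabs_ge0 z.
  move: (cabs (q`_0 - _)) (cabs q`_0) (cabs q`_1) (cabs z) ((size l)%:R) h1 rz IH
    => A B D Z N h1 rz IH Z0 B0.
  have : Z * (r * D) <= Z * (N * B) by rewrite ler_wpM2l.
  have : r * B <= Z * B by rewrite ler_wpM2r.
  have : r * A <= r * (B + Z * D) by rewrite ler_wpM2l // ltW.
  by lra.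
have {}key : r * cabs p`_1 <= 4 * cabs p`_0.
  have h : r * cabs (\prod_(z <- rs) ('X - z%:P))`_1 <=
      (size rs)%:R * cabs (\prod_(z <- rs) ('X - z%:P))`_0.
    by apply: key => z zr; rewrite ltW // ltNge; exact: big.
  rewrite hrs !coefZ !cabsM mulrCA [leRHS]mulrCA ler_wpM2l ?cabs_ge0 //.
  by apply: le_trans h _; rewrite ler_wpM2r ?cabs_ge0 // ler_nat.
have : r * b <= 4 * a.
  have h1 : r * b <= r * cabs p`_1 by rewrite ler_pM2l.
  by have h2 := le_trans h1 key; lra.
by rewrite leNgt hab.
Qed.

Lemma horner5 p s : (size p <= 5)%N ->
  p.[s] = p`_0 + p`_1 * s + p`_2 * s ^+ 2 + p`_3 * s ^+ 3 + p`_4 * s ^+ 4.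
Proof.
move=> sp; rewrite (horner_coef_wide _ sp) !big_ord_recl big_ord0 /= /bump /=.
by rewrite expr0; ring.
Qed.

(** The difference factors as [(s - z) (p_1 + T)], where [T] collects 2, 3 and 4 monomials from the
    degrees 2, 3 and 4; hence [|T| <= 9 K r <= b / 2]. *)
Lemma root_lipschitz p s z (K b r : R) : (size p <= 5)%N -> r <= 1 -> 18 * K * r <= b ->
  b <= cabs p`_1 -> (forall k, (2 <= k)%N -> cabs p`_k <= K) ->
  cabs s <= r -> cabs z <= r ->
  b / 2 * cabs (s - z) <= cabs (p.[s] - p.[z]).
Proof.
move=> sp r1 Kr hb hK sr zr.
rewrite (horner5 s sp) (horner5 z sp).
set T := p`_2 * (s + z) + p`_3 * (s * s + s * z + z * z)
   + p`_4 * (s * s * s + s * s * z + s * z * z + z * z * z).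
have -> : p`_0 + p`_1 * s + p`_2 * s ^+ 2 + p`_3 * s ^+ 3 + p`_4 * s ^+ 4 -
  (p`_0 + p`_1 * z + p`_2 * z ^+ 2 + p`_3 * z ^+ 3 + p`_4 * z ^+ 4) = (s - z) * (p`_1 + T).
  by rewrite /T; ring.
rewrite cabsM [leRHS]mulrC; apply: ler_wpM2r; first exact: cabs_ge0.
have r0 : 0 <= r by apply: le_trans sr; exact: cabs_ge0.
have K0 : 0 <= K by apply: le_trans (hK 2%N isT); exact: cabs_ge0.
have m1 (x y : C) (A B : R) : cabs x <= A -> cabs y <= B -> cabs (x * y) <= A * B.
  by move=> hx hy; rewrite cabsM; apply: ler_pM => //; exact: cabs_ge0.
have a1 (x y : C) (A B : R) : cabs x <= A -> cabs y <= B -> cabs (x + y) <= A + B.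
  by move=> hx hy; apply: le_trans (cabsD _ _) _; exact: lerD.
have hT : cabs T <= K * (r + r) + K * (r * r + r * r + r * r)
    + K * (r * r * r + r * r * r + r * r * r + r * r * r).
  rewrite /T; apply: (a1); first apply: (a1); (apply: (m1); first exact: hK).
  - exact: a1.
  - by do 2?apply: (a1); apply: (m1).
  - by do 3?apply: (a1); do 2?apply: (m1).
have rr : r * r <= r by rewrite ler_piMr.
have rrr : r * r * r <= r by rewrite -mulrA ler_piMr // mulr_ile1.
have hT9 : cabs T <= 9 * (K * r).
  apply: le_trans hT _; have := ler_wpM2l K0 rr; have := ler_wpM2l K0 rrr; lra.
have : cabs p`_1 <= cabs (p`_1 + T) + cabs T.
  by rewrite -[p`_1 in leLHS](addrK T); exact: cabsB.
by lra.
Qed.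

Lemma root_approx p s (K r : R) : (size p <= 5)%N -> r <= 1 ->
  (forall k, (2 <= k)%N -> cabs p`_k <= K) -> cabs s <= r -> p.[s] = 0 ->
  cabs (p`_1 * s + p`_0) <= 3 * K * r ^+ 2.
Proof.
move=> sp r1 hK sr; rewrite (horner5 s sp) => e.
have -> : p`_1 * s + p`_0 = - (p`_2 * s ^+ 2 + p`_3 * s ^+ 3 + p`_4 * s ^+ 4).
  by apply/eqP; rewrite -subr_eq0 opprK -[X in _ == X]e; apply/eqP; ring.
have r0 : 0 <= r by apply: le_trans sr; exact: cabs_ge0.
have K0 : 0 <= K by apply: le_trans (hK 2%N isT); exact: cabs_ge0.
have h k : (2 <= k)%N -> cabs (p`_k * s ^+ k) <= K * r ^+ 2.
  move=> k2; rewrite cabsM cabsX; apply: ler_pM; rewrite ?cabs_ge0 ?exprn_ge0 ?cabs_ge0 ?hK //.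
  apply: (@le_trans _ _ (r ^+ k)); first by rewrite lerXn2r ?nnegrE ?cabs_ge0.
  by apply: ler_wiXn2l.
rewrite cabsN; apply: le_trans (cabsD _ _) _.
have := cabsD (p`_2 * s ^+ 2) (p`_3 * s ^+ 3).
have := h 2%N isT; have := h 3%N isT; have := h 4%N isT; lra.
Qed.

(** At a root [z] of [q] the polynomial [p] takes the value of [p - q], a sum of five small terms,
    and the lower Lipschitz bound converts this into a distance between roots. For [p = q] it shows
    that the small root is unique. *)
Lemma root_perturb p q s z (K b r d : R) : (size p <= 5)%N -> (size q <= 5)%N ->
  r <= 1 -> 18 * K * r <= b ->
  b <= cabs p`_1 -> (forall k, (2 <= k)%N -> cabs p`_k <= K) ->
  (forall k, cabs (p`_k - q`_k) <= d) ->
  cabs s <= r -> cabs z <= r -> p.[s] = 0 -> q.[z] = 0 ->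
  b / 2 * cabs (s - z) <= 5 * d.
Proof.
move=> sp sq r1 Kr hb hK hd sr zr ps qz.
apply: le_trans (root_lipschitz sp r1 Kr hb hK sr zr) _.
rewrite ps sub0r cabsN; have -> : p.[z] = (p - q).[z] by rewrite hornerD hornerN qz subr0.
have d0 : 0 <= d by apply: le_trans (hd 0%N); exact: cabs_ge0.
rewrite (@horner_coef_wide _ 5); last by rewrite (leq_trans (size_polyD _ _)) // geq_max sp size_polyN.
apply: le_trans (cabs_sum _ _) _.
have -> : 5 * d = \sum_(i < 5) d by rewrite sumr_cst card_ord.
apply: ler_sum => i _; rewrite coefB cabsM cabsX.
rewrite -[leRHS]mulr1; apply: ler_pM; rewrite ?cabs_ge0 ?exprn_ge0 ?cabs_ge0 ?hd //.
by rewrite exprn_ile1 ?cabs_ge0 // (le_trans zr).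
Qed.

Lemma cabs_shift s (e : R) : cabs (1 + e%:C%C * s) ^+ 2 =
  1 + 2 * e * complex.Re s + e ^+ 2 * cabs s ^+ 2.
Proof. by case: s => x y; rewrite !sqr_cabs /=; ring. Qed.

Lemma continuous_quadratic (f g : R -> R) (A B : R) : continuous f -> continuous g ->
  continuous (fun t => 1 + A * f t + B * (f t * f t + g t * g t)).
Proof.
move=> cf cg t.
have cM (u v : R -> R) : continuous u -> continuous v -> continuous (fun x => u x * v x).
  by move=> cu cv x; apply: continuousM; [exact: cu | exact: cv].
have cD (u v : R -> R) : continuous u -> continuous v -> continuous (fun x => u x + v x).
  by move=> cu cv x; apply: continuousD; [exact: cu | exact: cv].
have cc (a : R) : continuous (fun _ : R => a) by move=> x; exact: cst_continuous.
by apply: (cD _ _ (cD _ _ (cc 1) (cM _ _ (cc A) cf)) (cM _ _ (cc B) _)); apply: cD; apply: cM.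
Qed.

(* A small simple root depending continuously on the parameter crosses the circle
   [|1 + e s| = 1] by the intermediate value theorem. *)
Lemma crossing_root (P : R -> {poly C}) (K a b r M e t0 t1 : R) : 0 < r -> r <= 1 -> 0 < b ->
  18 * K * r <= b -> 4 * a < r * b -> t0 <= t1 ->
  (forall t, (size (P t) <= 5)%N) ->
  (forall t, b <= cabs (P t)`_1) -> (forall t, cabs (P t)`_0 <= a) ->
  (forall t k, (2 <= k)%N -> cabs (P t)`_k <= K) ->
  (forall t t' k, cabs ((P t)`_k - (P t')`_k) <= M * `|t - t'|) ->
  (forall s z, (P t0).[s] = 0 -> (P t1).[z] = 0 -> cabs s <= r -> cabs z <= r ->
    (cabs (1 + e%:C%C * s) <= 1 <= cabs (1 + e%:C%C * z)) ||
    (cabs (1 + e%:C%C * z) <= 1 <= cabs (1 + e%:C%C * s))) ->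
  exists t s, [/\ t0 <= t <= t1, (P t).[s] = 0 & cabs (1 + e%:C%C * s) = 1].
Proof.
move=> r0 r1 b0 Kr ab t01 sP hb ha hK hM hsgn.
have hs t : exists s, (P t).[s] = 0 /\ cabs s <= r.
  by have [s] := small_root_exists r0 b0 (sP t) (hb t) (ha t) ab; exists s.
(* The roots are selected independently for each parameter; the bound [lip] shows that the selection
   is nevertheless continuous. *)
have [s hs'] := choice hs.
have M0 : 0 <= M.
  have := hM 0 1 0%N; rewrite sub0r normrN normr1 mulr1.
  by apply: le_trans; exact: cabs_ge0.
have lip t t' : cabs (s t - s t') <= 10 * M / b * `|t - t'|.
  have := root_perturb (sP t) (sP t') r1 Kr (hb t) (hK t) (hM t t') (hs' t).2 (hs' t').2
    (hs' t).1 (hs' t').1.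
  move: (cabs _) `|_| => S d h.
  have -> : 10 * M / b * d = (10 * (M * d)) / b by rewrite mulrAC !mulrA.
  by rewrite ler_pdivlMr //; lra.
have csub (f : C -> R) : (forall x y, `|f x - f y| <= cabs (x - y)) ->
    continuous (fun t => f (s t)).
  move=> hf t; apply/cvgrPdist_lt => d d0.
  have L0 : 0 < 10 * M / b + 1 by rewrite ltr_wpDl // !mulr_ge0 // invr_ge0 ltW.
  have q0 : 0 < d / (10 * M / b + 1) by exact: divr_gt0 d0 L0.
  near=> t'; apply: le_lt_trans (hf _ _) _; apply: le_lt_trans (lip t t') _.
  have : `|t - t'| < d / (10 * M / b + 1).
    by near: t'; exists (d / (10 * M / b + 1)); [exact: q0 | move=> y].
  rewrite ltr_pdivlMr //; have := normr_ge0 (t - t'); nra.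
have cRe : continuous (fun t => complex.Re (s t)).
  by apply: csub => x y; rewrite -raddfB; exact: ler_Re_cabs.
have cIm : continuous (fun t => complex.Im (s t)).
  by apply: csub => x y; rewrite -raddfB; exact: ler_Im_cabs.
pose g t := 1 + 2 * e * complex.Re (s t)
  + e ^+ 2 * (complex.Re (s t) * complex.Re (s t) + complex.Im (s t) * complex.Im (s t)).
have gE t : g t = cabs (1 + e%:C%C * s t) ^+ 2.
  by rewrite cabs_shift sqr_cabs /g !expr2.
have cg : continuous g.
  exact: continuous_quadratic.
have [|t tin gt] := @IVT R g t0 t1 1 t01 (continuous_subspaceT cg).
  have sq t : (cabs (1 + e%:C%C * s t) <= 1) = (g t <= 1).
    by rewrite gE expr_le1 // cabs_ge0.
  have sq' t : (1 <= cabs (1 + e%:C%C * s t)) = (1 <= g t).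
    by rewrite gE expr_ge1 // cabs_ge0.
  have := hsgn _ _ (hs' t0).1 (hs' t1).1 (hs' t0).2 (hs' t1).2.
  rewrite !sq !sq' ge_min le_max.
  by move=> /orP[]/andP[-> ->]; rewrite ?orbT.
exists t, (s t); split; first by move: tin; rewrite in_itv.
  exact: (hs' t).1.
have := gE t; rewrite gt => /esym/eqP; rewrite sqrf_eq1 => /orP[/eqP//|/eqP h].
by have := cabs_ge0 (1 + e%:C%C * s t); rewrite h lerNr oppr0 ler10.
Unshelve. all: by end_near.
Qed.

End SmallRoot.

(** * Which side of the unit circle the multiplier lies on *)

Section Crossing.
Context {R : realType}.
Local Notation C := R[i].
Implicit Types (p q : {poly C}) (s z x y : C).

(** This is [Re (x * conj y)], which has the sign of [Re (x / y)]. *)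
Definition rdot (x y : C) : R :=
  complex.Re x * complex.Re y + complex.Im x * complex.Im y.

Lemma rdot_le x y : `|rdot x y| <= cabs x * cabs y.
Proof.
have -> : rdot x y = complex.Re (x * Complex (complex.Re y) (- complex.Im y)).
  by case: x y => [a b] [c d]; rewrite /rdot /=; ring.
have -> : cabs y = cabs (Complex (complex.Re y) (- complex.Im y)).
  by case: y => c d; rewrite /cabs /= sqrrN.
by rewrite -cabsM; exact: ler_Re_cabs.
Qed.

Lemma rdotDl x x' y : rdot (x + x') y = rdot x y + rdot x' y.
Proof. by case: x x' y => [a b] [c d] [e f]; rewrite /rdot /=; ring. Qed.

Lemma rdotDr x y y' : rdot x (y + y') = rdot x y + rdot x y'.
Proof. by case: x y y' => [a b] [c d] [e f]; rewrite /rdot /=; ring. Qed.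

Lemma rdot_real_mul (a : R) x y : rdot (a%:C%C * x) y = a * rdot x y.
Proof. by case: x y => [b c] [d e]; rewrite /rdot /=; ring. Qed.

Lemma rdot_real_mulr (a : R) x y : rdot x (a%:C%C * y) = a * rdot x y.
Proof. by case: x y => [b c] [d e]; rewrite /rdot /=; ring. Qed.

Lemma rdot_mul x y s : rdot (x * s) x = cabs x ^+ 2 * complex.Re s.
Proof. by case: x s => [a b] [c d]; rewrite /rdot sqr_cabs /=; ring. Qed.

(** One has [|1 + e s|^2 - 1 = e (2 Re s + e |s|^2)], and [x s] is close to [- y]: multiplied by
    [|x|^2], [Re s] is [- rdot y x] up to an error [k |x|]. The threshold [h] dominates this error
    and the quadratic term. *)
Lemma modulus_side x y s (e h k : R) : 0 < e -> 0 < cabs x ->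
  cabs (x * s + y) <= k -> 2 * (k * cabs x) + e * (cabs x * cabs s) ^+ 2 < 2 * h ->
  (h <= rdot y x -> cabs (1 + e%:C%C * s) <= 1) /\
  (rdot y x <= - h -> 1 <= cabs (1 + e%:C%C * s)).
Proof.
move=> e0 x0 hk hh.
have h1 : `|cabs x ^+ 2 * complex.Re s + rdot y x| <= k * cabs x.
  rewrite -(rdot_mul x y) -rdotDl; apply: le_trans (rdot_le _ _) _.
  by rewrite ler_wpM2r // cabs_ge0.
have E : cabs (1 + e%:C%C * s) ^+ 2 - 1 =
    e / cabs x ^+ 2 * (2 * (cabs x ^+ 2 * complex.Re s) + e * (cabs x * cabs s) ^+ 2).
  rewrite cabs_shift; field; exact: lt0r_neq0.
have f0 : 0 < e / cabs x ^+ 2 by rewrite divr_gt0 // exprn_gt0.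
have g0 : 0 <= e * (cabs x * cabs s) ^+ 2 by apply: mulr_ge0; [exact: ltW | rewrite exprn_ge0 // mulr_ge0 // cabs_ge0].
have c0 := cabs_ge0 (1 + e%:C%C * s).
move: h1 hh; rewrite ler_norml => /andP[h1 h2] hh.
split=> hy.
  rewrite -(@expr_le1 _ 2) // -subr_le0 E pmulr_rle0 //; lra.
rewrite -(@expr_ge1 _ 2) // -subr_ge0 E pmulr_rge0 //; lra.
Qed.

Lemma perturb_sign (x d : R) : `|d| < `|x| -> 0 < (x + d) * x.
Proof.
have [x0|x0] := ger0P x; rewrite ltr_norml => /andP[h1 h2].
  by apply: mulr_gt0; lra.
by rewrite -mulrNN; apply: mulr_gt0; lra.
Qed.

Lemma sign_transfer (x y x' y' : R) : 0 < x' * x -> 0 < y' * y -> x * y < 0 -> x' * y' < 0.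
Proof.
move=> hx hy hxy; have : (x' * y') * (x * y) > 0.
  by rewrite mulrACA mulr_gt0.
by rewrite nmulr_lgt0.
Qed.

Lemma near_small (A B : R) : 0 < B -> \forall r \near (0 : R)^'+, A * r < B.
Proof.
move=> B0; near=> r.
have r0 : 0 < r by near: r; exact: nbhs_right_gt.
have : r < B / (`|A| + 1).
  by near: r; apply: nbhs_right_lt; rewrite divr_gt0 // ltr_wpDl.
rewrite ltr_pdivlMr ?ltr_wpDl //; have := ler_norm A; have : 0 < r by [].
have := normr_ge0 A; nra.
Unshelve. all: by end_near.
Qed.

(** The limit coefficients [p] satisfy everything with a margin, the factors 2 in the bounds on
    [p t 1] and [p t 0] and strict inequalities at the two ends, so that coefficients at distance
    [c e] inherit it once [e] is small. Opposite signs at the ends put the roots on opposite sides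
    of the circle. *)
Lemma crossing_along (p : R -> nat -> C) (Q : R -> R -> {poly C})
    (K c b a rho t0 t1 : R) : 0 <= c -> 0 < rho -> rho <= 1 -> 0 < b ->
  18 * (K + c) * rho <= b -> 4 * a < rho * b -> t0 <= t1 ->
  (forall e t, (size (Q e t) <= 5)%N) ->
  (forall e t k, 0 < e -> e <= 1 -> cabs ((Q e t)`_k - p t k) <= c * e) ->
  (forall t k, cabs (p t k) <= K) ->
  (forall t, 2 * b <= cabs (p t 1)) -> (forall t, 2 * cabs (p t 0) <= a) -> 0 < a ->
  (forall e, 0 < e -> e <= 1 ->
    exists M, forall t t' k, cabs ((Q e t)`_k - (Q e t')`_k) <= M * `|t - t'|) ->
  rdot (p t0 0%N) (p t0 1%N) * rdot (p t1 0%N) (p t1 1%N) < 0 ->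
  (forall t, t = t0 \/ t = t1 ->
    3 * (K + c) * rho ^+ 2 * cabs (p t 1) < `|rdot (p t 0%N) (p t 1%N)|) ->
  forall e0, 0 < e0 -> exists e t s,
    [/\ 0 < e < e0, t0 <= t <= t1, (Q e t).[s] = 0 & cabs (1 + e%:C%C * s) = 1].
Proof.
move=> c0 rho0 rho1 b0 Krho ab t01 sQ hQ hK hp1 hp0 a0 hM hsgn hside e0 e00.
(* Error budget for [modulus_side]: the terms of degree at least 2, the perturbation of the first
   two coefficients, and the term [e |s|^2]. *)
pose G t e := 2 * ((3 * (K + c) * rho ^+ 2 + 2 * c * e) * cabs (p t 1))
    + e * (cabs (p t 1) * rho) ^+ 2.
have hG t : t = t0 \/ t = t1 -> \forall e \near (0 : R)^'+,
    G t e < 2 * `|rdot (p t 0%N) (p t 1%N)|.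
  move=> /hside h; near=> e.
  have : (4 * c * cabs (p t 1) + (cabs (p t 1) * rho) ^+ 2) * e
       < 2 * (`|rdot (p t 0%N) (p t 1%N)| - 3 * (K + c) * rho ^+ 2 * cabs (p t 1)).
    by near: e; apply: near_small; rewrite mulr_gt0 // subr_gt0.
  by rewrite /G; lra.
near (0 : R)^'+ => e.
have ee : 0 < e by near: e; exact: nbhs_right_gt.
have e1 : e <= 1 by near: e; apply: nbhs_right_le.
have ee0 : e < e0 by near: e; apply: nbhs_right_lt.
have eb : c * e < b by near: e; apply: near_small.
have ea : c * e < a / 2 by near: e; apply: near_small; rewrite divr_gt0.
have g0 : G t0 e < 2 * `|rdot (p t0 0%N) (p t0 1%N)| by near: e; apply: hG; left.
have g1 : G t1 e < 2 * `|rdot (p t1 0%N) (p t1 1%N)| by near: e; apply: hG; right.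
have [M HM] := hM e ee e1.
have hb t : b <= cabs (Q e t)`_1.
  have := hQ e t 1%N ee e1; have := hp1 t.
  have : cabs (p t 1%N) <= cabs (Q e t)`_1 + cabs ((Q e t)`_1 - p t 1%N).
    by rewrite -[p t 1%N in leLHS](subKr (Q e t)`_1); exact: cabsB.
  lra.
have ha t : cabs (Q e t)`_0 <= a.
  have := hQ e t 0%N ee e1; have := hp0 t.
  have : cabs (Q e t)`_0 <= cabs ((Q e t)`_0 - p t 0%N) + cabs (p t 0%N).
    by rewrite -[(Q e t)`_0 in leLHS](subrK (p t 0%N)); exact: cabsD.
  lra.
have hKQ t k : (2 <= k)%N -> cabs (Q e t)`_k <= K + c.
  move=> _; have := hQ e t k ee e1; have := hK t k.
  have : cabs (Q e t)`_k <= cabs ((Q e t)`_k - p t k) + cabs (p t k).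
    by rewrite -[(Q e t)`_k in leLHS](subrK (p t k)); exact: cabsD.
  have : c * e <= c by rewrite ler_piMr.
  lra.
have side t s : G t e < 2 * `|rdot (p t 0%N) (p t 1%N)| -> (Q e t).[s] = 0 -> cabs s <= rho ->
    (0 < rdot (p t 0%N) (p t 1%N) -> cabs (1 + e%:C%C * s) <= 1) /\
    (rdot (p t 0%N) (p t 1%N) < 0 -> 1 <= cabs (1 + e%:C%C * s)).
  move=> gt Qs sr.
  have h1 := root_approx (sQ e t) rho1 (hKQ t) sr Qs.
  have p1 : 0 < cabs (p t 1%N) by apply: lt_le_trans (hp1 t); rewrite mulr_gt0.
  have h2 : cabs (p t 1%N * s + p t 0%N) <= 3 * (K + c) * rho ^+ 2 + 2 * c * e.
    have -> : p t 1%N * s + p t 0%N = ((Q e t)`_1 * s + (Q e t)`_0)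
        - (((Q e t)`_1 - p t 1%N) * s + ((Q e t)`_0 - p t 0%N)) by ring.
    apply: le_trans (cabsB _ _) _; apply: lerD => //.
    apply: le_trans (cabsD _ _) _; rewrite cabsM.
    have h0 := hQ e t 0%N ee e1; have h1' := hQ e t 1%N ee e1.
    have : cabs ((Q e t)`_1 - p t 1%N) * cabs s <= c * e * 1.
      by apply: ler_pM; rewrite ?cabs_ge0 // (le_trans sr).
    lra.
  have h3 : 2 * ((3 * (K + c) * rho ^+ 2 + 2 * c * e) * cabs (p t 1))
      + e * (cabs (p t 1) * cabs s) ^+ 2 < 2 * `|rdot (p t 0%N) (p t 1%N)|.
    apply: le_lt_trans gt; rewrite /G lerD2l ler_pM2l //.
    by rewrite lerXn2r ?nnegrE ?mulr_ge0 ?cabs_ge0 ?(ltW rho0) // ler_wpM2l ?cabs_ge0.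
  have [A B] := modulus_side ee p1 h2 h3.
  split=> hh; [apply: A | apply: B].
    by rewrite ger0_norm // ltW.
  by rewrite ltr0_norm // opprK.
have [|t [s [tt Qs s1]]] := @crossing_root R (Q e) (K + c) a b rho M e t0 t1 rho0 rho1 b0 Krho ab
    t01 (sQ e) hb ha hKQ HM.
  move=> s z Qs Qz sr zr.
  have [A0 B0] := side t0 s g0 Qs sr; have [A1 B1] := side t1 z g1 Qz zr.
  move: hsgn; case: (ltgtP 0 (rdot (p t0 0%N) (p t0 1%N))) => h0.
  - by rewrite pmulr_rlt0 // => h1; rewrite (A0 h0) (B1 h1).
  - by rewrite nmulr_rlt0 // => h1; rewrite (B0 h0) (A1 h1) orbT.
  - by rewrite -h0 mul0r ltxx.
by exists e, t, s; rewrite ee ee0.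
Unshelve. all: by end_near.
Qed.

(** Two kinds of zeros are covered: [beta = 0] for a double zero where the linear coefficient
    survives, [beta = 1] for a fourfold zero where it vanishes to first order. The root has size
    [r^(2 + beta)], and the neglected quadratic terms contribute [r^(4 + 3 beta)] to a quantity of
    order [r^(2 + 3 beta)]; a fixed small [r] therefore decides the signs before [e] is chosen. *)
Lemma crossing_scaled (beta : nat) (g0 g1 : R -> C) (p : R -> R -> nat -> C)
    (Q : R -> R -> R -> {poly C}) (c K L m G t0 t1 : R) :
  0 <= c -> 0 <= L -> 0 < m -> 0 < G -> t0 <= t1 ->
  (forall r e t, (size (Q r e t) <= 5)%N) ->
  (forall r e t k, 0 < r -> r <= 1 -> 0 < e -> e <= 1 ->
     cabs ((Q r e t)`_k - p r t k) <= c * e) ->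
  (forall r t k, 0 < r -> r <= 1 -> cabs (p r t k) <= K) ->
  (forall r e, 0 < r -> r <= 1 -> 0 < e -> e <= 1 ->
    exists M, forall t t' k, cabs ((Q r e t)`_k - (Q r e t')`_k) <= M * `|t - t'|) ->
  (forall r t, 0 < r -> r <= 1 -> exists2 x, cabs x <= L * r &
     p r t 0%N = ((r ^+ (2 + 2 * beta))%:C)%C * (g0 t + x)) ->
  (forall r t, 0 < r -> r <= 1 -> exists2 x, cabs x <= L * r &
     p r t 1%N = ((r ^+ beta)%:C)%C * (g1 t + x)) ->
  (forall t, m <= cabs (g1 t)) -> (forall t, cabs (g1 t) <= G) ->
  (forall t, cabs (g0 t) <= G) ->
  rdot (g0 t0) (g1 t0) * rdot (g0 t1) (g1 t1) < 0 ->
  forall e0, 0 < e0 -> exists r e t s,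
    [/\ 0 < r <= 1, 0 < e < e0, t0 <= t <= t1, (Q r e t).[s] = 0 &
        cabs (1 + e%:C%C * s) = 1].
Proof.
move=> c0 L0 m0 G0 t01 sQ hQ hK hM hp0 hp1 hm hG1 hG0 hsgn e0 e00.
have K0 : 0 <= K by apply: le_trans (hK 1 0 0%N _ _) => //; exact: cabs_ge0.
pose h t := rdot (g0 t) (g1 t).
have h0 : 0 < `|h t0|.
  by rewrite normr_gt0; apply: contraTneq hsgn => e; rewrite -/(h t0) e mul0r ltxx.
have h1 : 0 < `|h t1|.
  by rewrite normr_gt0; apply: contraTneq hsgn => e; rewrite -/(h t1) e mulr0 ltxx.
pose L' := L * (2 * G + L).
(* The disc will have radius [B r^2 r^beta]. With [a = 4 r^2 r^(2 beta) (G + L)] and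
   [b = (m / 4) r^beta], the condition that [4 a] be less than the radius times [b] reads
   [16 < 80 / 4]. *)
pose B := 80 * (G + L) / m.
near (0 : R)^'+ => r.
have r0 : 0 < r by near: r; exact: nbhs_right_gt.
have r1 : r <= 1 by near: r; apply: nbhs_right_le.
have s1 : L * r < m / 2 by near: r; apply: near_small; rewrite divr_gt0.
have s2 : B * r < 1 by near: r; apply: near_small.
have s3 : (18 * (K + c) * B) * r < m / 4 by near: r; apply: near_small; rewrite divr_gt0.
have s4 : (L' + 3 * (K + c) * B ^+ 2 * (G + L)) * r < `|h t0| by near: r; exact: near_small.
have s5 : (L' + 3 * (K + c) * B ^+ 2 * (G + L)) * r < `|h t1| by near: r; exact: near_small.
pose u := r ^+ beta.
have u0 : 0 < u by exact: exprn_gt0.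
have u1 : u <= 1 by rewrite /u exprn_ile1 // ltW.
have uE : r ^+ (2 + 2 * beta) = r * r * (u * u) by rewrite exprD mulnC exprM !expr2.
have B0 : 0 < B by rewrite /B divr_gt0 // !mulr_gt0 // ltr_wpDr.
have GL0 : 0 <= G + L by rewrite addr_ge0 // ltW.
have ru0 : 0 < r * r * u by apply: mulr_gt0 => //; exact: mulr_gt0.
have ruu0 : 0 < r * r * (u * u) by apply: mulr_gt0; exact: mulr_gt0.
have rr : r * r <= r by rewrite ler_piMr // ltW.
have Bm : B * m = 80 * (G + L) by rewrite /B divfK // lt0r_neq0.
have KC : 0 <= K + c by rewrite addr_ge0.
have hE t : exists2 d, `|d| <= L' * r & rdot (p r t 0%N) (p r t 1%N) = r * r * (u * u * u) * (h t + d).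
  have [x hx ->] := hp0 r t r0 r1; have [y hy ->] := hp1 r t r0 r1.
  exists (rdot (g0 t) y + rdot x (g1 t) + rdot x y); last first.
    by rewrite rdot_real_mul rdot_real_mulr uE -/u rdotDl !rdotDr /h; ring.
  have e1 := rdot_le (g0 t) y; have e2 := rdot_le x (g1 t); have e3 := rdot_le x y.
  have f1 : cabs (g0 t) * cabs y <= G * (L * r) by apply: ler_pM; rewrite ?cabs_ge0.
  have f2 : cabs x * cabs (g1 t) <= L * r * G by apply: ler_pM; rewrite ?cabs_ge0.
  have f3 : cabs x * cabs y <= L * r * (L * 1).
    apply: ler_pM; rewrite ?cabs_ge0 //; apply: le_trans hy _; exact: ler_wpM2l.
  have d1 := ler_normD (rdot (g0 t) y + rdot x (g1 t)) (rdot x y).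
  have d2 := ler_normD (rdot (g0 t) y) (rdot x (g1 t)).
  by rewrite /L'; lra.
have p1u t : cabs (p r t 1%N) <= u * (G + L).
  have [y hy ->] := hp1 r t r0 r1; rewrite cabsM cabs_real (ger0_norm (ltW u0)) ler_pM2l //.
  apply: le_trans (cabsD _ _) _; apply: lerD => //; apply: le_trans hy _; exact: ler_piMr.
have side t : (L' + 3 * (K + c) * B ^+ 2 * (G + L)) * r < `|h t| ->
    0 < rdot (p r t 0%N) (p r t 1%N) * h t /\
    3 * (K + c) * (B * (r * r * u)) ^+ 2 * cabs (p r t 1) < `|rdot (p r t 0%N) (p r t 1%N)|.
  move=> hs; have [d hd ->] := hE t.
  have w0 : 0 < r * r * (u * u * u) by rewrite !mulr_gt0.
  have z0 : 0 <= 3 * (K + c) * B ^+ 2 * (G + L) by rewrite mulr_ge0 // mulr_ge0 ?sqr_ge0 // mulr_ge0.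
  have z1 : 0 <= 3 * (K + c) * B ^+ 2 * (G + L) * r by rewrite mulr_ge0 // ltW.
  have dh : `|d| < `|h t| - 3 * (K + c) * B ^+ 2 * (G + L) * r by lra.
  split.
    rewrite -(mulrA (_ * (u * u * u))) (pmulr_rgt0 _ w0); have {dh} : `|d| < `|h t| by lra.
    exact: perturb_sign.
  rewrite normrM (gtr0_norm w0).
  have hd' : `|h t| - `|d| <= `|h t + d| by rewrite -[h t in leLHS](addrK d) lerBlDr ler_normB.
  have : r * r * (u * u * u) * (3 * (K + c) * B ^+ 2 * (G + L) * r) < r * r * (u * u * u) * `|h t + d|.
    by rewrite ltr_pM2l //; lra.
  apply: le_lt_trans.
  apply: (@le_trans _ _ (3 * (K + c) * (B * (r * r * u)) ^+ 2 * (u * (G + L)))).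
    by rewrite ler_wpM2l // mulr_ge0 ?sqr_ge0 // mulr_ge0.
  have -> : 3 * (K + c) * (B * (r * r * u)) ^+ 2 * (u * (G + L)) =
    r * r * (u * u * u) * ((3 * (K + c) * B ^+ 2 * (G + L)) * (r * r)) by rewrite !expr2; ring.
  by rewrite ler_pM2l // ler_wpM2l.
have [q0 w0] := side t0 s4; have [q1 w1] := side t1 s5.
have [] := @crossing_along (p r) (Q r) K c (m / 4 * u) (4 * (r * r * (u * u)) * (G + L))
  (B * (r * r * u)) t0 t1 c0 _ _ _ _ _ t01 _ _ _ _ _ _ _ _ _ e0 e00 => //.
- exact: mulr_gt0 B0 ru0.
- have : r * r * u <= r * 1 by apply: ler_pM => //; [exact: ltW (mulr_gt0 r0 r0) | exact: ltW].
  by move: (r * r * u) => w; have := B0; have := s2; nra.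
- by apply: mulr_gt0 => //; rewrite divr_gt0.
- have -> : 18 * (K + c) * (B * (r * r * u)) = (18 * (K + c) * B) * (r * r) * u by ring.
  rewrite ler_pM2r //; apply: le_trans (ltW s3); rewrite ler_wpM2l //.
  by rewrite mulr_ge0 ?(ltW B0) // mulr_ge0.
- have -> : B * (r * r * u) * (m / 4 * u) = 4^-1 * (B * m) * (r * r * (u * u)) by ring.
  rewrite Bm; have : 0 < (G + L) * (r * r * (u * u)) by apply: mulr_gt0 => //; exact: ltr_wpDr.
  by move: (G + L) (r * r * (u * u)) => x y; lra.
- by move=> e t k; exact: hQ.
- by move=> t k; exact: hK.
- move=> t; have [y hy ->] := hp1 r t r0 r1; rewrite cabsM cabs_real -/u (ger0_norm (ltW u0)).
  have : m / 2 <= cabs (g1 t + y).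
    have : cabs (g1 t) <= cabs (g1 t + y) + cabs y by rewrite -[g1 t in leLHS](addrK y); exact: cabsB.
    have := hm t; lra.
  by move: (cabs _) u0 => z; nra.
- move=> t; have [y hy ->] := hp0 r t r0 r1; rewrite cabsM cabs_real uE (ger0_norm (ltW ruu0)).
  have : cabs (g0 t + y) <= G + L.
    apply: le_trans (cabsD _ _) _; apply: lerD => //; apply: le_trans hy _; exact: ler_piMr.
  by move: (cabs _) (r * r * (u * u)) ruu0 => z w; nra.
- by apply: mulr_gt0; [exact: mulr_gt0 | exact: ltr_wpDr].
- by move=> e; exact: hM.
- move: hsgn; rewrite -/(h t0) -/(h t1).
  move: (h t0) (h t1) q0 q1 => x y; move: (rdot _ _) (rdot _ _) => x' y'; exact: sign_transfer.
- by move=> t [] ->.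
move=> e [t [s [ee tt Qs s1']]]; exists r, e, t, s; split=> //; by rewrite r0 r1.
Unshelve. all: by end_near.
Qed.

End Crossing.

(** * The segment beside a multiple zero *)

Section Path.
Context {R : realType}.
Local Notation C := R[i].
Implicit Types (s z x y : C).

(** Directions of approach to a zero of the constant term, with real part 1 to move into the right
    half plane. Clamping makes the bounds hold for every real [t]. The bound 2 on the imaginary part
    leaves room for [tau^2] to sweep more than a half turn. *)
Definition tau (t : R) : C := Complex 1 (Num.max (-2) (Num.min t 2)).

Lemma tau_eq t : - 2 <= t -> t <= 2 -> tau t = Complex 1 t.
Proof. by move=> h1 h2; rewrite /tau (min_l h2) (max_r h1). Qed.

Lemma tau_le t : cabs (tau t) <= 3.
Proof.
rewrite -(@ler_pXn2r _ 2) ?nnegrE ?cabs_ge0 // sqr_cabs /=.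
have : `|Num.max (-2) (Num.min t 2)| <= 2 :> R.
  rewrite ler_norml le_max lexx ge_max /= ge_min lexx orbT andbT; lra.
by rewrite ler_norml => /andP[]; move: (Num.max _ _) => u; nra.
Qed.

Lemma tau_ge t : 1 <= cabs (tau t).
Proof. by apply: le_trans (ler_Re_cabs _); rewrite /= normr1. Qed.

Lemma tau_lip t t' : cabs (tau t - tau t') <= `|t - t'|.
Proof.
have -> : tau t - tau t' =
    Complex 0 (Num.max (-2) (Num.min t 2) - Num.max (-2) (Num.min t' 2)).
  by apply/eqP; rewrite eq_complex /= subrr !eqxx.
rewrite /cabs /= expr0n add0r sqrtr_sqr.
case: (leP t 2) => h1; [case: (leP (- 2 : R) t) => h3 | case: (leP (- 2 : R) 2) => h3];
  (case: (leP t' 2) => h2; [case: (leP (- 2 : R) t') => h4 | case: (leP (- 2 : R) 2) => h4]);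
  case: (ger0P (t - t')) => h5; rewrite ?ler_norml; try (apply/andP; split); lra.
Qed.

Variables (p : C -> nat -> C) (Q : R -> C -> {poly C}).
Hypothesis bounded_p : forall L : R, exists K : R, forall l k, cabs l <= L -> cabs (p l k) <= K.
Hypothesis size_Q : forall e l, (size (Q e l) <= 5)%N.
Hypothesis close_Q : forall L : R, exists c, forall e l k, 0 < e -> e <= 1 -> cabs l <= L ->
  cabs ((Q e l)`_k - p l k) <= c * e.
Hypothesis lip_Q : forall (L e : R), 0 < e -> e <= 1 -> exists M : R, forall l l' k,
  cabs l <= L -> cabs l' <= L -> cabs ((Q e l)`_k - (Q e l')`_k) <= M * cabs (l - l').

(** Along [l + r tau t] the real part is [Re l + r]: even a zero on the imaginary axis is approached
    from the unstable side. *)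
Lemma crossing_path (beta : nat) (l : C) (g0 g1 : R -> C) (L m G t0 t1 : R) :
  0 <= complex.Re l -> 0 < m -> 0 < G -> t0 <= t1 ->
  (forall r t, 0 < r -> r <= 1 -> exists2 x, cabs x <= L &
     p (l + r%:C%C * tau t) 0%N = ((r ^+ (2 + 2 * beta))%:C)%C * (g0 t + r%:C%C * x)) ->
  (forall r t, 0 < r -> r <= 1 -> exists2 x, cabs x <= L &
     p (l + r%:C%C * tau t) 1%N = ((r ^+ beta)%:C)%C * (g1 t + r%:C%C * x)) ->
  (forall t, m <= cabs (g1 t)) -> (forall t, cabs (g1 t) <= G) ->
  (forall t, cabs (g0 t) <= G) ->
  rdot (g0 t0) (g1 t0) * rdot (g0 t1) (g1 t1) < 0 ->
  forall e0, 0 < e0 -> exists e l' s,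
    [/\ 0 < e < e0, 0 < complex.Re l' /\ cabs l' <= cabs l + 3,
        (Q e l').[s] = 0 & cabs (1 + e%:C%C * s) = 1].
Proof.
move=> l0 m0 G0 t01 hp0 hp1 hm hG1 hG0 hsgn e0 e00.
pose P (r t : R) := l + r%:C%C * tau t.
have [K hK] := bounded_p (cabs l + 3); have [c hc] := close_Q (cabs l + 3).
have inb r t : 0 < r -> r <= 1 -> cabs (P r t) <= cabs l + 3.
  move=> r0 r1; apply: le_trans (cabsD _ _) _; rewrite lerD2l cabsM cabs_real (gtr0_norm r0).
  by rewrite -[leRHS]mul1r; apply: ler_pM; rewrite ?cabs_ge0 ?tau_le // ltW.
have L0 : 0 <= L by have [x hx _] := hp0 1 0 ltr01 (lexx _); apply: le_trans hx; exact: cabs_ge0.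
have sc r x : 0 < r -> cabs x <= L -> cabs (r%:C%C * x) <= L * r.
  by move=> r0 hx; rewrite cabsM cabs_real (gtr0_norm r0) mulrC ler_pM2r.
have c0 : 0 <= c.
  have h := hc 1 (P 1 0) 0%N ltr01 (lexx _) (inb _ _ ltr01 (lexx _)); rewrite mulr1 in h.
  by apply: le_trans h; exact: cabs_ge0.
have [] := @crossing_scaled R beta g0 g1 (fun r t => p (P r t)) (fun r e t => Q e (P r t))
  c K L m G t0 t1 c0 L0 m0 G0 t01 _ _ _ _ _ _ hm hG1 hG0 hsgn e0 e00.
- by move=> r e t; exact: size_Q.
- by move=> r e t k r0 r1 ee e1; apply: hc => //; exact: inb.
- by move=> r t k r0 r1; apply: hK; exact: inb.
- move=> r e r0 r1 ee e1; have [M hM] := lip_Q (cabs l + 3) ee e1.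
  exists `|M| => t t' k; apply: le_trans (hM _ _ _ (inb _ _ r0 r1) (inb _ _ r0 r1)) _.
  apply: (@le_trans _ _ (`|M| * cabs (P r t - P r t'))).
    by rewrite ler_wpM2r ?cabs_ge0 // ler_norm.
  rewrite ler_wpM2l //; have -> : P r t - P r t' = r%:C%C * (tau t - tau t') by rewrite /P; ring.
  rewrite cabsM cabs_real (gtr0_norm r0) -[leRHS]mul1r.
  by apply: ler_pM; rewrite ?cabs_ge0 ?tau_lip // ltW.
- by move=> r t r0 r1; have [x hx e] := hp0 r t r0 r1; exists (r%:C%C * x) => //; exact: sc.
- by move=> r t r0 r1; have [x hx e] := hp1 r t r0 r1; exists (r%:C%C * x) => //; exact: sc.
move=> r [e [t [s [/andP[r0 r1] ee tt Qs s1]]]]; exists e, (P r t), s; split => //; split; last exact: inb.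
have -> : complex.Re (P r t) = complex.Re l + r.
  by rewrite /P; case: (l) => u v; rewrite /tau /=; ring.
by rewrite ltr_wpDl.
Qed.

Variables (A N d a : R).
Hypothesis A0 : A != 0.
Hypothesis N0 : N != 0.
Hypothesis p0E : forall l, p l 0%N = A%:C%C * (l ^+ 2 + a%:C%C) ^+ 2.
Hypothesis p1E : forall l, p l 1%N = l * (N%:C%C + d%:C%C * (l ^+ 2 + a%:C%C)).

Lemma cabs_le_mul x y (X Y : R) : cabs x <= X -> cabs y <= Y -> cabs (x * y) <= X * Y.
Proof. by move=> hx hy; rewrite cabsM; apply: ler_pM => //; exact: cabs_ge0. Qed.

Lemma cabs_le_add x y (X Y : R) : cabs x <= X -> cabs y <= Y -> cabs (x + y) <= X + Y.
Proof. by move=> hx hy; apply: le_trans (cabsD _ _) _; exact: lerD. Qed.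

Lemma cabs_r_le (r : R) : 0 < r -> r <= 1 -> cabs (r%:C%C) <= 1.
Proof. by move=> r0 r1; rewrite cabs_real gtr0_norm. Qed.

Lemma cabs_nat_le n : cabs (n%:R : C) <= n%:R.
Proof.
have -> : (n%:R : C) = (n%:R)%:C%C by rewrite rmorph_nat.
by rewrite cabs_real ger0_norm.
Qed.

Lemma cabs_real_le (u : R) : cabs (u%:C%C) <= `|u|.
Proof. by rewrite cabs_real. Qed.

Ltac bnd := repeat first [exact: tau_le | exact: cabs_nat_le | (apply: cabs_r_le; assumption)
  | exact: cabs_real_le | exact: lexx | apply: cabs_le_add | apply: cabs_le_mul].

(** As [l^2 = - a], one has [z^2 + a = r tau (2 l + r tau)] at [z = l + r tau]. The leading parts
    are thus [4 A l^2 tau^2 r^2] for the constant term and [N l] for the linear one;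
    [4 A l^2 = - 4 A a] is real and drops out of the sign condition. *)
Lemma crossing_nonzero (l : C) (t0 t1 : R) : l != 0 -> 0 <= complex.Re l ->
  l ^+ 2 + a%:C%C = 0 -> t0 <= t1 ->
  rdot (tau t0 ^+ 2) l * rdot (tau t1 ^+ 2) l < 0 -> a != 0 ->
  forall e0, 0 < e0 -> exists e l' s,
    [/\ 0 < e < e0, 0 < complex.Re l' /\ cabs l' <= cabs l + 3,
        (Q e l').[s] = 0 & cabs (1 + e%:C%C * s) = 1].
Proof.
move=> l0 rl la t01 hs a0.
have l2 : l ^+ 2 = - a%:C%C by apply/eqP; rewrite -subr_eq0 opprK; apply/eqP.
have cl : 0 < cabs l by rewrite cabs_gt0.
have cN : 0 < `|N| by rewrite normr_gt0.
pose g0 t := ((-4 * A * a)%:C)%C * tau t ^+ 2.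
pose g1 (_ : R) := N%:C%C * l.
pose L0 := `|A| * (3 * 3 * 3) * (4 * cabs l + 1 * 3).
pose L1 := 3 * `|N| + cabs l * (`|d| * (3 * (2 * cabs l + 1 * 3))) + 1 * 3 * (`|d| * (3 * (2 * cabs l + 1 * 3))).
have L00 : 0 <= L0 by rewrite !mulr_ge0 // addr_ge0 // mulr_ge0 // cabs_ge0.
have L10 : 0 <= L1.
  by rewrite /L1 !addr_ge0 // !mulr_ge0 ?cabs_ge0 // !addr_ge0 // mulr_ge0 // cabs_ge0.
apply: (@crossing_path 0 l g0 g1 (L0 + L1) (`|N| * cabs l)
   (`|N| * cabs l + `|-4 * A * a| * (3 * 3)) t0 t1) => //.
- exact: mulr_gt0.
- by rewrite ltr_wpDr ?mulr_ge0 // mulr_gt0.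
- move=> r t r0 r1.
  exists (A%:C%C * (tau t * tau t * tau t) * (4%:R * l + r%:C%C * tau t)).
    rewrite -[leRHS]addr0; apply: (@le_trans _ _ L0); last by rewrite addr0 lerDl.
    by bnd.
  rewrite p0E /g0 muln0 addn0.
  have -> : (l + r%:C%C * tau t) ^+ 2 + a%:C%C = r%:C%C * tau t * (2%:R * l + r%:C%C * tau t).
    by rewrite -[a%:C%C]opprK -l2; ring.
  have -> : ((-4 * A * a)%:C)%C = 4%:R * A%:C%C * l ^+ 2 :> C.
    by rewrite l2 !rmorphM /= rmorphN rmorph_nat; ring.
  rewrite rmorphXn /=; ring.
- move=> r t r0 r1.
  exists (tau t * N%:C%C + l * (d%:C%C * (tau t * (2%:R * l + r%:C%C * tau t)))
    + r%:C%C * tau t * (d%:C%C * (tau t * (2%:R * l + r%:C%C * tau t)))).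
    apply: (@le_trans _ _ L1); last by rewrite lerDr.
    by bnd.
  rewrite p1E /g1 expr0 mul1r.
  have -> : (l + r%:C%C * tau t) ^+ 2 + a%:C%C = r%:C%C * tau t * (2%:R * l + r%:C%C * tau t).
    by rewrite -[a%:C%C]opprK -l2; ring.
  ring.
- by move=> t; rewrite /g1 cabsM cabs_real.
- by move=> t; rewrite /g1 cabsM cabs_real lerDl mulr_ge0.
- move=> t; apply: (@le_trans _ _ (`|-4 * A * a| * (3 * 3))).
    by rewrite /g0 expr2; bnd.
  by rewrite lerDr mulr_ge0 // ltW.
- rewrite /g0 /g1 !rdot_real_mul !rdot_real_mulr.
  move: (rdot _ _) (rdot _ _) hs => x y hs.
  have -> : -4 * A * a * (N * y) * (-4 * A * a * (N * x)) = (4 * A * a * N) ^+ 2 * (x * y) by ring.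
  have n4 : (4 : R) != 0 by rewrite pnatr_eq0.
  have sq0 : 0 < (4 * A * a * N) ^+ 2 by rewrite exprn_even_gt0 //= !mulf_neq0.
  by rewrite pmulr_rlt0 // mulrC.
Qed.

(** The constant term is [A z^4] and the linear one starts with [N z]. Their ratio follows [tau^3],
    whose argument goes from 0 to [3 arctan 2], a little more than a half turn, between [t = 0] and
    [t = 2]. *)
Lemma crossing_zero : a = 0 ->
  forall e0, 0 < e0 -> exists e l' s,
    [/\ 0 < e < e0, 0 < complex.Re l' /\ cabs l' <= cabs (0 : C) + 3,
        (Q e l').[s] = 0 & cabs (1 + e%:C%C * s) = 1].
Proof.
move=> a0.
have cN : 0 < `|N| by rewrite normr_gt0.
pose g0 t := A%:C%C * tau t ^+ 4.
pose g1 t := N%:C%C * tau t.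
apply: (@crossing_path 1 0 g0 g1 (1 * (`|d| * (3 * 3 * 3))) `|N|
   (`|N| * 3 + `|A| * (3 * 3 * 3 * 3)) 0 2) => //.
- by rewrite ltr_wpDr ?mulr_ge0 // mulr_gt0.
- move=> r t r0 r1; exists 0; first by rewrite cabs0 !mulr_ge0.
  by rewrite p0E a0 /g0 rmorphXn /= rmorph0; ring.
- move=> r t r0 r1; exists (r%:C%C * (d%:C%C * (tau t * tau t * tau t))).
    by bnd.
  by rewrite p1E a0 /g1 expr1 rmorph0; ring.
- by move=> t; rewrite cabsM cabs_real ler_peMr // tau_ge.
- move=> t; apply: (@le_trans _ _ (`|N| * 3)); last by rewrite lerDl mulr_ge0.
  by bnd.
- move=> t; apply: (@le_trans _ _ (`|A| * (3 * 3 * 3 * 3))); last by rewrite lerDr mulr_ge0.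
  have -> : g0 t = A%:C%C * (tau t * tau t * tau t * tau t) by rewrite /g0; ring.
  by bnd.
- rewrite /g0 /g1 !rdot_real_mul !rdot_real_mulr !tau_eq; try lra.
  (* [rdot (w^4) w = |w|^2 Re (w^3)], which is [5 * (-11)] at [w = 1 + 2 i] and 1 at [w = 1]. *)
  have -> : A * (N * rdot (Complex 1 0 ^+ 4) (Complex 1 0)) *
    (A * (N * rdot (Complex 1 2 ^+ 4) (Complex 1 2))) = - (55 * (A * N) ^+ 2).
    by rewrite /rdot !exprS !expr0 /=; ring.
  by rewrite oppr_lt0 mulr_gt0 // exprn_even_gt0 //= mulf_neq0.
Qed.

(** For [a < 0] the zero is real and the sign is that of [Re tau^2], which is 1 and -3 at [t = 0]
    and [t = 2]. For [a > 0] it is imaginary and the sign is that of [Im tau^2], which is -2 and 4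
    at [t = -1] and [t = 2]. *)
Theorem unstable_crossing : exists L : R, forall e0, 0 < e0 -> exists e l s,
  [/\ 0 < e < e0, 0 < complex.Re l /\ cabs l <= L,
      (Q e l).[s] = 0 & cabs (1 + e%:C%C * s) = 1].
Proof.
have [a0|a0|a0] := ltgtP a 0; last by eexists; exact: crossing_zero.
- have s0 : 0 < Num.sqrt (- a) by rewrite sqrtr_gt0 oppr_gt0.
  eexists; apply: (@crossing_nonzero ((Num.sqrt (- a))%:C)%C 0 2) => //=.
  + by apply/eqP => /(congr1 (@complex.Re R)) /= e; rewrite e ltxx in s0.
  + by rewrite -rmorphXn /= sqr_sqrtr ?oppr_ge0 ?ltW // -rmorphD /= addNr.
  + rewrite !tau_eq; try lra.
    move: (Num.sqrt (- a)) s0 => l l0.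
    have -> : rdot (Complex 1 0 ^+ 2) (l%:C)%C * rdot (Complex 1 2 ^+ 2) (l%:C)%C = - (3 * l ^+ 2).
      by rewrite /rdot !exprS !expr0 /=; ring.
    by rewrite oppr_lt0 mulr_gt0 // exprn_gt0.
  + by rewrite lt_eqF.
- have s0 : 0 < Num.sqrt a by rewrite sqrtr_gt0.
  eexists; apply: (@crossing_nonzero (Complex 0 (Num.sqrt a)) (-1) 2) => //=.
  + by apply/eqP => /(congr1 (@complex.Im R)) /= e; rewrite e ltxx in s0.
  + have -> : Complex 0 (Num.sqrt a) ^+ 2 = - ((Num.sqrt a ^+ 2)%:C)%C.
      by rewrite !expr2; apply/eqP; rewrite eq_complex /=; apply/andP; split; apply/eqP; ring.
    by rewrite sqr_sqrtr ?ltW // addNr.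
  + lra.
  + rewrite !tau_eq; try lra.
    move: (Num.sqrt a) s0 => l l0.
    have -> : rdot (Complex 1 (-1) ^+ 2) (Complex 0 l) * rdot (Complex 1 2 ^+ 2) (Complex 0 l) = - (8 * l ^+ 2).
      by rewrite /rdot !exprS !expr0 /=; ring.
    by rewrite oppr_lt0 mulr_gt0 // exprn_gt0.
  + by rewrite gt_eqF.
Qed.

End Path.

(** * Floquet multipliers of the perturbed system *)

Section RealContinuity.
Context {R : realType}.
Implicit Types f g : R -> R.

Lemma contD f g : continuous f -> continuous g -> continuous (fun x => f x + g x).
Proof. by move=> cf cg x; apply: continuousD; [exact: cf | exact: cg]. Qed.

Lemma contM f g : continuous f -> continuous g -> continuous (fun x => f x * g x).
Proof. by move=> cf cg x; apply: continuousM; [exact: cf | exact: cg]. Qed.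

Lemma cont_cst (c : R) : continuous (fun _ : R => c).
Proof. by move=> x; exact: cst_continuous. Qed.

Lemma contN f : continuous f -> continuous (fun x => - f x).
Proof. by move=> cf x; apply: continuousN; exact: cf. Qed.

End RealContinuity.

(** * Complex linear systems on the line *)

Section ComplexDerivative.
Context {R : realType}.
Local Notation C := R[i].
Implicit Types (f g : R -> C) (a b l : C).

(** Stated on real and imaginary parts, so that the real theory applies without any differential
    structure on the complex numbers. *)
Definition cder (x : R) f l : Prop :=
  is_derive x 1 (fun t => complex.Re (f t)) (complex.Re l) /\
  is_derive x 1 (fun t => complex.Im (f t)) (complex.Im l).

Lemma cder_eq x f l l' : cder x f l -> l = l' -> cder x f l'.
Proof. by move=> ? <-. Qed.

Lemma ReM a b : complex.Re (a * b) = complex.Re a * complex.Re b - complex.Im a * complex.Im b.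
Proof. by case: a b => [? ?] [? ?]. Qed.

Lemma ImM a b : complex.Im (a * b) = complex.Re a * complex.Im b + complex.Im a * complex.Re b.
Proof. by case: a b => [? ?] [? ?]. Qed.

Lemma complexP a b : complex.Re a = complex.Re b -> complex.Im a = complex.Im b -> a = b.
Proof. by case: a b => [? ?] [? ?] /= -> ->. Qed.

Lemma cderD x f g a b : cder x f a -> cder x g b -> cder x (fun t => f t + g t) (a + b).
Proof.
move=> [f1 f2] [g1 g2]; split.
  have -> : (fun t => complex.Re (f t + g t)) = (fun t => complex.Re (f t) + complex.Re (g t)).
    by apply/funext => t; rewrite raddfD.
  by rewrite raddfD; exact: derD.
have -> : (fun t => complex.Im (f t + g t)) = (fun t => complex.Im (f t) + complex.Im (g t)).
  by apply/funext => t; rewrite raddfD.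
by rewrite raddfD; exact: derD.
Qed.

Lemma cderM x f g a b : cder x f a -> cder x g b ->
  cder x (fun t => f t * g t) (a * g x + f x * b).
Proof.
move=> [f1 f2] [g1 g2]; split.
  have -> : (fun t => complex.Re (f t * g t)) = (fun t => complex.Re (f t) * complex.Re (g t)
      - complex.Im (f t) * complex.Im (g t)) by apply/funext => t; rewrite ReM.
  by rewrite raddfD /= !ReM; der_ring.
have -> : (fun t => complex.Im (f t * g t)) = (fun t => complex.Re (f t) * complex.Im (g t)
    + complex.Im (f t) * complex.Re (g t)) by apply/funext => t; rewrite ImM.
by rewrite raddfD /= !ImM; der_ring.
Qed.

Lemma cder_cst x a : cder x (fun=> a) 0.
Proof. by split; exact: der_cst. Qed.

Lemma cder_real (u : R -> R) (x d : R) : is_derive x 1 u d -> cder x (fun t => (u t)%:C%C) (d%:C)%C.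
Proof. by move=> h; split => //=; exact: der_cst. Qed.

Lemma cderN x f a : cder x f a -> cder x (fun t => - f t) (- a).
Proof.
move=> h; have := cderM (cder_cst x (-1)) h.
have -> : (fun t => -1 * f t) = (fun t => - f t) by apply/funext => t; rewrite mulN1r.
by move/cder_eq; apply; rewrite mul0r add0r mulN1r.
Qed.

Lemma cderB x f g a b : cder x f a -> cder x g b -> cder x (fun t => f t - g t) (a - b).
Proof. by move=> hf hg; apply: cderD => //; exact: cderN. Qed.

Lemma cder_scale x f a l : cder x f a -> cder x (fun t => l * f t) (l * a).
Proof. by move=> h; apply: cder_eq (cderM (cder_cst x l) h) _; rewrite mul0r add0r. Qed.

Lemma cder_sum (I : Type) (s : seq I) (F : I -> R -> C) (dF : I -> C) x :
  (forall i, cder x (F i) (dF i)) -> cder x (fun t => \sum_(i <- s) F i t) (\sum_(i <- s) dF i).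
Proof.
move=> h; elim: s => [|i s IH].
  rewrite big_nil; have -> : (fun t => \sum_(i <- [::]) F i t) = (fun=> 0).
    by apply/funext => t; rewrite big_nil.
  exact: cder_cst.
rewrite big_cons; have -> : (fun t => \sum_(j <- i :: s) F j t) =
    (fun t => F i t + \sum_(j <- s) F j t) by apply/funext => t; rewrite big_cons.
exact: cderD.
Qed.

(** The mean value theorem is applied to the real and the imaginary part separately, at two
    different points; hence the factor 2. *)
Lemma cder_mean f (df : R -> C) (X G : R) : 0 < X ->
  (forall x, 0 <= x <= X -> cder x f (df x)) -> (forall x, 0 <= x <= X -> cabs (df x) <= G) ->
  cabs (f X - f 0) <= 2 * X * G.
Proof.
move=> X0 hd hG.
have [c1 i1 e1] := @mean_value R (fun t => complex.Re (f t)) (fun t => complex.Re (df t)) 0 X X0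
  (fun x h => (hd x h).1).
have [c2 i2 e2] := @mean_value R (fun t => complex.Im (f t)) (fun t => complex.Im (df t)) 0 X X0
  (fun x h => (hd x h).2).
rewrite subr0 in e1; rewrite subr0 in e2.
apply: le_trans (cabs_le _) _; rewrite !raddfB /= e1 e2 !normrM (gtr0_norm X0).
have {}i1 : 0 <= c1 <= X by case/andP: i1 => /ltW -> /ltW ->.
have {}i2 : 0 <= c2 <= X by case/andP: i2 => /ltW -> /ltW ->.
have h1 : `|complex.Re (df c1)| <= G by apply: le_trans (ler_Re_cabs _) (hG _ i1).
have h2 : `|complex.Im (df c2)| <= G by apply: le_trans (ler_Im_cabs _) (hG _ i2).
by nra.
Qed.

Section System.
Variable I : finType.
Implicit Types (A : I -> I -> R -> C) (y : I -> R -> C).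

(** A complex system indexed by [I] is a real one indexed by [bool * I], where [true] marks real
    parts; existence, uniqueness and the energy estimate transfer in this way. *)
Let realA A (p q : bool * I) (x : R) : R :=
  if p.1 == q.1 then complex.Re (A p.2 q.2 x)
  else if p.1 then - complex.Im (A p.2 q.2 x) else complex.Im (A p.2 q.2 x).

Let part y (p : bool * I) (x : R) : R :=
  if p.1 then complex.Re (y p.2 x) else complex.Im (y p.2 x).

Let sum_pair (F : bool * I -> R) : \sum_p F p = \sum_i (F (true, i) + F (false, i)).
Proof.
have -> : \sum_p F p = \sum_(p : bool * I) F (p.1, p.2) by apply: eq_bigr => -[].
rewrite -(pair_bigA _ (fun (b : bool) (i : I) => F (b, i))) /= exchange_big /=.
by apply: eq_bigr => i _; rewrite big_bool.
Qed.

Let part_sum A y p x :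
  \sum_q realA A p q x * part y q x =
  if p.1 then complex.Re (\sum_j A p.2 j x * y j x) else complex.Im (\sum_j A p.2 j x * y j x).
Proof.
rewrite sum_pair; case: p => -[] i /=; rewrite raddf_sum; apply: eq_bigr => j _.
  by rewrite /realA /part /= ReM; ring.
by rewrite /realA /part /= ImM; ring.
Qed.

Let realA_continuous A : (forall i j, continuous (fun x => complex.Re (A i j x))) ->
  (forall i j, continuous (fun x => complex.Im (A i j x))) ->
  forall p q, continuous (realA A p q).
Proof.
move=> h1 h2 [b i] [b' j]; rewrite /realA /=; case: b b' => -[] //= x.
by apply: continuousN; exact: h2.
Qed.

Lemma complex_ode_exists A (y0 : I -> C) :
  (forall i j, continuous (fun x => complex.Re (A i j x))) ->
  (forall i j, continuous (fun x => complex.Im (A i j x))) ->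
  exists y, (forall i, y i 0 = y0 i) /\ forall i x, cder x (y i) (\sum_j A i j x * y j x).
Proof.
move=> cR cI.
have [u [u0 du]] := linear_ode_exists
  (fun p : bool * I => if p.1 then complex.Re (y0 p.2) else complex.Im (y0 p.2))
  (realA_continuous cR cI).
pose y i x := Complex (u (true, i) x) (u (false, i) x).
exists y; split; first by move=> i; rewrite /y !u0 /=; case: (y0 i).
have yE : u = part y by apply/funext => -[[] i].
by move=> i x; split; rewrite /y /=; [have := du (true, i) x | have := du (false, i) x];
  rewrite yE part_sum.
Qed.

(** It depends on the system only through the bound [K] of the coefficients, hence is uniform in all
    parameters. The energy estimate bounds a square with this factor, which is at least 1, so that
    no square root has to be taken. *)
Definition ode_const (K L : R) : R := 2 * #|I|%:R * expR ((4 * #|I|%:R * K + 1) * L).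

Lemma complex_ode_bound A y (f : I -> R -> C) (K F Y L : R) :
  0 <= K -> 0 <= F -> 0 <= Y ->
  (forall i x, cder x (y i) (\sum_j A i j x * y j x + f i x)) ->
  (forall i j x, `|x| <= L -> cabs (A i j x) <= K) ->
  (forall i x, `|x| <= L -> cabs (f i x) <= F) ->
  (forall i, cabs (y i 0) <= Y) ->
  forall i x, `|x| <= L -> cabs (y i x) <= ode_const K L * (Y + F).
Proof.
move=> K0 F0 Y0 dy hA hf hy i x xL.
have L0 : 0 <= L by apply: le_trans xL.
have := @linear_ode_bound R (bool * I)%type (realA A) (part y) (part f) K F L K0.
have -> : #|{: bool * I}|%:R = 2 * #|I|%:R :> R by rewrite card_prod card_bool natrM.
have H1 : forall p (t : R), `|t| <= L ->
    is_derive t 1 (part y p) (\sum_q realA A p q t * part y q t + part f p t).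
  move=> [b j] t _; rewrite part_sum; have [h1 h2] := dy j t.
  by case: b; rewrite /part /=; [move: h1 | move: h2]; rewrite raddfD.
have H2 : forall p q t, `|t| <= L -> `|realA A p q t| <= K.
  move=> [b j] [b' l] t tL; rewrite /realA /=; apply: le_trans (hA j l t tL).
  by case: ifP => _; [exact: ler_Re_cabs | case: b; rewrite ?normrN; exact: ler_Im_cabs].
have H3 : forall p t, `|t| <= L -> `|part f p t| <= F.
  move=> [b j] t tL; rewrite /part /=; apply: le_trans (hf j t tL).
  by case: b; [exact: ler_Re_cabs | exact: ler_Im_cabs].
move=> /(_ H1 H2 H3 x xL) {H1 H2 H3}.
have sqE t : \sum_p part y p t ^+ 2 = \sum_j cabs (y j t) ^+ 2.
  by rewrite sum_pair; apply: eq_bigr => j _; rewrite /part /= sqr_cabs.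
rewrite !sqE => h.
set n : R := #|I|%:R in h *.
have n1 : 1 <= n by rewrite /n ler1n; apply/card_gt0P; exists i.
set e := expR _ in h.
have ec : ode_const K L = 2 * n * e by rewrite /ode_const /e -/n; congr (_ * expR _); ring.
have e1 : 1 <= e.
  rewrite /e -expR0 ler_expR mulr_ge0 // addr_ge0 // !mulr_ge0 //; exact: le_trans n1.
have h0 : \sum_j cabs (y j 0) ^+ 2 <= n * Y ^+ 2.
  rewrite -sumr_cst; apply: ler_sum => j _; rewrite lerXn2r ?nnegrE ?cabs_ge0 //.
have hi : cabs (y i x) ^+ 2 <= \sum_j cabs (y j x) ^+ 2.
  by rewrite (bigD1 i) //= lerDl sumr_ge0 // => j _; exact: sqr_ge0.
rewrite ec -(@ler_pXn2r _ 2) ?nnegrE ?cabs_ge0 //; last first.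
  by rewrite !mulr_ge0 ?addr_ge0 // ?(le_trans _ n1) // (le_trans _ e1).
apply: le_trans hi (le_trans h _).
apply: (@le_trans _ _ ((n * Y ^+ 2 + 2 * n * F ^+ 2) * e)).
  by rewrite ler_wpM2r ?lerD2r // (le_trans _ e1).
have YF : Y ^+ 2 + F ^+ 2 <= (Y + F) ^+ 2 by have := mulr_ge0 Y0 F0; nra.
apply: (@le_trans _ _ (2 * n * e * (Y ^+ 2 + F ^+ 2))).
  have : 0 <= n * e * Y ^+ 2 by rewrite !mulr_ge0 ?sqr_ge0 // ?(le_trans _ n1) // (le_trans _ e1).
  lra.
have -> : (2 * n * e * (Y + F)) ^+ 2 = 2 * n * e * (2 * n * e * (Y + F) ^+ 2) by ring.
have ne : 1 <= 2 * n * e.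
  have : 1 * 1 <= n * e by apply: ler_pM.
  lra.
apply: ler_wpM2l; first exact: le_trans ne.
by apply: le_trans YF _; rewrite ler_peMl // sqr_ge0.
Qed.

Lemma complex_ode_unique A y :
  (forall i j, continuous (fun x => complex.Re (A i j x))) ->
  (forall i j, continuous (fun x => complex.Im (A i j x))) ->
  (forall i x, cder x (y i) (\sum_j A i j x * y j x)) ->
  (forall i, y i 0 = 0) -> forall i x, y i x = 0.
Proof.
move=> cR cI dy y0 i x.
have h := @linear_ode_unique R (bool * I)%type (realA A) (part y) (realA_continuous cR cI).
have H : forall p (t : R), is_derive t 1 (part y p) (\sum_q realA A p q t * part y q t).
  move=> [b j] t; rewrite part_sum; have [h1 h2] := dy j t.
  by case: b; rewrite /part /=; [move: h1 | move: h2].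
have H0 : forall p, part y p 0 = 0 by move=> [[] j]; rewrite /part /= y0.
by apply: complexP; [have := h H H0 (true, i) x | have := h H H0 (false, i) x].
Qed.

End System.

End ComplexDerivative.

(** * Orders of magnitude in [e] and Lipschitz dependence on the spectral parameter *)

Section Orders.
Context {R : realType}.
Local Notation C := R[i].
Variables (L X : R).
Implicit Types (F G : R -> C -> R -> C) (f g : C -> C).

(* [F e l x = O(e ^ k)] uniformly for [|l| <= L] and [|x| <= X]. *)
Definition ap k F := exists2 c : R, 0 <= c & forall e l x, 0 < e -> e <= 1 ->
  cabs l <= L -> `|x| <= X -> cabs (F e l x) <= c * e ^+ k.

Lemma ap_eq k F G : (forall e l x, 0 < e -> e <= 1 -> cabs l <= L -> `|x| <= X ->
  F e l x = G e l x) -> ap k G -> ap k F.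
Proof. by move=> h [c c0 hc]; exists c => // e l x *; rewrite h // hc. Qed.

Lemma ap0 k : ap k (fun _ _ _ => 0).
Proof. by exists 0 => // *; rewrite cabs0 mul0r. Qed.

Lemma ap_weaken k m F : (k <= m)%N -> ap m F -> ap k F.
Proof.
move=> km [c c0 hc]; exists c => // e l x e0 e1 hl hx; apply: le_trans (hc e l x e0 e1 hl hx) _.
by rewrite ler_wpM2l //; apply: ler_wiXn2l => //; exact: ltW.
Qed.

Lemma apD k F G : ap k F -> ap k G -> ap k (fun e l x => F e l x + G e l x).
Proof.
move=> [c c0 hc] [d d0 hd]; exists (c + d); first exact: addr_ge0.
move=> e l x e0 e1 hl hx; apply: le_trans (cabsD _ _) _; rewrite mulrDl.
by apply: lerD; [exact: hc | exact: hd].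
Qed.

Lemma apM k m F G : ap k F -> ap m G -> ap (k + m) (fun e l x => F e l x * G e l x).
Proof.
move=> [c c0 hc] [d d0 hd]; exists (c * d); first exact: mulr_ge0.
move=> e l x e0 e1 hl hx; rewrite cabsM exprD mulrACA.
by apply: ler_pM; rewrite ?cabs_ge0 ?hc ?hd.
Qed.

Lemma apMl k F G : ap 0 F -> ap k G -> ap k (fun e l x => F e l x * G e l x).
Proof. by move=> hF hG; have := apM hF hG. Qed.

Lemma ap_sum k (I : Type) (s : seq I) (F : I -> R -> C -> R -> C) :
  (forall i, ap k (F i)) -> ap k (fun e l x => \sum_(i <- s) F i e l x).
Proof.
move=> h; elim: s => [|i s IH].
  by apply: ap_eq (ap0 k) => *; rewrite big_nil.
by apply: ap_eq (apD (h i) IH) => *; rewrite big_cons.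
Qed.

Lemma ap_eps k : ap k (fun e _ _ => (e ^+ k)%:C%C).
Proof.
exists 1 => // e l x e0 e1 _ _; by rewrite cabs_real mul1r ger0_norm // exprn_ge0 // ltW.
Qed.

Lemma ap_e : ap 1 (fun e _ _ => e%:C%C).
Proof. exact: (ap_eps 1). Qed.

Lemma ap_l : ap 0 (fun _ l _ => l).
Proof.
exists `|L| => // e l x _ _ hl _; rewrite mulr1; apply: le_trans hl _; exact: ler_norm.
Qed.

Lemma ap_cst (a : C) : ap 0 (fun _ _ _ => a).
Proof. by exists (cabs a); rewrite ?cabs_ge0 // => *; rewrite mulr1. Qed.

Lemma ap_real (u : R -> R) : continuous u -> ap 0 (fun _ _ x => (u x)%:C%C).
Proof.
move=> cu; have [K K0 hK] := bounded_on_segment X cu; exists K => // e l x _ _ _ hx.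
by rewrite cabs_real mulr1; exact: hK.
Qed.

Lemma ap_at k F (x0 : R) : `|x0| <= X -> ap k F -> ap k (fun e l _ => F e l x0).
Proof. by move=> h [c c0 hc]; exists c => // *; exact: hc. Qed.

Lemma ap_uniform (I : finType) k (F : I -> R -> C -> R -> C) : (forall i, ap k (F i)) ->
  exists2 c : R, 0 <= c & forall i e l x, 0 < e -> e <= 1 -> cabs l <= L -> `|x| <= X ->
    cabs (F i e l x) <= c * e ^+ k.
Proof.
move=> h; have h' i : exists c : R, 0 <= c /\ forall e l x, 0 < e -> e <= 1 -> cabs l <= L ->
    `|x| <= X -> cabs (F i e l x) <= c * e ^+ k.
  by have [c c0 hc] := h i; exists c.
have [c hc] := choice h'; exists (\sum_i c i); first by apply: sumr_ge0 => i _; case: (hc i).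
move=> i e l x e0 e1 hl hx; apply: le_trans ((hc i).2 e l x e0 e1 hl hx) _.
have eX : 0 <= e ^+ k by rewrite exprn_ge0 // ltW.
by rewrite ler_wpM2r // (bigD1 i) //= lerDl; apply: sumr_ge0 => j _; case: (hc j).
Qed.

(** Needed for the entries of the characteristic matrix: the intermediate value argument requires
    the small root to move continuously with the spectral parameter. *)
Definition lip f := exists2 c : R, 0 <= c & forall l l', cabs l <= L -> cabs l' <= L ->
  cabs (f l - f l') <= c * cabs (l - l').

Lemma lip_eq f g : f =1 g -> lip g -> lip f.
Proof. by move=> /funext ->. Qed.

Lemma lip_cst a : lip (fun=> a).
Proof. by exists 0 => // *; rewrite subrr cabs0 mul0r. Qed.

Lemma lip_id : lip id.
Proof. by exists 1 => // *; rewrite mul1r. Qed.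

Lemma lipD f g : lip f -> lip g -> lip (fun l => f l + g l).
Proof.
move=> [c c0 hc] [d d0 hd]; exists (c + d); first exact: addr_ge0.
move=> l l' hl hl'; have -> : f l + g l - (f l' + g l') = (f l - f l') + (g l - g l') by ring.
by apply: le_trans (cabsD _ _) _; rewrite mulrDl; apply: lerD; [exact: hc | exact: hd].
Qed.

Lemma lip_bounded f : lip f -> exists2 b : R, 0 <= b & forall l, cabs l <= L -> cabs (f l) <= b.
Proof.
move=> [c c0 hc]; exists (cabs (f 0) + c * `|L|); first by rewrite addr_ge0 ?cabs_ge0 // mulr_ge0.
move=> l hl; have -> : f l = f 0 + (f l - f 0) by ring.
have L0 : 0 <= L by apply: le_trans hl; exact: cabs_ge0.
apply: le_trans (cabsD _ _) _; rewrite lerD2l; apply: le_trans (hc _ _ hl _) _.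
  by rewrite cabs0.
by rewrite subr0 ler_wpM2l // ger0_norm.
Qed.

Lemma lipM f g : lip f -> lip g -> lip (fun l => f l * g l).
Proof.
move=> hf hg; have [bf bf0 hbf] := lip_bounded hf; have [bg bg0 hbg] := lip_bounded hg.
move: hf hg => [c c0 hc] [d d0 hd]; exists (c * bg + bf * d).
  by rewrite addr_ge0 // mulr_ge0.
move=> l l' hl hl'; have -> : f l * g l - f l' * g l' = (f l - f l') * g l + f l' * (g l - g l').
  by ring.
apply: le_trans (cabsD _ _) _; rewrite [leRHS]mulrDl !cabsM; apply: lerD.
  by rewrite mulrAC; apply: ler_pM; rewrite ?cabs_ge0 ?hc ?hbg.
by rewrite -mulrA; apply: ler_pM; rewrite ?cabs_ge0 ?hd ?hbf.
Qed.

Lemma lipN f : lip f -> lip (fun l => - f l).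
Proof. by move=> h; apply: lip_eq (lipM (lip_cst (-1)) h) => l; rewrite mulN1r. Qed.

Lemma lipB f g : lip f -> lip g -> lip (fun l => f l - g l).
Proof. by move=> hf hg; apply: lipD => //; exact: lipN. Qed.

Lemma lip_sum (I : Type) (s : seq I) (F : I -> C -> C) : (forall i, lip (F i)) ->
  lip (fun l => \sum_(i <- s) F i l).
Proof.
move=> h; elim: s => [|i s IH].
  by apply: lip_eq (lip_cst 0) => l; rewrite big_nil.
by apply: lip_eq (lipD (h i) IH) => l; rewrite big_cons.
Qed.

End Orders.

Section Sums.
Variables (K : comRingType) (I J : finType).

Lemma sum_assoc (u : I -> K) (A : I -> J -> K) (w : J -> K) :
  \sum_i u i * (\sum_j A i j * w j) = \sum_j (\sum_i u i * A i j) * w j.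
Proof.
under eq_bigr do rewrite mulr_sumr.
rewrite exchange_big /=; apply: eq_bigr => j _; rewrite mulr_suml.
by apply: eq_bigr => i _; rewrite mulrA.
Qed.

Lemma sum_delta (u : I -> K) k : \sum_i (i == k)%:R * u i = u k.
Proof.
rewrite (bigD1 k) //= eqxx mul1r big1 ?addr0 // => i ik.
by rewrite (negbTE ik) mul0r.
Qed.

Lemma sum_deltar (u : I -> K) k : \sum_i u i * (i == k)%:R = u k.
Proof. by rewrite -[RHS](sum_delta u); apply: eq_bigr => i _; rewrite mulrC. Qed.

End Sums.

(** * Expansion of the characteristic matrix in an abstract setting *)

Section Monodromy.
Context {R : realType}.
Local Notation C := R[i].
Variables (M N E : 'I_4 -> 'I_4 -> R -> R) (X M0 : R).
(* [Phi j i] and [Psi j i] are the components of index [i] of the columns [j]. *)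
Variables (Phi Psi : 'I_4 -> 'I_4 -> R -> R) (l : 'I_2 -> 'I_4 -> R -> R).
Variables (Rot Rinv B : 'I_4 -> 'I_4 -> R) (xi Xp : 'I_4 -> R).
Hypothesis X0 : 0 < X.
Hypothesis cM : forall i k, continuous (M i k).
Hypothesis cN : forall i k, continuous (N i k).
Hypothesis cE : forall i k, continuous (E i k).
Hypothesis dPhi : forall j i (x : R), is_derive x 1 (Phi j i) (\sum_k M i k x * Phi j k x).
Hypothesis dPsi : forall j i (x : R), is_derive x 1 (Psi j i)
  (\sum_k M i k x * Psi j k x + (j < 2)%N%:R * \sum_k N i k x * Phi j k x).
Hypothesis Psi_high : forall (j i : 'I_4) x, (2 <= j)%N -> Psi j i x = 0.
(** The rows [l] solve the adjoint system, so that [l . y] is constant along solutions of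
    [y' = M y], and only the perturbations [N] and [E] contribute to its increments. *)
Hypothesis dl : forall a i (x : R), is_derive x 1 (l a i) (- \sum_k l a k x * M k i x).
Hypothesis lPhi : forall a j, \sum_i l a i 0 * Phi j i 0 = (j == (2 + a)%N :> nat)%:R.
Hypothesis lPsi : forall a j, \sum_i l a i 0 * Psi j i 0 = - (j + a == 1)%N%:R * M0.
Hypothesis RinvK : forall i k, \sum_m Rinv i m * Rot m k = (i == k)%:R.
Hypothesis RotK : forall i k, \sum_m Rot i m * Rinv m k = (i == k)%:R.
Hypothesis lRot : forall a k, \sum_i l a i X * Rot i k = l a k 0.
Hypothesis PhiX : forall j i : 'I_4, (j < 2)%N -> Phi j i X = \sum_k Rot i k * Phi j k 0.
Hypothesis BK : forall i j, \sum_k B i k * Phi j k 0 = (i == j)%:R.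

Hypothesis KB : forall i k, \sum_j Phi j i 0 * B j k = (i == k)%:R.

(** The derivative of the profile in parameter [j]: a first-order corrector for the frequency and
    the speed, a solution of the unperturbed system for the constants of integration. *)
Definition par (j i : 'I_4) (x : R) : R := if (j < 2)%N then Psi j i x else Phi j i x.

Hypothesis parX : forall j i, par j i X =
  \sum_k Rot i k * (par j k 0 + xi j * Phi 0 k 0 + Xp j * Phi 1 k 0).

Definition bil (P : 'I_4 -> 'I_4 -> R -> R) a (w : 'I_4 -> R -> R) (x : R) : R :=
  \sum_i \sum_k l a i x * P i k x * w k x.

Hypothesis NPhi0 : forall a (j : 'I_4), (j < 2)%N -> prim (bil N a (Phi j)) X = 0.

(** [Sigma_t] in terms of the abstract data. The terms with [M0] are due to the variation of the
    period and of the phase: a boundary term for the mass, and what an integration by parts leaves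
    for the momentum. *)
Definition Sig (i j : 'I_4) : R :=
  if i == 0 then xi j else if i == 1 then Xp j
  else if i == 2%N :> nat then prim (bil N 0 (par j)) X + M0 * Xp j
  else prim (bil N 1 (par j)) X + M0 * xi j.

Definition Sgy (i j : 'I_4) : R :=
  if (2 <= i)%N && (j < 2)%N then prim (bil E (if i == 2%N :> nat then 0 else 1) (Phi j)) X else 0.

(** Powers of [e] in the characteristic matrix: increments of the linearized constants ([i >= 2])
    are one order smaller, and so are those of the symmetry modes ([j < 2]), which close up exactly
    at order zero. *)
Definition wt (i j : 'I_4) : nat := (2 <= i)%N + (j < 2)%N.

Definition lim_mx (z : C) : 'M[C]_4 := \matrix_(i, j)
  (z ^+ wt i j * (Sig i j)%:C%C + (Sgy i j)%:C%C).

(** First-order form at spectral parameter [e z] and transverse wave number [e]. *)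
Definition sys e z i k x : C :=
  (M i k x)%:C%C + e%:C%C * z * (N i k x)%:C%C + ((e ^+ 2)%:C)%C * (E i k x)%:C%C.

Definition is_sol e z (y : 'I_4 -> R -> C) :=
  forall i x, cder x (y i) (\sum_k sys e z i k x * y k x).

Let cPhi j i : continuous (Phi j i).
Proof. by move=> x; exact: is_derive1_continuous (dPhi j i x). Qed.

Let cPsi j i : continuous (Psi j i).
Proof. by move=> x; exact: is_derive1_continuous (dPsi j i x). Qed.

Let cl a i : continuous (l a i).
Proof. by move=> x; exact: is_derive1_continuous (dl a i x). Qed.

Let cbil P a w : (forall i k, continuous (P i k)) -> (forall k, continuous (w k)) ->
  continuous (bil P a w).
Proof.
move=> cP cw; apply: continuous_sumr => i; apply: continuous_sumr => k.
by apply: contM => //; exact: contM.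
Qed.

Lemma sys_Re e z i k : continuous (fun x => complex.Re (sys e z i k x)).
Proof.
have -> : (fun x => complex.Re (sys e z i k x)) = (fun x => M i k x
    + (e * complex.Re z) * N i k x + e ^+ 2 * E i k x).
  by apply/funext => x; rewrite /sys; case: z => u v /=; ring.
apply: contD; first apply: contD => //.
  by apply: contM => //; exact: cont_cst.
by apply: contM => //; exact: cont_cst.
Qed.

Lemma sys_Im e z i k : continuous (fun x => complex.Im (sys e z i k x)).
Proof.
have -> : (fun x => complex.Im (sys e z i k x)) = (fun x => (e * complex.Im z) * N i k x).
  by apply/funext => x; rewrite /sys; case: z => u v /=; ring.
by apply: contM => //; exact: cont_cst.
Qed.

(** The initial data include the first-order correction, so that the remainder [rem] starts from
    0. *)
Lemma columns_exist : exists Y : R -> C -> 'I_4 -> 'I_4 -> R -> C,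
  forall e z j, is_sol e z (Y e z j) /\
    forall i, Y e z j i 0 = (Phi j i 0)%:C%C + e%:C%C * z * (Psi j i 0)%:C%C.
Proof.
have h (p : R * C * 'I_4) : exists y : 'I_4 -> R -> C, is_sol p.1.1 p.1.2 y /\
    forall i, y i 0 = (Phi p.2 i 0)%:C%C + p.1.1%:C%C * p.1.2 * (Psi p.2 i 0)%:C%C.
  have [y [y0 dy]] := complex_ode_exists
    (fun i => (Phi p.2 i 0)%:C%C + p.1.1%:C%C * p.1.2 * (Psi p.2 i 0)%:C%C)
    (@sys_Re p.1.1 p.1.2) (@sys_Im p.1.1 p.1.2).
  by exists y.
by have [Y hY] := choice h; exists (fun e z j => Y (e, z, j)) => e z j; exact: hY (e, z, j).
Qed.

Lemma ap_sys (L : R) (p : 'I_4 * 'I_4) : ap L X 0 (fun e z x => sys e z p.1 p.2 x).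
Proof.
apply: apD; first apply: apD; first exact: ap_real.
  apply: apMl; last exact: ap_real.
  by apply: (@apM R L X 0 0); [exact: ap_weaken (ap_e L X) | exact: ap_l].
apply: apMl; last exact: ap_real.
by apply: ap_weaken (ap_eps L X 2).
Qed.

Section Columns.
Variable Y : R -> C -> 'I_4 -> 'I_4 -> R -> C.
Hypothesis solY : forall e z j, is_sol e z (Y e z j).
Hypothesis Y0 : forall e z j i, Y e z j i 0 = (Phi j i 0)%:C%C + e%:C%C * z * (Psi j i 0)%:C%C.

Definition rem (j i : 'I_4) e z x : C :=
  Y e z j i x - ((Phi j i x)%:C%C + e%:C%C * z * (Psi j i x)%:C%C).

(** What [Phi + e z Psi] leaves over in the equation. The term [e z N Phi] is compensated by [Psi]
    for [j < 2] only, hence the factor [1 - (j < 2)]. *)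
Definition frc (j i : 'I_4) (e : R) (z : C) x : C :=
  e%:C%C * z * (1 - (j < 2)%N%:R) * (\sum_k (N i k x)%:C%C * (Phi j k x)%:C%C)
  + ((e ^+ 2)%:C)%C * (z ^+ 2 * (\sum_k (N i k x)%:C%C * (Psi j k x)%:C%C)
     + \sum_k (E i k x)%:C%C * ((Phi j k x)%:C%C + e%:C%C * z * (Psi j k x)%:C%C)).

Lemma rem_derive (j i : 'I_4) e z x :
  cder x (rem j i e z) (\sum_k sys e z i k x * rem j k e z x + frc j i e z x).
Proof.
have h := cderB (solY e z j i x) (cderD (cder_real (dPhi j i x))
  (cder_scale (e%:C%C * z) (cder_real (dPsi j i x)))).
apply: cder_eq h _; rewrite /frc !rmorphD /= rmorphM /= !rmorph_sum /=.
have -> : (((j < 2)%N%:R : R)%:C)%C = (j < 2)%N%:R by rewrite rmorph_nat.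
have e2 : ((e ^+ 2)%:C)%C = e%:C%C ^+ 2 by rewrite rmorphXn.
move: ((j < 2)%N%:R : C) => b; rewrite /sys /rem e2 !mulrDr !mulr_sumr -!big_split /=.
rewrite -sumrB; apply: eq_bigr => k _; rewrite !rmorphM /=; ring.
Qed.

Lemma ap_frc (L : R) (j i : 'I_4) : ap L X (1 + (j < 2)%N) (frc j i).
Proof.
have aN k : ap L X 0 (fun _ _ x => (N i k x)%:C%C) by exact: ap_real.
have aE k : ap L X 0 (fun _ _ x => (E i k x)%:C%C) by exact: ap_real.
have aF k : ap L X 0 (fun _ _ x => (Phi j k x)%:C%C) by exact: ap_real.
have aG k : ap L X 0 (fun _ _ x => (Psi j k x)%:C%C) by exact: ap_real.
have aez : ap L X 1 (fun e z _ => e%:C%C * z) by apply: apM (ap_e L X) (ap_l L X).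
have aez0 : ap L X 0 (fun e z _ => e%:C%C * z) by exact: ap_weaken aez.
have second : ap L X 2 (fun e z x => ((e ^+ 2)%:C)%C * (z ^+ 2 * (\sum_k (N i k x)%:C%C * (Psi j k x)%:C%C)
     + \sum_k (E i k x)%:C%C * ((Phi j k x)%:C%C + e%:C%C * z * (Psi j k x)%:C%C))).
  apply: (@apM R L X 2 0 (fun e _ _ => ((e ^+ 2)%:C)%C)); first exact: ap_eps.
  apply: apD.
    apply: apMl; first by apply: apMl; exact: ap_l.
    by apply: ap_sum => k; exact: apMl.
  by apply: ap_sum => k; apply: apMl => //; apply: apD => //; exact: apMl.
case j2 : (j < 2)%N.
  by apply: ap_eq second => e z x *; rewrite /frc j2 subrr mulr0 mul0r add0r.
apply: apD; last exact: ap_weaken second.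
apply: (@apM R L X 1 0 (fun e z _ => e%:C%C * z * (1 - (j < 2)%N%:R))); last first.
  by apply: ap_sum => k; exact: apMl.
by apply: ap_eq aez => *; rewrite j2 subr0 mulr1.
Qed.

(** The remainder vanishes at 0 and its forcing has this order; the energy estimate is uniform in
    [e] and [z]. *)
Lemma ap_rem (L : R) (j i : 'I_4) : ap L X (1 + (j < 2)%N) (rem j i).
Proof.
have [c c0 hc] := ap_uniform (ap_frc L j).
have [K K0 hK'] := ap_uniform (ap_sys L).
have hK i' k e z x : 0 < e -> e <= 1 -> cabs z <= L -> `|x| <= X -> cabs (sys e z i' k x) <= K.
  by move=> e0 e1 hz hx; have := hK' (i', k) e z x e0 e1 hz hx; rewrite expr0 mulr1.
exists (ode_const 'I_4 K X * c).
  by rewrite mulr_ge0 // /ode_const !mulr_ge0 // expR_ge0.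
move=> e z x e0 e1 hz hx.
have en : 0 <= e ^+ (1 + (j < 2)%N) by rewrite exprn_ge0 // ltW.
rewrite -mulrA -[c * _]add0r.
apply: (@complex_ode_bound R 'I_4 (sys e z) (fun i => rem j i e z) (fun i => frc j i e z)) => //.
- exact: mulr_ge0.
- by move=> i' t; exact: rem_derive.
- by move=> i' k t ht; exact: hK.
- by move=> i' t ht; exact: hc.
- by move=> i'; rewrite /rem Y0 subrr cabs0.
Qed.

(** In the basis [Phi] at 0, the increment of the columns over a period once the rotation is undone.
    A combination of columns has multiplier [1 + e s] exactly when its coefficients lie in the
    kernel of [top_mx - e s init_mx]. *)
Definition top_mx e z (i j : 'I_4) : C :=
  \sum_k (B i k)%:C%C * (\sum_m (Rinv k m)%:C%C * Y e z j m X - Y e z j k 0).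

Definition init_mx e z (i j : 'I_4) : C := \sum_k (B i k)%:C%C * Y e z j k 0.

Lemma Y_rem e z j i x : Y e z j i x = (Phi j i x)%:C%C + e%:C%C * z * (Psi j i x)%:C%C
  + rem j i e z x.
Proof. by rewrite /rem addrC subrK. Qed.

Lemma realsum (I : finType) (u v : I -> R) :
  \sum_k (u k)%:C%C * (v k)%:C%C = ((\sum_k u k * v k)%:C)%C.
Proof. by rewrite rmorph_sum /=; apply: eq_bigr => k _; rewrite rmorphM. Qed.

Lemma init_mxE e z i j : init_mx e z i j =
  (i == j)%:R + e%:C%C * z * ((\sum_k B i k * Psi j k 0)%:C)%C.
Proof.
have -> : ((i == j)%:R : C) = ((\sum_k B i k * Phi j k 0)%:C)%C by rewrite BK rmorph_nat.
rewrite -(realsum (fun k => B i k) (fun k => Phi j k 0)).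
rewrite -(realsum (fun k => B i k) (fun k => Psi j k 0)) mulr_sumr -big_split /=.
by apply: eq_bigr => k _; rewrite Y0; ring.
Qed.

Lemma Rinv_Rot (u : 'I_4 -> R) k : \sum_m Rinv k m * (\sum_q Rot m q * u q) = u k.
Proof.
rewrite sum_assoc -[RHS](sum_delta u); apply: eq_bigr => q _.
by rewrite RinvK eq_sym.
Qed.

(** Over a period the parameter derivatives pick up the multiples [xi] and [Xp] of the two symmetry
    modes, the first two basis vectors: at leading order only the rows 0 and 1 are filled. *)
Lemma top_mxE e z (i j : 'I_4) : top_mx e z i j =
  (e%:C%C * z) ^+ (j < 2)%N * ((xi j * (i == 0)%:R + Xp j * (i == 1)%:R)%:C)%C
  + \sum_k (B i k)%:C%C * (\sum_m (Rinv k m)%:C%C * rem j m e z X).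
Proof.
have h k : \sum_m (Rinv k m)%:C%C * Y e z j m X - Y e z j k 0 =
    (e%:C%C * z) ^+ (j < 2)%N * ((xi j * Phi 0 k 0 + Xp j * Phi 1 k 0)%:C)%C
    + \sum_m (Rinv k m)%:C%C * rem j m e z X.
  have -> : \sum_m (Rinv k m)%:C%C * Y e z j m X =
      ((\sum_m Rinv k m * Phi j m X)%:C)%C + e%:C%C * z * ((\sum_m Rinv k m * Psi j m X)%:C)%C
      + \sum_m (Rinv k m)%:C%C * rem j m e z X.
    rewrite -(realsum (fun m => Rinv k m) (fun m => Phi j m X)).
    rewrite -(realsum (fun m => Rinv k m) (fun m => Psi j m X)) mulr_sumr -!big_split /=.
    by apply: eq_bigr => m _; rewrite Y_rem; ring.
  rewrite Y0.
  have hp : \sum_m Rinv k m * par j m X = par j k 0 + xi j * Phi 0 k 0 + Xp j * Phi 1 k 0.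
    under eq_bigr do rewrite parX.
    by rewrite Rinv_Rot.
  move: hp; rewrite /par; case j2 : (j < 2)%N => hp.
    have -> : \sum_m Rinv k m * Phi j m X = Phi j k 0.
      under eq_bigr do rewrite PhiX //.
      by rewrite Rinv_Rot.
    rewrite hp expr1 -[_ + _ * _ + _]addrA [((_ + _)%:C)%C]rmorphD /=; ring.
  have j2' : (2 <= j)%N by rewrite leqNgt j2.
  have -> : \sum_m Rinv k m * Psi j m X = 0 by apply: big1 => m _; rewrite Psi_high // mulr0.
  rewrite hp Psi_high // expr0 -[_ + _ * _ + _]addrA [((_ + _)%:C)%C]rmorphD /= rmorph0; ring.
have -> : xi j * (i == 0)%:R + Xp j * (i == 1)%:R =
    \sum_k B i k * (xi j * Phi 0 k 0 + Xp j * Phi 1 k 0).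
  rewrite -!BK !mulr_sumr -big_split /=; apply: eq_bigr => k _; ring.
rewrite -(realsum (fun k => B i k) (fun k => xi j * Phi 0 k 0 + Xp j * Phi 1 k 0)).
rewrite /top_mx mulr_sumr -big_split /=; apply: eq_bigr => k _; rewrite h; ring.
Qed.

Lemma ap_top (L : R) (i j : 'I_4) : ap L X (1 + (j < 2)%N) (fun e z _ => top_mx e z i j -
  (e%:C%C * z) ^+ (j < 2)%N * ((xi j * (i == 0)%:R + Xp j * (i == 1)%:R)%:C)%C).
Proof.
have hX : `|X| <= X by rewrite gtr0_norm.
apply: (@ap_eq _ _ _ _ _ (fun e z _ => \sum_k (B i k)%:C%C * (\sum_m (Rinv k m)%:C%C * rem j m e z X))).
  by move=> e z x *; rewrite top_mxE addrC addKr.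
apply: ap_sum => k; apply: apMl; first exact: ap_cst.
apply: ap_sum => m; apply: apMl; first exact: ap_cst.
exact: (ap_at hX (ap_rem L j m)).
Qed.

(** By [lPhi] the rows [l] at 0 are two vectors of the dual basis of [Phi], hence rows of its
    inverse. *)
Lemma l_row (a : 'I_2) k (b : 'I_4) : b = (2 + a)%N :> nat -> l a k 0 = B b k.
Proof.
move=> ba; have -> : l a k 0 = \sum_i l a i 0 * (\sum_j Phi j i 0 * B j k).
  by rewrite -[LHS](sum_deltar (fun i => l a i 0)); apply: eq_bigr => i _; rewrite KB.
rewrite sum_assoc -[RHS](sum_delta (fun j => B j k)); apply: eq_bigr => j _.
by rewrite lPhi -ba.
Qed.

Lemma l_Rinv a m : \sum_k l a k 0 * Rinv k m = l a m X.
Proof.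
have -> : l a m X = \sum_i l a i X * (\sum_k Rot i k * Rinv k m).
  by rewrite -[LHS](sum_deltar (fun i => l a i X)); apply: eq_bigr => i _; rewrite RotK.
by rewrite sum_assoc; apply: eq_bigr => k _; rewrite lRot.
Qed.

(** This gains one order in the lower rows: they become increments of [l . Y], whose derivative is
    of order [e], instead of differences of quantities of order 1. *)
Lemma bottom_mxE e z (a : 'I_2) (b j : 'I_4) : b = (2 + a)%N :> nat -> top_mx e z b j =
  \sum_i (l a i X)%:C%C * Y e z j i X - \sum_i (l a i 0)%:C%C * Y e z j i 0.
Proof.
move=> ba; rewrite /top_mx; under eq_bigr do rewrite -(l_row _ ba) mulrBr.
rewrite sumrB; congr (_ - _); under eq_bigr do rewrite mulr_sumr.
rewrite exchange_big /=; apply: eq_bigr => m _.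
rewrite -l_Rinv rmorph_sum mulr_suml; apply: eq_bigr => k _.
by rewrite rmorphM mulrA.
Qed.

(** As [l] is adjoint, [(l . Y)' = l . (e z N + e^2 E) Y]. Inserting [Y = Phi + e z Psi + rem] and
    integrating gives the three integrals; the rest is one order smaller. *)
Lemma ap_jump (L : R) a (j : 'I_4) : ap L X (2 + (j < 2)%N) (fun e z _ =>
  (\sum_i (l a i X)%:C%C * Y e z j i X - \sum_i (l a i 0)%:C%C * Y e z j i 0)
  - (e%:C%C * z * (prim (bil N a (Phi j)) X)%:C%C
     + (e%:C%C * z) ^+ 2 * (prim (bil N a (Psi j)) X)%:C%C
     + ((e ^+ 2)%:C)%C * (prim (bil E a (Phi j)) X)%:C%C)).
Proof.
pose g e z x : C := \sum_i (l a i x)%:C%C * Y e z j i x -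
  (e%:C%C * z * (prim (bil N a (Phi j)) x)%:C%C
     + (e%:C%C * z) ^+ 2 * (prim (bil N a (Psi j)) x)%:C%C
     + ((e ^+ 2)%:C)%C * (prim (bil E a (Phi j)) x)%:C%C).
(* Derivative of the error [g]: every term contains [rem], or the product of [e^2] with
   [e z Psi]. *)
pose dg e z x : C := \sum_i \sum_k ((l a i x)%:C%C *
    (e%:C%C * z * (N i k x)%:C%C + ((e ^+ 2)%:C)%C * (E i k x)%:C%C)) * rem j k e z x
  + ((e ^+ 2)%:C)%C * (e%:C%C * z) * \sum_i \sum_k (l a i x)%:C%C * (E i k x)%:C%C * (Psi j k x)%:C%C.
have [p0 dp] := primP (@cbil N a (Phi j) cN (@cPhi j)).
have [q0 dq] := primP (@cbil N a (Psi j) cN (@cPsi j)).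
have [r0 dr] := primP (@cbil E a (Phi j) cE (@cPhi j)).
have bilC P w x : ((bil P a w x)%:C)%C = \sum_i \sum_k (l a i x)%:C%C * (P i k x)%:C%C * (w k x)%:C%C.
  rewrite /bil rmorph_sum; apply: eq_bigr => i _; rewrite rmorph_sum.
  by apply: eq_bigr => k _; rewrite !rmorphM.
have dgE e z x : cder x (g e z) (dg e z x).
  have h1 := cderD (cderD (cder_scale (e%:C%C * z) (cder_real (dp x)))
    (cder_scale ((e%:C%C * z) ^+ 2) (cder_real (dq x))))
    (cder_scale (((e ^+ 2)%:C)%C) (cder_real (dr x))).
  have h2 := cder_sum (index_enum 'I_4) (fun i => cderM (cder_real (dl a i x)) (solY e z j i x)).
  apply: cder_eq (cderB h2 h1) _; rewrite /dg !bilC.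
  rewrite big_split /=.
  have -> : \sum_i ((- (\sum_k l a k x * M k i x))%:C)%C * Y e z j i x =
      - \sum_i \sum_k (l a i x)%:C%C * (M i k x)%:C%C * Y e z j k x.
    rewrite exchange_big /= -sumrN; apply: eq_bigr => i _.
    rewrite rmorphN mulNr rmorph_sum mulr_suml; congr (- _).
    by apply: eq_bigr => k _; rewrite rmorphM.
  rewrite !mulr_sumr -sumrN -!big_split -sumrB /=; apply: eq_bigr => i _.
  rewrite !mulr_sumr -sumrN -!big_split -sumrB /=; apply: eq_bigr => k _.
  by rewrite /sys /rem; ring.
have aN i k : ap L X 0 (fun _ _ x => (N i k x)%:C%C) by exact: ap_real.
have aE i k : ap L X 0 (fun _ _ x => (E i k x)%:C%C) by exact: ap_real.
have al i : ap L X 0 (fun _ _ x => (l a i x)%:C%C) by exact: ap_real.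
have aG k : ap L X 0 (fun _ _ x => (Psi j k x)%:C%C) by exact: ap_real.
have aez : ap L X 1 (fun e z _ => e%:C%C * z) by apply: apM (ap_e L X) (ap_l L X).
have adg : ap L X (2 + (j < 2)%N) dg.
  apply: apD.
    apply: ap_sum => i; apply: ap_sum => k.
    apply: (@apM R L X 1 (1 + (j < 2)%N)); last exact: ap_rem.
    apply: apMl => //; apply: apD.
      exact: (@apM R L X 1 0).
    by apply: (@apM R L X 1 0) => //; apply: ap_weaken (ap_eps L X 2).
  case j2 : (j < 2)%N.
    apply: (@apM R L X 3 0); first by apply: (@apM R L X 2 1) => //; exact: ap_eps.
    by apply: ap_sum => i; apply: ap_sum => k; apply: apMl => //; exact: apMl.
  apply: ap_eq (ap0 L X _) => e z x *.
  rewrite big1 ?mulr0 // => i _; rewrite big1 // => k _.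
  by rewrite Psi_high ?rmorph0 ?mulr0 // leqNgt j2.
have [c c0 hc] := adg; exists (2 * X * c); first by rewrite !mulr_ge0 // ltW.
move=> e z x e0 e1 hz hx; rewrite -[leRHS]mulrA.
have := @cder_mean R (g e z) (dg e z) X (c * e ^+ (2 + (j < 2)%N)) X0 (fun x _ => dgE e z x).
have hG : forall x, 0 <= x <= X -> cabs (dg e z x) <= c * e ^+ (2 + (j < 2)%N).
  by move=> y /andP[y0 yX]; apply: hc => //; rewrite ger0_norm.
move=> /(_ hG); rewrite /g p0 q0 r0 rmorph0 !mulr0 !addr0 subr0.
by rewrite addrAC.
Qed.

(* Subtracting multiples of the first rows removes the terms of order [e ^ 2] in
   the lower left block of [init_mx]. *)
Definition rowop (D : 'I_4 -> 'I_4 -> C) e z (i j : 'I_4) : C :=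
  D i j + e%:C%C * z * M0%:C%C *
    (if i == 2%N :> nat then D 1 j else if i == 3%N :> nat then D 0 j else 0).

Lemma rowop_top D e z (i j : 'I_4) : (i < 2)%N -> rowop D e z i j = D i j.
Proof. by move=> i2; rewrite /rowop !ltn_eqF ?(ltnW i2) ?mulr0 ?addr0 // (leq_trans i2). Qed.

(** The weight is a row weight plus a column weight, so that the division amounts to invertible
    diagonal matrices on both sides. The additional factor [e] in [unit_mx] is that of the
    multiplier [1 + e s]. *)
Definition mono_mx e z : 'M[C]_4 := \matrix_(i, j)
  (((e ^+ wt i j)^-1%:C)%C * rowop (top_mx e z) e z i j).

Definition unit_mx e z : 'M[C]_4 := \matrix_(i, j)
  (((e ^+ wt i j)^-1%:C)%C * (e%:C%C * rowop (init_mx e z) e z i j)).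

Lemma rshift_row (i : 'I_4) : (2 <= i)%N -> exists a : 'I_2, i = (2 + a)%N :> nat.
Proof.
move=> i2; have h : (i - 2 < 2)%N by rewrite ltn_subLR // ltn_ord.
by exists (Ordinal h); rewrite /= subnKC.
Qed.

(** The row operation adds [e z M0] times row [1 - a], whose leading entries are [Xp] or [xi]; it
    produces the boundary terms [M0 * Xp] and [M0 * xi] of [Sig]. *)
Lemma ap_mono_bottom (L : R) (a : 'I_2) (i b j : 'I_4) (sh : R) :
  i = (2 + a)%N :> nat -> b = (1 - a)%N :> nat ->
  Sig i j = prim (bil N a (par j)) X + M0 * sh ->
  xi j * (b == 0)%:R + Xp j * (b == 1)%:R = sh ->
  Sgy i j = (if (j < 2)%N then prim (bil E a (Phi j)) X else 0) ->
  ap L X (2 + (j < 2)%N) (fun e z _ =>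
   top_mx e z i j + e%:C%C * z * M0%:C%C * top_mx e z b j
   - ((e ^+ (1 + (j < 2)%N))%:C)%C * (z ^+ (1 + (j < 2)%N) * (Sig i j)%:C%C + (Sgy i j)%:C%C)).
Proof.
move=> ia ba sE shE syE.
have h1 := ap_jump L a j; have h2 := ap_top L b j.
have aez : ap L X 1 (fun e z _ => e%:C%C * z) by apply: apM (ap_e L X) (ap_l L X).
have h3 : ap L X (2 + (j < 2)%N) (fun e z _ => e%:C%C * z * M0%:C%C * (top_mx e z b j -
  (e%:C%C * z) ^+ (j < 2)%N * ((xi j * (b == 0)%:R + Xp j * (b == 1)%:R)%:C)%C)).
  apply: (@apM R L X 1 (1 + (j < 2)%N)) => //.
  by apply: (@apM R L X 1 0) => //; exact: ap_cst.
have h12 := apD h1 h3.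
have e2 (e : R) : ((e ^+ 2)%:C)%C = e%:C%C ^+ 2 by rewrite rmorphXn.
have e1 (e : R) : ((e ^+ 1)%:C)%C = e%:C%C by rewrite expr1.
move: h12 sE syE; rewrite /par; case j2 : (j < 2)%N => h12 sE syE.
  apply: ap_eq h12 => e z x _ _ _ _; rewrite (bottom_mxE e z j ia) NPhi0 // sE syE shE e2.
  by rewrite rmorphD rmorphM /= rmorph0; ring.
have h4 : ap L X 2 (fun e z _ => (e%:C%C * z) ^+ 2 * (prim (bil N a (Psi j)) X)%:C%C
     + ((e ^+ 2)%:C)%C * (prim (bil E a (Phi j)) X)%:C%C).
  apply: apD; apply: (@apM R L X 2 0); rewrite ?ap_eps //; try exact: ap_cst.
    by apply: (@apM R L X 1 1).
  exact: ap_eps.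
apply: ap_eq (apD h12 h4) => e z x _ _ _ _; rewrite (bottom_mxE e z j ia) sE syE shE e1.
by rewrite rmorphD rmorphM /= rmorph0; ring.
Qed.

Lemma ap_mono (L : R) (i j : 'I_4) : ap L X (wt i j).+1 (fun e z _ =>
  rowop (top_mx e z) e z i j - ((e ^+ wt i j)%:C)%C * lim_mx z i j).
Proof.
have lE z : lim_mx z i j = z ^+ wt i j * (Sig i j)%:C%C + (Sgy i j)%:C%C by rewrite mxE.
case: (leqP 2 i) => i2; last first.
  have w : wt i j = (j < 2)%N by rewrite /wt leqNgt i2.
  have s0 : Sgy i j = 0 by rewrite /Sgy leqNgt i2.
  have sE : Sig i j = xi j * (i == 0)%:R + Xp j * (i == 1)%:R.
    rewrite /Sig; case: i i2 {lE w s0} => -[|[|//]] p _ /=.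
      by rewrite mulr1 mulr0 addr0.
    by rewrite mulr0 mulr1 add0r.
  rewrite w; apply: ap_eq (ap_top L i j) => e z x *.
  rewrite lE w s0 sE rmorph0 addr0 rowop_top //.
  by rewrite exprMn rmorphXn /= mulrA.
have [a ia] := rshift_row i2.
have w : wt i j = (1 + (j < 2))%N by rewrite /wt i2.
rewrite w -[(1 + _).+1]/(2 + (j < 2))%N.
case: (ord2P a) ia => -> ia.
  have ii : i = 2%N :> nat by rewrite ia.
  have h := @ap_mono_bottom L 0 i 1 j (Xp j) ia.
  have hh : ap L X (2 + (j < 2)%N) (fun e z _ =>
   top_mx e z i j + e%:C%C * z * M0%:C%C * top_mx e z 1 j
   - ((e ^+ (1 + (j < 2)%N))%:C)%C * (z ^+ (1 + (j < 2)%N) * (Sig i j)%:C%C + (Sgy i j)%:C%C)).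
    apply: h => //.
    - by rewrite /Sig -!val_eqE /= ii.
    - by rewrite mulr0 mulr1 add0r.
    - by rewrite /Sgy ii.
  by apply: ap_eq hh => e z x *; rewrite lE w /rowop ii eqxx.
have ii : i = 3%N :> nat by rewrite ia.
have h := @ap_mono_bottom L 1 i 0 j (xi j) ia.
have hh : ap L X (2 + (j < 2)%N) (fun e z _ =>
   top_mx e z i j + e%:C%C * z * M0%:C%C * top_mx e z 0 j
   - ((e ^+ (1 + (j < 2)%N))%:C)%C * (z ^+ (1 + (j < 2)%N) * (Sig i j)%:C%C + (Sgy i j)%:C%C)).
  apply: h => //.
  - by rewrite /Sig -!val_eqE /= ii.
  - by rewrite mulr0 mulr1 addr0.
  - by rewrite /Sgy ii.
by apply: ap_eq hh => e z x *; rewrite lE w /rowop ii.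
Qed.

(** By [lPsi] the unwanted entries in the lower left block of [e init_mx] are [- e^2 z M0]. They
    cancel against [e z M0] times the diagonal entry [e] of the row that is added. *)
Lemma ap_unit (L : R) (i j : 'I_4) : ap L X (wt i j).+1 (fun e z _ =>
  e%:C%C * rowop (init_mx e z) e z i j - ((e ^+ wt i j)%:C)%C * (i == j)%:R).
Proof.
have aez : ap L X 1 (fun e z _ => e%:C%C * z) by apply: apM (ap_e L X) (ap_l L X).
have hlow k : \sum_m B k m * Psi j m 0 = 0 \/ (j < 2)%N.
  case: (ltnP j 2) => j2; [by right | left].
  by apply: big1 => m _; rewrite Psi_high // mulr0.
have hbot (a : 'I_2) : i = (2 + a)%N :> nat ->
    \sum_m B i m * Psi j m 0 = - (j + a == 1)%N%:R * M0.
  by move=> ia; rewrite -lPsi; apply: eq_bigr => m _; rewrite (l_row _ ia).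
have main (a : 'I_2) (b : 'I_4) : i = (2 + a)%N :> nat -> b = (1 - a)%N :> nat ->
   ap L X (2 + (j < 2)%N) (fun e z _ => e%:C%C *
     (init_mx e z i j + e%:C%C * z * M0%:C%C * init_mx e z b j)
     - ((e ^+ (1 + (j < 2)%N))%:C)%C * (i == j)%:R).
  move=> ia ba; case j2 : (j < 2)%N.
    have nij : (i == j) = false.
      by apply/negbTE; apply: contraTneq j2 => <-; rewrite ia.
    have bj : (b == j) = (j + a == 1)%N.
      rewrite -val_eqE /= ba; case: (ord2P a) => ->; move: j2; case: (j) => -[|[|]] //.
    apply: (@ap_eq _ _ _ _ _ (fun e z _ => e%:C%C * ((e%:C%C * z) * (e%:C%C * z)) *
       ((M0 * \sum_m B b m * Psi j m 0)%:C)%C)).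
      move=> e z x *; rewrite !init_mxE nij bj (hbot a ia) rmorphM rmorphN rmorph_nat /=.
      by rewrite rmorphM; ring.
    apply: (@apM R L X 3 0); last exact: ap_cst.
    by apply: (@apM R L X 1 2); [exact: ap_e | apply: (@apM R L X 1 1)].
  have nbj : (b == j) = false.
    apply/negbTE; apply: contraFneq j2 => <-; rewrite ba; by case: (ord2P a) => ->.
  apply: ap_eq (ap0 L X _) => e z x *.
  have z0 k : \sum_m B k m * Psi j m 0 = 0 by case: (hlow k) => //; rewrite j2.
  by rewrite !init_mxE nbj !z0 rmorph0 /= addn0 expr1; ring.
case: (leqP 2 i) => i2; last first.
  have w : wt i j = (j < 2)%N by rewrite /wt leqNgt i2.
  rewrite w; case j2 : (j < 2)%N.
    apply: (@ap_eq _ _ _ _ _ (fun e z _ => e%:C%C * (e%:C%C * z) * ((\sum_m B i m * Psi j m 0)%:C)%C)).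
      move=> e z x *; rewrite rowop_top // init_mxE expr1; ring.
    apply: (@apM R L X 2 0); last exact: ap_cst.
    by apply: (@apM R L X 1 1) => //; exact: ap_e.
  have nij : (i == j) = false by apply/negbTE; apply: contraFneq j2 => <-.
  apply: ap_eq (ap0 L X _) => e z x *.
  have z0 : \sum_m B i m * Psi j m 0 = 0 by case: (hlow i) => //; rewrite j2.
  by rewrite rowop_top // init_mxE z0 nij rmorph0 /=; ring.
have [a ia] := rshift_row i2.
have w : wt i j = (1 + (j < 2))%N by rewrite /wt i2.
rewrite w -[(1 + _).+1]/(2 + (j < 2))%N.
case: (ord2P a) ia => -> ia.
  have ii : i = 2%N :> nat by rewrite ia.
  by apply: ap_eq (main 0 1 ia erefl) => e z x *; rewrite /rowop ii.
have ii : i = 3%N :> nat by rewrite ia.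
by apply: ap_eq (main 1 0 ia erefl) => e z x *; rewrite /rowop ii.
Qed.

Lemma ap_Y (L : R) (j i : 'I_4) : ap L X 0 (fun e z x => Y e z j i x).
Proof.
apply: (@ap_eq _ _ _ _ _ (fun e z x => (Phi j i x)%:C%C + e%:C%C * z * (Psi j i x)%:C%C
  + rem j i e z x)) => [e z x *|]; first exact: Y_rem.
apply: apD; last exact: ap_weaken (ap_rem L j i).
apply: apD; first exact: ap_real.
apply: apMl; last exact: ap_real.
by apply: (@apM R L X 0 0); [exact: ap_weaken (ap_e L X) | exact: ap_l].
Qed.

(** The difference of the solutions for [z] and [z'] solves the system for [z] with forcing
    [e (z - z') N Y], to which the energy estimate applies. *)
Lemma lip_Y (L e : R) j i x : 0 < e -> e <= 1 -> `|x| <= X -> lip L (fun z => Y e z j i x).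
Proof.
move=> e0 e1 hx.
have [K K0 hK'] := ap_uniform (ap_sys L).
have [Z Z0 hZ] := ap_uniform (ap_Y L j).
have hK i' k z t : cabs z <= L -> `|t| <= X -> cabs (sys e z i' k t) <= K.
  by move=> hz ht; have := hK' (i', k) e z t e0 e1 hz ht; rewrite expr0 mulr1.
have [B0 B00 hB0] := ap_uniform (fun p : 'I_4 * 'I_4 => @ap_real R L X _ (@cN p.1 p.2)).
have [P P0 hP] := ap_uniform (fun k : 'I_4 => @ap_real R L X _ (@cPsi j k)).
exists (ode_const 'I_4 K X * (P + \sum_(k < 4) B0 * Z)).
  rewrite mulr_ge0 ?addr_ge0 //; first by rewrite /ode_const !mulr_ge0 // expR_ge0.
  by apply: sumr_ge0 => k _; rewrite mulr_ge0.
move=> z z' hz hz'; rewrite -mulrA mulrDl.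
have ez : cabs (e%:C%C * (z - z')) <= cabs (z - z').
  by rewrite cabsM cabs_real (gtr0_norm e0) ler_piMl // cabs_ge0.
apply: (@complex_ode_bound R 'I_4 (sys e z) (fun i t => Y e z j i t - Y e z' j i t)
  (fun i t => \sum_k e%:C%C * (z - z') * (N i k t)%:C%C * Y e z' j k t)) => //.
- by rewrite mulr_ge0 ?cabs_ge0 // sumr_ge0 // => k _; rewrite mulr_ge0.
- by rewrite mulr_ge0 ?cabs_ge0.
- move=> i' t; apply: cder_eq (cderB (solY e z j i' t) (solY e z' j i' t)) _.
  rewrite -sumrB -big_split /=; apply: eq_bigr => k _; rewrite /sys; ring.
- by move=> i' k t ht; exact: hK.
- move=> i' t ht; apply: le_trans (cabs_sum _ _) _; rewrite mulr_suml; apply: ler_sum => k _.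
  rewrite [leRHS]mulrC mulrA !cabsM; apply: ler_pM; rewrite ?mulr_ge0 ?cabs_ge0 //.
    apply: ler_pM; rewrite -?cabsM ?cabs_ge0 //.
    by have := hB0 (i', k) e z t e0 e1 hz ht; rewrite expr0 mulr1.
  by have := hZ k e z' t e0 e1 hz' ht; rewrite expr0 mulr1.
move=> i'; rewrite !Y0; have -> : (Phi j i' 0)%:C%C + e%:C%C * z * (Psi j i' 0)%:C%C -
  ((Phi j i' 0)%:C%C + e%:C%C * z' * (Psi j i' 0)%:C%C) = (Psi j i' 0)%:C%C * (e%:C%C * (z - z')).
  by ring.
rewrite cabsM; apply: ler_pM; rewrite ?cabs_ge0 //.
by have := hP i' e z 0 e0 e1 hz; rewrite normr0 expr0 mulr1; apply; exact: ltW.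
Qed.

Lemma lip_rowop (L e : R) (D : C -> 'I_4 -> 'I_4 -> C) i j : (forall i j, lip L (fun z => D z i j)) ->
  lip L (fun z => rowop (D z) e z i j).
Proof.
move=> hD; apply: lipD => //; apply: lipM.
  by apply: lipM; [apply: lipM; [exact: lip_cst | exact: lip_id] | exact: lip_cst].
by case: (i == 2%N :> nat) => //; case: (i == 3%N :> nat) => //; exact: lip_cst.
Qed.

Lemma lip_mono (L e : R) (i j : 'I_4) : 0 < e -> e <= 1 -> lip L (fun z => mono_mx e z i j).
Proof.
move=> e0 e1; apply: (@lip_eq _ _ _ (fun z => ((e ^+ wt i j)^-1%:C)%C * rowop (top_mx e z) e z i j)).
  by move=> z; rewrite mxE.
apply: lipM; first exact: lip_cst.
apply: lip_rowop => {}i {}j; apply: lip_sum => k; apply: lipM; first exact: lip_cst.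
apply: lipB; last by apply: lip_Y => //; rewrite normr0 ltW.
apply: lip_sum => m; apply: lipM; first exact: lip_cst.
by apply: lip_Y => //; rewrite gtr0_norm.
Qed.

Lemma lip_unit (L e : R) (i j : 'I_4) : 0 < e -> e <= 1 -> lip L (fun z => unit_mx e z i j).
Proof.
move=> e0 e1; apply: (@lip_eq _ _ _ (fun z => ((e ^+ wt i j)^-1%:C)%C *
    (e%:C%C * rowop (init_mx e z) e z i j))).
  by move=> z; rewrite mxE.
apply: lipM; first exact: lip_cst.
apply: lipM; first exact: lip_cst.
apply: lip_rowop => {}i {}j; apply: lip_sum => k; apply: lipM; first exact: lip_cst.
by apply: lip_Y => //; rewrite normr0 ltW.
Qed.

Lemma scaled_bound (c e : R) (n : nat) (x y : C) : 0 < e ->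
  cabs (x - ((e ^+ n)%:C)%C * y) <= c * e ^+ n.+1 ->
  cabs (((e ^+ n)^-1%:C)%C * x - y) <= c * e.
Proof.
move=> e0 h; have en : 0 < e ^+ n by exact: exprn_gt0.
have -> : ((e ^+ n)^-1%:C)%C * x - y = ((e ^+ n)^-1%:C)%C * (x - ((e ^+ n)%:C)%C * y).
  rewrite mulrBr mulrA -rmorphM /= mulVf ?lt0r_neq0 // rmorph1; ring.
rewrite cabsM cabs_real ger0_norm ?invr_ge0 ?(ltW en) // ler_pdivrMl //.
by rewrite mulrCA -exprSr.
Qed.

Lemma mono_close (L : R) : exists2 c : R, 0 <= c & forall e z i j, 0 < e -> e <= 1 ->
  cabs z <= L -> cabs (mono_mx e z i j - lim_mx z i j) <= c * e.
Proof.
have h (p : 'I_4 * 'I_4) : exists c : R, 0 <= c /\ forall e z, 0 < e -> e <= 1 ->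
    cabs z <= L -> cabs (mono_mx e z p.1 p.2 - lim_mx z p.1 p.2) <= c * e.
  have [c c0 hc] := ap_mono L p.1 p.2; exists c; split => // e z e0 e1 hz.
  rewrite mxE; apply: scaled_bound => //; apply: (hc e z 0) => //.
  by rewrite normr0 ltW.
have [c hc] := choice h; exists (\sum_p c p); first by apply: sumr_ge0 => p _; case: (hc p).
move=> e z i j e0 e1 hz; apply: le_trans ((hc (i, j)).2 e z e0 e1 hz) _.
rewrite ler_pM2r // (bigD1 (i, j)) //= lerDl; apply: sumr_ge0 => p _; by case: (hc p).
Qed.

Lemma unit_close (L : R) : exists2 c : R, 0 <= c & forall e z i j, 0 < e -> e <= 1 ->
  cabs z <= L -> cabs (unit_mx e z i j - (i == j)%:R) <= c * e.
Proof.
have h (p : 'I_4 * 'I_4) : exists c : R, 0 <= c /\ forall e z, 0 < e -> e <= 1 ->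
    cabs z <= L -> cabs (unit_mx e z p.1 p.2 - (p.1 == p.2)%:R) <= c * e.
  have [c c0 hc] := ap_unit L p.1 p.2; exists c; split => // e z e0 e1 hz.
  rewrite mxE; apply: scaled_bound => //; apply: (hc e z 0) => //.
  by rewrite normr0 ltW.
have [c hc] := choice h; exists (\sum_p c p); first by apply: sumr_ge0 => p _; case: (hc p).
move=> e z i j e0 e1 hz; apply: le_trans ((hc (i, j)).2 e z e0 e1 hz) _.
rewrite ler_pM2r // (bigD1 (i, j)) //= lerDl; apply: sumr_ge0 => p _; by case: (hc p).
Qed.

Lemma rowop_sum (D : 'I_4 -> 'I_4 -> C) e z (al : 'I_4 -> C) :
  (forall i, \sum_j rowop D e z i j * al j = 0) -> forall i, \sum_j D i j * al j = 0.
Proof.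
move=> h; have top (i : 'I_4) : (i < 2)%N -> \sum_j D i j * al j = 0.
  by move=> i2; rewrite -[RHS](h i); apply: eq_bigr => j _; rewrite rowop_top.
move=> i; case: (ltnP i 2) => i2; first exact: top.
have := h i; rewrite /rowop; under eq_bigr do rewrite mulrDl.
rewrite big_split /=; have -> // : \sum_j e%:C%C * z * M0%:C%C *
    (if i == 2%N :> nat then D 1 j else if i == 3%N :> nat then D 0 j else 0) * al j = 0.
  under eq_bigr do rewrite -mulrA; rewrite -mulr_sumr.
  suff -> : \sum_j (if i == 2%N :> nat then D 1 j else if i == 3%N :> nat then D 0 j else 0) * al j = 0.
    by rewrite mulr0.
  case: (i == 2%N :> nat); first exact: top.
  by case: (i == 3%N :> nat); [exact: top | apply: big1 => j _; rewrite mul0r].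
by rewrite addr0.
Qed.

(** Undoing the scalings turns a kernel vector into the coefficients of a solution; invertibility of
    [unit_mx] prevents this solution from being 0. *)
Lemma floquet_solution e z s : 0 < e -> \det (mono_mx e z - s *: unit_mx e z) = 0 ->
  \det (unit_mx e z) != 0 ->
  exists y, [/\ is_sol e z y, exists i, y i 0 != 0 &
    forall i, y i X = (1 + e%:C%C * s) * \sum_k (Rot i k)%:C%C * y k 0].
Proof.
move=> e0 /eqP; rewrite -det_tr => /det0P[v v0 hv] du.
pose al (j : 'I_4) : C := ((e ^+ (j < 2)%N)^-1%:C)%C * v 0 j.
have eC n : ((e ^+ n)%:C)%C != 0 :> C.
  by apply/eqP => /(congr1 (@complex.Re R)) /= /eqP; rewrite expf_eq0 gt_eqF // andbF.
have wtE (i j : 'I_4) : ((e ^+ wt i j)^-1%:C)%C = ((e ^+ (2 <= i)%N)^-1%:C)%C * ((e ^+ (j < 2)%N)^-1%:C)%C :> C.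
  by rewrite /wt exprD invfM rmorphM.
have unscale (F : 'I_4 -> 'I_4 -> C) (i : 'I_4) :
    \sum_j ((e ^+ wt i j)^-1%:C)%C * F i j * v 0 j = ((e ^+ (2 <= i)%N)^-1%:C)%C * \sum_j F i j * al j.
  rewrite mulr_sumr; apply: eq_bigr => j _; rewrite wtE /al; ring.
have cancel (w : C) (i : 'I_4) : ((e ^+ (2 <= i)%N)^-1%:C)%C * w = 0 -> w = 0.
  move=> /eqP; rewrite mulf_eq0 => /orP[/eqP h|/eqP //].
  by have := eC (2 <= i)%N; rewrite -invr_eq0 -fmorphV /= h eqxx.
pose y i x := \sum_j al j * Y e z j i x.
have soly : is_sol e z y.
  move=> i x; have h := cder_sum (index_enum 'I_4) (fun j => cder_scale (al j) (solY e z j i x)).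
  apply: cder_eq h _; rewrite /y.
  under [RHS]eq_bigr do rewrite mulr_sumr.
  rewrite [RHS]exchange_big /=; apply: eq_bigr => j _; rewrite mulr_sumr.
  by apply: eq_bigr => k _; rewrite mulrCA.
have topy i : \sum_j top_mx e z i j * al j =
    \sum_k (B i k)%:C%C * (\sum_m (Rinv k m)%:C%C * y m X - y k 0).
  rewrite /top_mx; under eq_bigr do rewrite mulr_suml.
  rewrite exchange_big /=; apply: eq_bigr => k _.
  under eq_bigr do rewrite -mulrA; rewrite -mulr_sumr; congr (_ * _).
  under [LHS]eq_bigr do rewrite mulrBl.
  rewrite sumrB; congr (_ - _); last first.
    by rewrite /y; apply: eq_bigr => j _; rewrite mulrC.
  under [LHS]eq_bigr do rewrite mulr_suml.
  rewrite exchange_big /=; apply: eq_bigr => m _; rewrite /y mulr_sumr.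
  by apply: eq_bigr => j _; ring.
have inity i : \sum_j init_mx e z i j * al j = \sum_k (B i k)%:C%C * y k 0.
  rewrite /init_mx; under eq_bigr do rewrite mulr_suml.
  rewrite exchange_big /=; apply: eq_bigr => k _; rewrite /y mulr_sumr.
  by apply: eq_bigr => j _; ring.
have Binv (w : 'I_4 -> C) : (forall i, \sum_k (B i k)%:C%C * w k = 0) -> forall k, w k = 0.
  move=> h k; have := sum_assoc (fun j => (Phi j k 0)%:C%C) (fun j i => (B j i)%:C%C) w.
  rewrite big1 => [|j _]; last by rewrite h mulr0.
  move=> /esym; rewrite (eq_bigr (fun i => (i == k)%:R * w i)) ?sum_delta // => i _.
  congr (_ * _); rewrite (realsum (fun j => Phi j k 0) (fun j => B j i)) KB eq_sym.
  by rewrite rmorph_nat.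
exists y; split => //.
(* If [y] vanished at 0, [unit_mx] would annihilate the kernel vector as well. *)
- apply: contrapT => hn.
  have y00 k : y k 0 = 0 by apply: contrapT => h; apply: hn; exists k; apply/eqP.
  have z0 i : \sum_j init_mx e z i j * al j = 0.
    by rewrite inity big1 // => k _; rewrite y00 mulr0.
  have r0 i : \sum_j rowop (init_mx e z) e z i j * al j = 0.
    rewrite /rowop; under eq_bigr do rewrite mulrDl; rewrite big_split /= z0 add0r.
    under eq_bigr do rewrite -mulrA; rewrite -mulr_sumr.
    case: (i == 2%N :> nat); first by rewrite z0 mulr0.
    case: (i == 3%N :> nat); first by rewrite z0 mulr0.
    by rewrite big1 ?mulr0 // => j _; rewrite mul0r.
  have ker : v *m (unit_mx e z)^T = 0.
    apply/rowP => i; rewrite mxE [RHS]mxE.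
    transitivity (\sum_j ((e ^+ wt i j)^-1%:C)%C * (e%:C%C * rowop (init_mx e z) e z i j) * v 0 j).
      by apply: eq_bigr => j _; rewrite !mxE mulrC.
    rewrite (unscale (fun i j => e%:C%C * rowop (init_mx e z) e z i j)).
    under eq_bigr do rewrite -mulrA; by rewrite -mulr_sumr r0 !mulr0.
  have : unit_mx e z \in unitmx by rewrite unitmxE unitfE.
  rewrite -unitmx_tr => ut; have h := mulmxK ut v.
  by rewrite ker mul0mx in h; rewrite -h eqxx in v0.
(* The row operation acts on both matrices alike, hence can be removed afterwards by [rowop_sum]. *)
have key i : \sum_j rowop (fun i j => top_mx e z i j - s * e%:C%C * init_mx e z i j) e z i j * al j = 0.
  apply: (cancel _ i).
  rewrite -(unscale (fun i j => rowop (fun i j => top_mx e z i j - s * e%:C%C * init_mx e z i j) e z i j)).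
  transitivity ((v *m (mono_mx e z - s *: unit_mx e z)^T) 0 i); last by rewrite hv mxE.
  rewrite [RHS]mxE.
  apply: eq_bigr => j _; rewrite !mxE /rowop.
  by case: ifP => _; [|case: ifP => _]; ring.
have := rowop_sum key => h i.
have {}h k : \sum_m (Rinv k m)%:C%C * y m X - y k 0 - s * e%:C%C * y k 0 = 0.
  move: k; apply: Binv => i'; rewrite -[RHS](h i').
  under [RHS]eq_bigr do rewrite mulrBl -[_ * _ * al _]mulrA.
  rewrite sumrB -mulr_sumr topy inity mulr_sumr -sumrB; apply: eq_bigr => k _; ring.
have hk k : \sum_m (Rinv k m)%:C%C * y m X = (1 + e%:C%C * s) * y k 0.
  by apply/eqP; rewrite -subr_eq0; apply/eqP; rewrite -[RHS](h k); ring.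
transitivity (\sum_k (Rot i k)%:C%C * (\sum_m (Rinv k m)%:C%C * y m X)); last first.
  by rewrite mulr_sumr; apply: eq_bigr => k _; rewrite hk; ring.
rewrite (sum_assoc (fun k => (Rot i k)%:C%C) (fun k m => (Rinv k m)%:C%C)).
rewrite (eq_bigr (fun m => (m == i)%:R * y m X)) ?sum_delta // => m _; congr (_ * _).
by rewrite (realsum (fun k => Rot i k) (fun k => Rinv k m)) RotK eq_sym rmorph_nat.
Qed.

End Columns.
End Monodromy.

(** * The limit determinant and the coefficients of [Delta0] *)

Section LimitPolynomial.
Context {R : realType}.
Local Notation C := R[i].
Variables (S T : 'M[R]_4) (delta : nat -> nat -> nat -> R).
Hypothesis deltaP : Delta0_coefficients S T delta.
Hypothesis T_block : forall i j : 'I_4, ~~ ((2 <= i)%N && (j < 2)%N) -> T i j = 0.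

(** A diagonal conjugate of [z S + T / z]. Because [T] is concentrated in the lower left block the
    conjugate is polynomial in [z], and [z = 0] is allowed. *)
Definition scaled_limit (z : C) : 'M[C]_4 := \matrix_(i, j)
  (z ^+ wt i j * (S i j)%:C%C + (T i j)%:C%C).

Let poly_mx : 'M[{poly R}]_4 := \matrix_(i, j) ('X ^+ wt i j * (S i j)%:P + (T i j)%:P).

Lemma poly_eq0_off0 (p : {poly R}) : (forall x, x != 0 -> p.[x] = 0) -> p = 0.
Proof.
move=> h; apply: (@roots_geq_poly_eq0 _ p [seq k.+1%:R | k <- iota 0 (size p)]).
- by apply/allP => x /mapP[k _ ->]; rewrite /root h // pnatr_eq0.
- rewrite map_inj_uniq ?iota_uniq // => a b /eqP.
  by rewrite eqr_nat eqSS => /eqP.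
- by rewrite size_map size_iota.
Qed.

Let real_mx (x : R) : 'M[R]_4 := \matrix_(i, j) (x ^+ wt i j * S i j + T i j).

(** Rows of index at least 2 are multiplied by [x] and the columns of the same index divided by it:
    the determinant and the multiples of the identity do not change, while [x S + T / x] becomes
    [x^wt S + T]. *)
Lemma real_limit_det x s : x != 0 -> \det (real_mx x - s *: 1%:M) = Delta0 S T x s 1.
Proof.
move=> x0; rewrite /Delta0 expr1n.
set M := x *: S - _ + _.
pose d1 : 'rV[R]_4 := \row_i x ^+ (2 <= i)%N.
pose d2 : 'rV[R]_4 := \row_i x ^- (2 <= i)%N.
have -> : real_mx x - s *: 1%:M = diag_mx d1 *m (M *m diag_mx d2).
  rewrite mul_mx_diag mul_diag_mx; apply/matrixP => i j; rewrite !mxE /wt.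
  have -> : T i j = (2 <= i)%N%:R * (j < 2)%N%:R * T i j.
    case: (boolP ((2 <= i)%N && (j < 2)%N)) => [/andP[-> ->]|h]; first by rewrite !mul1r.
    by rewrite T_block // mulr0.
  have ij : (i == j)%:R = (i == j)%:R * ((2 <= i)%N == (2 <= j)%N)%:R :> R.
    by case: eqVneq => [->|]; rewrite ?eqxx ?mulr1 ?mul0r.
  rewrite -[s *+ (i == j)]mulr_natr; move: ij.
  have -> : (j < 2)%N = ~~ (2 <= j)%N by rewrite ltnNge.
  move: ((i == j)%:R : R) (S i j) (T i j) (2 <= i)%N (2 <= j)%N => u a b p q.
  case: p; case: q; rewrite /= ?mulr1n ?mulr0n ?mulr0 => hu;
    rewrite ?addn0 ?add0n ?expr0 ?expr1 ?invr1; try (by field); rewrite hu; by field.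
rewrite !det_mulmx !det_diag mulrCA -big_split /= big1 ?mulr1 // => i _.
by rewrite !mxE mulfV // expf_neq0.
Qed.

Definition limit_coef (k : nat) : {poly R} :=
  \sum_(m < 5) \sum_(q < 5 | (m + k + q == 4)%N && (q <= m)%N) (delta m k q)%:P * 'X^(m - q).

Lemma pencil_real_coef x k : x != 0 -> (k < 5)%N ->
  (pencil (real_mx x) 1%:M)`_k = (limit_coef k).[x].
Proof.
move=> x0 k5.
suff -> : pencil (real_mx x) 1%:M = \poly_(k < 5) (limit_coef k).[x] by rewrite coef_poly k5.
apply/eqP; rewrite -subr_eq0; apply/eqP; apply: poly_eq0_off0 => s _.
have hz : (pencil (real_mx x) 1%:M).[s] = Delta0 S T x s 1.
  rewrite -real_limit_det // /pencil -horner_evalE -det_map_mx; congr (\det _).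
  by apply/matrixP => i j; rewrite !mxE /= horner_evalE !hornerE.
rewrite hornerD hornerN hz (deltaP s 1 x0) horner_poly; apply/eqP; rewrite subr_eq0; apply/eqP.
rewrite exchange_big /=; apply: eq_bigr => k' _; rewrite /limit_coef horner_sum mulr_suml.
apply: eq_bigr => m _; rewrite horner_sum mulr_suml; apply: eq_bigr => q _.
by rewrite expr1n mulr1 hornerM hornerC hornerXn.
Qed.

(** The coefficients of [Delta0] are defined by an identity for real arguments with [lambda != 0].
    Both sides being polynomial, it holds in the polynomial ring, where complex values can be
    substituted. *)
Lemma pencil_limit_coef z k : (k < 5)%N ->
  (pencil (scaled_limit z) 1%:M)`_k = (map_poly (real_complex R) (limit_coef k)).[z].
Proof.
move=> k5.
have h : (pencil poly_mx 1%:M)`_k = limit_coef k.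
  apply/eqP; rewrite -subr_eq0; apply/eqP; apply: poly_eq0_off0 => x x0.
  rewrite hornerD hornerN -(pencil_real_coef x0 k5); apply/eqP; rewrite subr_eq0; apply/eqP.
  rewrite -horner_evalE -coef_map -pencil_map; congr ((pencil _ _)`_k).
    by apply/matrixP => i j; rewrite !mxE /= horner_evalE !hornerE.
  by rewrite map_mx1.
rewrite -h -horner_evalE.
pose f := horner_eval z \o map_poly (real_complex R).
have -> : horner_eval z (map_poly (real_complex R) (pencil poly_mx 1%:M)`_k) =
  (map_poly f (pencil poly_mx 1%:M))`_k by rewrite coef_map.
rewrite -pencil_map; congr ((pencil _ _)`_k).
  apply/matrixP => i j; rewrite !mxE /= /f /= horner_evalE.
  by rewrite rmorphD rmorphM rmorphXn /= map_polyX !map_polyC !hornerE.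
by rewrite map_mx1.
Qed.

Lemma map_monomial (c : R) n (z : C) :
  (map_poly (real_complex R) (c%:P * 'X^n)).[z] = c%:C%C * z ^+ n.
Proof. by rewrite mul_polyC map_polyZ map_polyXn hornerZ hornerXn. Qed.

Lemma pencil_limit0 z : (pencil (scaled_limit z) 1%:M)`_0 =
  (delta 4 0 0)%:C%C * z ^+ 4 + (delta 3 0 1)%:C%C * z ^+ 2 + (delta 2 0 2)%:C%C.
Proof.
rewrite pencil_limit_coef // /limit_coef.
have -> : \sum_(m < 5) \sum_(q < 5 | (m + 0 + q == 4)%N && (q <= m)%N) (delta m 0%N q)%:P * 'X^(m - q)
  = (delta 4 0 0)%:P * 'X^4 + (delta 3 0 1)%:P * 'X^2 + (delta 2 0 2)%:P.
  under eq_bigr do rewrite big_mkcond.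
  by rewrite !big_ord_recl !big_ord0 /= /bump /= !addr0 !add0r expr0; ring.
by rewrite !rmorphD /= !hornerD !map_monomial map_polyC hornerC.
Qed.

Lemma pencil_limit1 z : (pencil (scaled_limit z) 1%:M)`_1 =
  (delta 3 1 0)%:C%C * z ^+ 3 + (delta 2 1 1)%:C%C * z.
Proof.
rewrite pencil_limit_coef // /limit_coef.
have -> : \sum_(m < 5) \sum_(q < 5 | (m + 1 + q == 4)%N && (q <= m)%N) (delta m 1%N q)%:P * 'X^(m - q)
  = (delta 3 1 0)%:P * 'X^3 + (delta 2 1 1)%:P * 'X^1.
  under eq_bigr do rewrite big_mkcond.
  by rewrite !big_ord_recl !big_ord0 /= /bump /= !addr0 !add0r expr1; ring.
by rewrite !rmorphD /= !hornerD !map_monomial expr1.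
Qed.

End LimitPolynomial.

(** * A unimodular multiplier at an unstable spectral parameter *)

Section UnstableMode.
Context {R : realType}.
Local Notation C := R[i].
Variables (S T : 'M[R]_4) (delta : nat -> nat -> nat -> R).
Hypothesis deltaP : Delta0_coefficients S T delta.
Hypothesis T_block : forall i j : 'I_4, ~~ ((2 <= i)%N && (j < 2)%N) -> T i j = 0.
Hypothesis d400 : delta 4 0 0 != 0.
Hypothesis discr : delta 3 0 1 ^+ 2 = 4 * delta 4 0 0 * delta 2 0 2.
Hypothesis nondeg : delta 2 1 1 * delta 4 0 0 - 2^-1 * delta 3 1 0 * delta 3 0 1 != 0.
Variables (Mo Un : R -> C -> 'M[C]_4).
Hypothesis Mo_close : forall L : R, exists2 c : R, 0 <= c & forall e z i j, 0 < e -> e <= 1 ->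
  cabs z <= L -> cabs (Mo e z i j - scaled_limit S T z i j) <= c * e.
Hypothesis Un_close : forall L : R, exists2 c : R, 0 <= c & forall e z i j, 0 < e -> e <= 1 ->
  cabs z <= L -> cabs (Un e z i j - (i == j)%:R) <= c * e.
Hypothesis Mo_lip : forall (L e : R) i j, 0 < e -> e <= 1 -> lip L (fun z => Mo e z i j).
Hypothesis Un_lip : forall (L e : R) i j, 0 < e -> e <= 1 -> lip L (fun z => Un e z i j).

Lemma lip_uniform (I : finType) (L : R) (F : I -> C -> C) : (forall i, lip L (F i)) ->
  exists2 c : R, 0 <= c & forall i z z', cabs z <= L -> cabs z' <= L ->
    cabs (F i z - F i z') <= c * cabs (z - z').
Proof.
move=> h; have h' i : exists c : R, 0 <= c /\ forall z z', cabs z <= L -> cabs z' <= L ->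
    cabs (F i z - F i z') <= c * cabs (z - z').
  by have [c c0 hc] := h i; exists c.
have [c hc] := choice h'; exists (\sum_i c i); first by apply: sumr_ge0 => i _; case: (hc i).
move=> i z z' hz hz'; apply: le_trans ((hc i).2 z z' hz hz') _.
rewrite ler_wpM2r ?cabs_ge0 // (bigD1 i) //= lerDl; apply: sumr_ge0 => j _; by case: (hc j).
Qed.

Lemma lip_bounded_uniform (I : finType) (L : R) (F : I -> C -> C) : (forall i, lip L (F i)) ->
  exists2 b : R, 0 <= b & forall i z, cabs z <= L -> cabs (F i z) <= b.
Proof.
move=> h; have h' i : exists b : R, 0 <= b /\ forall z, cabs z <= L -> cabs (F i z) <= b.
  by have [b b0 hb] := lip_bounded (h i); exists b.
have [b hb] := choice h'; exists (\sum_i b i); first by apply: sumr_ge0 => i _; case: (hb i).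
move=> i z hz; apply: le_trans ((hb i).2 z hz) _.
by rewrite (bigD1 i) //= lerDl; apply: sumr_ge0 => j _; case: (hb j).
Qed.

Let lim_lip (L : R) (p : 'I_4 * 'I_4) : lip L (fun z => scaled_limit S T z p.1 p.2).
Proof.
apply: (@lip_eq _ _ _ (fun z => z ^+ wt p.1 p.2 * (S p.1 p.2)%:C%C + (T p.1 p.2)%:C%C)).
  by move=> z; rewrite mxE.
apply: lipD; last exact: lip_cst.
apply: lipM; last exact: lip_cst.
elim: (wt _ _) => [|k IH]; first by apply: lip_eq (lip_cst L 1) => z; rewrite expr0.
by apply: lip_eq (lipM (lip_id L) IH) => z; rewrite exprS.
Qed.

Let nat_bool_le1 (b : bool) : cabs (b%:R : C) <= 1.
Proof. by case: b; rewrite ?cabs1 ?cabs0. Qed.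

Let entries_bounded (L : R) : exists2 K : R, 1 <= K & forall e z i j, 0 < e -> e <= 1 ->
  cabs z <= L -> [/\ cabs (scaled_limit S T z i j) <= K, cabs (Mo e z i j) <= K
    & cabs (Un e z i j) <= K].
Proof.
have [b b0 hb] := lip_bounded_uniform (lim_lip L).
have [c c0 hc] := Mo_close L; have [c' c'0 hc'] := Un_close L.
exists (1 + b + c + c'); first by rewrite -!addrA lerDl !addr_ge0.
move=> e z i j e0 e1 hz.
have h1 := hb (i, j) z hz; have h2 := hc e z i j e0 e1 hz; have h3 := hc' e z i j e0 e1 hz.
have ce : c * e <= c by rewrite ler_piMr.
have ce' : c' * e <= c' by rewrite ler_piMr.
have h4 := nat_bool_le1 (i == j).
have h5 : cabs (Mo e z i j) <= cabs (Mo e z i j - scaled_limit S T z i j) + cabs (scaled_limit S T z i j).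
  by rewrite -[Mo e z i j in leLHS](subrK (scaled_limit S T z i j)); exact: cabsD.
have h6 : cabs (Un e z i j) <= cabs (Un e z i j - (i == j)%:R) + cabs ((i == j)%:R : C).
  by rewrite -[Un e z i j in leLHS](subrK ((i == j)%:R : C)); exact: cabsD.
move: h1 h2 h3 h4 h5 h6 => /=.
move: (cabs _) (cabs _) (cabs _) (cabs _) (cabs _) (cabs _) => u1 u2 u3 u4 u5 u6 h1 h2 h3 h4 h5 h6.
by split; lra.
Qed.

Theorem unstable_mode : forall e0 : R, 0 < e0 -> exists e z s,
  [/\ 0 < e < e0, 0 < complex.Re z, \det (Mo e z - s *: Un e z) = 0,
      \det (Un e z) != 0 & cabs (1 + e%:C%C * s) = 1].
Proof.
pose a := delta 3 0 1 / (2 * delta 4 0 0).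
(* The linear coefficient divided by [z], at [z^2 = - a]; the nondegeneracy hypothesis is
   [N * delta 4 0 0 != 0]. *)
pose N := delta 2 1 1 - a * delta 3 1 0.
pose p z k := (pencil (scaled_limit S T z) 1%:M)`_k.
pose Q e z := pencil (Mo e z) (Un e z).
have n2 : (2 : R) != 0 by rewrite pnatr_eq0.
have N0 : N != 0.
  apply: contraNneq nondeg => h; apply/eqP.
  transitivity (N * delta 4 0 0); last by rewrite h mul0r.
  by rewrite /N /a; field.
have d202 : delta 2 0 2 = delta 4 0 0 * a ^+ 2.
  apply: (@mulfI _ (4 * delta 4 0 0)); first by rewrite mulf_neq0 // pnatr_eq0.
  by rewrite -discr /a; field.
have d301 : delta 3 0 1 = 2 * a * delta 4 0 0 by rewrite /a; field.
have bp L : exists K : R, forall l k, cabs l <= L -> cabs (p l k) <= K.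
  have [K K1 hK] := entries_bounded L; have [c c0 hc] := pencil_perturb K1.
  have K0 : 0 <= K by apply: le_trans K1.
  exists (c * K) => z k hz.
  (* A coefficient is bounded by comparison with the zero pencil. *)
  have -> : p z k = (pencil (scaled_limit S T z) 1%:M)`_k - (pencil (0 : 'M[C]_4) 0)`_k.
    rewrite /p [X in _ - X](_ : _ = 0) ?subr0 //.
    have -> : pencil (0 : 'M[C]_4) 0 = 0.
      rewrite /pencil (_ : \matrix_(i, j) _ = 0) ?det0 //.
      by apply/matrixP => i j; rewrite !mxE mulr0 subr0.
    by rewrite coef0.
  have e01 : (0 : R) < 1 by [].
  have h0 : cabs (0 : C) <= K by rewrite cabs0.
  have h1 i j : cabs ((1%:M : 'M[C]_4) i j) <= K.
    by rewrite mxE; exact: le_trans (nat_bool_le1 _) K1.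
  have z0 (i j : 'I_4) : (0 : 'M[C]_4) i j = 0 by rewrite mxE.
  by apply: hc => // i j; rewrite ?z0 ?subr0 //; have [] := hK 1 z i j e01 (lexx _) hz.
have cQ L : exists c : R, forall e l k, 0 < e -> e <= 1 -> cabs l <= L ->
    cabs ((Q e l)`_k - p l k) <= c * e.
  have [K K1 hK] := entries_bounded L; have [c c0 hc] := pencil_perturb K1.
  have [d d0 hd] := Mo_close L; have [d' d'0 hd'] := Un_close L.
  exists (c * (d + d')) => e z k e0 e1 hz; rewrite -mulrA.
  apply: hc; first by rewrite mulr_ge0 ?addr_ge0 // ltW.
  - by move=> i j; have [] := hK e z i j e0 e1 hz.
  - by move=> i j; have [] := hK e z i j e0 e1 hz.
  - by move=> i j; have [] := hK e z i j e0 e1 hz.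
  - by move=> i j; rewrite mxE; exact: le_trans (nat_bool_le1 _) K1.
  - move=> i j; apply: le_trans (hd e z i j e0 e1 hz) _.
    by rewrite ler_pM2r // lerDl.
  - move=> i j; rewrite [1%:M i j]mxE; apply: le_trans (hd' e z i j e0 e1 hz) _.
    by rewrite ler_pM2r // lerDr.
have lQ (L e : R) : 0 < e -> e <= 1 -> exists M : R, forall l l' k,
    cabs l <= L -> cabs l' <= L -> cabs ((Q e l)`_k - (Q e l')`_k) <= M * cabs (l - l').
  move=> e0 e1.
  have [K K1 hK] := entries_bounded L; have [c c0 hc] := pencil_perturb K1.
  have [d d0 hd] := lip_uniform (fun q : 'I_4 * 'I_4 => Mo_lip L q.1 q.2 e0 e1).
  have [d' d'0 hd'] := lip_uniform (fun q : 'I_4 * 'I_4 => Un_lip L q.1 q.2 e0 e1).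
  exists (c * (d + d')) => z z' k hz hz'; rewrite -mulrA.
  apply: hc; first by rewrite mulr_ge0 ?addr_ge0 // cabs_ge0.
  - by move=> i j; have [] := hK e z i j e0 e1 hz.
  - by move=> i j; have [] := hK e z i j e0 e1 hz.
  - by move=> i j; have [] := hK e z' i j e0 e1 hz'.
  - by move=> i j; have [] := hK e z' i j e0 e1 hz'.
  - move=> i j; apply: le_trans (hd (i, j) z z' hz hz') _.
    by rewrite ler_wpM2r ?cabs_ge0 // lerDl.
  - move=> i j; apply: le_trans (hd' (i, j) z z' hz hz') _.
    by rewrite ler_wpM2r ?cabs_ge0 // lerDr.
have p0E z : p z 0%N = (delta 4 0 0)%:C%C * (z ^+ 2 + a%:C%C) ^+ 2.
  rewrite /p (pencil_limit0 deltaP T_block) d202 d301 !rmorphM /= rmorph_nat; ring.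
have p1E z : p z 1%N = z * (N%:C%C + (delta 3 1 0)%:C%C * (z ^+ 2 + a%:C%C)).
  rewrite /p (pencil_limit1 deltaP T_block) /N rmorphB rmorphM /=; ring.
have [L HL] := unstable_crossing bp (fun e l => pencil_size _ _) cQ lQ d400 N0 p0E p1E.
have [K K1 hK] := entries_bounded L; have [d d0 hd] := Un_close L.
pose c := #|{perm 'I_4}|%:R * (4%:R * K ^+ 4) * d.
have K4 : 0 <= K ^+ 4 by rewrite exprn_ge0 // (le_trans _ K1).
have c0 : 0 <= c by rewrite /c mulr_ge0 // mulr_ge0 // mulr_ge0.
move=> e0 e00.
(* The third bound on [e] keeps [Un], at distance of order [e] from the identity, invertible. *)
have m0 : 0 < Num.min e0 (Num.min 1 (c + 1)^-1).
  by rewrite !lt_min e00 ltr01 invr_gt0 ltr_wpDl.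
have [e [z [s [/andP[ee]]]]] := HL _ m0.
rewrite !lt_min => /andP[ee0 /andP[e1 ec]] [rz zL] Qs s1.
exists e, z, s; split => //; first by rewrite ee.
  by rewrite -pencil_horner.
apply/eqP => du.
have H : cabs (\det (Un e z) - \det (1%:M : 'M[C]_4)) <= #|{perm 'I_4}|%:R * (4%:R * K ^+ 4) * (d * e).
  apply: (@det_perturb R _ (@cabs R) (@cabs_ge0 R) (@cabsD R)) => //.
  - by move=> x y; rewrite cabsM.
  - exact: cabsN.
  - exact: cabs0.
  - by rewrite cabs1.
  - by rewrite mulr_ge0 // ltW.
  - by move=> i j; have [] := hK e z i j ee (ltW e1) zL.
  - by move=> i j; rewrite mxE; exact: le_trans (nat_bool_le1 _) K1.
  - by move=> i j; rewrite [1%:M i j]mxE; apply: hd => //; exact: ltW.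
move: H; rewrite du det1 sub0r cabsN cabs1 mulrA -/c => H.
have c1 : 0 < c + 1 by rewrite ltr_wpDl.
have : e * (c + 1) < 1 by rewrite -ltr_pdivlMr // div1r.
by rewrite mulrDr mulr1 mulrC => H2; have := ltW ee; lra.
Qed.

End UnstableMode.

(** * The profile and its linearized equation *)

Ltac cont := lazymatch goal with
  | |- continuous (fun x => (@?f x + @?g x)%R) => apply: contD; cont
  | |- continuous (fun x => (@?f x * @?g x)%R) => apply: contM; cont
  | |- continuous (fun x => (- @?f x)%R) => apply: contN; cont
  | _ => first [assumption | exact: cont_cst]
  end.

Lemma is_derive_unique (R : realType) (V : normedModType R) (f : V -> R) (x v : V) (a b : R) :
  is_derive x v f a -> is_derive x v f b -> a = b.
Proof. by move=> ha hb; rewrite -(@derive_val _ _ _ _ _ _ _ ha) (@derive_val _ _ _ _ _ _ _ hb). Qed.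

Lemma prim_eq (R : realType) (f F : R -> R) (X : R) : 0 < X -> continuous f ->
  (forall x : R, is_derive x 1 F (f x)) -> prim f X = F X - F 0.
Proof.
move=> X0 cf dF; have [p0 dp] := primP cf.
by rewrite -(period_integral_prim X0 cf dF) (period_integral_prim X0 cf dp) p0 subr0.
Qed.

(** * Rotation equivariance of the linearized operator *)

Section Rotation.
Context {R : realType}.
Variables (k k1 k2 W1 W2 : R -> R) (om c co si : R).
Hypothesis cs : co * co + si * si = 1.

Definition rot (i : 'I_2) (a0 a1 : R) : R := sel i (co * a0 + si * a1) (co * a1 - si * a0).

Definition lvec (u0 u1 p0 p1 q0 q1 w0 w1 r0 r1 t0 t1 : R) (i : 'I_2) : R :=
  lform k k1 k2 W1 W2 om c u0 u1 p0 p1 (sel i u0 u1) (sel i p0 p1) (sel i q0 q1)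
    w0 w1 r0 r1 (sel i w0 w1) (sel i r0 r1) (sel i t0 t1) (sel i r1 (- r0)).

(** The coefficients depend on the vectors through inner products, which rotations preserve; the
    rest is linear in the vectors, and [J] commutes with rotations. *)
Lemma lvec_rot u0 u1 p0 p1 q0 q1 w0 w1 r0 r1 t0 t1 i :
  lvec (rot 0 u0 u1) (rot 1 u0 u1) (rot 0 p0 p1) (rot 1 p0 p1) (rot 0 q0 q1) (rot 1 q0 q1)
    (rot 0 w0 w1) (rot 1 w0 w1) (rot 0 r0 r1) (rot 1 r0 r1) (rot 0 t0 t1) (rot 1 t0 t1) i =
  rot i (lvec u0 u1 p0 p1 q0 q1 w0 w1 r0 r1 t0 t1 0) (lvec u0 u1 p0 p1 q0 q1 w0 w1 r0 r1 t0 t1 1).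
Proof.
have inv a0 a1 b0 b1 : (co * a0 + si * a1) * (co * b0 + si * b1)
    + (co * a1 - si * a0) * (co * b1 - si * b0) = a0 * b0 + a1 * b1.
  by rewrite -[RHS]mul1r -cs; ring.
have inv4 a0 a1 b0 b1 d0 d1 f0 f1 : (co * a0 + si * a1) * (co * b0 + si * b1)
    + (co * a1 - si * a0) * (co * b1 - si * b0) + (co * d0 + si * d1) * (co * f0 + si * f1)
    + (co * d1 - si * d0) * (co * f1 - si * f0) = a0 * b0 + a1 * b1 + d0 * f0 + d1 * f1.
  by rewrite inv -addrA inv addrA.
by case: (ord2P i) => ->; rewrite /lvec /rot /lform /sel /= !inv4 !inv; ring.
Qed.

End Rotation.

Section Profile.
Context {R : realType}.
Variables (k k1 k2 W W1 W2 : R -> R) (om c : R).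
Hypothesis dk : forall s : R, is_derive s 1 k (k1 s).
Hypothesis dk1 : forall s : R, is_derive s 1 k1 (k2 s).
Hypothesis dW : forall s : R, is_derive s 1 W (W1 s).
Hypothesis dW1 : forall s : R, is_derive s 1 W1 (W2 s).
Hypothesis ck2 : continuous k2.
Hypothesis cW2 : continuous W2.

(* [u], [p], [q] are the profile and its first two derivatives. *)
Variables (u0 u1 p0 p1 q0 q1 h0 h1 : R -> R).
Hypothesis du0 : forall x : R, is_derive x 1 u0 (p0 x).
Hypothesis du1 : forall x : R, is_derive x 1 u1 (p1 x).
Hypothesis dp0 : forall x : R, is_derive x 1 p0 (q0 x).
Hypothesis dp1 : forall x : R, is_derive x 1 p1 (q1 x).
Hypothesis dq0 : forall x : R, is_derive x 1 q0 (h0 x).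
Hypothesis dq1 : forall x : R, is_derive x 1 q1 (h1 x).

Definition msq x := u0 x * u0 x + u1 x * u1 x.
Local Notation s := msq.

Hypothesis k_gt0 : forall x, 0 < k (s x).

Local Notation vfm := (vform k k1 W1 om c).
Local Notation lfm := (lform k k1 k2 W1 W2 om c).

Hypothesis eq0 : forall x, vfm (u0 x) (u1 x) (p0 x) (p1 x) (u0 x) (p0 x) (q0 x) (p1 x) = 0.
Hypothesis eq1 : forall x, vfm (u0 x) (u1 x) (p0 x) (p1 x) (u1 x) (p1 x) (q1 x) (- p0 x) = 0.

(* The components of the linearized operator at [w], where [r] and [t] are the
   first and second derivatives of [w]. *)
Definition lop (i : 'I_2) x w0 w1 r0 r1 t0 t1 : R :=
  lfm (u0 x) (u1 x) (p0 x) (p1 x) (sel i (u0 x) (u1 x)) (sel i (p0 x) (p1 x)) (sel i (q0 x) (q1 x))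
    w0 w1 r0 r1 (sel i w0 w1) (sel i r0 r1) (sel i t0 t1) (sel i r1 (- r0)).

Definition ent (l : seq (seq R)) (i j : 'I_4) : R := nth 0 (nth [::] l i) j.
Definition unit_state (j m : nat) : R := (j == m)%:R.

(** The coefficient of the [j]-th component of [(w, w')], extracted by evaluation at a unit vector,
    so that the entries of the system need not be written out. *)
Definition lop0 (i : 'I_2) (j : nat) x : R :=
  lop i x (unit_state j 0) (unit_state j 1) (unit_state j 2) (unit_state j 3) 0 0.

Definition Mmx (i j : 'I_4) x : R := ent
  [:: [:: 0; 0; 1; 0]; [:: 0; 0; 0; 1];
   [:: lop0 0 0 x / k (s x); lop0 0 1 x / k (s x); lop0 0 2 x / k (s x); lop0 0 3 x / k (s x)];
   [:: lop0 1 0 x / k (s x); lop0 1 1 x / k (s x); lop0 1 2 x / k (s x); lop0 1 3 x / k (s x)]] i j.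

(** [J Hess w = lambda w] is [Hess w = - lambda J w]; solving for [w''], which occurs with the
    factor [- k], leaves [lambda J w / k]. *)
Definition Nmx (i j : 'I_4) x : R := ent
  [:: [:: 0; 0; 0; 0]; [:: 0; 0; 0; 0]; [:: 0; (k (s x))^-1; 0; 0]; [:: - (k (s x))^-1; 0; 0; 0]] i j.

(** At transverse wave number [e] the Laplacian adds [k e^2 w], and the factor [k] is divided out
    with that of the second derivative. *)
Definition Emx (i j : 'I_4) (x : R) : R := ent
  [:: [:: 0; 0; 0; 0]; [:: 0; 0; 0; 0]; [:: 1; 0; 0; 0]; [:: 0; 1; 0; 0]] i j.

(* The linearizations of the two constants of integration. *)
Definition lfun (a : 'I_2) (j : 'I_4) x : R :=
  let K := k (s x) in let K1 := k1 (s x) in let A := u1 x * p0 x - u0 x * p1 x in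
  let P := p0 x * p0 x + p1 x * p1 x in
  nth 0 (nth [::]
  [:: [:: 2 * K1 * u0 x * A - K * p1 x + c * u0 x; 2 * K1 * u1 x * A + K * p0 x + c * u1 x;
          K * u1 x; - (K * u0 x)];
      [:: K1 * u0 x * P - 2 * W1 (s x) * u0 x + om * u0 x;
          K1 * u1 x * P - 2 * W1 (s x) * u1 x + om * u1 x; K * p0 x; K * p1 x]] a) j.

Lemma k_neq0 x : k (s x) != 0. Proof. exact: lt0r_neq0. Qed.

Lemma ds (x : R) : is_derive x 1 s (2 * (u0 x * p0 x + u1 x * p1 x)).
Proof. by rewrite /msq; have := du0; have := du1 => *; der_ring. Qed.

Lemma dks (x : R) : is_derive x 1 (fun x => k (s x)) (k1 (s x) * (2 * (u0 x * p0 x + u1 x * p1 x))).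
Proof. by apply: der_comp; exact: ds. Qed.

Lemma dk1s (x : R) : is_derive x 1 (fun x => k1 (s x)) (k2 (s x) * (2 * (u0 x * p0 x + u1 x * p1 x))).
Proof. by apply: der_comp; exact: ds. Qed.

Lemma dW1s (x : R) : is_derive x 1 (fun x => W1 (s x)) (W2 (s x) * (2 * (u0 x * p0 x + u1 x * p1 x))).
Proof. by apply: der_comp; exact: ds. Qed.

Lemma q0E x : q0 x = (k1 (s x) * (p0 x * p0 x + p1 x * p1 x) * u0 x + 2 * W1 (s x) * u0 x
  - om * u0 x - c * p1 x - 2 * k1 (s x) * (u0 x * p0 x + u1 x * p1 x) * p0 x) / k (s x).
Proof.
have := eq0 x; rewrite /vform /= -/(s x) => h; apply: (mulIf (k_neq0 x)); rewrite divfK ?k_neq0 //.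
by rewrite -[RHS]subr0 -h; ring.
Qed.

Lemma q1E x : q1 x = (k1 (s x) * (p0 x * p0 x + p1 x * p1 x) * u1 x + 2 * W1 (s x) * u1 x
  - om * u1 x + c * p0 x - 2 * k1 (s x) * (u0 x * p0 x + u1 x * p1 x) * p1 x) / k (s x).
Proof.
have := eq1 x; rewrite /vform /= -/(s x) => h; apply: (mulIf (k_neq0 x)); rewrite divfK ?k_neq0 //.
by rewrite -[RHS]subr0 -h; ring.
Qed.

Lemma lop_lin (i : 'I_2) x w0 w1 r0 r1 t0 t1 : lop i x w0 w1 r0 r1 t0 t1 =
  lop0 i 0 x * w0 + lop0 i 1 x * w1 + lop0 i 2 x * r0 + lop0 i 3 x * r1 - k (s x) * sel i t0 t1.
Proof.
rewrite /lop0 /unit_state /= ?mulr1n ?mulr0n /lop /lform /=.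
by case: (ord2P i) => -> /=; rewrite /sel /= -/(s x); ring.
Qed.

(** Rotation invariance: at [J u] the linearized operator returns, up to sign, the other component
    of the profile equation. *)
Lemma lop_rotation x : lop 0 x (u1 x) (- u0 x) (p1 x) (- p0 x) (q1 x) (- q0 x) = 0.
Proof.
rewrite /lop /lform /sel /= -/(s x).
have := eq1 x; rewrite /vform /= -/(s x) => h.
by rewrite -[RHS]h; ring.
Qed.

Lemma lop_rotation1 x : lop 1 x (u1 x) (- u0 x) (p1 x) (- p0 x) (q1 x) (- q0 x) = 0.
Proof.
rewrite /lop /lform /sel /= -/(s x).
have := eq0 x; rewrite /vform /= -/(s x) => h.
by rewrite -[RHS]oppr0 -[in RHS]h; ring.
Qed.

(** This is the profile equation differentiated in [x]. *)
Lemma lop_translation (i : 'I_2) x : lop i x (p0 x) (p1 x) (q0 x) (q1 x) (h0 x) (h1 x) = 0.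
Proof.
have dsel f0 f1 (a b : R) : is_derive x 1 f0 a -> is_derive x 1 f1 b ->
    is_derive x 1 (fun x => sel i (f0 x) (f1 x)) (sel i a b).
  by rewrite /sel; case: (i == 0).
have h := der_vform om c dk dk1 dW1 (du0 x) (du1 x) (dp0 x) (dp1 x) (dsel _ _ _ _ (du0 x) (du1 x))
  (dsel _ _ _ _ (dp0 x) (dp1 x)) (dsel _ _ _ _ (dq0 x) (dq1 x)) (dsel _ _ _ _ (dp1 x) (derN (dp0 x))).
have e0 : is_derive x 1 (fun t => vfm (u0 t) (u1 t) (p0 t) (p1 t) (sel i (u0 t) (u1 t))
    (sel i (p0 t) (p1 t)) (sel i (q0 t) (q1 t)) (sel i (p1 t) (- p0 t))) 0.
  apply: (@is_derive_ext _ R _ (fun=> 0)) => t.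
  by case: (ord2P i) => ->; rewrite /sel /=; [exact: eq0 | exact: eq1].
exact: is_derive_unique h e0.
Qed.

(** The linearization of a first integral of the profile equation is constant along the linearized
    flow. Once the second derivatives are eliminated by the profile equation, this is a rational
    identity. *)
Lemma dlfun a j (x : R) : is_derive x 1 (lfun a j) (- \sum_i lfun a i x * Mmx i j x).
Proof.
have d1 := du0; have d2 := du1; have d3 := dp0; have d4 := dp1.
have d5 := dks; have d6 := dk1s; have d7 := dW1s.
have kn := k_neq0 x.
case: a => -[|[|//]] ha; case: j => -[|[|[|[|//]]]] hj;
  rewrite !big_ord_recl big_ord0 /Mmx /ent /lfun /=; der_eq;
  rewrite /lop0 /lop /lform /unit_state /sel /= ?mulr1n ?mulr0n -/(s x) (q0E x) (q1E x);
  move: (k (s x)) (k1 (s x)) (k2 (s x)) (W1 (s x)) (W2 (s x)) (u0 x) (u1 x) (p0 x) (p1 x) kn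
    => K K1 K2 B1 B2 U0 U1 P0 P1 kn; by field.
Qed.

Definition stt (w0 w1 r0 r1 : R -> R) (i : 'I_4) x : R := nth 0 [:: w0 x; w1 x; r0 x; r1 x] i.

Lemma stt_derive (w0 w1 r0 r1 t0 t1 g0 g1 : R -> R) (i : 'I_4) (x : R) :
  is_derive x 1 w0 (r0 x) -> is_derive x 1 w1 (r1 x) ->
  is_derive x 1 r0 (t0 x) -> is_derive x 1 r1 (t1 x) ->
  lop 0 x (w0 x) (w1 x) (r0 x) (r1 x) (t0 x) (t1 x) = g0 x ->
  lop 1 x (w0 x) (w1 x) (r0 x) (r1 x) (t0 x) (t1 x) = g1 x ->
  is_derive x 1 (stt w0 w1 r0 r1 i) (\sum_m Mmx i m x * stt w0 w1 r0 r1 m x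
    - nth 0 [:: 0; 0; g0 x / k (s x); g1 x / k (s x)] i).
Proof.
move=> dw0 dw1 dr0 dr1; rewrite !lop_lin /sel /= => e0 e1.
have kn := k_neq0 x.
case: i => -[|[|[|[|//]]]] hi; rewrite !big_ord_recl big_ord0 /Mmx /ent /stt /=.
- by apply: is_derive_eq dw0 _; ring.
- by apply: is_derive_eq dw1 _; ring.
- by apply: is_derive_eq dr0 _; rewrite -e0; field.
- by apply: is_derive_eq dr1 _; rewrite -e1; field.
Qed.

Definition rot_state := stt u1 (fun x => - u0 x) p1 (fun x => - p0 x).
(** The sign is chosen so that the parameter derivatives close up with [+ Xp] times this mode, as in
    [par_stateX]. *)
Definition tra_state := stt (fun x => - p0 x) (fun x => - p1 x) (fun x => - q0 x) (fun x => - q1 x).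

Lemma rot_state_derive i (x : R) :
  is_derive x 1 (rot_state i) (\sum_m Mmx i m x * rot_state m x).
Proof.
have h := stt_derive (t0 := q1) (t1 := fun x => - q0 x) (g0 := fun=> 0) (g1 := fun=> 0) i (du1 x) (derN (du0 x)) (dp1 x) (derN (dp0 x))
  (lop_rotation x) (lop_rotation1 x).
apply: is_derive_eq h _; rewrite [X in _ - X](_ : _ = 0) ?subr0 //.
by rewrite mul0r; case: i => -[|[|[|[|//]]]].
Qed.

Lemma lop_opp (i : 'I_2) x w0 w1 r0 r1 t0 t1 :
  lop i x (- w0) (- w1) (- r0) (- r1) (- t0) (- t1) = - lop i x w0 w1 r0 r1 t0 t1.
Proof. by rewrite !lop_lin; case: (ord2P i) => -> /=; rewrite /sel /=; ring. Qed.

Lemma tra_state_derive i (x : R) :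
  is_derive x 1 (tra_state i) (\sum_m Mmx i m x * tra_state m x).
Proof.
have e (i' : 'I_2) : lop i' x (- p0 x) (- p1 x) (- q0 x) (- q1 x) (- h0 x) (- h1 x) = 0.
  by rewrite lop_opp lop_translation oppr0.
have h := stt_derive (t0 := fun x => - h0 x) (t1 := fun x => - h1 x) (g0 := fun=> 0) (g1 := fun=> 0) i
  (derN (dp0 x)) (derN (dp1 x)) (derN (dq0 x)) (derN (dq1 x)) (e 0) (e 1).
apply: is_derive_eq h _; rewrite [X in _ - X](_ : _ = 0) ?subr0 //.
by rewrite mul0r; case: i => -[|[|[|[|//]]]].
Qed.

(** Pairing the linearized constants with [N] yields the differential of the mass density for
    [a = 0] and, up to an exact derivative, that of the momentum density for [a = 1]: this is how
    the last two rows of [Sigma_t] arise. *)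
Lemma bilN0 (w : 'I_4 -> R -> R) x : bil lfun Nmx 0 w x = u0 x * w 0 x + u1 x * w 1 x.
Proof.
have kn := k_neq0 x; rewrite /bil !big_ord_recl !big_ord0 /Nmx /ent /lfun /=.
have -> : lift ord0 ord0 = 1 :> 'I_4 by exact/val_inj.
have -> : (ord0 : 'I_4) = 0 by exact/val_inj.
by move: (w _ x) (w _ x) (w _ x) (w _ x) => a b d e; field.
Qed.

Lemma bilN1 (w : 'I_4 -> R -> R) x : bil lfun Nmx 1 w x = p0 x * w 1 x - p1 x * w 0 x.
Proof.
have kn := k_neq0 x; rewrite /bil !big_ord_recl !big_ord0 /Nmx /ent /lfun /=.
have -> : lift ord0 ord0 = 1 :> 'I_4 by exact/val_inj.
have -> : (ord0 : 'I_4) = 0 by exact/val_inj.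
by move: (w _ x) (w _ x) (w _ x) (w _ x) => a b d e; field.
Qed.

(** On the symmetry modes these pairings are, up to sign, the integrands of the coefficients of
    [Sigma_y]. *)
Lemma bilE0 (w : 'I_4 -> R -> R) x : bil lfun Emx 0 w x = k (s x) * (u1 x * w 0 x - u0 x * w 1 x).
Proof.
rewrite /bil !big_ord_recl !big_ord0 /Emx /ent /lfun /=.
have -> : lift ord0 ord0 = 1 :> 'I_4 by exact/val_inj.
have -> : (ord0 : 'I_4) = 0 by exact/val_inj.
by move: (w _ x) (w _ x) (w _ x) (w _ x) => a b d e; ring.
Qed.

Lemma bilE1 (w : 'I_4 -> R -> R) x : bil lfun Emx 1 w x = k (s x) * (p0 x * w 0 x + p1 x * w 1 x).
Proof.
rewrite /bil !big_ord_recl !big_ord0 /Emx /ent /lfun /=.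
have -> : lift ord0 ord0 = 1 :> 'I_4 by exact/val_inj.
have -> : (ord0 : 'I_4) = 0 by exact/val_inj.
by move: (w _ x) (w _ x) (w _ x) (w _ x) => a b d e; ring.
Qed.

Lemma lfun0E (w0 w1 r0 r1 : R -> R) x : \sum_i lfun 0 i x * stt w0 w1 r0 r1 i x =
  2 * k1 (s x) * (u0 x * w0 x + u1 x * w1 x) * (u1 x * p0 x - u0 x * p1 x)
  + k (s x) * (w1 x * p0 x - w0 x * p1 x + u1 x * r0 x - u0 x * r1 x)
  + c * (u0 x * w0 x + u1 x * w1 x).
Proof. by rewrite !big_ord_recl big_ord0 /lfun /stt /=; ring. Qed.

Lemma lfun1E (w0 w1 r0 r1 : R -> R) x : \sum_i lfun 1 i x * stt w0 w1 r0 r1 i x =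
  k1 (s x) * (u0 x * w0 x + u1 x * w1 x) * (p0 x * p0 x + p1 x * p1 x)
  + k (s x) * (p0 x * r0 x + p1 x * r1 x) - 2 * W1 (s x) * (u0 x * w0 x + u1 x * w1 x)
  + om * (u0 x * w0 x + u1 x * w1 x).
Proof. by rewrite !big_ord_recl big_ord0 /lfun /stt /=; ring. Qed.

Lemma lfun_rot a x : \sum_i lfun a i x * rot_state i x = 0.
Proof. by case: (ord2P a) => ->; rewrite ?lfun0E ?lfun1E; ring. Qed.

(** The constants of integration do not vary along the profile. *)
Lemma lfun_tra a x : \sum_i lfun a i x * tra_state i x = 0.
Proof.
have kn := k_neq0 x.
by case: (ord2P a) => ->; rewrite ?lfun0E ?lfun1E (q0E x) (q1E x); field.
Qed.

(** * Behaviour under a shift by one period *)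

Section Rotation.
Variables (X co si : R).
Hypothesis X0 : 0 < X.
Hypothesis cs : co * co + si * si = 1.
Hypothesis u0X : forall x, u0 (x + X) = co * u0 x + si * u1 x.
Hypothesis u1X : forall x, u1 (x + X) = co * u1 x - si * u0 x.

Lemma is_derive_translate (f : R -> R) (x a : R) : is_derive (x + X) 1 f a ->
  is_derive x 1 (fun t => f (t + X)) a.
Proof.
move=> h; have hx : is_derive x 1 (fun t : R => t + X) 1.
  by apply: is_derive_eq (derD (der_id x) (der_cst X x 1)) _; rewrite addr0.
by have := @der_comp _ _ f (fun t : R => t + X) x 1 a 1 h hx; rewrite mulr1.
Qed.

Let shift_derive (f g df dg : R -> R) (b : R) : (forall x : R, is_derive x 1 f (df x)) ->
  (forall x : R, is_derive x 1 g (dg x)) ->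
  (forall x, f (x + X) = co * f x + b * g x) -> forall x, df (x + X) = co * df x + b * dg x.
Proof.
move=> hf hg e x.
have e1 := is_derive_translate (hf (x + X)).
have e2 : is_derive x 1 (fun t => f (t + X)) (co * df x + b * dg x).
  by apply: (is_derive_ext e); der_ring.
exact: is_derive_unique e1 e2.
Qed.

Lemma p0X x : p0 (x + X) = co * p0 x + si * p1 x.
Proof. exact: shift_derive du0 du1 u0X x. Qed.

Lemma p1X x : p1 (x + X) = co * p1 x - si * p0 x.
Proof.
rewrite -mulNr; apply: (shift_derive du1 du0) => y; by rewrite u1X mulNr.
Qed.

Lemma q0X x : q0 (x + X) = co * q0 x + si * q1 x.
Proof. exact: shift_derive dp0 dp1 p0X x. Qed.

Lemma q1X x : q1 (x + X) = co * q1 x - si * q0 x.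
Proof.
rewrite -mulNr; apply: (shift_derive dp1 dp0) => y; by rewrite p1X mulNr.
Qed.

Lemma cs_mul (a : R) : (co * co + si * si) * a = a.
Proof. by rewrite cs mul1r. Qed.

Lemma sX x : s (x + X) = s x.
Proof. by rewrite /msq u0X u1X -[RHS]cs_mul; ring. Qed.

Definition Rot (i j : 'I_4) : R := ent
  [:: [:: co; si; 0; 0]; [:: - si; co; 0; 0]; [:: 0; 0; co; si]; [:: 0; 0; - si; co]] i j.
Definition Rinv (i j : 'I_4) : R := ent
  [:: [:: co; - si; 0; 0]; [:: si; co; 0; 0]; [:: 0; 0; co; - si]; [:: 0; 0; si; co]] i j.

Lemma RinvK i j : \sum_m Rinv i m * Rot m j = (i == j)%:R.
Proof.
case: i => -[|[|[|[|//]]]] hi; case: j => -[|[|[|[|//]]]] hj;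
  rewrite !big_ord_recl big_ord0 /Rot /Rinv /ent /=; first [rewrite -cs; ring | ring].
Qed.

Lemma RotK i j : \sum_m Rot i m * Rinv m j = (i == j)%:R.
Proof.
case: i => -[|[|[|[|//]]]] hi; case: j => -[|[|[|[|//]]]] hj;
  rewrite !big_ord_recl big_ord0 /Rot /Rinv /ent /=; first [rewrite -cs; ring | ring].
Qed.

Lemma Rot_sum (w : 'I_4 -> R) (i : 'I_4) : \sum_m Rot i m * w m =
  nth 0 [:: co * w 0 + si * w 1; co * w 1 - si * w 0; co * w (lift ord0 (lift ord0 ord0)) + si * w (lift ord0 (lift ord0 (lift ord0 ord0)));
     co * w (lift ord0 (lift ord0 (lift ord0 ord0))) - si * w (lift ord0 (lift ord0 ord0))] i.
Proof.
have e1 : lift ord0 ord0 = 1 :> 'I_4 by exact/val_inj.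
have e0 : (ord0 : 'I_4) = 0 by exact/val_inj.
case: i => -[|[|[|[|//]]]] hi; rewrite !big_ord_recl big_ord0 /Rot /ent /= ?e1 ?e0;
  move: (w _) (w _) (w _) (w _) => a b d e; ring.
Qed.

Lemma stt_rot (w0 w1 r0 r1 : R -> R) (y x : R) i :
  \sum_m Rot i m * stt w0 w1 r0 r1 m x =
  stt (fun _ => co * w0 x + si * w1 x) (fun _ => co * w1 x - si * w0 x)
      (fun _ => co * r0 x + si * r1 x) (fun _ => co * r1 x - si * r0 x) i y.
Proof. by rewrite (Rot_sum (fun m => stt w0 w1 r0 r1 m x)) /stt /=. Qed.

Lemma lRot a j x : \sum_i lfun a i (x + X) * Rot i j = lfun a j x.
Proof.
have hA : u1 (x + X) * p0 (x + X) - u0 (x + X) * p1 (x + X) = u1 x * p0 x - u0 x * p1 x.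
  by rewrite u0X u1X p0X p1X -[RHS]cs_mul; ring.
have hP : p0 (x + X) * p0 (x + X) + p1 (x + X) * p1 (x + X) = p0 x * p0 x + p1 x * p1 x.
  by rewrite p0X p1X -[RHS]cs_mul; ring.
case: a => -[|[|//]] ha; case: j => -[|[|[|[|//]]]] hj;
  rewrite !big_ord_recl big_ord0 /Rot /ent /lfun /= ?hA ?hP sX u0X u1X p0X p1X -[RHS]cs_mul; ring.
Qed.

Lemma lop_rot x w0 w1 r0 r1 t0 t1 :
  lop 0 (x + X) (co * w0 + si * w1) (co * w1 - si * w0) (co * r0 + si * r1) (co * r1 - si * r0)
     (co * t0 + si * t1) (co * t1 - si * t0) =
   co * lop 0 x w0 w1 r0 r1 t0 t1 + si * lop 1 x w0 w1 r0 r1 t0 t1 /\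
  lop 1 (x + X) (co * w0 + si * w1) (co * w1 - si * w0) (co * r0 + si * r1) (co * r1 - si * r0)
     (co * t0 + si * t1) (co * t1 - si * t0) =
   co * lop 1 x w0 w1 r0 r1 t0 t1 - si * lop 0 x w0 w1 r0 r1 t0 t1.
Proof.
have h := lvec_rot k k1 k2 W1 W2 om c cs (u0 x) (u1 x) (p0 x) (p1 x) (q0 x) (q1 x) w0 w1 r0 r1 t0 t1.
by rewrite /lop u0X u1X p0X p1X q0X q1X; split; [exact: (h 0) | exact: (h 1)].
Qed.

(** The coefficients repeat after a period up to conjugation by the rotation, so that a solution
    shifted by a period and rotated back is again a solution. *)
Lemma Mmx_rot i j x : \sum_m Mmx i m (x + X) * Rot m j = \sum_m Rot i m * Mmx m j x.
Proof.
have kn := k_neq0 x.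
have e (n : nat) := lop_rot x (unit_state n 0) (unit_state n 1) (unit_state n 2) (unit_state n 3) 0 0.
have lin (a b A B : R) : a = b -> A - B = (a - b) / k (s x) -> A = B.
  by move=> ->; rewrite subrr mul0r => /eqP; rewrite subr_eq0 => /eqP.
have [e00 e01] := e 0%N; have [e10 e11] := e 1%N; have [e20 e21] := e 2%N; have [e30 e31] := e 3%N.
rewrite !lop_lin sX /unit_state /sel /= ?mulr1n ?mulr0n in e00 e01 e10 e11 e20 e21 e30 e31.
case: i => -[|[|[|[|//]]]] hi; case: j => -[|[|[|[|//]]]] hj;
  rewrite !big_ord_recl !big_ord0 /Mmx /Rot /ent /= ?sX; try ring.
- by apply: (lin _ _ _ _ e00); field.
- by apply: (lin _ _ _ _ e10); field.
- by apply: (lin _ _ _ _ e20); field.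
- by apply: (lin _ _ _ _ e30); field.
- by apply: (lin _ _ _ _ e01); field.
- by apply: (lin _ _ _ _ e11); field.
- by apply: (lin _ _ _ _ e21); field.
- by apply: (lin _ _ _ _ e31); field.
Qed.

Lemma Nmx_rot i j x : \sum_m Nmx i m (x + X) * Rot m j = \sum_m Rot i m * Nmx m j x.
Proof.
by case: i => -[|[|[|[|//]]]] hi; case: j => -[|[|[|[|//]]]] hj;
  rewrite !big_ord_recl !big_ord0 /Nmx /Rot /ent /= ?sX; ring.
Qed.

Lemma Emx_rot i j x : \sum_m Emx i m (x + X) * Rot m j = \sum_m Rot i m * Emx m j x.
Proof.
by case: i => -[|[|[|[|//]]]] hi; case: j => -[|[|[|[|//]]]] hj;
  rewrite !big_ord_recl !big_ord0 /Emx /Rot /ent /=; ring.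
Qed.

Hypothesis nonconst : exists x, u0 x * p0 x + u1 x * p1 x != 0.

Lemma u0_continuous : continuous u0. Proof. by move=> x; exact: is_derive1_continuous (du0 x). Qed.
Lemma u1_continuous : continuous u1. Proof. by move=> x; exact: is_derive1_continuous (du1 x). Qed.
Lemma p0_continuous : continuous p0. Proof. by move=> x; exact: is_derive1_continuous (dp0 x). Qed.
Lemma p1_continuous : continuous p1. Proof. by move=> x; exact: is_derive1_continuous (dp1 x). Qed.
Lemma q0_continuous : continuous q0. Proof. by move=> x; exact: is_derive1_continuous (dq0 x). Qed.
Lemma q1_continuous : continuous q1. Proof. by move=> x; exact: is_derive1_continuous (dq1 x). Qed.

Lemma s_continuous : continuous s.
Proof. by move=> x; exact: is_derive1_continuous (ds x). Qed.
Lemma ks_continuous : continuous (fun x => k (s x)).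
Proof. by move=> x; exact: is_derive1_continuous (dks x). Qed.
Lemma k1s_continuous : continuous (fun x => k1 (s x)).
Proof. by move=> x; exact: is_derive1_continuous (dk1s x). Qed.
Lemma W1s_continuous : continuous (fun x => W1 (s x)).
Proof. by move=> x; exact: is_derive1_continuous (dW1s x). Qed.
Lemma k2s_continuous : continuous (fun x => k2 (s x)).
Proof. by move=> x; apply: continuous_comp; [exact: s_continuous | exact: ck2]. Qed.
Lemma W2s_continuous : continuous (fun x => W2 (s x)).
Proof. by move=> x; apply: continuous_comp; [exact: s_continuous | exact: cW2]. Qed.
Lemma kV_continuous : continuous (fun x => (k (s x))^-1).
Proof. by move=> x; apply: continuousV; [exact: k_neq0 | exact: ks_continuous]. Qed.

Lemma lop0_continuous i j : continuous (lop0 i j).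
Proof.
have cK1 := k1s_continuous; have cK2 := k2s_continuous; have cB1 := W1s_continuous.
have cB2 := W2s_continuous; have cu0 := u0_continuous; have cu1 := u1_continuous.
have cp0 := p0_continuous; have cp1 := p1_continuous; have cq0 := q0_continuous.
have cq1 := q1_continuous; have cK := ks_continuous.
by case: (ord2P i) => ->; rewrite /lop0 /lop /lform /sel /= -/msq; cont.
Qed.

Lemma Mmx_continuous i j : continuous (Mmx i j).
Proof.
case: i => -[|[|[|[|//]]]] hi; case: j => -[|[|[|[|//]]]] hj; rewrite /Mmx /ent /=;
  first [exact: cont_cst | apply: contM; [exact: lop0_continuous | exact: kV_continuous]].
Qed.

Lemma Nmx_continuous i j : continuous (Nmx i j).
Proof.
have cV := kV_continuous.
by case: i => -[|[|[|[|//]]]] hi; case: j => -[|[|[|[|//]]]] hj; rewrite /Nmx /ent /=; cont.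
Qed.

Lemma Emx_continuous i j : continuous (Emx i j).
Proof.
by case: i => -[|[|[|[|//]]]] hi; case: j => -[|[|[|[|//]]]] hj; rewrite /Emx /ent /=; cont.
Qed.

End Rotation.
End Profile.

(** * The bounded mode of the linearized equation *)

Section FloquetMode.
Context {R : realType}.
Local Notation C := R[i].
Variables (k k1 k2 W W1 W2 : R -> R) (om c : R).
Hypothesis dk : forall s : R, is_derive s 1 k (k1 s).
Hypothesis dk1 : forall s : R, is_derive s 1 k1 (k2 s).
Hypothesis dW : forall s : R, is_derive s 1 W (W1 s).
Hypothesis dW1 : forall s : R, is_derive s 1 W1 (W2 s).
Hypothesis ck2 : continuous k2.
Hypothesis cW2 : continuous W2.
Variables (u0 u1 p0 p1 q0 q1 h0 h1 : R -> R).
Hypothesis du0 : forall x : R, is_derive x 1 u0 (p0 x).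
Hypothesis du1 : forall x : R, is_derive x 1 u1 (p1 x).
Hypothesis dp0 : forall x : R, is_derive x 1 p0 (q0 x).
Hypothesis dp1 : forall x : R, is_derive x 1 p1 (q1 x).
Hypothesis dq0 : forall x : R, is_derive x 1 q0 (h0 x).
Hypothesis dq1 : forall x : R, is_derive x 1 q1 (h1 x).
Local Notation s := (msq u0 u1).
Hypothesis k_gt0 : forall x, 0 < k (s x).
Local Notation vfm := (vform k k1 W1 om c).
Hypothesis eq0 : forall x, vfm (u0 x) (u1 x) (p0 x) (p1 x) (u0 x) (p0 x) (q0 x) (p1 x) = 0.
Hypothesis eq1 : forall x, vfm (u0 x) (u1 x) (p0 x) (p1 x) (u1 x) (p1 x) (q1 x) (- p0 x) = 0.
Variables (X co si : R).
Hypothesis X0 : 0 < X.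
Hypothesis cs : co * co + si * si = 1.
Hypothesis u0X : forall x, u0 (x + X) = co * u0 x + si * u1 x.
Hypothesis u1X : forall x, u1 (x + X) = co * u1 x - si * u0 x.
Hypothesis nonconst : exists x, u0 x * p0 x + u1 x * p1 x != 0.

Local Notation lop := (lop k k1 k2 W1 W2 om c u0 u1 p0 p1 q0 q1).
Local Notation lfun := (lfun k k1 W1 om c u0 u1 p0 p1).
Local Notation M := (Mmx k k1 k2 W1 W2 om c u0 u1 p0 p1 q0 q1).
Local Notation N := (Nmx k u0 u1).
Local Notation E := (@Emx R).
Local Notation Ro := (Rot co si).

(* [a], [b], [d] are the derivatives of the profile and of its first two
   derivatives with respect to the parameters. *)
Variables (a0 a1 b0 b1 d0 d1 : 'I_4 -> R -> R) (xi Xp : 'I_4 -> R).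
Hypothesis da0 : forall j (x : R), is_derive x 1 (a0 j) (b0 j x).
Hypothesis da1 : forall j (x : R), is_derive x 1 (a1 j) (b1 j x).
Hypothesis db0 : forall j (x : R), is_derive x 1 (b0 j) (d0 j x).
Hypothesis db1 : forall j (x : R), is_derive x 1 (b1 j) (d1 j x).
Hypothesis lop_par0 : forall (j : 'I_4) x,
  lop 0 x (a0 j x) (a1 j x) (b0 j x) (b1 j x) (d0 j x) (d1 j x) = nth 0 [:: u0 x; p1 x; 0; 0] j.
Hypothesis lop_par1 : forall (j : 'I_4) x,
  lop 1 x (a0 j x) (a1 j x) (b0 j x) (b1 j x) (d0 j x) (d1 j x) = nth 0 [:: u1 x; - p0 x; 0; 0] j.
Let M0 : R := s 0 / 2.
Hypothesis lfun_par : forall (a : 'I_2) (j : 'I_4),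
  \sum_i lfun a i 0 * stt (a0 j) (a1 j) (b0 j) (b1 j) i 0
  = (j == (2 + a)%N :> nat)%:R - (j + a == 1)%N%:R * M0.
Hypothesis a0X : forall j x, a0 j (x + X) + Xp j * p0 (x + X) =
  co * (a0 j x + xi j * u1 x) + si * (a1 j x - xi j * u0 x).
Hypothesis a1X : forall j x, a1 j (x + X) + Xp j * p1 (x + X) =
  co * (a1 j x - xi j * u0 x) - si * (a0 j x + xi j * u1 x).

Variables (S T : 'M[R]_4) (delta : nat -> nat -> nat -> R).
Hypothesis S0 : forall j, S 0 j = xi j.
Hypothesis S1 : forall j, S 1 j = Xp j.
Hypothesis S2 : forall j, S (inord 2) j = prim (fun x => u0 x * a0 j x + u1 x * a1 j x) X + M0 * Xp j.
Hypothesis S3 : forall j, S (inord 3) j = prim (fun x => p0 x * a1 j x - p1 x * a0 j x) X + M0 * xi j.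
Hypothesis T_block : forall i j : 'I_4, ~~ ((2 <= i)%N && (j < 2)%N) -> T i j = 0.
Hypothesis T20 : T (inord 2) 0 = prim (fun x => k (s x) * s x) X.
Hypothesis T21 : T (inord 2) 1 = - prim (fun x => k (s x) * (u1 x * p0 x - u0 x * p1 x)) X.
Hypothesis T30 : T (inord 3) 0 = prim (fun x => k (s x) * (u1 x * p0 x - u0 x * p1 x)) X.
Hypothesis T31 : T (inord 3) 1 = - prim (fun x => k (s x) * (p0 x * p0 x + p1 x * p1 x)) X.
Hypothesis deltaP : Delta0_coefficients S T delta.
Hypothesis d400 : delta 4%N 0%N 0%N != 0.
Hypothesis discr : delta 3%N 0%N 1%N ^+ 2 = 4 * delta 4%N 0%N 0%N * delta 2%N 0%N 2%N.
Hypothesis nondeg : delta 2%N 1%N 1%N * delta 4%N 0%N 0%N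
            - 2^-1 * delta 3%N 1%N 0%N * delta 3%N 0%N 1%N != 0.

Definition par_state j := stt (a0 j) (a1 j) (b0 j) (b1 j).

Definition Phi (j : 'I_4) : 'I_4 -> R -> R :=
  if j == 0 then rot_state u0 u1 p0 p1 else
  if j == 1 then tra_state p0 p1 q0 q1 else par_state j.

Definition Psi (j : 'I_4) (i : 'I_4) (x : R) : R := if (j < 2)%N then par_state j i x else 0.

Lemma par_stateE j i x : par Phi Psi j i x = par_state j i x.
Proof.
rewrite /par /Psi /Phi; case: ltnP => // j2.
by case: j j2 => -[|[|[|[|//]]]].
Qed.

(** Differentiating the profile equation in the frequency or the speed gives a right hand side [u]
    or [J u'], which corresponds to [N] applied to a symmetry mode: a Jordan chain of length two. *)
Lemma par_state_derive (j i : 'I_4) (x : R) : is_derive x 1 (par_state j i)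
  (\sum_m M i m x * par_state j m x + (j < 2)%N%:R * \sum_m N i m x * Phi j m x).
Proof.
have kn := k_neq0 k_gt0 x.
have h := @stt_derive _ _ k1 k2 W1 W2 om c u0 u1 p0 p1 q0 q1 k_gt0 _ _ _ _ _ _
  (fun x => nth 0 [:: u0 x; p1 x; 0; 0] j) (fun x => nth 0 [:: u1 x; - p0 x; 0; 0] j) i x
  (da0 j x) (da1 j x) (db0 j x) (db1 j x) (lop_par0 j x) (lop_par1 j x).
apply: is_derive_eq h _; congr (_ + _).
rewrite !big_ord_recl big_ord0 /Nmx /ent /Phi.
case: j => -[|[|[|[|//]]]] hj; case: i => -[|[|[|[|//]]]] hi;
  rewrite /= /rot_state /tra_state /stt /=; by field.
Qed.

Lemma dPhi (j i : 'I_4) (x : R) : is_derive x 1 (Phi j i) (\sum_m M i m x * Phi j m x).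
Proof.
rewrite /Phi; case: (altP (j =P 0)) => [_|n0].
  exact: (rot_state_derive k2 W2 du0 du1 dp0 dp1 k_gt0 eq0 eq1).
case: (altP (j =P 1)) => [_|n1].
  exact: (tra_state_derive dk dk1 dW1 du0 du1 dp0 dp1 dq0 dq1 k_gt0 eq0 eq1).
apply: is_derive_eq (par_state_derive j i x) _.
have -> : (j < 2)%N = false by case: j n0 n1 => -[|[|[|[|//]]]].
by rewrite mul0r addr0.
Qed.

Lemma dPsi (j i : 'I_4) (x : R) : is_derive x 1 (Psi j i)
  (\sum_m M i m x * Psi j m x + (j < 2)%N%:R * \sum_m N i m x * Phi j m x).
Proof.
have := par_state_derive j i x; rewrite /Psi; case: (j < 2)%N => // _.
apply: is_derive_eq (der_cst _ _ _) _; rewrite mul0r addr0 big1 // => m _.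
by rewrite mulr0.
Qed.

Lemma lfun_Phi a j : \sum_i lfun a i 0 * Phi j i 0 = (j == (2 + a)%N :> nat)%:R.
Proof.
rewrite /Phi; case: (altP (j =P 0)) => [->|n0]; first by rewrite lfun_rot.
case: (altP (j =P 1)) => [->|n1]; first by rewrite (lfun_tra k_gt0 eq0 eq1).
rewrite lfun_par.
have -> : (j + a == 1)%N = false by case: j n0 n1 => -[|[|[|[|//]]]].
by rewrite mul0r subr0.
Qed.

Lemma lfun_Psi a (j : 'I_4) : \sum_i lfun a i 0 * Psi j i 0 = - (j + a == 1)%N%:R * M0.
Proof.
rewrite /Psi; case: ltnP => j2.
  rewrite lfun_par (_ : (j == _ :> nat) = false) ?sub0r ?mulNr //.
  by case: j j2 => -[|[|[|[|//]]]].
rewrite big1; last by move=> i _; rewrite mulr0.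
have -> : (j + a == 1)%N = false by case: j j2 => -[|[|[|[|//]]]].
by rewrite oppr0 mul0r.
Qed.

Let bX (f : R -> R) (x v : R) : is_derive (x + X) 1 f v -> is_derive x 1 (fun t => f (t + X)) v.
Proof. exact: is_derive_translate. Qed.

Lemma b0X j x : b0 j (x + X) + Xp j * q0 (x + X) =
  co * (b0 j x + xi j * p1 x) + si * (b1 j x - xi j * p0 x).
Proof.
have e1 : is_derive x 1 (fun t => a0 j (t + X) + Xp j * p0 (t + X)) (b0 j (x + X) + Xp j * q0 (x + X)).
  by have := bX (da0 j (x + X)); have := bX (dp0 (x + X)) => *; der_ring.
have e2 : is_derive x 1 (fun t => co * (a0 j t + xi j * u1 t) + si * (a1 j t - xi j * u0 t))
    (co * (b0 j x + xi j * p1 x) + si * (b1 j x - xi j * p0 x)).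
  by have := da0 j; have := da1 j => *; der_ring.
exact: is_derive_unique e1 (is_derive_ext (a0X j) e2).
Qed.

Lemma b1X j x : b1 j (x + X) + Xp j * q1 (x + X) =
  co * (b1 j x - xi j * p0 x) - si * (b0 j x + xi j * p1 x).
Proof.
have e1 : is_derive x 1 (fun t => a1 j (t + X) + Xp j * p1 (t + X)) (b1 j (x + X) + Xp j * q1 (x + X)).
  by have := bX (da1 j (x + X)); have := bX (dp1 (x + X)) => *; der_ring.
have e2 : is_derive x 1 (fun t => co * (a1 j t - xi j * u0 t) - si * (a0 j t + xi j * u1 t))
    (co * (b1 j x - xi j * p0 x) - si * (b0 j x + xi j * p1 x)).
  by have := da0 j; have := da1 j => *; der_ring.
exact: is_derive_unique e1 (is_derive_ext (a1X j) e2).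
Qed.

Let p0X' := p0X du0 du1 u0X.
Let p1X' := p1X du0 du1 u1X.
Let q0X' := q0X du0 du1 dp0 dp1 u0X.
Let q1X' := q1X du0 du1 dp0 dp1 u1X.

Lemma PhiX (j i : 'I_4) : (j < 2)%N -> Phi j i X = \sum_m Ro i m * Phi j m 0.
Proof.
have e0 : X = 0 + X by rewrite add0r.
case: j => -[|[|//]] hj _; rewrite /Phi /= /rot_state /tra_state (stt_rot _ _ _ _ _ _ X);
  case: i => -[|[|[|[|//]]]] hi; rewrite /stt /= {1}e0 ?u0X ?u1X ?p0X' ?p1X' ?q0X' ?q1X'; ring.
Qed.

Lemma par_stateX j i : par_state j i X =
  \sum_m Ro i m * (par_state j m 0 + xi j * Phi 0 m 0 + Xp j * Phi 1 m 0).
Proof.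
have e0 : X = 0 + X by rewrite add0r.
have e (A B : R) (f : R) : A + f = B -> A = B - f by move=> <-; rewrite addrK.
rewrite (Rot_sum _ _ (fun m => par_state j m 0 + xi j * Phi 0 m 0 + Xp j * Phi 1 m 0)).
rewrite /Phi /= /rot_state /tra_state /par_state.
case: i => -[|[|[|[|//]]]] hi; rewrite /stt /= {1}e0.
- by rewrite (e _ _ _ (a0X j 0)) p0X'; ring.
- by rewrite (e _ _ _ (a1X j 0)) p1X'; ring.
- by rewrite (e _ _ _ (b0X j 0)) q0X'; ring.
- by rewrite (e _ _ _ (b1X j 0)) q1X'; ring.
Qed.

Let cM i m : continuous (M i m).
Proof. exact: (Mmx_continuous dk dk1 dW1 ck2 cW2 du0 du1 dp0 dp1 dq0 dq1 k_gt0). Qed.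

Let cN i m : continuous (N i m).
Proof. exact: (Nmx_continuous dk du0 du1 k_gt0). Qed.

Let cE i m : continuous (E i m).
Proof. exact: Emx_continuous. Qed.

Definition Phi_mx : 'M[R]_4 := \matrix_(i, j) Phi j i 0.

Lemma sum_ord4 (F : 'I_4 -> R) : \sum_i F i = F 0 + F 1 + F (inord 2) + F (inord 3).
Proof.
rewrite !big_ord_recl big_ord0 addr0 !addrA; congr (F _ + F _ + F _ + F _);
  by apply/val_inj; rewrite /= ?inordK.
Qed.

(** [lfun] separates the last two columns. A relation between the two symmetry modes at 0 propagates
    to all [x] by uniqueness; its inner product with [u], which is orthogonal to [J u], contradicts
    the nonconstant modulus. *)
Lemma Phi_mx_unit : Phi_mx \in unitmx.
Proof.
rewrite unitmxE unitfE -det_tr; apply/negP => /det0P[v v0 hv].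
have comb i : \sum_j v 0 j * Phi j i 0 = 0.
  by move/rowP : hv => /(_ i); rewrite !mxE => e0; rewrite -[RHS]e0; apply: eq_bigr => j _; rewrite !mxE.
have high (a : 'I_2) (j : 'I_4) : j = (2 + a)%N :> nat -> v 0 j = 0.
  move=> ja; have : \sum_i lfun a i 0 * \sum_j v 0 j * Phi j i 0 = 0.
    by apply: big1 => i _; rewrite comb mulr0.
  under eq_bigr do rewrite mulr_sumr.
  rewrite exchange_big /= (bigD1 j) //= [X in _ + X]big1 ?addr0.
    under eq_bigr do rewrite mulrCA.
    by rewrite -mulr_sumr lfun_Phi ja eqxx mulr1.
  move=> m mj; under eq_bigr do rewrite mulrCA.
  by rewrite -mulr_sumr lfun_Phi -ja (inj_eq val_inj) (negPf mj) mulr0.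
have v2 : v 0 (inord 2) = 0 by apply: (high 0); rewrite inordK.
have v3 : v 0 (inord 3) = 0 by apply: (high 1); rewrite inordK.
have vanish i x : v 0 0 * rot_state u0 u1 p0 p1 i x + v 0 1 * tra_state p0 p1 q0 q1 i x = 0.
  apply: (@linear_ode_unique _ 'I_4 M (fun i x => v 0 0 * rot_state u0 u1 p0 p1 i x
    + v 0 1 * tra_state p0 p1 q0 q1 i x)) => //.
    move=> {}i {}x; have e1 := dPhi 0 i x; have e2 := dPhi 1 i x; rewrite /Phi /= in e1 e2.
    have h := derD (derM (der_cst (v 0 0) x 1) e1) (derM (der_cst (v 0 1) x 1) e2).
    apply: is_derive_eq h _; rewrite !mul0r !add0r !mulr_sumr -big_split /=.
    by apply: eq_bigr => j _; ring.
  by move=> {}i; have := comb i; rewrite sum_ord4 v2 v3 !mul0r !addr0 /Phi.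
have e0 x : v 0 0 * u1 x = v 0 1 * p0 x.
  by have := vanish 0 x; rewrite /rot_state /tra_state /stt /= mulrN => /eqP; rewrite subr_eq0 => /eqP.
have e1 x : v 0 0 * u0 x = - (v 0 1 * p1 x).
  by have := vanish 1 x; rewrite /rot_state /tra_state /stt /= !mulrN => /eqP;
    rewrite -opprD oppr_eq0 addr_eq0 => /eqP.
have [x hx] := nonconst.
have z1 : v 0 1 = 0.
  apply: (mulIf hx); rewrite mul0r.
  have -> : v 0 1 * (u0 x * p0 x + u1 x * p1 x) = u0 x * (v 0 1 * p0 x) - u1 x * (- (v 0 1 * p1 x)) by ring.
  by rewrite -e0 -e1; ring.
have z0 : v 0 0 = 0.
  apply: (mulIf hx); rewrite mul0r mulrDr !mulrA e0 e1 z1; ring.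
move/negP : v0; apply; apply/eqP/rowP => j; rewrite !mxE.
case: j => -[|[|[|[|//]]]] hj.
- by rewrite -[RHS]z0; congr (v _ _); exact/val_inj.
- by rewrite -[RHS]z1; congr (v _ _); exact/val_inj.
- by rewrite -[RHS]v2; congr (v _ _); apply/val_inj; rewrite /= inordK.
- by rewrite -[RHS]v3; congr (v _ _); apply/val_inj; rewrite /= inordK.
Qed.

Definition Phi_inv (i j : 'I_4) : R := invmx Phi_mx i j.

Lemma Phi_invK i j : \sum_m Phi_inv i m * Phi j m 0 = (i == j)%:R.
Proof.
have := mulVmx Phi_mx_unit => /matrixP/(_ i j); rewrite !mxE => <-.
by apply: eq_bigr => m _; rewrite mxE.
Qed.

Lemma Phi_Kinv i m : \sum_j Phi j i 0 * Phi_inv j m = (i == m)%:R.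
Proof.
have := mulmxV Phi_mx_unit => /matrixP/(_ i m); rewrite !mxE => <-.
by apply: eq_bigr => j _; rewrite mxE.
Qed.

Let cu0 : continuous u0. Proof. by move=> x; exact: is_derive1_continuous (du0 x). Qed.
Let cu1 : continuous u1. Proof. by move=> x; exact: is_derive1_continuous (du1 x). Qed.
Let cp0 : continuous p0. Proof. by move=> x; exact: is_derive1_continuous (dp0 x). Qed.
Let cp1 : continuous p1. Proof. by move=> x; exact: is_derive1_continuous (dp1 x). Qed.

(** The integrand is 0 or the derivative of [- s / 2], and [s] has period [X]. *)
Lemma N_Phi0 (a : 'I_2) (j : 'I_4) : (j < 2)%N -> prim (bil lfun N a (Phi j)) X = 0.
Proof.
move=> j2.
have per F f : continuous f -> (forall x : R, is_derive x 1 F (f x)) -> F X = F 0 ->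
    bil lfun N a (Phi j) = f -> prim (bil lfun N a (Phi j)) X = 0.
  by move=> cf dF FX ->; rewrite (prim_eq X0 cf dF) FX subrr.
have sX0 : s X = s 0 by rewrite -(sX cs u0X u1X 0) add0r.
case: j j2 per => -[|[|//]] hj _ per; case: (ord2P a) => ea; rewrite ea in per *.
- apply: (per (fun=> 0) (fun=> 0)) => //; first exact: cont_cst.
  by apply/funext => x; rewrite (bilN0 k1 W1 om c p0 p1 k_gt0) /Phi /= /rot_state /stt /=; ring.
- apply: (per (fun x => - (s x / 2)) (fun x => - (u0 x * p0 x + u1 x * p1 x))).
  + by cont.
  + by move=> x; have h := ds du0 du1 x; apply: is_derive_eq (derN (derM h (der_cst 2^-1 x 1))) _; field.
  + by rewrite sX0.
  by apply/funext => x; rewrite (bilN1 k1 W1 om c p0 p1 k_gt0) /Phi /= /rot_state /stt /=; ring.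
- apply: (per (fun x => - (s x / 2)) (fun x => - (u0 x * p0 x + u1 x * p1 x))).
  + by cont.
  + by move=> x; have h := ds du0 du1 x; apply: is_derive_eq (derN (derM h (der_cst 2^-1 x 1))) _; field.
  + by rewrite sX0.
  by apply/funext => x; rewrite (bilN0 k1 W1 om c p0 p1 k_gt0) /Phi /= /tra_state /stt /=; ring.
- apply: (per (fun=> 0) (fun=> 0)) => //; first exact: cont_cst.
  by apply/funext => x; rewrite (bilN1 k1 W1 om c p0 p1 k_gt0) /Phi /= /tra_state /stt /=; ring.
Qed.

Lemma S_entries i j : S i j = Sig N X M0 Phi Psi lfun xi Xp i j.
Proof.
have e2 : (Ordinal (isT : 2 < 4)%N) = inord 2 by apply/val_inj; rewrite /= inordK.
have e3 : (Ordinal (isT : 3 < 4)%N) = inord 3 by apply/val_inj; rewrite /= inordK.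
have eb a : bil lfun N a (par Phi Psi j) = bil lfun N a (par_state j).
  by congr bil; apply/funext => m; apply/funext => x; exact: par_stateE.
rewrite /Sig !eb; case: i => -[|[|[|[|//]]]] hi /=.
- by rewrite -S0; congr (S _ _); exact/val_inj.
- by rewrite -S1; congr (S _ _); exact/val_inj.
- rewrite (_ : Ordinal hi = inord 2); last by apply/val_inj; rewrite /= inordK.
  rewrite S2; congr (prim _ _ + _); apply/funext => x.
  by rewrite (bilN0 k1 W1 om c p0 p1 k_gt0) /par_state /stt.
- rewrite (_ : Ordinal hi = inord 3); last by apply/val_inj; rewrite /= inordK.
  rewrite S3; congr (prim _ _ + _); apply/funext => x.
  by rewrite (bilN1 k1 W1 om c p0 p1 k_gt0) /par_state /stt.
Qed.

Let cs' : continuous s.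
Proof. by move=> x; exact: is_derive1_continuous (ds du0 du1 x). Qed.

Let cks : continuous (fun x => k (s x)).
Proof. by move=> x; exact: is_derive1_continuous (dks dk du0 du1 x). Qed.

Lemma prim_opp f : continuous f -> prim (fun x => - f x) X = - prim f X.
Proof.
move=> cf; have [f0 df] := primP cf.
have h := @prim_eq _ (fun x => - f x) (fun x => - prim f x) X X0.
rewrite h ?f0 ?oppr0 ?addr0 //; exact: contN.
Qed.

Lemma T_entries i j : T i j = Sgy E X Phi lfun i j.
Proof.
rewrite /Sgy; case: ifPn => [/andP[i2 j2]|]; last exact: T_block.
case: i i2 => -[|[|[|[|//]]]] hi // _; case: j j2 => -[|[|//]] hj _ /=.
- rewrite (_ : Ordinal hi = inord 2); last by apply/val_inj; rewrite /= inordK.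
  rewrite (_ : Ordinal hj = 0) ?T20; last exact/val_inj.
  congr prim; apply/funext => x; rewrite bilE0 /Phi /= /rot_state /stt /=.
  by rewrite /msq; ring.
- rewrite (_ : Ordinal hi = inord 2); last by apply/val_inj; rewrite /= inordK.
  rewrite (_ : Ordinal hj = 1) ?T21; last exact/val_inj.
  rewrite -prim_opp; last by cont.
  congr prim; apply/funext => x; rewrite bilE0 /Phi /= /tra_state /stt /=; ring.
- rewrite (_ : Ordinal hi = inord 3); last by apply/val_inj; rewrite /= inordK.
  rewrite (_ : Ordinal hj = 0) ?T30; last exact/val_inj.
  congr prim; apply/funext => x; rewrite bilE1 /Phi /= /rot_state /stt /=; ring.
- rewrite (_ : Ordinal hi = inord 3); last by apply/val_inj; rewrite /= inordK.
  rewrite (_ : Ordinal hj = 1) ?T31; last exact/val_inj.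
  rewrite -prim_opp; last by cont.
  congr prim; apply/funext => x; rewrite bilE1 /Phi /= /tra_state /stt /=; ring.
Qed.

Lemma cder_translate (x : R) (f : R -> C) (v : C) : cder (x + X) f v -> cder x (fun t => f (t + X)) v.
Proof. by case=> ? ?; split; apply: is_derive_translate. Qed.

Lemma sys_rot e z i j x : \sum_m sys M N E e z i m (x + X) * (Ro m j)%:C%C =
  \sum_m (Ro i m)%:C%C * sys M N E e z m j x.
Proof.
pose cC (A : 'I_4 -> R) : C := (\sum_m A m)%:C%C.
have toC (A : 'I_4 -> R) (B : 'I_4 -> R) : \sum_m (A m)%:C%C * (B m)%:C%C = cC (fun m => A m * B m) :> C.
  by rewrite /cC rmorph_sum /=; apply: eq_bigr => m _; rewrite rmorphM.
rewrite /sys; under eq_bigr do rewrite !mulrDl -!mulrA.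
rewrite !big_split /= -!mulr_sumr !toC /cC.
rewrite (Mmx_rot k1 k2 W1 W2 om c du0 du1 dp0 dp1 k_gt0 cs u0X u1X) (Nmx_rot k cs u0X u1X) (Emx_rot X).
under [RHS]eq_bigr do rewrite !mulrDr ![(Ro _ _)%:C%C * (_ * _)]mulrCA.
by rewrite !big_split /= -!mulr_sumr !toC /cC -!mulrA.
Qed.

Let c_translate (f : R -> R) : continuous f -> continuous (fun x => f (x + X)).
Proof.
move=> cf x; apply: (@continuous_comp _ _ _ (fun x => x + X) f); last exact: cf.
by apply: (@contD _ (fun x => x) (fun=> X)); [move=> y; exact: cvg_id | exact: cont_cst].
Qed.

Theorem bloch_mode : exists e z (y : 'I_4 -> R -> C) (mu : C),
  [/\ 0 < e < 1, 0 < complex.Re z, is_sol M N E e z y, exists i, y i 0 != 0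
    & cabs mu = 1 /\ forall i x, y i (x + X) = mu * \sum_m (Ro i m)%:C%C * y m x].
Proof.
have [Y hY] := columns_exist Phi Psi cM cN cE.
have solY e z j := (hY e z j).1; have Y0 e z j i := (hY e z j).2 i.
have ha : forall j i, par Phi Psi j i X = \sum_m Ro i m *
    (par Phi Psi j m 0 + xi j * Phi 0 m 0 + Xp j * Phi 1 m 0).
  by move=> j i; rewrite par_stateE par_stateX; under [RHS]eq_bigr do rewrite par_stateE.
have hl a j : \sum_i lfun a i X * Ro i j = lfun a j 0.
  by rewrite -(lRot k k1 W1 om c du0 du1 cs u0X u1X) add0r.
have Psi_high (j i : 'I_4) x : (2 <= j)%N -> Psi j i x = 0 by rewrite leqNgt /Psi => /negPf ->.
have dl := dlfun dk dk1 dW1 du0 du1 dp0 dp1 k_gt0 eq0 eq1.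
have SE z : scaled_limit S T z = lim_mx N E X M0 Phi Psi lfun xi Xp z.
  by apply/matrixP => i j; rewrite !mxE S_entries T_entries.
have [] := @unstable_mode _ S T delta deltaP T_block d400 discr nondeg
  (mono_mx X M0 (Rinv co si) Phi_inv Y) (unit_mx M0 Phi_inv Y) _ _ _ _ 1 ltr01.
- move=> L; have [bd bd0 hb] := mono_close M0 X0 cM cN cE dPhi dPsi Psi_high dl lfun_Phi
    (RinvK cs) (RotK cs) hl PhiX Phi_invK Phi_Kinv ha N_Phi0 solY Y0 L.
  by exists bd => // e z i j e0 e1 hz; rewrite SE; exact: hb.
- by move=> L; exact: (unit_close X0 Psi_high lfun_Phi lfun_Psi Phi_invK Phi_Kinv Y0 L).
- by move=> L e i j e0 e1; exact: (lip_mono M0 _ _ X0 cM cN cE dPhi dPsi solY Y0).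
- by move=> L e i j e0 e1; exact: (lip_unit M0 _ X0 cM cN cE dPhi dPsi solY Y0).
move=> e [z [sg [/andP[e0 e1] z0 hdet hun hmu]]].
have [y [soly y0 yX]] := floquet_solution (RotK cs) Phi_Kinv solY e0 hdet hun.
exists e, z, y, (1 + e%:C%C * sg); split => //; first by rewrite e0.
(* The relation is known at [x = 0]. Both sides solve the same system, the one shifted by [X], hence
   agree everywhere. *)
split => // i x; apply/eqP; rewrite -subr_eq0; apply/eqP.
apply: (@complex_ode_unique _ 'I_4 (fun i j x => sys M N E e z i j (x + X))
  (fun i x => y i (x + X) - (1 + e%:C%C * sg) * \sum_m (Ro i m)%:C%C * y m x)).
- by move=> i' j'; apply: (@c_translate (fun x => complex.Re (sys M N E e z i' j' x))); apply: sys_Re.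
- by move=> i' j'; apply: (@c_translate (fun x => complex.Im (sys M N E e z i' j' x))); apply: sys_Im.
- move=> {}i {}x; have f1 := cder_translate (soly i (x + X)).
  have f2 : cder x (fun x => \sum_m (Ro i m)%:C%C * y m x)
      (\sum_m (Ro i m)%:C%C * \sum_j sys M N E e z m j x * y j x).
    by apply: cder_sum => m; apply: cder_scale.
  apply: cder_eq (cderB f1 (cder_scale _ f2)) _.
  under [RHS]eq_bigr do rewrite mulrBr.
  rewrite sumrB; congr (_ - _).
  under [RHS]eq_bigr do rewrite mulrCA mulr_sumr.
  rewrite -mulr_sumr exchange_big /=; congr (_ * _).
  under [LHS]eq_bigr do rewrite mulr_sumr.
  rewrite exchange_big /=; apply: eq_bigr => j _.
  under [LHS]eq_bigr do rewrite mulrA.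
  under [RHS]eq_bigr do rewrite mulrA.
  by rewrite -!mulr_suml sys_rot.
by move=> {}i; rewrite add0r yX subrr.
Qed.

End FloquetMode.

Section PointContinuity.
Context {R : realType} {T : topologicalType}.
Implicit Types (f g : T -> R) (x : T).

Lemma ctpD f g x : {for x, continuous f} -> {for x, continuous g} ->
  {for x, continuous (fun t => f t + g t)}.
Proof. exact: cvgD. Qed.

Lemma ctpM f g x : {for x, continuous f} -> {for x, continuous g} ->
  {for x, continuous (fun t => f t * g t)}.
Proof. exact: cvgM. Qed.

Lemma ctpN f x : {for x, continuous f} -> {for x, continuous (fun t => - f t)}.
Proof. exact: cvgN. Qed.

Lemma ctp_cst (a : R) x : {for x, continuous (fun _ : T => a)}.
Proof. exact: cvg_cst. Qed.

End PointContinuity.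

Ltac contp := lazymatch goal with
  | |- {for _, continuous (fun x => (@?f x + @?g x)%R)} => apply: ctpD; contp
  | |- {for _, continuous (fun x => (@?f x * @?g x)%R)} => apply: ctpM; contp
  | |- {for _, continuous (fun x => (- @?f x)%R)} => apply: ctpN; contp
  | _ => first [match goal with H : forall y : _, {for _, continuous _} |- _ => exact: H end | exact: ctp_cst]
  end.

(** * Derivatives along a curve of profiles *)

Section OneParameter.
Context {R : realType}.
Variables (k k1 k2 W W1 W2 : R -> R) (om c mu mx : R).
Hypothesis dk : forall s : R, is_derive s 1 k (k1 s).
Hypothesis dk1 : forall s : R, is_derive s 1 k1 (k2 s).
Hypothesis dW : forall s : R, is_derive s 1 W (W1 s).
Hypothesis dW1 : forall s : R, is_derive s 1 W1 (W2 s).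

(* A curve [t |-> U t] of profiles, with parameters moving in the direction
   [(w0, w1, w2, w3)]; [P] and [Q] are the derivatives of [U] in space and
   [A], [B], [D] those of [U], [P], [Q] in [t]. *)
Variables (U0 U1 P0 P1 Q0 Q1 A0 A1 B0 B1 : R -> R -> R) (D0 D1 : R -> R).
Variables (w0 w1 w2 w3 d : R) (Xt xit : R -> R) (Xp xi : R).
Hypothesis d_gt0 : 0 < d.
Hypothesis dU0 : forall t y : R, `|t| < d -> is_derive y 1 (U0 t) (P0 t y).
Hypothesis dU1 : forall t y : R, `|t| < d -> is_derive y 1 (U1 t) (P1 t y).
Hypothesis dP0 : forall t y : R, `|t| < d -> is_derive y 1 (P0 t) (Q0 t y).
Hypothesis dP1 : forall t y : R, `|t| < d -> is_derive y 1 (P1 t) (Q1 t y).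
Hypothesis tU0 : forall t y : R, `|t| < d -> is_derive t 1 (fun t => U0 t y) (A0 t y).
Hypothesis tU1 : forall t y : R, `|t| < d -> is_derive t 1 (fun t => U1 t y) (A1 t y).
Hypothesis tP0 : forall t y : R, `|t| < d -> is_derive t 1 (fun t => P0 t y) (B0 t y).
Hypothesis tP1 : forall t y : R, `|t| < d -> is_derive t 1 (fun t => P1 t y) (B1 t y).
Hypothesis tQ0 : forall y : R, is_derive (0 : R) 1 (fun t => Q0 t y) (D0 y).
Hypothesis tQ1 : forall y : R, is_derive (0 : R) 1 (fun t => Q1 t y) (D1 y).
Hypothesis dA0 : forall y : R, is_derive y 1 (A0 0) (B0 0 y).
Hypothesis dA1 : forall y : R, is_derive y 1 (A1 0) (B1 0 y).
Hypothesis dB0 : forall y : R, is_derive y 1 (B0 0) (D0 y).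
Hypothesis dB1 : forall y : R, is_derive y 1 (B1 0) (D1 y).
Hypothesis cU0 : forall y, {for (0, y), continuous (fun z : R * R => U0 z.1 z.2)}.
Hypothesis cU1 : forall y, {for (0, y), continuous (fun z : R * R => U1 z.1 z.2)}.
Hypothesis cP0 : forall y, {for (0, y), continuous (fun z : R * R => P0 z.1 z.2)}.
Hypothesis cP1 : forall y, {for (0, y), continuous (fun z : R * R => P1 z.1 z.2)}.
Hypothesis cA0 : forall y, {for (0, y), continuous (fun z : R * R => A0 z.1 z.2)}.
Hypothesis cA1 : forall y, {for (0, y), continuous (fun z : R * R => A1 z.1 z.2)}.
Hypothesis cB0 : forall y, {for (0, y), continuous (fun z : R * R => B0 z.1 z.2)}.
Hypothesis cB1 : forall y, {for (0, y), continuous (fun z : R * R => B1 z.1 z.2)}.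
Hypothesis dXt : is_derive (0 : R) 1 Xt Xp.
Hypothesis dxit : is_derive (0 : R) 1 xit xi.
Hypothesis Xt_gt0 : forall t, `|t| < d -> 0 < Xt t.

Local Notation sq t y := (U0 t y * U0 t y + U1 t y * U1 t y).
Hypothesis eq0 : forall t y, `|t| < d -> vform k k1 W1 (om + t * w0) (c + t * w1)
  (U0 t y) (U1 t y) (P0 t y) (P1 t y) (U0 t y) (P0 t y) (Q0 t y) (P1 t y) = 0.
Hypothesis eq1 : forall t y, `|t| < d -> vform k k1 W1 (om + t * w0) (c + t * w1)
  (U0 t y) (U1 t y) (P0 t y) (P1 t y) (U1 t y) (P1 t y) (Q1 t y) (- P0 t y) = 0.
Hypothesis cst0 : forall t y, `|t| < d -> mu + t * w2 =
  k (sq t y) * (U1 t y * P0 t y - U0 t y * P1 t y) + (c + t * w1) / 2 * sq t y.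
Hypothesis cst1 : forall t y, `|t| < d -> mx + t * w3 =
  2^-1 * k (sq t y) * (P0 t y * P0 t y + P1 t y * P1 t y) - W (sq t y)
  + (om + t * w0) / 2 * sq t y.
Hypothesis U0X : forall t y, `|t| < d ->
  U0 t (y + Xt t) = cos (xit t) * U0 t y + sin (xit t) * U1 t y.
Hypothesis U1X : forall t y, `|t| < d ->
  U1 t (y + Xt t) = cos (xit t) * U1 t y - sin (xit t) * U0 t y.

Let near_d : \forall t \near (0 : R), `|t| < d.
Proof. by exists d => //= t /=; rewrite distrC subr0. Qed.

Let d00 : `|0 : R| < d. Proof. by rewrite normr0. Qed.

Let dcst (a : R) : is_derive (0 : R) 1 (fun=> a) 0.
Proof. exact: der_cst. Qed.

Let did : is_derive (0 : R) 1 (fun t : R => t) 1.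
Proof. exact: der_id. Qed.

Let cst_near (F : R -> R) (a v : R) : (forall t, `|t| < d -> F t = a) ->
  is_derive (0 : R) 1 F v -> v = 0.
Proof.
move=> Fa dF; apply: (is_derive_unique dF).
apply: (@is_derive_near _ (fun=> a) _ _ _ _ (dcst a)).
near=> t; apply/esym/Fa; near: t; exact: near_d.
Unshelve. all: by end_near.
Qed.

(** The profile equation holds for all small [t]. Its derivative at 0 consists of the linearized
    operator at the derivative of the profile and of the explicit dependence on the frequency and
    the speed. *)
Lemma lop_parE (i : 'I_2) y : lop k k1 k2 W1 W2 om c (U0 0) (U1 0) (P0 0) (P1 0) (Q0 0) (Q1 0)
    i y (A0 0 y) (A1 0 y) (B0 0 y) (B1 0 y) (D0 y) (D1 y) =
  w0 * sel i (U0 0 y) (U1 0 y) + w1 * sel i (P1 0 y) (- P0 0 y).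
Proof.
have dsel f0 f1 (a b : R) : is_derive (0 : R) 1 f0 a -> is_derive (0 : R) 1 f1 b ->
    is_derive (0 : R) 1 (fun x => sel i (f0 x) (f1 x)) (sel i a b).
  by rewrite /sel; case: (i == 0).
have h := der_vform om c dk dk1 dW1 (tU0 y d00) (tU1 y d00) (tP0 y d00) (tP1 y d00)
  (dsel _ _ _ _ (tU0 y d00) (tU1 y d00)) (dsel _ _ _ _ (tP0 y d00) (tP1 y d00))
  (dsel _ _ _ _ (tQ0 y) (tQ1 y)) (dsel _ _ _ _ (tP1 y d00) (derN (tP0 y d00))).
have hu := dsel _ _ _ _ (tU0 y d00) (tU1 y d00).
have hp := dsel _ _ _ _ (tP1 y d00) (derN (tP0 y d00)).
have hw (w : R) f a : is_derive (0 : R) 1 f a -> is_derive (0 : R) 1 (fun t => t * w * f t) (w * f 0).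
  move=> df; apply: is_derive_eq (derM (derM did (dcst w)) df) _; ring.
have := derB (derB h (hw w0 _ _ hu)) (hw w1 _ _ hp).
move/(cst_near (a := 0)) => e; apply/eqP; rewrite -subr_eq0 opprD addrA; apply/eqP; apply: e => t td.
case: (ord2P i) => ->; rewrite /sel /=; [rewrite -(eq0 y td)|rewrite -(eq1 y td)];
  by rewrite /vform /=; ring.
Qed.

Let ds : forall y : R, is_derive (0 : R) 1 (fun t => sq t y) (2 * (U0 0 y * A0 0 y + U1 0 y * A1 0 y)).
Proof. by move=> y; have := tU0 y d00; have := tU1 y d00 => *; der_ring. Qed.

Lemma lfun_parE (a : 'I_2) y :
  \sum_i lfun k k1 W1 om c (U0 0) (U1 0) (P0 0) (P1 0) a i y *
    stt (A0 0) (A1 0) (B0 0) (B1 0) i y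
  = (if a == 0 then w2 else w3) - (if a == 0 then w1 else w0) * (sq 0 y / 2).
Proof.
have e0 := tU0 y d00; have e1 := tU1 y d00; have e2 := tP0 y d00; have e3 := tP1 y d00.
have e4 := ds y; have e5 := der_comp (dk _) e4; have e6 := der_comp (dW _) e4.
have hw (w v : R) : is_derive (0 : R) 1 (fun t => v + t * w) w.
  by apply: is_derive_eq (derD (dcst v) (derM did (dcst w))) _; ring.
have h1 := hw w2 mu; have h2 := hw w3 mx; have h3 := hw w0 om; have h4 := hw w1 c.
case: (ord2P a) => ->; rewrite ?lfun0E ?lfun1E /= /msq.
  have := @cst_near (fun t => mu + t * w2 - (k (sq t y) * (U1 t y * P0 t y - U0 t y * P1 t y)
    + (c + t * w1) / 2 * sq t y)) 0 _ _ _.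
  move=> H; apply/eqP; rewrite eq_sym -subr_eq0; apply/eqP; apply: H.
    by move=> t td; rewrite (cst0 y td) subrr.
  apply: is_derive_eq (derB h1 (derD (derM e5 (derB (derM e1 e2) (derM e0 e3)))
    (derM (derM h4 (dcst 2^-1)) e4))) _; by field.
have := @cst_near (fun t => mx + t * w3 - (2^-1 * k (sq t y) * (P0 t y * P0 t y + P1 t y * P1 t y)
  - W (sq t y) + (om + t * w0) / 2 * sq t y)) 0 _ _ _.
move=> H; apply/eqP; rewrite eq_sym -subr_eq0; apply/eqP; apply: H.
  by move=> t td; rewrite (cst1 y td) subrr.
apply: is_derive_eq (derB h2 (derD (derB (derM (derM (dcst 2^-1) e5)
  (derD (derM e2 e2) (derM e3 e3))) e6)
    (derM (derM h3 (dcst 2^-1)) e4))) _; by field.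
Qed.

Let co := cos (xit 0).
Let si := sin (xit 0).

Let dco : is_derive (0 : R) 1 (fun t => cos (xit t)) (- si * xi).
Proof. by apply: der_comp => //; exact: is_derive_cos. Qed.

Let dsi : is_derive (0 : R) 1 (fun t => sin (xit t)) (co * xi).
Proof. by apply: der_comp => //; exact: is_derive_sin. Qed.

Let dYt (y : R) : is_derive (0 : R) 1 (fun t => y + Xt t) Xp.
Proof. by apply: is_derive_eq (derD (dcst y) dXt) _; rewrite add0r. Qed.

(** Derivative at [t = 0] of [U (y + X) = e^{xi J} U y], where the argument moves with the
    period. *)
Lemma A0X y : A0 0 (y + Xt 0) + Xp * P0 0 (y + Xt 0) =
  co * (A0 0 y + xi * U1 0 y) + si * (A1 0 y - xi * U0 0 y).
Proof.
have h1 := chain2 d_gt0 dU0 (@cP0 (y + Xt 0)) (tU0 (y + Xt 0) d00) erefl (dYt y).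
have h2 := derD (derM dco (tU0 y d00)) (derM dsi (tU1 y d00)).
apply/eqP; rewrite -subr_eq0; apply/eqP.
apply: (@cst_near (fun t => U0 t (y + Xt t) - (cos (xit t) * U0 t y + sin (xit t) * U1 t y)) 0).
  by move=> t td; rewrite U0X ?subrr.
by apply: is_derive_eq (derB h1 h2) _; rewrite -/co -/si; ring.
Qed.

Lemma A1X y : A1 0 (y + Xt 0) + Xp * P1 0 (y + Xt 0) =
  co * (A1 0 y - xi * U0 0 y) - si * (A0 0 y + xi * U1 0 y).
Proof.
have h1 := chain2 d_gt0 dU1 (@cP1 (y + Xt 0)) (tU1 (y + Xt 0) d00) erefl (dYt y).
have h2 := derB (derM dco (tU1 y d00)) (derM dsi (tU0 y d00)).
apply/eqP; rewrite -subr_eq0; apply/eqP.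
apply: (@cst_near (fun t => U1 t (y + Xt t) - (cos (xit t) * U1 t y - sin (xit t) * U0 t y)) 0).
  by move=> t td; rewrite U1X ?subrr.
by apply: is_derive_eq (derB h1 h2) _; rewrite -/co -/si; ring.
Qed.

Let cUt0 t : `|t| < d -> continuous (U0 t).
Proof. by move=> td y; exact: is_derive1_continuous (dU0 y td). Qed.
Let cUt1 t : `|t| < d -> continuous (U1 t).
Proof. by move=> td y; exact: is_derive1_continuous (dU1 y td). Qed.
Let cPt0 t : `|t| < d -> continuous (P0 t).
Proof. by move=> td y; exact: is_derive1_continuous (dP0 y td). Qed.
Let cPt1 t : `|t| < d -> continuous (P1 t).
Proof. by move=> td y; exact: is_derive1_continuous (dP1 y td). Qed.

Lemma prim_moving (g gt : R -> R -> R) :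
  (forall t y : R, `|t| < d -> is_derive t 1 (fun s => g s y) (gt t y)) ->
  (forall t, `|t| < d -> continuous (g t)) ->
  (forall y, {for (0, y), continuous (fun z : R * R => g z.1 z.2)}) ->
  (forall y, {for (0, y), continuous (fun z : R * R => gt z.1 z.2)}) ->
  is_derive (0 : R) 1 (fun t => prim (g t) (Xt t)) (prim (gt 0) (Xt 0) + g 0 (Xt 0) * Xp).
Proof.
move=> dg cg cg2 cgt; have X0 := Xt_gt0 d00.
have h := prim_under d_gt0 X0 dg cg cgt.
exact: (chain2 (f := fun t => prim (g t)) d_gt0 (fun t y td => (primP (cg t td)).2 y)
  (cg2 (Xt 0)) h erefl dXt).
Qed.

Let U0X0 : U0 0 (Xt 0) = co * U0 0 0 + si * U1 0 0.
Proof. by rewrite -(U0X 0 d00) add0r. Qed.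
Let U1X0 : U1 0 (Xt 0) = co * U1 0 0 - si * U0 0 0.
Proof. by rewrite -(U1X 0 d00) add0r. Qed.

Let cs : co * co + si * si = 1.
Proof. by rewrite -!expr2; exact: cos2Dsin2. Qed.

Let cA0' : continuous (A0 0).
Proof. by move=> y; exact: is_derive1_continuous (dA0 y). Qed.
Let cA1' : continuous (A1 0).
Proof. by move=> y; exact: is_derive1_continuous (dA1 y). Qed.

Lemma mass_derive : is_derive (0 : R) 1 (fun t => prim (fun y => 2^-1 * sq t y) (Xt t))
  (prim (fun y => U0 0 y * A0 0 y + U1 0 y * A1 0 y) (Xt 0) + sq 0 0 / 2 * Xp).
Proof.
have h := @prim_moving (fun t y => 2^-1 * sq t y)
  (fun t y => U0 t y * A0 t y + U1 t y * A1 t y).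
apply: is_derive_eq (h _ _ _ _) _.
- move=> t y td; have := tU0 y td; have := tU1 y td => *.
  by der_eq; rewrite /=; field.
- by move=> t td; have ca := cUt0 td; have cb := cUt1 td; cont.
- by move=> y; contp.
- by move=> y; contp.
congr (_ + _ * _); rewrite U0X0 U1X0.
transitivity (2^-1 * ((co * co + si * si) * sq 0 0)); first by ring.
by rewrite cs mul1r mulrC.
Qed.

(** The derivative of the momentum density contains space derivatives of [A], which are integrated
    by parts. By [A0X] and [A1X] the contribution of the moving end cancels, and the rotation leaves
    [xi] times the mass density at 0. *)
Lemma momentum_derive :
  is_derive (0 : R) 1 (fun t => prim (fun y => 2^-1 * (U1 t y * P0 t y - U0 t y * P1 t y)) (Xt t))
  (prim (fun y => P0 0 y * A1 0 y - P1 0 y * A0 0 y) (Xt 0) + sq 0 0 / 2 * xi).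
Proof.
have h := @prim_moving (fun t y => 2^-1 * (U1 t y * P0 t y - U0 t y * P1 t y))
  (fun t y => 2^-1 * (A1 t y * P0 t y + U1 t y * B0 t y - (A0 t y * P1 t y + U0 t y * B1 t y))).
apply: is_derive_eq (h _ _ _ _) _.
- move=> t y td; have := tU0 y td; have := tU1 y td; have := tP0 y td; have := tP1 y td => *.
  by der_ring.
- by move=> t td; have ca := cUt0 td; have cb := cUt1 td; have cc := cPt0 td; have cd := cPt1 td; cont.
- by move=> y; contp.
- by move=> y; contp.
have c0 := cUt0 d00; have c1 := cUt1 d00; have c2 := cPt0 d00; have c3 := cPt1 d00.
have cg : continuous (fun y => P0 0 y * A1 0 y - P1 0 y * A0 0 y) by cont.
have [g0 dg] := primP cg.
have cB0' : continuous (B0 0) by move=> y; exact: is_derive1_continuous (dB0 y).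
have cB1' : continuous (B1 0) by move=> y; exact: is_derive1_continuous (dB1 y).
pose g0t y := 2^-1 * (A1 0 y * P0 0 y + U1 0 y * B0 0 y - (A0 0 y * P1 0 y + U0 0 y * B1 0 y)).
(* A primitive of the integrand in the form given by the integration by parts. *)
pose G y := prim (fun y => P0 0 y * A1 0 y - P1 0 y * A0 0 y) y
  + 2^-1 * (U1 0 y * A0 0 y - U0 0 y * A1 0 y).
have eP : prim g0t (Xt 0) = G (Xt 0) - G 0.
  apply: prim_eq; first exact: Xt_gt0.
    by rewrite /g0t; cont.
  move=> y; rewrite /G /g0t.
  have f1 := dg y; have f2 := dU0 y d00; have f3 := dU1 y d00; have f4 := dA0 y; have f5 := dA1 y.
  by der_eq; rewrite /=; field.
rewrite eP /G g0 add0r.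
have e0 := A0X 0; have e1 := A1X 0; rewrite !add0r in e0 e1.
rewrite (canRL (addrK _) e0) (canRL (addrK _) e1) U0X0 U1X0.
transitivity (prim (fun y => P0 0 y * A1 0 y - P1 0 y * A0 0 y) (Xt 0)
  + 2^-1 * ((co * co + si * si) * (xi * sq 0 0 + (U1 0 0 * A0 0 0 - U0 0 0 * A1 0 0)))
  - 2^-1 * (U1 0 0 * A0 0 0 - U0 0 0 * A1 0 0)); first by ring.
by rewrite cs; field.
Qed.

End OneParameter.

(** * Families of profiles *)

Section ProfileFamily.
Context {R : realType}.
Local Notation P4 := 'rV[R]_4.
Variables (kappa Wp k k1 k2 W W1 W2 : R -> R).
Hypothesis kappaE : forall s, 0 <= s -> kappa s = k s.
Hypothesis WpE : forall s, 0 <= s -> Wp s = W s.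
Hypothesis dk : forall s : R, is_derive s 1 k (k1 s).
Hypothesis dk1 : forall s : R, is_derive s 1 k1 (k2 s).
Hypothesis dW : forall s : R, is_derive s 1 W (W1 s).
Hypothesis dW1 : forall s : R, is_derive s 1 W1 (W2 s).

(** The unscaled density is the scaled one with [kx = 1] and [kp = 0], without transverse variables.
    The smooth extensions of [kappa] and [W] can be used because they are evaluated at squared
    norms. *)
Lemma profile_vform om c (V : R -> 'cV[R]_2) X xi (i : 'I_2) x : is_profile kappa Wp om c V X xi ->
  let u0 := fun y => V y 0 0 in let u1 := fun y => V y 1 0 in
  vform k k1 W1 om c (u0 x) (u1 x) ('D_1 u0 x) ('D_1 u1 x) (sel i (u0 x) (u1 x))
    (sel i ('D_1 u0 x) ('D_1 u1 x)) (sel i ('D_1 ('D_1 u0) x) ('D_1 ('D_1 u1) x))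
    (sel i ('D_1 u1 x) (- 'D_1 u0 x)) = 0.
Proof.
case=> sV hV _ _ _ u0 u1.
have AE : (fun U P => H0 kappa Wp U P - om * Mass U P + c * Q1 U P) =
    @scaled_density R 0 k W om c 1 0.
  apply/funext => U; apply/funext => P; rewrite /scaled_density.
  have -> : \matrix_(i, j) (if j == ord0 then 1 * P i j + 0 * (Jmx *m U) i 0 else P i j) = P.
    by apply/matrixP => a b; rewrite !mxE mul1r mul0r addr0 if_same.
  by rewrite /H0 kappaE ?WpE // sqn_ge0.
have cu a m : Ck_on setT m (fun y => V y a 0).
  by have := sV m; rewrite Ck_on_mxP; [apply | exact: openT].
have cY : Ck_on setT 2 (@plane R 0 V).
  rewrite Ck_on_mxP; last exact: openT.
  by move=> a b; rewrite ord1; apply: (@Ck_on_coord _ _ ord0 2 (fun y => V y a 0)).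
pose x' : 'rV[R]_1 := const_mx x.
have e : variational_derivative (@scaled_density R 0 k W om c 1 0) (plane V) x' i 0 = 0.
  by rewrite -AE hV mxE.
move: e; rewrite (var_derE om c dk dW 1 0 x' i cY) /vd_expr !big_ord0 mulr0 mul0r addr0 subr0.
have pdE (f : R -> R) : Ck_on setT 1 f ->
    'D_(delta_mx 0 ord0 : 'rV[R]_1) (fun y : 'rV[R]_1 => f (y 0 ord0)) = fun y => 'D_1 f (y 0 ord0).
  move=> cf; apply/funext => y.
  have := plane_derive (delta_mx 0 ord0 : 'rV[R]_1) (Ck_on_is_derive cf (I : setT (y 0 ord0))).
  by move=> /(@derive_val _ _ _ _ _ _ _) ->; rewrite mxE eqxx mulr1.
have cD a : Ck_on setT 1 ('D_1 (fun y => V y a 0)) by exact: Ck_on_derive (cu a 2%N).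
have x'E : x' 0 ord0 = x by rewrite mxE.
have pd1 a : 'D_(delta_mx 0 ord0 : 'rV[R]_1) (fun y => plane V y a 0) x' = 'D_1 (fun y => V y a 0) x.
  by rewrite -[in RHS]x'E; exact: (congr1 (fun f => f x') (pdE _ (cu a 1%N))).
have pd2 a : 'D_(delta_mx 0 ord0 : 'rV[R]_1) ('D_(delta_mx 0 ord0 : 'rV[R]_1) (fun y => plane V y a 0)) x'
    = 'D_1 ('D_1 (fun y => V y a 0)) x.
  rewrite -[in RHS]x'E; have h : 'D_(delta_mx 0 ord0 : 'rV[R]_1) (fun y => plane V y a 0) = _
    := pdE _ (cu a 1%N).
  rewrite h; exact: (congr1 (fun f => f x') (pdE _ (cD a))).
rewrite (pd2 0) (pd2 1) (pd1 0) (pd1 1) /plane x'E -/(u0 x) -/(u1 x) -/u0 -/u1.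
move: (u0 x) (u1 x) ('D_1 u0 x) ('D_1 u1 x) ('D_1 ('D_1 u0) x) ('D_1 ('D_1 u1) x) => v0 v1 a0 a1 b0 b1.
by rewrite !mul1r !mul0r !addr0 !subr0.
Qed.

Variables (D : set P4) (Vf : P4 -> R -> 'cV[R]_2) (Xf xif : P4 -> R).
Hypothesis family : smooth_profile_family kappa Wp D Vf Xf xif.

Local Notation DR := (D `*` [set: R]).

Definition sm (G : P4 * R -> R) := forall m, Ck_on DR m G.
Definition Dx (G : P4 * R -> R) : P4 * R -> R := 'D_((0, 1) : P4 * R) G.
Definition Dj (j : 'I_4) (G : P4 * R -> R) : P4 * R -> R := 'D_((delta_mx 0 j, 0) : P4 * R) G.

Lemma sm_Dx G : sm G -> sm (Dx G).
Proof. by move=> sG m; exact: Ck_on_derive (sG m.+1). Qed.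

Lemma sm_Dj j G : sm G -> sm (Dj j G).
Proof. by move=> sG m; exact: Ck_on_derive (sG m.+1). Qed.

Let oD : open D. Proof. by case: family. Qed.

Lemma open_DR : open DR.
Proof.
rewrite openE => -[p y] [Dp _]; exists (D, setT) => //=.
by split; [exact: open_nbhs_nbhs | exact: filterT].
Qed.

Lemma slice_x G p (y : R) : sm G -> D p -> is_derive y 1 (fun y => G (p, y)) (Dx G (p, y)).
Proof.
move=> sG Dp; have /is_derive_lineE h : is_derive (p, y) ((0, 1) : P4 * R) G (Dx G (p, y)).
  by apply: Ck_on_is_derive (sG 1%N) _; split.
apply/is_derive_lineE; apply: is_derive_ext h => t.
suff -> : t *: ((0, 1) : P4 * R) + (p, y) = (p, t%:A + y) by [].
by congr pair; rewrite /= ?scaler0 ?add0r.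
Qed.

Lemma slice_j G (j : 'I_4) p (t y : R) : sm G -> D (t *: delta_mx 0 j + p) ->
  is_derive t 1 (fun t => G (t *: delta_mx 0 j + p, y)) (Dj j G (t *: delta_mx 0 j + p, y)).
Proof.
move=> sG Dp; set pt := (t *: delta_mx 0 j + p).
have /is_derive_lineE h : is_derive (pt, y) ((delta_mx 0 j, 0) : P4 * R) G (Dj j G (pt, y)).
  by apply: Ck_on_is_derive (sG 1%N) _; split.
apply/is_derive_lineE; apply: is_derive_ext h => s.
congr (G (_, _)); last by rewrite /= scaler0 add0r.
by rewrite /pt /= -[s%:A]/(s * 1) mulr1 scalerDl addrA.
Qed.

Lemma Dj_Dx G j p y : sm G -> D p -> Dj j (Dx G) (p, y) = Dx (Dj j G) (p, y).
Proof. by move=> sG Dp; apply: (derive_comm _ _ open_DR) => //; split. Qed.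

Lemma joint G (j : 'I_4) p y : sm G -> D p ->
  {for (0, y), continuous (fun z : R * R => G (z.1 *: delta_mx 0 j + p, z.2))}.
Proof.
move=> sG Dp.
apply: (@continuous_comp _ _ _ (fun z : R * R => (z.1 *: delta_mx 0 j + p, z.2)) G).
  have h2 : z.2 @[z --> nbhs ((0, y) : R * R)] --> y by exact: cvg_snd.
  have h1 : z.1 *: delta_mx 0 j + p @[z --> nbhs ((0, y) : R * R)] --> (0 : R) *: delta_mx 0 j + p.
    apply: cvgD; last exact: cvg_cst.
    by apply: cvgZr_tmp; exact: cvg_fst.
  exact: (cvg_pair h1 h2).
rewrite /= scale0r add0r; apply: Ck_on_continuous (sG 0%N) _ _; by split.
Qed.

Definition F (i : 'I_2) (q : P4 * R) : R := Vf q.1 q.2 i 0.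

Lemma sm_F i : sm (F i).
Proof.
move=> m; case: family => _ h _ _ _; have := h m; rewrite Ck_on_mxP; last exact: open_DR.
exact.
Qed.

Lemma family_D1 (G : P4 * R -> R) p : sm G -> D p -> 'D_1 (fun y : R => G (p, y)) = fun y => Dx G (p, y).
Proof. by move=> sG Dp; apply/funext => y; exact: (@derive_val _ _ _ _ _ _ _ (slice_x y sG Dp)). Qed.

Lemma family_derive1 p y i : D p -> derive1 (Vf p) y i 0 = Dx (F i) (p, y).
Proof.
move=> Dp; rewrite derive1E.
have cV : derivable (Vf p) y 1.
  apply/derivable_mxP => a b; rewrite ord1.
  by have [] := slice_x y (sm_F a) Dp.
by rewrite (derive_mx cV) mxE; exact: (@derive_val _ _ _ _ _ _ _ (slice_x y (sm_F i) Dp)).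
Qed.

(** The family is described only at points of the form [params]; this brings a displaced parameter
    into that form. *)
Lemma params_shift (om c mu mx : R) (j : 'I_4) (t : R) : t *: delta_mx 0 j + params om c mu mx =
  params (om + t * (j == 0%N :> nat)%:R) (c + t * (j == 1%N :> nat)%:R)
    (mu + t * (j == 2%N :> nat)%:R) (mx + t * (j == 3%N :> nat)%:R).
Proof.
apply/rowP => m; rewrite !mxE eqxx /= -[m == j]/(val m == val j) eq_sym.
by case: m => -[|[|[|[|//]]]] hm /=; rewrite addrC.
Qed.

Lemma expJ0 (t : R) (v : 'cV[R]_2) : (expJ t *m v) 0 0 = cos t * v 0 0 + sin t * v 1 0.
Proof.
rewrite /expJ mulmxDl mul_scalar_mx -scalemxAl; move: (JmxE0 v) => e.
by rewrite mxE [X in X + _]mxE [X in _ + X]mxE e.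
Qed.

Lemma expJ1 (t : R) (v : 'cV[R]_2) : (expJ t *m v) 1 0 = cos t * v 1 0 - sin t * v 0 0.
Proof.
rewrite /expJ mulmxDl mul_scalar_mx -scalemxAl; move: (JmxE1 v) => e.
by rewrite mxE [X in X + _]mxE [X in _ + X]mxE e mulrN.
Qed.

Local Notation Fp i := (Dx (F i)).
Local Notation Fq i := (Dx (Dx (F i))).

Let sF i := sm_F i.
Let sP i := sm_Dx (sm_F i).
Let sQ i := sm_Dx (sm_Dx (sm_F i)).

Lemma family_vform om c mu mx (i : 'I_2) y : D (params om c mu mx) ->
  let q := (params om c mu mx, y) in
  vform k k1 W1 om c (F 0 q) (F 1 q) (Fp 0 q) (Fp 1 q) (sel i (F 0 q) (F 1 q))
    (sel i (Fp 0 q) (Fp 1 q)) (sel i (Fq 0 q) (Fq 1 q)) (sel i (Fp 1 q) (- Fp 0 q)) = 0.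
Proof.
move=> Dp q; case: family => _ _ _ _ /(_ _ _ _ _ Dp)[prof _].
have := profile_vform i y prof; rewrite /= -/(F 0 q) -/(F 1 q).
have e a : 'D_1 (fun y => Vf (params om c mu mx) y a 0) = fun y => Fp a (params om c mu mx, y).
  exact: (family_D1 (sF a) Dp).
have e1 a : 'D_1 (fun y => Vf (params om c mu mx) y a 0) y = Fp a q.
  exact: (congr1 (fun f => f y) (e a)).
have e2 a : 'D_1 ('D_1 (fun y => Vf (params om c mu mx) y a 0)) y = Fq a q.
  exact: (etrans (congr1 (fun f => 'D_1 f y) (e a)) (congr1 (fun f => f y) (family_D1 (sP a) Dp))).
by rewrite (e2 0) (e2 1) (e1 0) (e1 1).
Qed.

Let dotJ p y : D p -> dotp (Jmx *m Vf p y) (derive1 (Vf p) y) =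
  F 1 (p, y) * Fp 0 (p, y) - F 0 (p, y) * Fp 1 (p, y).
Proof. by move=> Dp; rewrite /dotp sum2 !JmxE !family_derive1 // mulNr. Qed.

Let sqnF p y : sqn (Vf p y) = F 0 (p, y) * F 0 (p, y) + F 1 (p, y) * F 1 (p, y).
Proof. exact: sqnE. Qed.

Lemma family_constants om c mu mx y : D (params om c mu mx) ->
  let q := (params om c mu mx, y) in let s := F 0 q * F 0 q + F 1 q * F 1 q in
  mu = k s * (F 1 q * Fp 0 q - F 0 q * Fp 1 q) + c / 2 * s /\
  mx = 2^-1 * k s * (Fp 0 q * Fp 0 q + Fp 1 q * Fp 1 q) - W s + om / 2 * s.
Proof.
move=> Dp q s; case: family => _ _ _ _ /(_ _ _ _ _ Dp)[_ /(_ y)].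
rewrite kappaE ?WpE ?sqn_ge0 // dotJ // sqnF -/q -/s.
by rewrite /sqn /dotp sum2 !family_derive1.
Qed.

Lemma family_rotation om c mu mx y : D (params om c mu mx) ->
  let p := params om c mu mx in
  [/\ 0 < Xf p, F 0 (p, y + Xf p) = cos (xif p) * F 0 (p, y) + sin (xif p) * F 1 (p, y)
    & F 1 (p, y + Xf p) = cos (xif p) * F 1 (p, y) - sin (xif p) * F 0 (p, y)].
Proof.
move=> Dp p; case: family => _ _ _ _ /(_ _ _ _ _ Dp)[[_ _ X0 hX _] _].
by split => //; rewrite /F /= hX ?expJ0 ?expJ1.
Qed.

Lemma period_integralE (f : R -> R) (X : R) : 0 < X -> continuous f -> period_integral X f = prim f X.
Proof.
move=> X0 cf; have [p0 dp] := primP cf.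
by rewrite (period_integral_prim X0 cf dp) p0 subr0.
Qed.

Section Base.
Variables (om c muphi mux : R).
Local Notation p0 := (params om c muphi mux).
Hypothesis D0 : D p0.

Let c_slice G p : sm G -> D p -> continuous (fun y => G (p, y)).
Proof. by move=> sG Dp y; exact: is_derive1_continuous (slice_x y sG Dp). Qed.

Section Direction.
Variable j : 'I_4.
Local Notation e := (delta_mx 0 j : P4).
Local Notation pt t := (t *: e + p0).
Local Notation Fl G := (fun t y => G (pt t, y)).
Let w0 : R := (j == 0%N :> nat)%:R.
Let w1 : R := (j == 1%N :> nat)%:R.
Let w2 : R := (j == 2%N :> nat)%:R.
Let w3 : R := (j == 3%N :> nat)%:R.

Let ptE t : pt t = params (om + t * w0) (c + t * w1) (muphi + t * w2) (mux + t * w3).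
Proof. exact: params_shift. Qed.

Let pt0 : pt 0 = p0. Proof. by rewrite scale0r add0r. Qed.

Let ball_exists : exists2 d : R, 0 < d & forall t : R, `|t| < d -> D (pt t).
Proof.
have [d d0 hd] := near0_plane 0 e oD D0; exists d => // t td.
by have := hd 0 t; rewrite scaler0 add0r normr0; apply.
Qed.

Let dXf (f : P4 -> R) : smooth_on D f -> is_derive (0 : R) 1 (fun t : R => f (pt t)) ('D_e f p0 : R).
Proof.
move=> sf; have h : is_derive p0 e f ('D_e f p0) by apply: (Ck_on_is_derive (sf 1%N)).
exact: ((is_derive_lineE f p0 e _).1 h).
Qed.

Lemma direction_lop (i : 'I_2) y :
  lop k k1 k2 W1 W2 om c (fun y => F 0 (p0, y)) (fun y => F 1 (p0, y)) (fun y => Fp 0 (p0, y))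
    (fun y => Fp 1 (p0, y)) (fun y => Fq 0 (p0, y)) (fun y => Fq 1 (p0, y)) i y
    (Dj j (F 0) (p0, y)) (Dj j (F 1) (p0, y)) (Dj j (Fp 0) (p0, y)) (Dj j (Fp 1) (p0, y))
    (Dj j (Fq 0) (p0, y)) (Dj j (Fq 1) (p0, y)) =
  w0 * sel i (F 0 (p0, y)) (F 1 (p0, y)) + w1 * sel i (Fp 1 (p0, y)) (- Fp 0 (p0, y)).
Proof.
have [d d0 hd] := ball_exists.
have tG G (t y' : R) : sm G -> `|t| < d -> is_derive t 1 (fun t => G (pt t, y')) (Dj j G (pt t, y')).
  by move=> sG td; apply: slice_j => //; exact: hd.
have tG0 G (y' : R) : sm G -> is_derive (0 : R) 1 (fun t => G (pt t, y')) (Dj j G (p0, y')).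
  by move=> sG; have := tG G 0 y' sG; rewrite pt0 normr0; apply.
have h := lop_parE (om := om) (c := c) (w0 := w0) (w1 := w1) dk dk1 dW1 d0
  (fun t y => tG _ t y (sF 0)) (fun t y => tG _ t y (sF 1)) (fun t y => tG _ t y (sP 0))
  (fun t y => tG _ t y (sP 1)) (fun y => tG0 _ y (sQ 0)) (fun y => tG0 _ y (sQ 1)).
have := h _ _ i y; rewrite pt0; apply.
- move=> t y' td; have := hd t td; rewrite ptE => Dt; exact: (family_vform 0 y' Dt).
- move=> t y' td; have := hd t td; rewrite ptE => Dt; exact: (family_vform 1 y' Dt).
Qed.

Lemma direction_lfun (a : 'I_2) y :
  \sum_i lfun k k1 W1 om c (fun y => F 0 (p0, y)) (fun y => F 1 (p0, y)) (fun y => Fp 0 (p0, y))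
    (fun y => Fp 1 (p0, y)) a i y * stt (fun y => Dj j (F 0) (p0, y)) (fun y => Dj j (F 1) (p0, y))
    (fun y => Dj j (Fp 0) (p0, y)) (fun y => Dj j (Fp 1) (p0, y)) i y =
  (if a == 0 then w2 else w3) - (if a == 0 then w1 else w0)
    * ((F 0 (p0, y) * F 0 (p0, y) + F 1 (p0, y) * F 1 (p0, y)) / 2).
Proof.
have [d d0 hd] := ball_exists.
have tG G (t y' : R) : sm G -> `|t| < d -> is_derive t 1 (fun t => G (pt t, y')) (Dj j G (pt t, y')).
  by move=> sG td; apply: slice_j => //; exact: hd.
have h := lfun_parE (om := om) (c := c) (mu := muphi) (mx := mux) (w0 := w0) (w1 := w1)
  (w2 := w2) (w3 := w3) dk dW d0
  (fun t y => tG _ t y (sF 0)) (fun t y => tG _ t y (sF 1)) (fun t y => tG _ t y (sP 0))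
  (fun t y => tG _ t y (sP 1)).
have := h _ _ a y; rewrite pt0; apply.
- move=> t y' td; have := hd t td; rewrite ptE => Dt; exact: (family_constants y' Dt).1.
- move=> t y' td; have := hd t td; rewrite ptE => Dt; exact: (family_constants y' Dt).2.
Qed.

Let dXif : is_derive (0 : R) 1 (fun t => xif (pt t)) ('D_e xif p0).
Proof. by apply: dXf; case: family. Qed.

Let dXX : is_derive (0 : R) 1 (fun t => Xf (pt t)) ('D_e Xf p0).
Proof. by apply: dXf; case: family. Qed.

Lemma direction_quasiperiodic y :
  Dj j (F 0) (p0, y + Xf p0) + 'D_e Xf p0 * Fp 0 (p0, y + Xf p0) =
    cos (xif p0) * (Dj j (F 0) (p0, y) + 'D_e xif p0 * F 1 (p0, y))
    + sin (xif p0) * (Dj j (F 1) (p0, y) - 'D_e xif p0 * F 0 (p0, y)) /\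
  Dj j (F 1) (p0, y + Xf p0) + 'D_e Xf p0 * Fp 1 (p0, y + Xf p0) =
    cos (xif p0) * (Dj j (F 1) (p0, y) - 'D_e xif p0 * F 0 (p0, y))
    - sin (xif p0) * (Dj j (F 0) (p0, y) + 'D_e xif p0 * F 1 (p0, y)).
Proof.
have [d d0 hd] := ball_exists.
have tG G (t y' : R) : sm G -> `|t| < d -> is_derive t 1 (fun t => G (pt t, y')) (Dj j G (pt t, y')).
  by move=> sG td; apply: slice_j => //; exact: hd.
have xG G (t y' : R) : sm G -> `|t| < d -> is_derive y' 1 (fun y => G (pt t, y)) (Dx G (pt t, y')).
  by move=> sG td; apply: slice_x => //; exact: hd.
split.
- have h := A0X (U0 := Fl (F 0)) (U1 := Fl (F 1)) d0 (fun t y => xG _ t y (sF 0)) (fun t y => tG _ t y (sF 0))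
    (fun t y => tG _ t y (sF 1)) (fun y => joint (j := j) (y := y) (sP 0) D0) dXX dXif.
  have := h _ y; rewrite pt0; apply.
  by move=> t y' td; have := hd t td; rewrite ptE => Dt; have [] := family_rotation y' Dt.
- have h := A1X (U0 := Fl (F 0)) (U1 := Fl (F 1)) d0 (fun t y => xG _ t y (sF 1)) (fun t y => tG _ t y (sF 0))
    (fun t y => tG _ t y (sF 1)) (fun y => joint (j := j) (y := y) (sP 1) D0) dXX dXif.
  have := h _ y; rewrite pt0; apply.
  by move=> t y' td; have := hd t td; rewrite ptE => Dt; have [] := family_rotation y' Dt.
Qed.

Lemma direction_mass : 'D_e (fun q => mass_integral (Vf q) (Xf q)) p0 =
  prim (fun y => F 0 (p0, y) * Dj j (F 0) (p0, y) + F 1 (p0, y) * Dj j (F 1) (p0, y)) (Xf p0)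
  + (F 0 (p0, 0) * F 0 (p0, 0) + F 1 (p0, 0) * F 1 (p0, 0)) / 2 * 'D_e Xf p0.
Proof.
have [d d0 hd] := ball_exists.
have tG G (t y' : R) : sm G -> `|t| < d -> is_derive t 1 (fun t => G (pt t, y')) (Dj j G (pt t, y')).
  by move=> sG td; apply: slice_j => //; exact: hd.
have xG G (t y' : R) : sm G -> `|t| < d -> is_derive y' 1 (fun y => G (pt t, y)) (Dx G (pt t, y')).
  by move=> sG td; apply: slice_x => //; exact: hd.
have X0 t : `|t| < d -> 0 < Xf (pt t).
  by move=> td; have := hd t td; rewrite ptE => Dt; have [] := family_rotation 0 Dt.
have h := mass_derive (U0 := Fl (F 0)) (U1 := Fl (F 1)) (xit := fun t => xif (pt t)) d0
  (fun t y => xG _ t y (sF 0)) (fun t y => xG _ t y (sF 1)) (fun t y => tG _ t y (sF 0))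
  (fun t y => tG _ t y (sF 1)) (fun y => joint (j := j) (y := y) (sF 0) D0) (fun y => joint (j := j) (y := y) (sF 1) D0)
  (fun y => joint (j := j) (y := y) (sm_Dj j (sF 0)) D0) (fun y => joint (j := j) (y := y) (sm_Dj j (sF 1)) D0) dXX X0.
have hh := h _ _; rewrite pt0 in hh.
apply: derive_val; apply/is_derive_lineE; apply: is_derive_near (hh _ _).
- exists d => //= t /=; rewrite distrC subr0 => td; have Dt := hd t td.
  have fE : (fun x => 2^-1 * sqn (Vf (pt t) x)) =
      fun x => 2^-1 * (F 0 (pt t, x) * F 0 (pt t, x) + F 1 (pt t, x) * F 1 (pt t, x)).
    by apply/funext => y; rewrite sqnF.
  rewrite /mass_integral fE period_integralE ?X0 //.
  have c0 := c_slice (sF 0) Dt; have c1 := c_slice (sF 1) Dt; cont.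
- by move=> t y' td; have := hd t td; rewrite ptE => Dt; have [] := family_rotation y' Dt.
- by move=> t y' td; have := hd t td; rewrite ptE => Dt; have [] := family_rotation y' Dt.
Qed.

Lemma direction_momentum : 'D_e (fun q => momentum_integral (Vf q) (Xf q)) p0 =
  prim (fun y => Fp 0 (p0, y) * Dj j (F 1) (p0, y) - Fp 1 (p0, y) * Dj j (F 0) (p0, y)) (Xf p0)
  + (F 0 (p0, 0) * F 0 (p0, 0) + F 1 (p0, 0) * F 1 (p0, 0)) / 2 * 'D_e xif p0.
Proof.
have [d d0 hd] := ball_exists.
have tG G (t y' : R) : sm G -> `|t| < d -> is_derive t 1 (fun t => G (pt t, y')) (Dj j G (pt t, y')).
  by move=> sG td; apply: slice_j => //; exact: hd.
have xG G (t y' : R) : sm G -> `|t| < d -> is_derive y' 1 (fun y => G (pt t, y)) (Dx G (pt t, y')).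
  by move=> sG td; apply: slice_x => //; exact: hd.
have X0 t : `|t| < d -> 0 < Xf (pt t).
  by move=> td; have := hd t td; rewrite ptE => Dt; have [] := family_rotation 0 Dt.
have xA i (y' : R) : is_derive y' 1 (fun y => Dj j (F i) (pt 0, y)) (Dj j (Fp i) (pt 0, y')).
  by rewrite pt0 (Dj_Dx j y' (sF i) D0); exact: (slice_x y' (sm_Dj j (sF i)) D0).
have xB i (y' : R) : is_derive y' 1 (fun y => Dj j (Fp i) (pt 0, y)) (Dj j (Fq i) (pt 0, y')).
  by rewrite pt0 (Dj_Dx j y' (sP i) D0); exact: (slice_x y' (sm_Dj j (sP i)) D0).
have jt G y' (sG : sm G) := joint (j := j) (y := y') sG D0.
have h := momentum_derive (U0 := Fl (F 0)) (U1 := Fl (F 1)) d0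
  (fun t y => xG _ t y (sF 0)) (fun t y => xG _ t y (sF 1)) (fun t y => xG _ t y (sP 0))
  (fun t y => xG _ t y (sP 1)) (fun t y => tG _ t y (sF 0)) (fun t y => tG _ t y (sF 1))
  (fun t y => tG _ t y (sP 0)) (fun t y => tG _ t y (sP 1)) (xA 0) (xA 1) (xB 0) (xB 1)
  (fun y => jt _ y (sF 0)) (fun y => jt _ y (sF 1)) (fun y => jt _ y (sP 0)) (fun y => jt _ y (sP 1))
  (fun y => jt _ y (sm_Dj j (sF 0))) (fun y => jt _ y (sm_Dj j (sF 1)))
  (fun y => jt _ y (sm_Dj j (sP 0))) (fun y => jt _ y (sm_Dj j (sP 1))) dXX dXif X0.
have hh := h _ _; rewrite pt0 in hh.
apply: derive_val; apply/is_derive_lineE; apply: is_derive_near (hh _ _).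
- exists d => //= t /=; rewrite distrC subr0 => td; have Dt := hd t td.
  have fE : (fun x => 2^-1 * dotp (Jmx *m Vf (pt t) x) (derive1 (Vf (pt t)) x)) =
      fun x => 2^-1 * (F 1 (pt t, x) * Fp 0 (pt t, x) - F 0 (pt t, x) * Fp 1 (pt t, x)).
    by apply/funext => y; rewrite dotJ.
  rewrite /momentum_integral fE period_integralE ?X0 //.
  have c0 := c_slice (sF 0) Dt; have c1 := c_slice (sF 1) Dt.
  have c2 := c_slice (sP 0) Dt; have c3 := c_slice (sP 1) Dt; cont.
- by move=> t y' td; have := hd t td; rewrite ptE => Dt; have [] := family_rotation y' Dt.
- by move=> t y' td; have := hd t td; rewrite ptE => Dt; have [] := family_rotation y' Dt.
Qed.

End Direction.
End Base.
End ProfileFamily.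

Lemma fundamental_period_unique (R : realType) (f : R -> R) (X Y : R) :
  fundamental_period f X -> fundamental_period f Y -> X = Y.
Proof.
move=> [X0 fX minX] [Y0 fY minY]; apply/eqP; rewrite eq_le.
by apply/andP; split; [exact: minX | exact: minY].
Qed.

(** The period and phase given with the wave and those of the family at its parameters are a priori
    unrelated. For a nonconstant modulus the former is the fundamental period and the latter an
    integral over it, hence they agree. *)
Lemma profile_period_unique (R : realType) (kappa W : R -> R) om c V (X xi Y zeta : R) :
  nonconstant_modulus V -> is_profile kappa W om c V X xi -> is_profile kappa W om c V Y zeta ->
  X = Y /\ xi = zeta.
Proof.
move=> nc [_ _ _ _ /(_ nc)[fX ->]] [_ _ _ _ /(_ nc)[fY ->]].
by have -> := fundamental_period_unique fX fY.
Qed.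

Theorem profile_bloch_mode (R : realType) (kappa Wp k k1 k2 W W1 W2 : R -> R)
  (kappaE : forall s, 0 <= s -> kappa s = k s) (WpE : forall s, 0 <= s -> Wp s = W s)
  (dk : forall s : R, is_derive s 1 k (k1 s)) (dk1 : forall s : R, is_derive s 1 k1 (k2 s))
  (dW : forall s : R, is_derive s 1 W (W1 s)) (dW1 : forall s : R, is_derive s 1 W1 (W2 s))
  (ck2 : continuous k2) (cW2 : continuous W2) (k_gt0 : forall s, 0 <= s -> 0 < k s)
  (om c muphi mux : R) (V : R -> 'cV[R]_2) (X xi : R)
  (profileV : is_profile kappa Wp om c V X xi) (nonconstV : nonconstant_modulus V)
  (D : set 'rV[R]_4) (Vf : 'rV[R]_4 -> R -> 'cV[R]_2) (Xf xif : 'rV[R]_4 -> R)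
  (family : smooth_profile_family kappa Wp D Vf Xf xif)
  (D0 : D (params om c muphi mux)) (Vf_params : Vf (params om c muphi mux) = V)
  (delta : nat -> nat -> nat -> R)
  (deltaP : Delta0_coefficients (Sigma_t Vf Xf xif (params om c muphi mux))
     (Sigma_y kappa V X) delta)
  (d400 : delta 4%N 0%N 0%N != 0)
  (discr : delta 3%N 0%N 1%N ^+ 2 = 4 * delta 4%N 0%N 0%N * delta 2%N 0%N 2%N)
  (nondeg : delta 2%N 1%N 1%N * delta 4%N 0%N 0%N
            - 2^-1 * delta 3%N 1%N 0%N * delta 3%N 0%N 1%N != 0) :
  let u := fun i y => V y i 0 in
  exists p0 p1 q0 q1 : R -> R,
  [/\ forall x : R, is_derive x 1 (u 0) (p0 x), forall x : R, is_derive x 1 (u 1) (p1 x),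
      forall x : R, is_derive x 1 p0 (q0 x), forall x : R, is_derive x 1 p1 (q1 x) &
  exists e z (y : 'I_4 -> R -> R[i]) (mu : R[i]),
  [/\ 0 < e < 1, 0 < complex.Re z,
      is_sol (Mmx k k1 k2 W1 W2 om c (u 0) (u 1) p0 p1 q0 q1) (Nmx k (u 0) (u 1)) (@Emx R) e z y,
      exists i, y i 0 != 0
    & cabs mu = 1 /\ forall i x, y i (x + X) = mu * \sum_m (Rot (cos xi) (sin xi) i m)%:C%C * y m x]].
Proof.
set p := params om c muphi mux in family D0 Vf_params deltaP *.
have [prof _] : is_profile kappa Wp om c (Vf p) (Xf p) (xif p) /\
    has_constants kappa Wp om c muphi mux (Vf p).
  by case: family => _ _ _ _; exact.
rewrite Vf_params in prof; have [EX Exi] := profile_period_unique nonconstV profileV prof.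
move: prof; rewrite -Vf_params {Vf_params} in nonconstV deltaP * => prof.
rewrite {}EX {}Exi {X xi profileV} in deltaP * => u.
have sF i := sm_F family i; have sP i := sm_Dx (sF i); have sQ i := sm_Dx (sP i).
pose P i y := Dx (F Vf i) (p, y); pose Q i y := Dx (Dx (F Vf i)) (p, y).
have dU i (x : R) : is_derive x 1 (u i) (P i x) := slice_x x (sF i) D0.
have dP i (x : R) : is_derive x 1 (P i) (Q i x) := slice_x x (sP i) D0.
have dQ i (x : R) := slice_x x (sQ i) D0.
exists (P 0), (P 1), (Q 0), (Q 1); split => //.
have [X0 _ _] := family_rotation family 0 D0.
have rot0 x : u 0 (x + Xf p) = cos (xif p) * u 0 x + sin (xif p) * u 1 x.
  by have [] := family_rotation family x D0.
have rot1 x : u 1 (x + Xf p) = cos (xif p) * u 1 x - sin (xif p) * u 0 x.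
  by have [] := family_rotation family x D0.
have cs : cos (xif p) * cos (xif p) + sin (xif p) * sin (xif p) = 1.
  by rewrite -!expr2 cos2Dsin2.
have kp x : 0 < k (msq (u 0) (u 1) x).
  by apply: k_gt0; rewrite /msq -!expr2 addr_ge0 // sqr_ge0.
have nc : exists x, u 0 x * P 0 x + u 1 x * P 1 x != 0.
  case: nonconstV => x hx; exists x; move: hx.
  by rewrite /dotp sum2 !(family_derive1 family) .
have cu i : continuous (u i) by move=> x; exact: is_derive1_continuous (dU i x).
have cP i : continuous (P i) by move=> x; exact: is_derive1_continuous (dP i x).
have cks : continuous (fun x => k (msq (u 0) (u 1) x)).
  by move=> x; exact: is_derive1_continuous (dks dk (dU 0) (dU 1) x).
have cs' : continuous (msq (u 0) (u 1)).
  by move=> x; exact: is_derive1_continuous (ds (dU 0) (dU 1) x).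
have c0 := cu 0; have c1 := cu 1; have c2 := cP 0; have c3 := cP 1.
have sqE x : sqn (Vf p x) = msq (u 0) (u 1) x by exact: sqnE.
have dotE x : dotp (Jmx *m Vf p x) (derive1 (Vf p) x) = u 1 x * P 0 x - u 0 x * P 1 x.
  by rewrite /dotp sum2 !JmxE !(family_derive1 family) // mulNr.
have sqdE x : sqn (derive1 (Vf p) x) = P 0 x * P 0 x + P 1 x * P 1 x.
  by rewrite sqnE !(family_derive1 family).
have T1 : period_integral (Xf p) (fun x => kappa (sqn (Vf p x)) * sqn (Vf p x)) =
    prim (fun x => k (msq (u 0) (u 1) x) * msq (u 0) (u 1) x) (Xf p).
  rewrite -period_integralE //; last by cont.
  by congr period_integral; apply/funext => x; rewrite kappaE ?sqn_ge0 // sqE.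
have T2 : period_integral (Xf p) (fun x => kappa (sqn (Vf p x)) * dotp (Jmx *m Vf p x) (derive1 (Vf p) x)) =
    prim (fun x => k (msq (u 0) (u 1) x) * (u 1 x * P 0 x - u 0 x * P 1 x)) (Xf p).
  rewrite -period_integralE //; last by cont.
  by congr period_integral; apply/funext => x; rewrite kappaE ?sqn_ge0 // sqE dotE.
have T3 : period_integral (Xf p) (fun x => kappa (sqn (Vf p x)) * sqn (derive1 (Vf p) x)) =
    prim (fun x => k (msq (u 0) (u 1) x) * (P 0 x * P 0 x + P 1 x * P 1 x)) (Xf p).
  rewrite -period_integralE //; last by cont.
  by congr period_integral; apply/funext => x; rewrite kappaE ?sqn_ge0 // sqE sqdE.
have vf i x := family_vform kappaE WpE dk dW family i x D0.
pose A (i : 'I_2) j y := Dj j (F Vf i) (p, y).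
pose B (i : 'I_2) j y := Dj j (Dx (F Vf i)) (p, y).
pose DD (i : 'I_2) j y := Dj j (Dx (Dx (F Vf i))) (p, y).
have dA i j (x : R) : is_derive x 1 (A i j) (B i j x).
  by rewrite /B (Dj_Dx family j x (sF i) D0); exact: (slice_x x (sm_Dj j (sF i)) D0).
have dB i j (x : R) : is_derive x 1 (B i j) (DD i j x).
  by rewrite /DD (Dj_Dx family j x (sP i) D0); exact: (slice_x x (sm_Dj j (sP i)) D0).
pose ex (j : 'I_4) : 'rV[R]_4 := delta_mx 0 j.
(* The abstract data of [bloch_mode] are the derivatives of the family at the parameters of the
   wave; its hypotheses are the identities of the four [direction_] lemmas together with those of
   the profile. *)
have := bloch_mode (u0 := u 0) (u1 := u 1) (p0 := P 0) (p1 := P 1) (q0 := Q 0) (q1 := Q 1)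
  dk dk1 dW1 ck2 cW2 (dU 0) (dU 1) (dP 0) (dP 1) (dQ 0) (dQ 1) kp (vf 0) (vf 1) X0 cs rot0 rot1 nc
  (a0 := A 0) (a1 := A 1) (b0 := B 0) (b1 := B 1) (d0 := DD 0) (d1 := DD 1)
  (xi := fun j => 'D_(ex j) xif p) (Xp := fun j => 'D_(ex j) Xf p)
  (dA 0) (dA 1) (dB 0) (dB 1) _ _ _ _ _ _ _ _ _ _ _ _ _ _ deltaP d400 discr nondeg.
apply.
- move=> j x; rewrite (direction_lop kappaE WpE dk dk1 dW dW1 family D0 j 0 x) /sel /=.
  by case: j => -[|[|[|[|//]]]] hj /=; rewrite ?mul1r ?mul0r ?addr0 ?add0r.
- move=> j x; rewrite (direction_lop kappaE WpE dk dk1 dW dW1 family D0 j 1 x) /sel /=.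
  by case: j => -[|[|[|[|//]]]] hj /=; rewrite ?mul1r ?mul0r ?addr0 ?add0r.
- move=> a j; rewrite (direction_lfun kappaE WpE dk dW family D0 j a 0).
  by case: (ord2P a) => ->; case: j => -[|[|[|[|//]]]] hj.
- by move=> j x; have [] := direction_quasiperiodic family D0 j x.
- by move=> j x; have [] := direction_quasiperiodic family D0 j x.
- by move=> j; rewrite mxE.
- by move=> j; rewrite mxE.
- move=> j; rewrite mxE inordK //=.
  by rewrite (direction_mass family D0 j).
- move=> j; rewrite mxE inordK //=.
  by rewrite (direction_momentum family D0 j).
- by move=> i j; rewrite mxE; case: i => -[|[|[|[|//]]]] hi; case: j => -[|[|[|[|//]]]] hj.
- by rewrite mxE inordK //= T1.
- by rewrite mxE inordK //= T2.
- by rewrite mxE inordK //= T2.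
- by rewrite mxE inordK //= T3.
Qed.

(** * Weyl's criterion *)

Section SquareNorm.
Context {R : realType} {n : nat}.
Local Notation C := R[i].
Local Notation cf := (@cfield R n).
Local Notation T := (n.+1.-tuple (measurableTypeR R)).
Local Notation mu := (lebesgue_Rn R n.+1).
Implicit Types (u v f : cf).

Definition sqm (w : 'cV[C]_2) : R := \sum_i (complex.Re (w i 0) ^+ 2 + complex.Im (w i 0) ^+ 2).

Lemma sqm_ge0 w : 0 <= sqm w.
Proof. by apply: sumr_ge0 => i _; apply: addr_ge0; exact: sqr_ge0. Qed.

Lemma sqm_add (w z : 'cV[C]_2) : sqm (w + z) <= 2 * sqm w + 2 * sqm z.
Proof.
rewrite /sqm !mulr_sumr -big_split /=; apply: ler_sum => i _; rewrite !mxE.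
case: (w i 0) (z i 0) => a b [c d] /=.
have h1 := sqr_ge0 (a - c); have h2 := sqr_ge0 (b - d); rewrite !expr2 in h1 h2 *; lra.
Qed.

Lemma sqm_scale (l : C) (w : 'cV[C]_2) :
  sqm (l *: w) = (complex.Re l ^+ 2 + complex.Im l ^+ 2) * sqm w.
Proof.
rewrite /sqm mulr_sumr; apply: eq_bigr => i _; rewrite !mxE.
by case: l (w i 0) => a b [c d] /=; ring.
Qed.

Lemma sqmN (w : 'cV[C]_2) : sqm (- w) = sqm w.
Proof. by rewrite -scaleN1r sqm_scale /= oppr0; ring. Qed.

Lemma L2sqE u : L2sq u = (\int[mu]_t (sqm (u (row_of t)))%:E)%E.
Proof. by []. Qed.

Lemma sqm_measurable u : measurable_cfield u ->
  measurable_fun setT (fun t : T => sqm (u (row_of t))).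
Proof.
move=> mu_; rewrite /sqm; under eq_fun do rewrite sum2.
by apply: measurable_funD; apply: measurable_funD; apply: measurable_funX; case: (mu_ 0); case: (mu_ 1).
Qed.

Lemma measurable_add u v : measurable_cfield u -> measurable_cfield v ->
  measurable_cfield (fun x => u x + v x).
Proof.
move=> mu_ mv i; have [u1 u2] := mu_ i; have [v1 v2] := mv i.
have e1 : (fun t : T => complex.Re ((u (row_of t) + v (row_of t)) i 0)) =
  (fun t : T => complex.Re (u (row_of t) i 0) + complex.Re (v (row_of t) i 0)).
  by apply/funext => t; rewrite mxE; case: (u _ i 0) (v _ i 0) => a b [].
have e2 : (fun t : T => complex.Im ((u (row_of t) + v (row_of t)) i 0)) =
  (fun t : T => complex.Im (u (row_of t) i 0) + complex.Im (v (row_of t) i 0)).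
  by apply/funext => t; rewrite mxE; case: (u _ i 0) (v _ i 0) => a b [].
by rewrite e1 e2; split; apply: measurable_funD.
Qed.

Lemma measurable_scale (l : C) u : measurable_cfield u -> measurable_cfield (fun x => l *: u x).
Proof.
move=> mu_ i; have [u1 u2] := mu_ i; case: l => a b.
have e1 : (fun t : T => complex.Re (((Complex a b) *: u (row_of t)) i 0)) =
  (fun t : T => a * complex.Re (u (row_of t) i 0) - b * complex.Im (u (row_of t) i 0)).
  by apply/funext => t; rewrite mxE; case: (u _ i 0).
have e2 : (fun t : T => complex.Im (((Complex a b) *: u (row_of t)) i 0)) =
  (fun t : T => a * complex.Im (u (row_of t) i 0) + b * complex.Re (u (row_of t) i 0)).
  by apply/funext => t; rewrite mxE; case: (u _ i 0).
by rewrite e1 e2; split; [apply: measurable_funB | apply: measurable_funD]; apply: measurable_funM.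
Qed.

Lemma L2sq_add u v : measurable_cfield u -> measurable_cfield v ->
  (L2sq (fun x => (u x + v x)%R) <= 2%:E * L2sq u + 2%:E * L2sq v)%E.
Proof.
move=> mu_ mv.
have m1 := sqm_measurable mu_; have m2 := sqm_measurable mv.
have nn w : forall t : T, setT t -> (0 <= (sqm (w (row_of t)))%:E)%E by move=> t _; rewrite lee_fin sqm_ge0.
have nn2 w : forall t : T, setT t -> (0 <= 2%:E * (sqm (w (row_of t)))%:E)%E.
  by move=> t _; rewrite -EFinM lee_fin mulr_ge0 ?sqm_ge0.
have Z w : measurable_fun setT (fun t : T => sqm (w (row_of t))) ->
    (2%:E * L2sq w = \int[mu]_t (2%:E * (sqm (w (row_of t)))%:E))%E.
  by move=> mw; rewrite L2sqE ge0_integralZl //; [exact/measurable_EFinP | exact: nn].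
rewrite !Z // L2sqE.
have mm w : measurable_fun setT (fun t : T => sqm (w (row_of t))) ->
    measurable_fun setT (fun t : T => (2%:E * (sqm (w (row_of t)))%:E)%E).
  by move=> mw; under eq_fun do rewrite -EFinM; apply/measurable_EFinP; apply: measurable_funM.
rewrite -ge0_integralD //; [|exact: nn2|exact: mm|exact: nn2|exact: mm].
apply: ge0_le_integral => //.
- by move=> t _; rewrite lee_fin sqm_ge0.
- by apply/measurable_EFinP; apply: (@sqm_measurable (fun x => u x + v x)); exact: measurable_add.
- by apply: emeasurable_funD; exact: mm.
- by move=> t _; rewrite -!EFinM -EFinD lee_fin sqm_add.
Qed.

Lemma L2sq_scale (l : C) u : measurable_cfield u -> (L2sq u < +oo)%E ->
  (L2sq (fun x => l *: u x) < +oo)%E.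
Proof.
move=> mu_ fu; rewrite L2sqE.
under eq_integral do rewrite sqm_scale EFinM.
rewrite ge0_integralZl //.
- by rewrite lte_mul_pinfty // lee_fin; apply: addr_ge0; exact: sqr_ge0.
- by apply/measurable_EFinP; exact: sqm_measurable.
- by move=> t _; rewrite lee_fin sqm_ge0.
- by rewrite lee_fin; apply: addr_ge0; exact: sqr_ge0.
Qed.

Lemma in_L2_add u v : in_L2 u -> in_L2 v -> in_L2 (fun x => u x + v x).
Proof.
move=> [mu_ fu] [mv fv]; split; first exact: measurable_add.
apply: le_lt_trans (L2sq_add mu_ mv) _.
by apply: lte_add_pinfty; apply: lte_mul_pinfty.
Qed.

Lemma in_L2_scale l u : in_L2 u -> in_L2 (fun x => l *: u x).
Proof. by move=> [mu_ fu]; split; [exact: measurable_scale | exact: L2sq_scale]. Qed.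

(* The solution [u] of [lambda u - T u = f] with [f = lambda v - T v] differs from
   [v] by an element of the kernel. *)
Lemma resolvent_bound (A : cf -> cf) (l : C) :
  (forall u v, test_cfield u -> test_cfield v ->
     test_cfield (fun x => u x - v x) /\ A (fun x => u x - v x) = fun x => A u x - A v x) ->
  in_resolvent_set A l -> exists K : R, forall v, test_cfield v -> in_L2 v ->
    in_L2 (fun x => l *: v x - A v x) ->
    (L2sq v <= 2%:E * (K%:E * L2sq (fun x => (l *: v x - A v x)%R)))%E.
Proof.
move=> subA [ker [K hK]]; exists K => v tv Lv Lf.
set f := (fun x => _ - _) in Lf *.
have [u [Lu _ [w [tw wu Awu]]] uf] := hK f Lf.
have Nv : in_L2 (fun x => - v x).
  have := in_L2_scale (- 1) Lv; rewrite (_ : (fun x => _) = (fun x => - v x)) //.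
  by apply/funext => x; rewrite scaleN1r.
have Luv : in_L2 (fun x => u x - v x) := in_L2_add Lu Nv.
have h0 : L2sq (fun x => u x - v x) = 0%E.
  apply: ker; split => //; first exact: (in_L2_scale l Luv).
  exists (fun m x => w m x - v x); split.
  - by move=> m; exact: (subA _ _ (tw m) tv).1.
  - suff -> : (fun m => L2sq (fun x => w m x - v x - (u x - v x))) =
        (fun m => L2sq (fun x => w m x - u x)) by exact: wu.
    apply/funext => m; congr L2sq; apply/funext => x.
    by rewrite opprB addrA subrK.
  - suff -> : (fun m => L2sq (fun x => A (fun x => w m x - v x) x - l *: (u x - v x))) =
        (fun m => L2sq (fun x => A (w m) x - (l *: u x - f x))) by exact: Awu.
    apply/funext => m; congr L2sq; apply/funext => x.
    rewrite (subA _ _ (tw m) tv).2 /f scalerBr !opprB -!addrA; congr (_ + _).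
    by rewrite addrCA.
have vE : v = fun x => u x + - (u x - v x) by apply/funext => x; rewrite opprB addrCA subrr addr0.
have Nuv : measurable_cfield (fun x => - (u x - v x)).
  have := measurable_scale (- 1) Luv.1; rewrite (_ : (fun x => _) = (fun x => - (u x - v x))) //.
  by apply/funext => x; rewrite scaleN1r.
have hN : L2sq (fun x => - (u x - v x)) = 0%E.
  by rewrite -h0 !L2sqE; apply: eq_integral => t _; rewrite sqmN.
rewrite [in leLHS]vE; apply: le_trans (L2sq_add Lu.1 Nuv) _.
by rewrite hN mule0 adde0 lee_pmul2l // ?lte_fin.
Qed.

End SquareNorm.

(** * Measurability of continuous functions on tuples *)

Section ContinuousMeasurable.
Context {R : realType} {m : nat}.
Local Notation T := (m.-tuple (measurableTypeR R)).

Lemma measurable_all_coord (A : 'I_m -> set R) : (forall j, measurable (A j)) ->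
  measurable [set t : T | forall j, A j (tnth t j)].
Proof.
move=> mA; have -> : [set t : T | forall j, A j (tnth t j)] =
    \bigcap_(j in [set: 'I_m]) ((fun t : T => tnth t j) @^-1` A j).
  by apply/seteqP; split => [t ht j _|t ht j] /=; [exact: ht | exact: (ht j)].
apply: fin_bigcap_measurable; first exact: finite_finset.
by move=> j _; have := @measurable_tnth _ (measurableTypeR R) m j measurableT _ (mA j); rewrite setTI.
Qed.

Definition round (k : nat) (s : R) : R := (Num.floor (k.+1%:R * s))%:~R / k.+1%:R.

Lemma round_dist k s : `|s - round k s| <= k.+1%:R^-1.
Proof.
have k0 : (0 : R) < k.+1%:R by rewrite ltr0n.
have /andP[h1 h2] := Num.Theory.floor_itv (k.+1%:R * s).
rewrite intrD in h2; rewrite /round -(ler_pM2r k0) mulVf ?gt_eqF // -[X in _ * X]gtr0_norm // -normrM.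
rewrite mulrBl divfK ?gt_eqF // ler_norml; rewrite [s * _]mulrC.
by apply/andP; split; lra.
Qed.

Lemma floor_level_measurable k (z : int) : measurable [set s : R | Num.floor (k.+1%:R * s) = z].
Proof.
have k0 : (0 : R) < k.+1%:R by rewrite ltr0n.
rewrite (_ : [set s | _] = [set` `[z%:~R / k.+1%:R, (z + 1)%:~R / k.+1%:R[]) //.
apply/seteqP; split => s /=; rewrite in_itv /= ler_pdivrMr // ltr_pdivlMr // mulrC.
  by move=> <-; exact: floor_itv.
by move=> /floor_def.
Qed.

(** Measurability refers to the product sigma-algebra of tuples, continuity to the norm of rows.
    Rounding the coordinates to a grid gives functions that are constant on countably many
    measurable boxes and converge pointwise by continuity. *)
Lemma measurable_continuous_row (g : 'rV[R]_m -> R) : continuous g ->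
  measurable_fun setT (fun t : T => g (row_of t)).
Proof.
move=> cg.
pose h k (t : T) : R := g (row_of (map_tuple (round k) t)).
apply: (@measurable_fun_cvg _ _ _ _ h).
- move=> k _ Y mY; rewrite setTI.
  pose G (v : m.-tuple int) : R := g (row_of (map_tuple (fun z : int => z%:~R / k.+1%:R) v)).
  have -> : h k @^-1` Y = \bigcup_(v in [set v | Y (G v)])
      [set t : T | forall j, [set s : R | Num.floor (k.+1%:R * s) = tnth v j] (tnth t j)].
    apply/seteqP; split => t /=.
      move=> ht; exists (map_tuple (fun s : R => Num.floor (k.+1%:R * s)) t); last by move=> j; rewrite tnth_map.
      rewrite /= /G; move: ht; rewrite /h /preimage /=; congr (Y (g _)).
      by apply/rowP => j; rewrite !mxE !tnth_map.
    move=> [v /= Yv hv]; rewrite /preimage /=; move: Yv; rewrite /h /G; congr (Y (g _)).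
    by apply/rowP => j; rewrite !mxE !tnth_map /round hv.
  rewrite bigcup_mkcond; apply: countable_bigcupT_measurable; first exact: countableP.
  move=> v; case: ifP => _; last exact: measurable0.
  apply: (@measurable_all_coord (fun j => [set s : R | Num.floor (k.+1%:R * s) = tnth v j])) => j.
  exact: floor_level_measurable.
move=> t _; apply: (@cvg_comp _ _ _ (fun k => row_of (map_tuple (round k) t)) g); last exact: cg.
apply/cvgrPdist_le => e e0; near=> k.
rewrite /Num.norm /= mx_normrE; apply/bigmax_leP; split; first exact: ltW.
move=> [i j] _ /=; rewrite !mxE tnth_map; apply: le_trans (round_dist _ _) _.
apply: ltW; near: k; exact: near_infty_natSinv_lt (PosNum e0).
Unshelve. all: by end_near.
Qed.

End ContinuousMeasurable.

(** * Lebesgue measure of boxes *)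

Section BoxMeasure.
Context {R : realType}.
Local Notation T m := (m.-tuple (measurableTypeR R)).
Local Notation leb := (@lebesgue_measure R).

Definition box (I : nat -> set R) m : set (T m) := [set t | forall j : 'I_m, I j (tnth t j)].
Arguments box I m : clear implicits.

Lemma measurable_box I m : (forall j, measurable (I j)) -> measurable (box I m).
Proof. by move=> mI; apply: (@measurable_all_coord _ _ (fun j : 'I_m => I j)). Qed.

Lemma lebesgue_box I m : (forall j, measurable (I j)) ->
  lebesgue_Rn R m (box I m) = (\prod_(j < m) leb (I j))%E.
Proof.
elim: m I => [|m IH] I mI.
  rewrite big_ord0 /lebesgue_Rn /= /dirac indicE mem_set //.
  by move=> [].
rewrite big_ord_recl -(IH (fun j => I j.+1)) //.
rewrite [LHS]/= /power_step /pushforward.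
have -> : @tuple_cons _ (measurableTypeR R) m @^-1` box I m.+1 = I 0%N `*` box (fun j => I j.+1) m.
  apply/seteqP; split => -[a t] /=.
    move=> h; split; first by have := h ord0; rewrite tnth0.
    by move=> j; have := h (lift ord0 j); rewrite tnthS.
  by move=> [h0 h] j; case: (unliftP ord0 j) => [i ->|->]; rewrite ?tnthS ?tnth0; [exact: h|].
have mb : measurable (box (fun j => I j.+1) m).
  by apply: measurable_box => j; exact: mI.
exact: (product_measure1E leb (power_measure leb m) (mI 0%N) mb).
Qed.

End BoxMeasure.
Arguments box {R} I m _.

(** * Spectrum from approximate eigenfunctions *)

Section Weyl.
Context {R : realType} {n : nat}.
Local Notation C := R[i].
Local Notation cf := (@cfield R n).
Local Notation T := (n.+1.-tuple (measurableTypeR R)).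
Local Notation mu := (lebesgue_Rn R n.+1).
Implicit Types (u v f : cf).

Lemma prod_EFin m (r : R) : (\prod_(j < m) r%:E)%E = (r ^+ m)%:E.
Proof.
elim: m => [|m IH]; first by rewrite big_ord0.
by rewrite big_ord_recl IH exprS EFinM.
Qed.

Definition cube (r : R) : set T := box (fun=> [set` `[- r, r]]) n.+1.

Lemma cube_measurable r : measurable (cube r).
Proof. exact: measurable_box. Qed.

Lemma lebesgue_cube r : 0 < r -> mu (cube r) = ((2 * r) ^+ n.+1)%:E.
Proof.
move=> r0; rewrite /cube lebesgue_box //.
rewrite -prod_EFin; apply: eq_bigr => j _.
rewrite lebesgue_measure_itv /= lte_fin gtrN // -EFinB; congr (_%:E); ring.
Qed.

Lemma L2sq_upper f (K r : R) : 0 <= K -> 0 < r -> measurable_cfield f ->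
  (forall x : 'rV[R]_n.+1, (exists j, r < `|x 0 j|) -> f x = 0) -> (forall x, sqm (f x) <= K) ->
  (L2sq f <= (K * (2 * r) ^+ n.+1)%:E)%E.
Proof.
move=> K0 r0 mf supp fK; rewrite EFinM -lebesgue_cube // L2sqE.
rewrite -integral_cst; last exact: cube_measurable.
rewrite [leRHS]integral_mkcond.
apply: ge0_le_integral => //.
- by move=> t _; rewrite lee_fin sqm_ge0.
- by apply/measurable_EFinP; exact: sqm_measurable.
- apply/(measurable_restrictT _ _).1 => //; exact: cube_measurable.
- move=> t _; rewrite patchE; case: ifPn => [_|]; first by rewrite lee_fin.
  rewrite notin_setE => ht.
  suff -> : f (row_of t) = 0 by rewrite /sqm big1 // => i _; rewrite mxE /= expr0n addr0.
  apply: supp; apply: contrapT => hn; apply: ht => j /=; rewrite in_itv /= -ler_norml.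
  by rewrite leNgt; apply/negP => hj; apply: hn; exists j; rewrite mxE.
Qed.

(** The mode is bounded below only over a fixed interval in [x], so that the growth is [r^n] against
    [r^(n + 1)] in [L2sq_upper]: one power of [r] is lost. *)
Lemma L2sq_lower f (c r a b : R) : 0 <= c -> 0 < r -> a < b -> measurable_cfield f ->
  (forall x : 'rV[R]_n.+1, a <= x 0 ord0 <= b -> (forall j, 0 <= x 0 (lift ord0 j) <= r) -> c <= sqm (f x)) ->
  ((c * ((b - a) * r ^+ n))%:E <= L2sq f)%E.
Proof.
move=> c0 r0 ab mf fc; rewrite L2sqE.
pose I (j : nat) : set R := if j is 0 then [set` `[a, b]] else [set` `[0, r]].
have mI j : measurable (I j) by case: j => [|j] /=; exact: measurable_itv.
have -> : ((c * ((b - a) * r ^+ n))%:E = c%:E * mu (box I n.+1))%E.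
  rewrite lebesgue_box // big_ord_recl /= EFinM EFinM -prod_EFin; congr (_ * (_ * _))%E.
    by rewrite lebesgue_measure_itv /= lte_fin ab.
  by apply: eq_bigr => j _; rewrite lebesgue_measure_itv /= lte_fin r0 -EFinB subr0.
have mb := @measurable_box _ I n.+1 mI.
rewrite -integral_cst // integral_mkcond.
apply: ge0_le_integral => //.
- by move=> t _; rewrite patchE; case: ifP => // _; rewrite lee_fin.
- exact/(measurable_restrictT _ _).1.
- by apply/measurable_EFinP; exact: sqm_measurable.
- move=> t _; rewrite patchE; case: ifPn => [|_]; last by rewrite lee_fin sqm_ge0.
  rewrite inE => ht; rewrite lee_fin; apply: fc.
    by have := ht ord0; rewrite /= in_itv /= mxE.
  by move=> j; have := ht (lift ord0 j); rewrite /= in_itv /= mxE.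
Qed.

(** A bounded resolvent would give [c (b - a) r^n <= C (K / r^2) r^(n + 1)] with [r = N + 1], that
    is a bound on [N]: the decay [1 / r^2] of the squared error makes up for the lost power of
    [r]. *)
Lemma weyl_spectrum (A : cf -> cf) (l : C) (v : nat -> cf) (N0 : nat) (c K a b : R) :
  (forall u v, test_cfield u -> test_cfield v ->
     test_cfield (fun x => u x - v x) /\ A (fun x => u x - v x) = fun x => A u x - A v x) ->
  0 < c -> 0 <= K -> a < b ->
  (forall N, (N0 <= N)%N -> let err := fun x => l *: v N x - A (v N) x in
    [/\ test_cfield (v N), measurable_cfield (v N), measurable_cfield err &
    [/\ forall x : 'rV[R]_n.+1, (exists j, 2 * N.+1%:R < `|x 0 j|) -> v N x = 0 /\ err x = 0,
        forall x, sqm (v N x) <= K, forall x, sqm (err x) <= K / N.+1%:R ^+ 2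
      & forall x : 'rV[R]_n.+1, a <= x 0 ord0 <= b -> (forall j, 0 <= x 0 (lift ord0 j) <= N.+1%:R) ->
        c <= sqm (v N x)]]) ->
  in_spectrum A l.
Proof.
move=> subA c0 K0 ab hv res.
have [K1 hK1] := resolvent_bound subA res.
(* The error is supported in a cube of side [4 r], hence the factor [4 ^+ n.+1]; the 2 is that of
   [resolvent_bound]. *)
pose M := 2 * (`|K1| * (K * 4 ^+ n.+1)).
have M0 : 0 <= M by rewrite /M; apply: mulr_ge0 => //; apply: mulr_ge0 => //; apply: mulr_ge0.
have key N : (N0 <= N)%N -> c * (b - a) * N.+1%:R <= M.
  move=> hN; have [tv mv me [supp vK eK vc]] := hv N hN.
  set r : R := N.+1%:R; have r0 : 0 < r by rewrite ltr0n.
  have r20 : 0 < 2 * r by apply: mulr_gt0.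
  have Lv : in_L2 (v N).
    split => //; apply: le_lt_trans (L2sq_upper K0 r20 mv (fun x hx => (supp x hx).1) vK) _.
    exact: ltry.
  have Kr : 0 <= K / r ^+ 2 by apply: divr_ge0 => //; exact: sqr_ge0.
  have Le := L2sq_upper Kr r20 me (fun x hx => (supp x hx).2) eK.
  have Lf : in_L2 (fun x => l *: v N x - A (v N) x) by split => //; apply: le_lt_trans Le _; exact: ltry.
  have h1 := L2sq_lower (ltW c0) r0 ab mv vc.
  have h2 := hK1 _ tv Lv Lf.
  have h3 : (L2sq (v N) <= 2%:E * (`|K1|%:E * (K / r ^+ 2 * (2 * (2 * r)) ^+ n.+1)%:E))%E.
    apply: le_trans h2 _; rewrite lee_pmul2l ?lte_fin //.
    have Lf0 : (0 <= L2sq (fun x => (l *: v N x - A (v N) x)%R))%E.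
      by rewrite L2sqE; apply: integral_ge0 => t _; rewrite lee_fin sqm_ge0.
    apply: (@le_trans _ _ (`|K1|%:E * L2sq (fun x => (l *: v N x - A (v N) x)%R))%E).
      by apply: lee_wpmul2r => //; rewrite lee_fin ler_norm.
    by apply: lee_wpmul2l => //; rewrite lee_fin.
  have := le_trans h1 h3; rewrite -!EFinM lee_fin => h4.
  have rn : 0 < r ^+ n by rewrite exprn_gt0.
  have E : 2 * (`|K1| * (K / r ^+ 2 * (2 * (2 * r)) ^+ n.+1)) = M / r * r ^+ n.
    rewrite /M (_ : 2 * (2 * r) = 4 * r); last by ring.
    rewrite exprMn [r ^+ n.+1]exprS; move: (r ^+ n) (4 ^+ n.+1) => x y; by field; rewrite gt_eqF.
  rewrite E !mulrA ler_pM2r // in h4.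
  by rewrite -ler_pdivlMr.
have [N hN] : exists N : nat, M < c * (b - a) * N%:R.
  have cb : 0 < c * (b - a) by rewrite mulr_gt0 // subr_gt0.
  exists (Num.bound (M / (c * (b - a)))); rewrite mulrC -ltr_pdivrMr //.
  by apply: archi_boundP; apply: divr_ge0 => //; exact: ltW.
have cb : 0 < c * (b - a) by rewrite mulr_gt0 // subr_gt0.
have := key (maxn N0 N) (leq_maxl _ _); rewrite leNgt => /negP; apply.
apply: lt_le_trans hN _; rewrite ler_pM2l // ler_nat.
by apply: (leq_trans (leq_maxr N0 N)).
Qed.

End Weyl.

(** * From a bounded mode to the spectrum *)

Lemma periodic_bounded (R : realType) (f : R -> R) (X : R) : 0 < X -> continuous f ->
  (forall x, f (x + X) = f x) -> exists2 K, 0 <= K & forall x, `|f x| <= K.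
Proof.
move=> X0 cf per.
have pn (m : nat) x : f (x + m%:R * X) = f x.
  elim: m x => [|m IH] x; first by rewrite mul0r addr0.
  by rewrite -natr1 mulrDl mul1r addrA per IH.
have pz (z : int) x : f (x + z%:~R * X) = f x.
  case: z => m; first exact: pn.
  by rewrite NegzE mulrNz mulNr -[RHS](pn m.+1) -[in LHS](pn m.+1 (x - _)) subrK pn.
have [K K0 hK] := bounded_on_segment X cf.
exists K => // x; rewrite -(pz (- Num.floor (x / X)) x); apply: hK.
have /andP[h1 h2] := Num.Theory.floor_itv (x / X).
rewrite intrD ler_pdivlMr // ltr_pdivrMr // mulrDl mul1r in h1 h2.
rewrite mulrNz mulNr; move: (_ * X) h1 h2 => y h1 h2.
by rewrite ger0_norm; lra.
Qed.

Section TopContinuity.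
Context {R : realType} {T : topologicalType}.
Implicit Types (f g : T -> R).
Lemma ctD f g : continuous f -> continuous g -> continuous (fun x => f x + g x).
Proof. by move=> cf cg x; exact: ctpD (cf x) (cg x). Qed.
Lemma ctM f g : continuous f -> continuous g -> continuous (fun x => f x * g x).
Proof. by move=> cf cg x; exact: ctpM (cf x) (cg x). Qed.
Lemma ctN f : continuous f -> continuous (fun x => - f x).
Proof. by move=> cf x; exact: ctpN (cf x). Qed.
Lemma ct_cst (a : R) : continuous (fun _ : T => a).
Proof. by move=> x; exact: ctp_cst. Qed.
End TopContinuity.

Ltac contE := lazymatch goal with
  | |- continuous (fun x => (@?f x + @?g x)%R) => notypeclasses refine (ctD _ _); contE
  | |- continuous (fun x => (@?f x * @?g x)%R) => notypeclasses refine (ctM _ _); contE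
  | |- continuous (fun x => (- @?f x)%R) => notypeclasses refine (ctN _); contE
  | _ => first [assumption | exact: ct_cst]
  end.

(** * The second variation as an operator with periodic coefficients *)

Section Operator.
Context {R : realType} {n : nat}.
Variables (k k1 k2 W W1 W2 : R -> R) (om c : R).
Hypothesis dk : forall s : R, is_derive s 1 k (k1 s).
Hypothesis dk1 : forall s : R, is_derive s 1 k1 (k2 s).
Hypothesis dW : forall s : R, is_derive s 1 W (W1 s).
Hypothesis dW1 : forall s : R, is_derive s 1 W1 (W2 s).
Hypothesis ck2 : continuous k2.
Hypothesis cW2 : continuous W2.
Variables (kx kp : R) (U : R -> 'cV[R]_2).
Hypothesis sU : forall m i, Ck_on setT m (fun t => U t i 0).
Hypothesis perU : forall t, U (t + 1) = U t.

Local Notation E := 'rV[R]_n.+1.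
Local Notation pd j f := ('D_(delta_mx 0 j : E) f).
Local Notation comp w i := (fun y : E => w y i 0).
Local Notation A := (@scaled_density R n k W om c kx kp).
Local Notation Ui i := (fun t : R => U t i 0).

Definition hc (i : 'I_2) (t : R) (w0 w1 c0 c1 d0 d1 : R) : R :=
  hess_expr k k1 k2 W1 W2 om c kx kp i (U t 0 0) (U t 1 0) ('D_1 (Ui 0) t) ('D_1 (Ui 1) t)
    ('D_1 ('D_1 (Ui 0)) t) ('D_1 ('D_1 (Ui 1)) t) w0 w1 c0 c1 d0 d1.

Definition km (t : R) : R := k (U t 0 0 * U t 0 0 + U t 1 0 * U t 1 0).

Lemma hess_expr_lin (i : 'I_2) u0 u1 a0 a1 b0 b1 (l w0 w1 c0 c1 d0 d1 w0' w1' c0' c1' d0' d1' : R) :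
  hess_expr k k1 k2 W1 W2 om c kx kp i u0 u1 a0 a1 b0 b1
    (l * w0 + w0') (l * w1 + w1') (l * c0 + c0') (l * c1 + c1') (l * d0 + d0') (l * d1 + d1') =
  l * hess_expr k k1 k2 W1 W2 om c kx kp i u0 u1 a0 a1 b0 b1 w0 w1 c0 c1 d0 d1
  + hess_expr k k1 k2 W1 W2 om c kx kp i u0 u1 a0 a1 b0 b1 w0' w1' c0' c1' d0' d1'.
Proof.
case: (ord2P i) => ->; rewrite /hess_expr /lform /sel /=; ring.
Qed.

Lemma hc_units (i : 'I_2) t c0 c1 d0 d1 : hc i t 0 0 c0 c1 d0 d1 =
  c0 * hc i t 0 0 1 0 0 0 + c1 * hc i t 0 0 0 1 0 0 + d0 * hc i t 0 0 0 0 1 0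
  + d1 * hc i t 0 0 0 0 0 1.
Proof.
have z : hc i t 0 0 0 0 0 0 = 0.
  have := hess_expr_lin i (U t 0 0) (U t 1 0) ('D_1 (Ui 0) t) ('D_1 (Ui 1) t)
    ('D_1 ('D_1 (Ui 0)) t) ('D_1 ('D_1 (Ui 1)) t) 1 0 0 0 0 0 0 0 0 0 0 0 0.
  rewrite mulr0 add0r mul1r -/(hc i t 0 0 0 0 0 0) => h; apply: (addrI (hc i t 0 0 0 0 0 0)).
  by rewrite -h addr0.
have lin l w0 w1 e0 e1 f0 f1 w0' w1' e0' e1' f0' f1' := hess_expr_lin i (U t 0 0) (U t 1 0)
  ('D_1 (Ui 0) t) ('D_1 (Ui 1) t) ('D_1 ('D_1 (Ui 0)) t) ('D_1 ('D_1 (Ui 1)) t)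
  l w0 w1 e0 e1 f0 f1 w0' w1' e0' e1' f0' f1'.
have e1 := lin c0 0 0 1 0 0 0 0 0 0 c1 d0 d1.
have e2 := lin c1 0 0 0 1 0 0 0 0 0 0 d0 d1.
have e3 := lin d0 0 0 0 0 1 0 0 0 0 0 0 d1.
have e4 := lin d1 0 0 0 0 0 1 0 0 0 0 0 0.
rewrite !mulr0 !mulr1 !add0r ?addr0 in e1 e2 e3 e4.
by rewrite /hc e1 e2 e3 e4 -/(hc i t 0 0 0 0 0 0) z addr0 !addrA.
Qed.

Let dU i (t : R) : is_derive t 1 (Ui i) ('D_1 (Ui i) t).
Proof. exact: Ck_on_is_derive (sU 1%N i) _. Qed.
Let cU0 i : continuous (Ui i).
Proof. by move=> t; exact: is_derive1_continuous (dU i t). Qed.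
Let cU1 i : continuous ('D_1 (Ui i)).
Proof. by move=> t; exact: (Ck_on_continuous (Ck_on_derive (1 : R) (sU 1%N i)) (I : setT t)). Qed.
Let cU2 i : continuous ('D_1 ('D_1 (Ui i))).
Proof. by move=> t; exact: (Ck_on_continuous (Ck_on_derive (1 : R) (Ck_on_derive (1 : R) (sU 2%N i))) (I : setT t)). Qed.

Local Notation sq t := (U t 0 0 * U t 0 0 + U t 1 0 * U t 1 0).
Let c_sq : continuous (fun t => sq t).
Proof. by have a0 := @cU0 0; have a1 := @cU0 1; contE. Qed.

Let c_comp (f : R -> R) : continuous f -> continuous (fun t => f (sq t)).
Proof. by move=> cf t; apply: (@continuous_comp _ _ _ (fun t => sq t) f); [exact: c_sq | exact: cf]. Qed.

Let der_cont (f g : R -> R) : (forall s : R, is_derive s 1 f (g s)) -> continuous f.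
Proof. by move=> h s; exact: is_derive1_continuous (h s). Qed.

Lemma lform_continuous (u0 u1 p0 p1 ua pa qa w0 w1 r0 r1 wa ra ta jra : R -> R) :
  continuous u0 -> continuous u1 -> continuous p0 -> continuous p1 -> continuous ua ->
  continuous pa -> continuous qa -> continuous w0 -> continuous w1 -> continuous r0 ->
  continuous r1 -> continuous wa -> continuous ra -> continuous ta -> continuous jra ->
  continuous (fun t => lform k k1 k2 W1 W2 om c (u0 t) (u1 t) (p0 t) (p1 t) (ua t) (pa t)
    (qa t) (w0 t) (w1 t) (r0 t) (r1 t) (wa t) (ra t) (ta t) (jra t)).
Proof.
move=> h1 h2 h3 h4 h5 h6 h7 h8 h9 h10 h11 h12 h13 h14 h15.
pose s t := u0 t * u0 t + u1 t * u1 t.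
have cs : continuous s by rewrite /s; contE.
have cc (f : R -> R) : continuous f -> continuous (fun t => f (s t)).
  by move=> cf t; apply: (@continuous_comp _ _ _ s f); [exact: cs | exact: cf].
have ck := cc _ (der_cont dk); have ck1 := cc _ (der_cont dk1); have ck2' := cc _ ck2.
have cw1 := cc _ (der_cont dW1); have cw2 := cc _ cW2.
pose up t := u0 t * p0 t + u1 t * p1 t; have cup : continuous up by rewrite /up; contE.
pose pp t := p0 t * p0 t + p1 t * p1 t; have cpp : continuous pp by rewrite /pp; contE.
pose ds t := 2 * (u0 t * w0 t + u1 t * w1 t); have cds : continuous ds by rewrite /ds; contE.
pose dup t := w0 t * p0 t + w1 t * p1 t + u0 t * r0 t + u1 t * r1 t.
have cdup : continuous dup by rewrite /dup; contE.
pose dpp t := 2 * (p0 t * r0 t + p1 t * r1 t); have cdpp : continuous dpp by rewrite /dpp; contE.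
pose f1 t := k2 (s t) * ds t * pp t * ua t + k1 (s t) * dpp t * ua t + k1 (s t) * pp t * wa t.
have cf1 : continuous f1 by rewrite /f1; contE.
pose f2 t := 2 * (W2 (s t) * ds t * ua t + W1 (s t) * wa t).
have cf2 : continuous f2 by rewrite /f2; contE.
pose f3 t := k2 (s t) * ds t * up t * pa t + k1 (s t) * dup t * pa t + k1 (s t) * up t * ra t.
have cf3 : continuous f3 by rewrite /f3; contE.
have : continuous (fun t => f1 t + f2 t - om * wa t - c * jra t - k1 (s t) * ds t * qa t
  - k (s t) * ta t - 2 * f3 t) by contE.
by [].
Qed.

Lemma hess_expr_continuous i (u0 u1 a0 a1 b0 b1 : R -> R) (w0 w1 c0 c1 d0 d1 : R) :
  continuous u0 -> continuous u1 -> continuous a0 -> continuous a1 -> continuous b0 ->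
  continuous b1 -> continuous (fun t => hess_expr k k1 k2 W1 W2 om c kx kp i (u0 t) (u1 t)
    (a0 t) (a1 t) (b0 t) (b1 t) w0 w1 c0 c1 d0 d1).
Proof.
move=> h1 h2 h3 h4 h5 h6.
have p0 : continuous (fun t => kx * a0 t + kp * u1 t) by contE.
have p1 : continuous (fun t => kx * a1 t - kp * u0 t) by contE.
have q0 : continuous (fun t => kx * (kx * b0 t + kp * a1 t) + kp * (kx * a1 t - kp * u0 t)) by contE.
have q1 : continuous (fun t => kx * (kx * b1 t - kp * a0 t) - kp * (kx * a0 t + kp * u1 t)) by contE.
have z (a : R) : continuous (fun _ : R => a) by exact: ct_cst.
case: (ord2P i) => ->.
  exact: (lform_continuous h1 h2 p0 p1 h1 p0 q0 (z _) (z _) (z _) (z _) (z _) (z _) (z _) (z _)).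
exact: (lform_continuous h1 h2 p0 p1 h2 p1 q1 (z _) (z _) (z _) (z _) (z _) (z _) (z _) (z _)).
Qed.

Lemma hc_continuous i w0 w1 c0 c1 d0 d1 : continuous (fun t => hc i t w0 w1 c0 c1 d0 d1).
Proof.
exact: (@hess_expr_continuous i (Ui 0) (Ui 1) ('D_1 (Ui 0)) ('D_1 (Ui 1)) ('D_1 ('D_1 (Ui 0)))
  ('D_1 ('D_1 (Ui 1))) w0 w1 c0 c1 d0 d1 (@cU0 0) (@cU0 1) (@cU1 0) (@cU1 1) (@cU2 0) (@cU2 1)).
Qed.

Lemma km_continuous : continuous km.
Proof. exact: c_comp (der_cont dk). Qed.

Let per1 (f df : R -> R) : (forall t : R, is_derive t 1 f (df t)) -> (forall t, f (t + 1) = f t) ->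
  forall t, df (t + 1) = df t.
Proof.
move=> hf per t; have h := is_derive_translate (hf (t + 1)).
by apply: is_derive_unique h _; apply: (is_derive_ext per).
Qed.

Lemma hc_periodic i t w0 w1 c0 c1 d0 d1 : hc i (t + 1) w0 w1 c0 c1 d0 d1 = hc i t w0 w1 c0 c1 d0 d1.
Proof.
have p0 j s : Ui j (s + 1) = Ui j s by rewrite perU.
have p1 j : forall s, 'D_1 (Ui j) (s + 1) = 'D_1 (Ui j) s := per1 (dU j) (p0 j).
have d2 j (s : R) : is_derive s 1 ('D_1 (Ui j)) ('D_1 ('D_1 (Ui j)) s).
  exact: (Ck_on_is_derive (Ck_on_derive (1 : R) (sU 2%N j)) (I : setT s)).
have p2 j : forall s, 'D_1 ('D_1 (Ui j)) (s + 1) = 'D_1 ('D_1 (Ui j)) s := per1 (d2 j) (p1 j).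
by rewrite /hc perU !p1 !p2.
Qed.

(** Continuous periodic coefficients are bounded. Those of order zero are left out because
    commutators with a cutoff do not involve them. *)
Lemma coefficients_bounded : exists2 K : R, 0 <= K & forall t,
  `|km t| <= K /\ forall i c0 c1 d0 d1,
    `|hc i t 0 0 c0 c1 d0 d1| <= K * (`|c0| + `|c1| + `|d0| + `|d1|).
Proof.
have kmP t : km (t + 1) = km t by rewrite /km perU.
have [K0 K00 hK0] := periodic_bounded ltr01 km_continuous kmP.
pose uv (m : 'I_4) (j : 'I_4) : R := (m == j)%:R.
pose F (p : 'I_2 * 'I_4) t := hc p.1 t 0 0 (uv p.2 0) (uv p.2 1) (uv p.2 (inord 2)) (uv p.2 (inord 3)).
have hF p : exists K, 0 <= K /\ forall t, `|F p t| <= K.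
  have [K a b] := periodic_bounded ltr01 (@hc_continuous p.1 0 0 (uv p.2 0) (uv p.2 1) (uv p.2 (inord 2)) (uv p.2 (inord 3)))
    (fun t => hc_periodic _ _ _ _ _ _ _ _); by exists K.
have [K hK] := choice hF; pose S := \sum_p K p.
have hS p t : `|F p t| <= S.
  apply: le_trans ((hK p).2 t) _; rewrite /S (bigD1 p) //= lerDl.
  by apply: sumr_ge0 => q _; case: (hK q).
have S0 : 0 <= S by apply: sumr_ge0 => q _; case: (hK q).
exists (K0 + S); first exact: addr_ge0.
move=> t; split; first by apply: le_trans (hK0 t) _; rewrite lerDl.
move=> i c0 c1 d0 d1.
have := hS (i, 0) t; have := hS (i, 1) t; have := hS (i, inord 2) t; have := hS (i, inord 3) t.
rewrite /F /uv /= -!val_eqE /= !inordK //= => h3 h2 h1 h0.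
rewrite hc_units.
have t4 (a b d e : R) : `|a + b + d + e| <= `|a| + `|b| + `|d| + `|e|.
  by apply: le_trans (ler_normD _ _) _; rewrite lerD2r; apply: le_trans (ler_normD _ _) _;
    rewrite lerD2r; exact: ler_normD.
apply: le_trans (t4 _ _ _ _) _; rewrite !normrM.
have step (a b : R) : 0 <= a -> b <= S -> a * b <= (K0 + S) * a.
  move=> a0 bS; rewrite mulrC; apply: ler_wpM2r => //; apply: le_trans bS _; by rewrite lerDr.
by rewrite !mulrDr; apply: lerD; [apply: lerD; [apply: lerD|]|]; apply: step.
Qed.

Local Notation C2 w := (Ck_on setT 2 w).

Let cvc (w : E -> 'cV[R]_2) i : C2 w -> C2 (comp w i).
Proof. by move=> cw; have := cw; rewrite Ck_on_mxP; [apply | exact: openT]. Qed.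

(** The commutator of the operator with multiplication by [chi], from the Leibniz rule: each term
    contains a derivative of [chi]. *)
Definition comm (chi : E -> R) (w : E -> 'cV[R]_2) (i : 'I_2) (x : E) : R :=
  hc i (x 0 ord0) 0 0 (pd ord0 chi x * w x 0 0) (pd ord0 chi x * w x 1 0)
    (pd ord0 (pd ord0 chi) x * w x 0 0 + 2 * (pd ord0 chi x * pd ord0 (comp w 0) x))
    (pd ord0 (pd ord0 chi) x * w x 1 0 + 2 * (pd ord0 chi x * pd ord0 (comp w 1) x))
  - km (x 0 ord0) * \sum_(j < n) (pd (lift ord0 j) (pd (lift ord0 j) chi) x * w x i 0
      + 2 * (pd (lift ord0 j) chi x * pd (lift ord0 j) (comp w i) x)).

Local Opaque derive.

Let pdM (f g : E -> R) j : Ck_on setT 1 f -> Ck_on setT 1 g ->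
  pd j (fun y => f y * g y) = fun y => pd j f y * g y + f y * pd j g y.
Proof.
move=> cf cg; apply/funext => y.
exact: (@derive_val _ _ _ _ _ _ _ (derM (Ck_on_is_derive cf (I : setT y)) (Ck_on_is_derive cg (I : setT y)))).
Qed.

Let pdB (f g : E -> R) j : Ck_on setT 1 f -> Ck_on setT 1 g ->
  pd j (fun y => f y - g y) = fun y => pd j f y - pd j g y.
Proof.
move=> cf cg; apply/funext => y.
exact: (@derive_val _ _ _ _ _ _ _ (derB (Ck_on_is_derive cf (I : setT y)) (Ck_on_is_derive cg (I : setT y)))).
Qed.

Lemma hessE' (w : E -> 'cV[R]_2) x i : C2 w -> Hess A (plane U) w x i 0 =
  hc i (x 0 ord0) (w x 0 0) (w x 1 0) (pd ord0 (comp w 0) x) (pd ord0 (comp w 1) x)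
    (pd ord0 (pd ord0 (comp w 0)) x) (pd ord0 (pd ord0 (comp w 1)) x)
  - km (x 0 ord0) * \sum_(j < n) pd (lift ord0 j) (pd (lift ord0 j) (comp w i)) x.
Proof. by move=> cw; exact: (hessE om c dk dk1 dW dW1 kx kp (sU 2%N) cw x i). Qed.

Let hc_comb i t (l w0 w1 a0 a1 b0 b1 w0' w1' a0' a1' b0' b1' v0 v1 e0 e1 f0 f1 : R) :
  v0 = l * w0 + w0' -> v1 = l * w1 + w1' -> e0 = l * a0 + a0' -> e1 = l * a1 + a1' ->
  f0 = l * b0 + b0' -> f1 = l * b1 + b1' ->
  hc i t v0 v1 e0 e1 f0 f1 = l * hc i t w0 w1 a0 a1 b0 b1 + hc i t w0' w1' a0' a1' b0' b1'.
Proof. by move=> -> -> -> -> -> ->; exact: hess_expr_lin. Qed.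

Let comb_sub (l m a b e f g h : R) : a = l * b + e -> f = l * g + h ->
  a - m * f = l * (b - m * g) + (e - m * h).
Proof. by move=> -> ->; ring. Qed.

Lemma hess_product (chi : E -> R) (w : E -> 'cV[R]_2) x i : C2 chi -> C2 w ->
  Hess A (plane U) (fun y => chi y *: w y) x i 0 =
  chi x * Hess A (plane U) w x i 0 + comm chi w i x.
Proof.
move=> cc cw.
have cE j : comp (fun y => chi y *: w y) j = fun y => chi y * w y j 0 by apply/funext => y; rewrite mxE.
have cp : C2 (fun y => chi y *: w y).
  rewrite Ck_on_mxP; last exact: openT.
  by move=> a b; rewrite ord1 cE; apply: Ck_onM; [exact: openT | | exact: cvc].
have c1 j : Ck_on setT 1 (comp w j) := Ck_onS (cvc j cw).
have c1c : Ck_on setT 1 chi := Ck_onS cc.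
have der (f : E -> R) a : Ck_on setT 1 f -> is_derive x (delta_mx 0 a : E) f (pd a f x).
  by move=> cf; exact: (Ck_on_is_derive cf (I : setT x)).
have d1 j a : pd a (comp (fun y => chi y *: w y) j) =
    fun y => pd a chi y * w y j 0 + chi y * pd a (comp w j) y.
  by rewrite cE; exact: (pdM a c1c (c1 j)).
have alg (p q r s t u : R) : p * q + r * s + (r * s + t * u) = t * u + (p * q + 2 * (r * s)) by ring.
have d2 j a : pd a (pd a (comp (fun y => chi y *: w y) j)) x =
    chi x * pd a (pd a (comp w j)) x
    + (pd a (pd a chi) x * w x j 0 + 2 * (pd a chi x * pd a (comp w j) x)).
  have e1 : Ck_on setT 1 (pd a chi) := Ck_on_derive _ cc.
  have e2 : Ck_on setT 1 (pd a (comp w j)) := Ck_on_derive _ (cvc j cw).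
  have h := derD (derM (der _ a e1) (der _ a (c1 j))) (derM (der _ a c1c) (der _ a e2)).
  exact: (etrans (@derive_val _ _ _ _ _ _ _ (is_derive_ext (fun y => congr1 (fun f => f y) (d1 j a)) h))
    (alg _ _ _ _ _ _)).
have d1x j a : pd a (comp (fun y => chi y *: w y) j) x =
    chi x * pd a (comp w j) x + pd a chi x * w x j 0.
  exact: (etrans (congr1 (fun f => f x) (d1 j a)) (addrC _ _)).
have d0 j : (chi x *: w x) j 0 = chi x * w x j 0 + 0 by rewrite mxE addr0.
have E1 := hc_comb i (x 0 ord0) (d0 0) (d0 1) (d1x 0 ord0) (d1x 1 ord0) (d2 0 ord0) (d2 1 ord0).
have E2 : \sum_(j < n) pd (lift ord0 j) (pd (lift ord0 j) (comp (fun y => chi y *: w y) i)) x =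
    chi x * (\sum_(j < n) pd (lift ord0 j) (pd (lift ord0 j) (comp w i)) x)
    + \sum_(j < n) (pd (lift ord0 j) (pd (lift ord0 j) chi) x * w x i 0
      + 2 * (pd (lift ord0 j) chi x * pd (lift ord0 j) (comp w i) x)).
  rewrite mulr_sumr -big_split /=; apply: eq_bigr => j _; exact: (d2 i (lift ord0 j)).
apply: (etrans (hessE' x i cp)).
apply: (etrans (comb_sub (km (x 0 ord0)) E1 E2)).
exact: (congr1 (fun h => chi x * h + comm chi w i x) (esym (hessE' x i cw))).
Qed.

Lemma hess_sub (w v : E -> 'cV[R]_2) x i : C2 w -> C2 v ->
  Hess A (plane U) (fun y => w y - v y) x i 0 =
  Hess A (plane U) w x i 0 - Hess A (plane U) v x i 0.
Proof.
move=> cw cv.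
have cE j : comp (fun y => w y - v y) j = fun y => w y j 0 - v y j 0 by apply/funext => y; rewrite !mxE.
have cp : C2 (fun y => w y - v y).
  rewrite Ck_on_mxP; last exact: openT.
  by move=> a b; rewrite ord1 cE; apply: Ck_onB; [exact: openT | exact: cvc..].
have c1 j : Ck_on setT 1 (comp w j) := Ck_onS (cvc j cw).
have c1v j : Ck_on setT 1 (comp v j) := Ck_onS (cvc j cv).
have der (f : E -> R) a : Ck_on setT 1 f -> is_derive x (delta_mx 0 a : E) f (pd a f x).
  by move=> cf; exact: (Ck_on_is_derive cf (I : setT x)).
have alg (p q : R) : p - q = - 1 * q + p by rewrite mulN1r addrC.
have d1 j a : pd a (comp (fun y => w y - v y) j) =
    fun y => pd a (comp w j) y - pd a (comp v j) y.
  by rewrite cE; exact: (pdB a (c1 j) (c1v j)).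
have d2 j a : pd a (pd a (comp (fun y => w y - v y) j)) x =
    - 1 * pd a (pd a (comp v j)) x + pd a (pd a (comp w j)) x.
  have h := derB (der _ a (Ck_on_derive (delta_mx 0 a : E) (cvc j cw)))
    (der _ a (Ck_on_derive (delta_mx 0 a : E) (cvc j cv))).
  exact: (etrans (@derive_val _ _ _ _ _ _ _ (is_derive_ext (fun y => congr1 (fun f => f y) (d1 j a)) h))
    (alg _ _)).
have d1x j a : pd a (comp (fun y => w y - v y) j) x = - 1 * pd a (comp v j) x + pd a (comp w j) x.
  exact: (etrans (congr1 (fun f => f x) (d1 j a)) (alg _ _)).
have d0 j : (w x - v x) j 0 = - 1 * v x j 0 + w x j 0 by rewrite !mxE alg.
have E1 := hc_comb i (x 0 ord0) (d0 0) (d0 1) (d1x 0 ord0) (d1x 1 ord0) (d2 0 ord0) (d2 1 ord0).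
have E2 : \sum_(j < n) pd (lift ord0 j) (pd (lift ord0 j) (comp (fun y => w y - v y) i)) x =
    - 1 * (\sum_(j < n) pd (lift ord0 j) (pd (lift ord0 j) (comp v i)) x)
    + \sum_(j < n) pd (lift ord0 j) (pd (lift ord0 j) (comp w i)) x.
  rewrite mulr_sumr -big_split /=; apply: eq_bigr => j _; exact: (d2 i (lift ord0 j)).
apply: (etrans (hessE' x i cp)).
apply: (etrans (comb_sub (km (x 0 ord0)) E1 E2)).
apply: (etrans (esym (alg _ _))).
exact: (congr2 (fun a b => a - b) (esym (hessE' x i cw)) (esym (hessE' x i cv))).
Qed.

End Operator.

(** * Cutoff functions at large scale *)

Section Cutoff.
Context {R : realType} {n : nat}.
Local Notation E := 'rV[R]_n.
Local Notation pd j f := ('D_(delta_mx 0 j : E) f).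

Definition cprod (F : 'I_n -> R -> R) (x : E) : R := \prod_j F j (x 0 j).
Definition upd (F : 'I_n -> R -> R) (a : 'I_n) (g : R -> R) (j : 'I_n) : R -> R :=
  if j == a then g else F j.

Lemma cprod_derive F a dF x : (forall s : R, is_derive s 1 (F a) (dF s)) ->
  is_derive x (delta_mx 0 a : E) (cprod F) (cprod (upd F a dF) x).
Proof.
move=> h; apply/is_derive_lineE.
have e t : cprod F (t *: delta_mx 0 a + x) = F a (t + x 0 a) * \prod_(j | j != a) F j (x 0 j).
  rewrite /cprod (bigD1 a) //= !mxE !eqxx mulr1; congr (_ * _).
  by apply: eq_bigr => j ja; rewrite !mxE eqxx (negPf ja) mulr0 add0r.
apply: (is_derive_ext e).
have -> : cprod (upd F a dF) x = dF (x 0 a) * \prod_(j | j != a) F j (x 0 j).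
  rewrite /cprod (bigD1 a) //= /upd eqxx; congr (_ * _).
  by apply: eq_bigr => j /negPf ->.
have h1 : is_derive (0 : R) 1 (fun t => F a (t + x 0 a)) (dF (x 0 a)).
  by apply: is_derive_translate; rewrite add0r; exact: h.
by apply: is_derive_eq (derM h1 (der_cst (\prod_(j | j != a) F j (x 0 j)) (0 : R) (1 : R))) _; rewrite mulr0 addr0.
Qed.

Lemma cprod_bound F (x : E) : (forall j, `|F j (x 0 j)| <= 1) -> `|cprod F x| <= 1.
Proof.
move=> h; rewrite /cprod normr_prod; apply: prodr_ile1 => j _; by rewrite normr_ge0 h.
Qed.

Lemma cprod_upd_bound F a g (B : R) x : 0 <= B -> (forall j s, `|F j s| <= 1) ->
  (forall s, `|g s| <= B) -> `|cprod (upd F a g) x| <= B.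
Proof.
move=> B0 h hg; rewrite /cprod (bigD1 a) //= /upd eqxx normrM -[leRHS]mulr1.
apply: ler_pM => //; rewrite normr_prod; apply: prodr_ile1 => j /negPf ->.
by rewrite normr_ge0 h.
Qed.

Lemma cprod_eq0 F (x : E) j : F j (x 0 j) = 0 -> cprod F x = 0.
Proof. by move=> h; rewrite /cprod (bigD1 j) //= h mul0r. Qed.

(** A product of one-variable bumps at scale [N + 1], with a constant independent of [N]. The second
    derivatives even carry [1 / (N + 1)^2], of which only one power is kept. *)
Lemma cutoff_exists : exists2 B : R, 0 <= B & forall N : nat, exists chi : E -> R,
  [/\ forall m, Ck_on setT m chi, forall x, `|chi x| <= 1,
      forall x j, `|pd j chi x| <= B / N.+1%:R,
      forall x j, `|pd j (pd j chi) x| <= B / N.+1%:R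
    & (forall x : E, (exists j, 2 * N.+1%:R < `|x 0 j|) ->
         chi x = 0 /\ forall j, pd j chi x = 0 /\ pd j (pd j chi) x = 0) /\
      forall x : E, (forall j, 0 <= x 0 j <= N.+1%:R) -> chi x = 1].
Proof.
have [b [sb b1 b01 b0]] := exists_bump (R := R).
have [b' sb' db] := smooth_derive1 sb; have [b'' sb'' db'] := smooth_derive1 sb'.
have cb' : continuous b' by move=> s; exact: is_derive1_continuous (db' s).
have cb'' : continuous b'' by move=> s; exact: (Ck_on_continuous (sb'' 0%N) (I : setT s)).
(* Outside the closed interval [f] vanishes on a neighbourhood of each point, so that its derivative
   vanishes there too. *)
have out (f df : R -> R) : (forall s : R, is_derive s 1 f (df s)) -> (forall s, 2 < `|s| -> f s = 0) ->
    forall s, 2 < `|s| -> df s = 0.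
  move=> hf f0 s hs; apply: is_derive_unique (hf s) _.
  apply: (@is_derive_near _ (fun=> 0) _ _ _ _ (der_cst 0 s 1)).
  near=> t; apply/esym/f0; near: t; exists (`|s| - 2); first by rewrite /= subr_gt0.
  move=> t /= ht; have := ler_dist_dist s t; have := ler_norm (`|s| - `|t|).
  by move: ht => /= h1 h2 h3; move: (`|s| - `|t|) (le_lt_trans (le_trans h2 h3) h1) => *; lra.
have z0 s : 2 < `|s| -> b s = 0 by move=> /ltW; exact: b0.
have z1 := out _ _ db z0; have z2 := out _ _ db' z1.
have [B1 B10 hB1] := bounded_on_segment 2 cb'; have [B2 B20 hB2] := bounded_on_segment 2 cb''.
have bd1 s : `|b' s| <= B1 + B2.
  have [h|h] := leP `|s| 2; first by apply: le_trans (hB1 s h) _; rewrite lerDl.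
  by rewrite z1 // normr0 addr_ge0.
have bd2 s : `|b'' s| <= B1 + B2.
  have [h|h] := leP `|s| 2; first by apply: le_trans (hB2 s h) _; rewrite lerDr.
  by rewrite z2 // normr0 addr_ge0.
exists (B1 + B2); first exact: addr_ge0.
move=> N; set r : R := N.+1%:R; have r0 : 0 < r by rewrite ltr0n.
have r1 : 1 <= r by rewrite ler1n.
have rV : 0 < r^-1 by rewrite invr_gt0.
pose f0 s := b (s * r^-1); pose f1 s := b' (s * r^-1) * r^-1; pose f2 s := b'' (s * r^-1) * r^-1 * r^-1.
have dl (s : R) : is_derive s 1 (fun s : R => s * r^-1) r^-1.
  by apply: is_derive_eq (derM (der_id s) (der_cst r^-1 s 1)) _; rewrite mul1r mulr0 addr0.
have df0 (s : R) : is_derive s 1 f0 (f1 s) by apply: der_comp.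
have df1 (s : R) : is_derive s 1 f1 (f2 s).
  by apply: is_derive_eq (derM (der_comp (db' _) (dl s)) (der_cst r^-1 s 1)) _; rewrite mulr0 addr0.
pose F0 (j : 'I_n) := f0.
have pd1 a : pd a (cprod F0) = cprod (upd F0 a f1).
  by apply/funext => x; exact: (@derive_val _ _ _ _ _ _ _ (cprod_derive x (df0 : forall s : R, is_derive s 1 (F0 a) (f1 s)))).
have pd2 a : pd a (pd a (cprod F0)) = cprod (upd F0 a f2).
  rewrite pd1; apply/funext => x.
  have h (s : R) : is_derive s 1 (upd F0 a f1 a) (f2 s) by rewrite /upd eqxx.
  have -> : cprod (upd F0 a f2) x = cprod (upd (upd F0 a f1) a f2) x.
    by apply: eq_bigr => j _; rewrite /upd; case: ifP.
  exact: (@derive_val _ _ _ _ _ _ _ (cprod_derive x h)).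
have F0_le j s : `|F0 j s| <= 1.
  by rewrite /F0 /f0; have /andP[h1 h2] := b01 (s * r^-1); rewrite ger0_norm.
have big s : 2 * r < `|s| -> 2 < `|s * r^-1|.
  by move=> h; rewrite normrM (gtr0_norm rV) ltr_pdivlMr.
exists (cprod F0); split.
- move=> m; apply: Ck_on_prod; first exact: openT.
  move=> j; apply: (@Ck_on_coord _ _ j m f0).
  apply: (@Ck_on_comp _ _ _ _ b (fun s : R => s * r^-1)); [exact: openT | exact: sb |].
  by apply: Ck_onM; [exact: openT | exact: Ck_on_id | apply: Ck_on_cst; exact: openT].
- by move=> x; apply: cprod_bound.
- move=> x j; rewrite [X in `|X|](congr1 (fun f => f x) (pd1 j)); apply: cprod_upd_bound => //.
    by apply: divr_ge0; [exact: addr_ge0 | exact: ltW].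
  by move=> s; rewrite /f1 normrM (gtr0_norm rV); apply: ler_wpM2r; [exact: ltW | exact: bd1].
- move=> x j; rewrite [X in `|X|](congr1 (fun f => f x) (pd2 j)); apply: cprod_upd_bound => //.
    by apply: divr_ge0; [exact: addr_ge0 | exact: ltW].
  move=> s; rewrite /f2 !normrM !(gtr0_norm rV); apply: ler_wpM2r; first exact: ltW.
  rewrite -[leRHS]mulr1; apply: ler_pM => //; first exact: ltW.
  by rewrite invf_le1.
split.
- move=> x [j hj]; have hb := big _ hj.
  have u0 a g : g (x 0 j) = 0 -> cprod (upd F0 a g) x = 0.
    by move=> hg; apply: (@cprod_eq0 _ _ j); rewrite /upd; case: ifP => // _; exact: z0.
  split; first by apply: (@cprod_eq0 _ _ j); exact: z0.
  have v1 : f1 (x 0 j) = 0 by rewrite /f1 z1 // mul0r.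
  have v2 : f2 (x 0 j) = 0 by rewrite /f2 z2 // !mul0r.
  move=> a; split; first exact: (etrans (congr1 (fun f => f x) (pd1 a)) (u0 a _ v1)).
  exact: (etrans (congr1 (fun f => f x) (pd2 a)) (u0 a _ v2)).
- move=> x hx; rewrite /cprod big1 // => j _; apply: b1; have /andP[h1 h2] := hx j.
  by apply/andP; split; [apply: divr_ge0 => //; exact: ltW | rewrite ler_pdivrMr // mul1r].
Unshelve. all: by end_near.
Qed.

End Cutoff.

(** * Truncation of a bounded eigenfunction *)

Section Eigenfunction.
Context {R : realType} {n : nat}.
Local Notation C := R[i].
Variables (k k1 k2 W W1 W2 : R -> R) (om c : R).
Hypothesis dk : forall s : R, is_derive s 1 k (k1 s).
Hypothesis dk1 : forall s : R, is_derive s 1 k1 (k2 s).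
Hypothesis dW : forall s : R, is_derive s 1 W (W1 s).
Hypothesis dW1 : forall s : R, is_derive s 1 W1 (W2 s).
Hypothesis ck2 : continuous k2.
Hypothesis cW2 : continuous W2.
Variables (kx kp : R) (U : R -> 'cV[R]_2).
Hypothesis sU : forall m i, Ck_on setT m (fun t => U t i 0).
Hypothesis perU : forall t, U (t + 1) = U t.

Local Notation E := 'rV[R]_n.+1.
Local Notation pd j f := ('D_(delta_mx 0 j : E) f).
Local Notation A := (@scaled_density R n k W om c kx kp).
Local Notation T := (complexify (fun v x => Jmx *m Hess A (plane U) v x)).
Local Notation cm chi w x := (\col_i comm k k1 k2 W1 W2 om c kx kp U chi w i x).

Lemma re_fieldE (u : @cfield R n) x i : re_field u x i 0 = complex.Re (u x i 0).
Proof. by rewrite mxE. Qed.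
Lemma im_fieldE (u : @cfield R n) x i : im_field u x i 0 = complex.Im (u x i 0).
Proof. by rewrite mxE. Qed.

Lemma re_field_sub (u v : @cfield R n) : re_field (fun x => u x - v x) =
  fun x => re_field u x - re_field v x.
Proof. by apply/funext => x; apply/matrixP => i j; rewrite !mxE; case: (u x i j) (v x i j) => a b []. Qed.

Lemma im_field_sub (u v : @cfield R n) : im_field (fun x => u x - v x) =
  fun x => im_field u x - im_field v x.
Proof. by apply/funext => x; apply/matrixP => i j; rewrite !mxE; case: (u x i j) (v x i j) => a b []. Qed.

Lemma re_field_scale (chi : E -> R) (u : @cfield R n) : re_field (fun x => (chi x)%:C%C *: u x) =
  fun x => chi x *: re_field u x.
Proof. by apply/funext => x; apply/matrixP => i j; rewrite !mxE; case: (u x i j) => a b /=; ring. Qed.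

Lemma im_field_scale (chi : E -> R) (u : @cfield R n) : im_field (fun x => (chi x)%:C%C *: u x) =
  fun x => chi x *: im_field u x.
Proof. by apply/funext => x; apply/matrixP => i j; rewrite !mxE; case: (u x i j) => a b /=; ring. Qed.

Lemma smooth_entries (w : E -> 'cV[R]_2) : smooth_on setT w <->
  forall i m, Ck_on setT m (fun x => w x i 0).
Proof.
split=> [h i m|h m]; first by have := h m; rewrite Ck_on_mxP; [apply | exact: openT].
by rewrite Ck_on_mxP; [move=> a b; rewrite ord1 | exact: openT].
Qed.

Lemma smooth_sub (w v : E -> 'cV[R]_2) : smooth_on setT w -> smooth_on setT v ->
  smooth_on setT (fun x => w x - v x).
Proof.
move=> /smooth_entries hw /smooth_entries hv; apply/smooth_entries => i m.
under eq_fun do rewrite !mxE.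
by apply: Ck_onB; [exact: openT | exact: hw | exact: hv].
Qed.

Lemma smooth_scale (chi : E -> R) (w : E -> 'cV[R]_2) : (forall m, Ck_on setT m chi) ->
  smooth_on setT w -> smooth_on setT (fun x => chi x *: w x).
Proof.
move=> hc /smooth_entries hw; apply/smooth_entries => i m.
under eq_fun do rewrite !mxE.
by apply: Ck_onM; [exact: openT | exact: hc | exact: hw].
Qed.

(** Pointwise form of [complexify]: the real and imaginary parts are two real fields, recombined
    after [J] is applied. *)
Definition stack (a b : 'cV[R]_2) : 'cV[C]_2 := \col_i Complex ((Jmx *m a) i 0) ((Jmx *m b) i 0).

Let stackB a b a' b' : stack (a - a') (b - b') = stack a b - stack a' b'.
Proof. by rewrite /stack !mulmxBr; apply/matrixP => i j; rewrite !mxE. Qed.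

Let stack_lin s a b a' b' : stack (s *: a + a') (s *: b + b') = s%:C%C *: stack a b + stack a' b'.
Proof.
rewrite /stack !mulmxDr -!scalemxAr; apply/matrixP => i j; rewrite !mxE /=.
by apply/eqP; rewrite eq_complex /= !mul0r subr0 addr0 !eqxx.
Qed.

Let sqm_stack a b : sqm (stack a b) = (a 0 0 ^+ 2 + a 1 0 ^+ 2) + (b 0 0 ^+ 2 + b 1 0 ^+ 2).
Proof. by rewrite /sqm sum2 ![stack _ _ _ _]mxE /= !JmxE0 !JmxE1; ring. Qed.

Lemma operator_sub (u v : @cfield R n) : test_cfield u -> test_cfield v ->
  test_cfield (fun x => u x - v x) /\ T (fun x => u x - v x) = fun x => T u x - T v x.
Proof.
move=> [su1 su2 [r hr]] [sv1 sv2 [r' hr']]; split.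
  split; rewrite ?re_field_sub ?im_field_sub; [exact: smooth_sub | exact: smooth_sub |].
  exists (Num.max r r') => x; rewrite gt_max => /andP[h1 h2]; by rewrite hr // hr' // subr0.
have hs w z x : smooth_on setT w -> smooth_on setT z ->
    Hess A (plane U) (fun y => w y - z y) x = Hess A (plane U) w x - Hess A (plane U) z x.
  move=> hw hz; apply/matrixP => i j; rewrite ord1 !mxE.
  exact: (hess_sub om c dk dk1 dW dW1 kx kp sU x i (hw 2%N) (hz 2%N)).
apply/funext => x; rewrite /complexify re_field_sub im_field_sub.
apply: (etrans (congr2 stack (hs _ _ x su1 sv1) (hs _ _ x su2 sv2))); exact: stackB.
Qed.

Lemma operator_product (chi : E -> R) (psi : @cfield R n) x : (forall m, Ck_on setT m chi) ->
  smooth_on setT (re_field psi) -> smooth_on setT (im_field psi) ->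
  T (fun x => (chi x)%:C%C *: psi x) x = (chi x)%:C%C *: T psi x +
  \col_i Complex ((Jmx *m cm chi (re_field psi) x) i 0) ((Jmx *m cm chi (im_field psi) x) i 0).
Proof.
move=> hc s1 s2.
have hp w : smooth_on setT w -> Hess A (plane U) (fun y => chi y *: w y) x =
    chi x *: Hess A (plane U) w x + cm chi w x.
  move=> hw; apply/matrixP => i j; rewrite ord1 [RHS]mxE [X in X + _]mxE [X in _ + X]mxE.
  exact: (hess_product om c dk dk1 dW dW1 kx kp sU x i (hc 2%N) (hw 2%N)).
rewrite /complexify re_field_scale im_field_scale.
apply: (etrans (congr2 stack (hp _ s1) (hp _ s2))); exact: stack_lin.
Qed.

Lemma sqm_comm (chi : E -> R) (w v : E -> 'cV[R]_2) x :
  sqm (\col_i Complex ((Jmx *m cm chi w x) i 0) ((Jmx *m cm chi v x) i 0)) =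
  (cm chi w x 0 0 ^+ 2 + cm chi w x 1 0 ^+ 2) + (cm chi v x 0 0 ^+ 2 + cm chi v x 1 0 ^+ 2).
Proof. exact: sqm_stack. Qed.

Let cE (f : R -> R) : continuous f -> continuous (fun x : E => f (x 0 ord0)).
Proof.
by move=> cf x; apply: (@continuous_comp _ _ _ (fun x : E => x 0 ord0) f);
  [exact: coord_continuous | exact: cf].
Qed.

Lemma comm_continuous (chi : E -> R) (w : E -> 'cV[R]_2) i : (forall m, Ck_on setT m chi) ->
  smooth_on setT w -> continuous (fun x => comm k k1 k2 W1 W2 om c kx kp U chi w i x).
Proof.
move=> hc /smooth_entries hw.
have ck0 (f : E -> R) : Ck_on setT 0 f -> continuous f by move=> h x; exact: (Ck_on_continuous h (I : setT x)).
have c1 a : continuous (pd a chi) by apply: ck0; exact: Ck_on_derive (hc 1%N).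
have c2 a : continuous (pd a (pd a chi)).
  by apply: ck0; apply: Ck_on_derive; exact: Ck_on_derive (hc 2%N).
have c3 j : continuous (fun x => w x j 0) by apply: ck0; exact: hw.
have c4 a j : continuous (pd a (fun x => w x j 0)) by apply: ck0; exact: Ck_on_derive (hw j 1%N).
have hcc c0 c1 d0 d1 := cE (@hc_continuous R k k1 k2 W1 W2 om c dk dk1 dW1 ck2 cW2 kx kp U sU i 0 0 c0 c1 d0 d1).
have kmc := cE (@km_continuous R k k1 dk U sU).
rewrite /comm; under eq_fun do rewrite hc_units.
have sc : continuous (fun x => \sum_(j < n) (pd (lift ord0 j) (pd (lift ord0 j) chi) x * w x i 0
      + 2 * (pd (lift ord0 j) chi x * pd (lift ord0 j) (fun x => w x i 0) x))).
  apply: continuous_sumr => j; apply: ctD; first by apply: ctM.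
  by apply: ctM; [exact: ct_cst | apply: ctM].
apply: ctD; last by apply: ctN; apply: ctM.
have q j : continuous (fun x => pd ord0 (pd ord0 chi) x * w x j 0
    + 2 * (pd ord0 chi x * pd ord0 (fun x => w x j 0) x)).
  by apply: ctD; [apply: ctM | apply: ctM; [exact: ct_cst | apply: ctM]].
have r j : continuous (fun x => pd ord0 chi x * w x j 0) by apply: ctM.
by apply: ctD; [apply: ctD; [apply: ctD|]|]; apply: ctM.
Qed.

Lemma comm_eq0 (chi : E -> R) (w : E -> 'cV[R]_2) i x :
  (forall j, pd j chi x = 0 /\ pd j (pd j chi) x = 0) ->
  comm k k1 k2 W1 W2 om c kx kp U chi w i x = 0.
Proof.
move=> h; have h1 j := (h j).1; have h2 j := (h j).2.
rewrite /comm hc_units h1 h2 !mul0r !mulr0 !addr0 !mul0r big1 ?mulr0 ?addr0 ?subr0 //.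
by move=> j _; rewrite h1 h2 !mul0r mulr0 addr0.
Qed.

Lemma comm_bound (B : R) : 0 <= B -> exists2 K : R, 0 <= K &
  forall (chi : E -> R) (w : E -> 'cV[R]_2) (b : R) i x, 0 <= b ->
    (forall j, `|pd j chi x| <= b) -> (forall j, `|pd j (pd j chi) x| <= b) ->
    (forall i, `|w x i 0| <= B) -> (forall i j, `|pd j (fun x => w x i 0) x| <= B) ->
    `|comm k k1 k2 W1 W2 om c kx kp U chi w i x| <= K * b.
Proof.
move=> B0; have [K K0 hK] := coefficients_bounded om c dk dk1 dW1 ck2 cW2 kx kp sU perU.
(* The four arguments of [hc] are bounded by [b B], [b B], [3 b B] and [3 b B], which add up to
   [8 b B]; each of the [n] transverse terms contributes [3 b B]. *)
exists (8 * K * B + K * n%:R * (3 * B)).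
  by apply: addr_ge0; apply: mulr_ge0 => //; apply: mulr_ge0.
move=> chi w b i x b0 h1 h2 h3 h4.
have p1 j m : `|pd j chi x * w x m 0| <= b * B by rewrite normrM; apply: ler_pM.
have p2 j m : `|pd j (pd j chi) x * w x m 0 + 2 * (pd j chi x * pd j (fun x => w x m 0) x)| <= 3 * (b * B).
  apply: le_trans (ler_normD _ _) _.
  have q1 : `|pd j (pd j chi) x * w x m 0| <= b * B by rewrite normrM; apply: ler_pM.
  have q2 : `|2 * (pd j chi x * pd j (fun x => w x m 0) x)| <= 2 * (b * B).
    by rewrite !normrM ger0_norm //; apply: ler_wpM2l => //; apply: ler_pM.
  have -> : 3 * (b * B) = b * B + 2 * (b * B) by ring.
  exact: lerD.
have [kb hb] := hK (x 0 ord0).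
have s1 : `|\sum_(j < n) (pd (lift ord0 j) (pd (lift ord0 j) chi) x * w x i 0
      + 2 * (pd (lift ord0 j) chi x * pd (lift ord0 j) (fun x => w x i 0) x))| <= n%:R * (3 * (b * B)).
  apply: le_trans (ler_norm_sum _ _ _) _.
  have -> : n%:R * (3 * (b * B)) = \sum_(j < n) (3 * (b * B)) by rewrite sumr_const card_ord mulr_natl.
  by apply: ler_sum => j _; exact: p2.
apply: le_trans (ler_normB _ _) _; rewrite normrM.
have t1 := hb i (pd ord0 chi x * w x 0 0) (pd ord0 chi x * w x 1 0)
  (pd ord0 (pd ord0 chi) x * w x 0 0 + 2 * (pd ord0 chi x * pd ord0 (fun x => w x 0 0) x))
  (pd ord0 (pd ord0 chi) x * w x 1 0 + 2 * (pd ord0 chi x * pd ord0 (fun x => w x 1 0) x)).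
have t2 : `|km k U (x 0 ord0)| * `|\sum_(j < n) (pd (lift ord0 j) (pd (lift ord0 j) chi) x * w x i 0
      + 2 * (pd (lift ord0 j) chi x * pd (lift ord0 j) (fun x => w x i 0) x))| <= K * (n%:R * (3 * (b * B))).
  by apply: ler_pM.
apply: le_trans (lerD t1 t2) _.
have -> : (8 * K * B + K * n%:R * (3 * B)) * b = K * (b * B + b * B + 3 * (b * B) + 3 * (b * B)) + K * (n%:R * (3 * (b * B))).
  by ring.
rewrite lerD2r; apply: ler_wpM2l => //.
by apply: lerD; [apply: lerD; [apply: lerD|]|].
Qed.

Lemma measurable_cfield_continuous (u : @cfield R n) :
  (forall i, continuous (fun x => complex.Re (u x i 0))) ->
  (forall i, continuous (fun x => complex.Im (u x i 0))) -> measurable_cfield u.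
Proof.
by move=> h1 h2 i; split; [exact: (measurable_continuous_row (h1 i)) | exact: (measurable_continuous_row (h2 i))].
Qed.

(* Weyl's criterion: cutting off a bounded eigenfunction at scale [N] produces
   approximate eigenfunctions. *)
Theorem eigenfunction_spectrum (psi : @cfield R n) (l : C) (B lo a b : R) :
  smooth_on setT (re_field psi) -> smooth_on setT (im_field psi) ->
  (forall x i, `|re_field psi x i 0| <= B) -> (forall x i, `|im_field psi x i 0| <= B) ->
  (forall x i j, `|pd j (fun x => re_field psi x i 0) x| <= B) ->
  (forall x i j, `|pd j (fun x => im_field psi x i 0) x| <= B) ->
  (forall x, T psi x = l *: psi x) ->
  0 < lo -> 0 <= a -> a < b -> (forall x : E, a <= x 0 ord0 <= b -> lo <= sqm (psi x)) ->
  in_spectrum T l.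
Proof.
move=> s1 s2 b1 b2 b3 b4 eig lo0 a0 ab low.
have B0 : 0 <= B by apply: le_trans (b1 0 0); exact: normr_ge0.
have [K K0 hK] := comm_bound B0.
have [D D0 /choice[chi hchi]] := cutoff_exists (R := R) (n := n.+1).
(* One constant for two bounds: four real components of the commutator, and four of the truncated
   function. *)
pose Q := 4 * (K * D) ^+ 2 + 4 * B ^+ 2.
have KD0 : 0 <= (K * D) ^+ 2 by exact: sqr_ge0.
have B20 : 0 <= B ^+ 2 by exact: sqr_ge0.
have Q0 : 0 <= Q by rewrite /Q; apply: addr_ge0; apply: mulr_ge0.
pose v N (x : E) := (chi N x)%:C%C *: psi x.
(* The interval [[a, b]] has to lie in the region where the cutoff equals 1. *)
have [N0 hN0] : exists N0 : nat, b <= N0%:R.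
  exists (Num.bound b); apply: ltW; apply: archi_boundP; exact: le_trans a0 (ltW ab).
apply: (@weyl_spectrum R n T l v N0 lo Q a b operator_sub lo0 Q0 ab).
move=> N hN err.
have [cN b01 cD cDD [supp one]] := hchi N.
(* As [psi] is an exact eigenfunction, the error reduces to the commutator. *)
have errE x : err x = - (\col_i Complex ((Jmx *m cm (chi N) (re_field psi) x) i 0)
    ((Jmx *m cm (chi N) (im_field psi) x) i 0)).
  rewrite /err operator_product // eig /v !scalerA [l * _]mulrC opprD addrA subrr add0r //.
have sqb (y z : R) : `|y| <= z -> y ^+ 2 <= z ^+ 2.
  move=> h; rewrite -real_normK ?num_real //; apply: lerXn2r => //; rewrite nnegrE //.
  exact: le_trans (normr_ge0 _) h.
have cI i : continuous (fun x => im_field psi x i 0).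
  by move=> x; have /smooth_entries/(_ i 0%N) h := s2; exact: (Ck_on_continuous h (I : setT x)).
have cR i : continuous (fun x => re_field psi x i 0).
  by move=> x; have /smooth_entries/(_ i 0%N) h := s1; exact: (Ck_on_continuous h (I : setT x)).
have cC : continuous (chi N) by move=> x; exact: (Ck_on_continuous (cN 0%N) (I : setT x)).
have cc1 i := @comm_continuous (chi N) (re_field psi) i cN s1; have cc2 i := @comm_continuous (chi N) (im_field psi) i cN s2.
split.
- split; rewrite ?re_field_scale ?im_field_scale; [exact: smooth_scale | exact: smooth_scale |].
  exists (2 * N.+1%:R) => x hx; rewrite /v (_ : chi N x = 0) ?scale0r //.
  apply: (proj1 (supp x _)); apply: contrapT => hn; move: hx; rewrite ltNge => /negP; apply.
  rewrite /Num.norm /= mx_normrE; apply/bigmax_leP; split; first exact: mulr_ge0.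
  move=> [i j] _ /=; rewrite ord1 leNgt; apply/negP => h; apply: hn; by exists j.
- apply: measurable_cfield_continuous => i.
    have -> : (fun x => complex.Re (v N x i 0)) = fun x => chi N x * re_field psi x i 0.
      by apply/funext => x; rewrite -[LHS]re_fieldE re_field_scale mxE.
    by apply: ctM.
  have -> : (fun x => complex.Im (v N x i 0)) = fun x => chi N x * im_field psi x i 0.
    by apply/funext => x; rewrite -[LHS]im_fieldE im_field_scale mxE.
  by apply: ctM.
- apply: measurable_cfield_continuous => i.
    have -> : (fun x => complex.Re (err x i 0)) = fun x => - (Jmx *m cm (chi N) (re_field psi) x) i 0.
      by apply/funext => x; rewrite errE !mxE.
    case: (ord2P i) => ->.
      by under eq_fun do rewrite JmxE0 mxE; apply: ctN.
    by under eq_fun do rewrite JmxE1 mxE opprK; exact: cc1.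
  have -> : (fun x => complex.Im (err x i 0)) = fun x => - (Jmx *m cm (chi N) (im_field psi) x) i 0.
    by apply/funext => x; rewrite errE !mxE.
  case: (ord2P i) => ->.
    by under eq_fun do rewrite JmxE0 mxE; apply: ctN.
  by under eq_fun do rewrite JmxE1 mxE opprK; exact: cc2.
split.
- move=> x hx; have [z0 zd] := supp x hx; rewrite /v z0 scale0r; split => //.
  have z w : cm (chi N) w x = 0 by apply/matrixP => p q; rewrite ord1 !mxE comm_eq0.
  by rewrite errE !z !mulmx0; apply/matrixP => i j; rewrite !mxE oppr0.
- move=> x; rewrite /v sqm_scale /= expr0n addr0 /sqm sum2.
  have h1 := sqb _ _ (b1 x 0); have h2 := sqb _ _ (b1 x 1).
  have h3 := sqb _ _ (b2 x 0); have h4 := sqb _ _ (b2 x 1).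
  rewrite !re_fieldE in h1 h2; rewrite !im_fieldE in h3 h4.
  have hc : chi N x ^+ 2 <= 1 by rewrite -(expr1n _ 2); exact: sqb.
  apply: (@le_trans _ _ (1 * (4 * B ^+ 2))); last by rewrite mul1r /Q lerDr mulr_ge0.
  apply: ler_pM => //; first exact: sqr_ge0.
    by apply: addr_ge0; apply: addr_ge0; exact: sqr_ge0.
  have -> : 4 * B ^+ 2 = B ^+ 2 + B ^+ 2 + (B ^+ 2 + B ^+ 2) by ring.
  by apply: lerD; apply: lerD.
- move=> x; rewrite errE sqmN sqm_comm !mxE.
  have DN : 0 <= D / N.+1%:R by apply: divr_ge0.
  have k1' i := sqb _ _ (hK (chi N) _ _ i x DN (cD x) (cDD x) (b1 x) (b3 x)).
  have k2' i := sqb _ _ (hK (chi N) _ _ i x DN (cD x) (cDD x) (b2 x) (b4 x)).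
  apply: (@le_trans _ _ (4 * (K * D) ^+ 2 / N.+1%:R ^+ 2)); last first.
    by apply: ler_wpM2r; [rewrite invr_ge0; exact: sqr_ge0 | rewrite /Q lerDl mulr_ge0].
  have -> : 4 * (K * D) ^+ 2 / N.+1%:R ^+ 2 = (K * (D / N.+1%:R)) ^+ 2 + (K * (D / N.+1%:R)) ^+ 2
      + ((K * (D / N.+1%:R)) ^+ 2 + (K * (D / N.+1%:R)) ^+ 2).
    by field.
  by apply: lerD; apply: lerD.
- move=> x hx hy; rewrite /v sqm_scale one /=; last first.
    move=> j; case: (unliftP ord0 j) => [m ->|->]; first exact: hy.
    have /andP[h1 h2] := hx; apply/andP; split; first exact: le_trans a0 h1.
    apply: le_trans h2 _; apply: le_trans hN0 _; by rewrite ler_nat; exact: leq_trans hN _.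
  by rewrite expr1n expr0n addr0 mul1r; exact: low.
Qed.

End Eigenfunction.

Lemma cos_sin_smooth (R : realType) m : Ck_on setT m (@cos R) /\ Ck_on setT m (@sin R).
Proof.
elim: m => [|m [IHc IHs]].
  by split; split => // x _; [exact: continuous_cos | exact: continuous_sin].
split; first by apply: (@Ck_on1_intro _ _ _ (fun x => - sin x)) => //; apply: Ck_onN => //; exact: openT.
exact: (@Ck_on1_intro _ _ _ cos).
Qed.

(** * Fields with separated variables *)

Section Separated.
Context {R : realType} {n : nat}.
Variable (j0 : 'I_n).
Local Notation E := 'rV[R]_n.+1.
Local Notation pd j f := ('D_(delta_mx 0 j : E) f).

(** For trigonometric [g] and [h] this is the real or imaginary part of [e^{i e y} (A + i B)], where
    [y] is the single transverse coordinate on which the mode depends. *)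
Definition sep (A B g h : R -> R) (x : E) : R :=
  g (x 0 (lift ord0 j0)) * A (x 0 ord0) + h (x 0 (lift ord0 j0)) * B (x 0 ord0).

Lemma coord_derive (f : R -> R) (d : R) (x v : E) (i : 'I_n.+1) : is_derive (x 0 i) 1 f d ->
  is_derive x v (fun y : E => f (y 0 i)) (v 0 i * d).
Proof.
move=> h; apply/is_derive_lineE.
have h1 : is_derive (0 : R) 1 (fun t : R => t * v 0 i + x 0 i) (v 0 i).
  apply: is_derive_eq (derD (derM (der_id (0 : R)) (der_cst (v 0 i) (0 : R) (1 : R))) (der_cst (x 0 i) (0 : R) (1 : R))) _.
  by rewrite mul1r mul0r !addr0.
have h2 : is_derive (0 * v 0 i + x 0 i) 1 f d by rewrite mul0r add0r.
rewrite mulrC; apply: is_derive_ext (der_comp (g := fun t : R => t * v 0 i + x 0 i) h2 h1).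
by move=> t; rewrite !mxE.
Qed.

Lemma sep_derive0 (A B g h A' B' : R -> R) : (forall t : R, is_derive t 1 A (A' t)) ->
  (forall t : R, is_derive t 1 B (B' t)) -> pd ord0 (sep A B g h) = sep A' B' g h.
Proof.
move=> dA dB; apply/funext => x.
have c (f : R -> R) : is_derive x (delta_mx 0 ord0 : E) (fun y : E => f (y 0 (lift ord0 j0))) 0.
  apply/is_derive_lineE; apply: (is_derive_ext _ (der_cst (f (x 0 (lift ord0 j0))) (0 : R) (1 : R))).
  by move=> t; rewrite !mxE /= mulr0 add0r.
have hA := coord_derive (delta_mx 0 ord0 : E) (dA (x 0 ord0)).
have hB := coord_derive (delta_mx 0 ord0 : E) (dB (x 0 ord0)).
apply: (etrans (@derive_val _ _ _ _ _ _ _ (derD (derM (c g) hA) (derM (c h) hB)))).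
by rewrite !mxE !eqxx /= !mul1r !mul0r !add0r.
Qed.

Lemma sep_deriveS (A B g h g' h' : R -> R) j : (forall t : R, is_derive t 1 g (g' t)) ->
  (forall t : R, is_derive t 1 h (h' t)) ->
  pd (lift ord0 j) (sep A B g h) = fun x => (j == j0)%:R * sep A B g' h' x.
Proof.
move=> dg dh; apply/funext => x.
have c (f : R -> R) : is_derive x (delta_mx 0 (lift ord0 j) : E) (fun y : E => f (y 0 ord0)) 0.
  apply/is_derive_lineE; apply: (is_derive_ext _ (der_cst (f (x 0 ord0)) (0 : R) (1 : R))).
  by move=> t; rewrite !mxE /= mulr0 add0r.
have hg := coord_derive (delta_mx 0 (lift ord0 j) : E) (dg (x 0 (lift ord0 j0))).
have hh := coord_derive (delta_mx 0 (lift ord0 j) : E) (dh (x 0 (lift ord0 j0))).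
apply: (etrans (@derive_val _ _ _ _ _ _ _ (derD (derM hg (c A)) (derM hh (c B))))).
rewrite !mxE !eqxx /= (inj_eq lift_inj) eq_sym /sep !mulr0 !addr0; ring.
Qed.

Lemma sep_smooth (A B g h : R -> R) m : Ck_on setT m A -> Ck_on setT m B -> Ck_on setT m g ->
  Ck_on setT m h -> Ck_on setT m (sep A B g h).
Proof.
move=> cA cB cg ch; have o := @openT E.
by apply: Ck_onD => //; apply: Ck_onM => //; exact: Ck_on_coord.
Qed.

Lemma sep_laplacian (A B g h g' h' g2 h2 : R -> R) x : (forall t : R, is_derive t 1 g (g' t)) ->
  (forall t : R, is_derive t 1 h (h' t)) -> (forall t : R, is_derive t 1 g' (g2 t)) ->
  (forall t : R, is_derive t 1 h' (h2 t)) ->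
  \sum_(j < n) pd (lift ord0 j) (pd (lift ord0 j) (sep A B g h)) x = sep A B g2 h2 x.
Proof.
move=> dg dh dg' dh'.
have e j : pd (lift ord0 j) (pd (lift ord0 j) (sep A B g h)) x = (j == j0)%:R * sep A B g2 h2 x.
  rewrite (sep_deriveS _ _ j dg dh); case: eqP => [->|_].
    have -> : (fun x => true%:R * sep A B g' h' x) = sep A B g' h' by apply/funext => y; rewrite mul1r.
    exact: (etrans (congr1 (fun f => f x) (sep_deriveS A B j0 dg' dh')) (congr1 (fun b : bool => b%:R * _) (eqxx j0))).
  have -> : (fun x => false%:R * sep A B g' h' x) = fun=> 0 by apply/funext => y; rewrite mul0r.
  by rewrite mul0r; exact: (@derive_val _ _ _ _ _ _ _ (der_cst 0 x _)).
under eq_bigr do rewrite e.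
by rewrite (bigD1 j0) //= eqxx mul1r big1 ?addr0 // => j /negPf ->; rewrite mul0r.
Qed.

End Separated.

(** * Passage between scaled and unscaled unknowns *)

Section Scaling.
Context {R : realType}.
Variables (kx kp : R).
Hypothesis kx0 : kx != 0.

Definition phase (t : R) : R := - (kp * (t / kx)).

(** The scaled unknown at [t] is the unscaled one at [t / kx] with the rotation of the profile
    undone. *)
Definition scl (f0 f1 : R -> R) (i : 'I_2) (t : R) : R :=
  rot (cos (phase t)) (sin (phase t)) i (f0 (t / kx)) (f1 (t / kx)).

(** Read off from [(kx d_t + kp J) (scl f) = scl f']; in this form the twisted derivatives of the
    scaled operator simplify at once. *)
Definition dscl (f0 f1 g0 g1 : R -> R) (i : 'I_2) (t : R) : R :=
  kx^-1 * sel i (scl g0 g1 0 t - kp * scl f0 f1 1 t) (scl g0 g1 1 t + kp * scl f0 f1 0 t).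

Definition ddscl (f0 f1 g0 g1 h0 h1 : R -> R) (i : 'I_2) (t : R) : R :=
  kx^-1 * sel i (dscl g0 g1 h0 h1 0 t - kp * dscl f0 f1 g0 g1 1 t)
                (dscl g0 g1 h0 h1 1 t + kp * dscl f0 f1 g0 g1 0 t).

Lemma scl_derive (f0 f1 g0 g1 : R -> R) i (t : R) : (forall x : R, is_derive x 1 f0 (g0 x)) ->
  (forall x : R, is_derive x 1 f1 (g1 x)) ->
  is_derive t 1 (scl f0 f1 i) (dscl f0 f1 g0 g1 i t).
Proof.
move=> d0 d1.
have dl : is_derive t 1 (fun t : R => t / kx) kx^-1.
  by apply: is_derive_eq (derM (der_id t) (der_cst kx^-1 t 1)) _; rewrite mul1r mulr0 addr0.
have dp : is_derive t 1 phase (- (kp * kx^-1)).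
  by apply: is_derive_eq (derN (derM (der_cst kp t 1) dl)) _; rewrite mul0r add0r.
have e0 := der_comp (g := fun t : R => t / kx) (d0 (t / kx)) dl.
have e1 := der_comp (g := fun t : R => t / kx) (d1 (t / kx)) dl.
have ec := der_comp (is_derive_cos (phase t)) dp; have es := der_comp (is_derive_sin (phase t)) dp.
case: (ord2P i) => ->; rewrite /dscl /scl /rot /sel /=.
  by apply: is_derive_eq (derD (derM ec e0) (derM es e1)) _; ring.
by apply: is_derive_eq (derB (derM ec e1) (derM es e0)) _; ring.
Qed.

Lemma dscl_derive (f0 f1 g0 g1 h0 h1 : R -> R) i (t : R) : (forall x : R, is_derive x 1 f0 (g0 x)) ->
  (forall x : R, is_derive x 1 f1 (g1 x)) -> (forall x : R, is_derive x 1 g0 (h0 x)) ->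
  (forall x : R, is_derive x 1 g1 (h1 x)) ->
  is_derive t 1 (dscl f0 f1 g0 g1 i) (ddscl f0 f1 g0 g1 h0 h1 i t).
Proof.
move=> d0 d1 d2 d3.
have f i := @scl_derive f0 f1 g0 g1 i t d0 d1; have g i := @scl_derive g0 g1 h0 h1 i t d2 d3.
have c (a : R) := der_cst a t 1.
case: (ord2P i) => ->; rewrite /ddscl /dscl /sel /=.
  by apply: is_derive_eq (derM (c kx^-1) (derB (g 0) (derM (c kp) (f 1)))) _; rewrite /dscl /sel /=; ring.
by apply: is_derive_eq (derM (c kx^-1) (derD (g 1) (derM (c kp) (f 0)))) _; rewrite /dscl /sel /=; ring.
Qed.

Lemma scl_smooth (f0 f1 : R -> R) i m : Ck_on setT m f0 -> Ck_on setT m f1 ->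
  Ck_on setT m (scl f0 f1 i).
Proof.
move=> c0 c1; have o := @openT R.
have cl : Ck_on setT m (fun t : R => t / kx).
  by apply: Ck_onM => //; [exact: Ck_on_id | exact: Ck_on_cst].
have cp : Ck_on setT m phase.
  by apply: Ck_onN => //; apply: Ck_onM => //; exact: Ck_on_cst.
have [kc ks] := cos_sin_smooth R m.
have e0 := Ck_on_comp o c0 cl; have e1 := Ck_on_comp o c1 cl.
have ec := Ck_on_comp o kc cp; have es := Ck_on_comp o ks cp.
case: (ord2P i) => ->; rewrite /scl /rot /sel /=.
  by apply: Ck_onD => //; apply: Ck_onM.
by apply: Ck_onB => //; apply: Ck_onM.
Qed.

Lemma scl_sqr (f0 f1 : R -> R) t :
  scl f0 f1 0 t ^+ 2 + scl f0 f1 1 t ^+ 2 = f0 (t / kx) ^+ 2 + f1 (t / kx) ^+ 2.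
Proof. by rewrite /scl /rot /sel /= -[RHS]mul1r -(cos2Dsin2 (phase t)); ring. Qed.

Lemma scl_bound (f0 f1 : R -> R) (K : R) i t : (forall x, `|f0 x| <= K) -> (forall x, `|f1 x| <= K) ->
  `|scl f0 f1 i t| <= 2 * K.
Proof.
move=> h0 h1; have hc : `|cos (phase t)| <= 1 by rewrite ler_norml cos_geN1 cos_le1.
have hs : `|sin (phase t)| <= 1 by rewrite ler_norml sin_geN1 sin_le1.
have -> : 2 * K = 1 * K + 1 * K by ring.
have b (a d : R) : `|a| <= 1 -> `|d| <= K -> `|a * d| <= 1 * K by move=> *; rewrite normrM; apply: ler_pM.
case: (ord2P i) => ->; rewrite /scl /rot /sel /=.
  by apply: le_trans (ler_normD _ _) _; apply: lerD; apply: b.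
by apply: le_trans (ler_normB _ _) _; apply: lerD; apply: b.
Qed.

Lemma dscl_bound (f0 f1 g0 g1 : R -> R) (K : R) i t : (forall x, `|f0 x| <= K) ->
  (forall x, `|f1 x| <= K) -> (forall x, `|g0 x| <= K) -> (forall x, `|g1 x| <= K) ->
  `|dscl f0 f1 g0 g1 i t| <= `|kx^-1| * (2 * K + `|kp| * (2 * K)).
Proof.
move=> a0 a1 b0 b1; rewrite /dscl normrM; apply: ler_wpM2l => //.
have f i := scl_bound i t a0 a1; have g i := scl_bound i t b0 b1.
case: (ord2P i) => ->; rewrite /sel /=.
  by apply: le_trans (ler_normB _ _) _; rewrite normrM; apply: lerD => //; apply: ler_wpM2l.
by apply: le_trans (ler_normD _ _) _; rewrite normrM; apply: lerD => //; apply: ler_wpM2l.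
Qed.

Let D0 (a b : R) : kx * (kx^-1 * (a - kp * b)) + kp * b = a.
Proof. by rewrite mulrA divff // mul1r subrK. Qed.
Let D1 (a b : R) : kx * (kx^-1 * (a + kp * b)) - kp * b = a.
Proof. by rewrite mulrA divff // mul1r addrK. Qed.

(** Twisted derivatives of scaled functions are scaled plain derivatives, and the remaining rotation
    passes through the operator by equivariance. *)
Lemma hess_expr_scl k k1 k2 W1 W2 om c (u0 u1 p0 p1 q0 q1 f0 f1 g0 g1 h0 h1 : R -> R) i t :
  hess_expr k k1 k2 W1 W2 om c kx kp i (scl u0 u1 0 t) (scl u0 u1 1 t)
    (dscl u0 u1 p0 p1 0 t) (dscl u0 u1 p0 p1 1 t)
    (ddscl u0 u1 p0 p1 q0 q1 0 t) (ddscl u0 u1 p0 p1 q0 q1 1 t)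
    (scl f0 f1 0 t) (scl f0 f1 1 t) (dscl f0 f1 g0 g1 0 t) (dscl f0 f1 g0 g1 1 t)
    (ddscl f0 f1 g0 g1 h0 h1 0 t) (ddscl f0 f1 g0 g1 h0 h1 1 t) =
  scl (fun x => lop k k1 k2 W1 W2 om c u0 u1 p0 p1 q0 q1 0 x (f0 x) (f1 x) (g0 x) (g1 x) (h0 x) (h1 x))
      (fun x => lop k k1 k2 W1 W2 om c u0 u1 p0 p1 q0 q1 1 x (f0 x) (f1 x) (g0 x) (g1 x) (h0 x) (h1 x)) i t.
Proof.
have cs : cos (phase t) * cos (phase t) + sin (phase t) * sin (phase t) = 1 by rewrite -!expr2 cos2Dsin2.
have e0 a0 a1 b0 b1 : kx * dscl a0 a1 b0 b1 0 t + kp * scl a0 a1 1 t = scl b0 b1 0 t by exact: D0.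
have e1 a0 a1 b0 b1 : kx * dscl a0 a1 b0 b1 1 t - kp * scl a0 a1 0 t = scl b0 b1 1 t by exact: D1.
have f0' a0 a1 b0 b1 d0 d1 : kx * ddscl a0 a1 b0 b1 d0 d1 0 t + kp * dscl a0 a1 b0 b1 1 t = dscl b0 b1 d0 d1 0 t by exact: D0.
have f1' a0 a1 b0 b1 d0 d1 : kx * ddscl a0 a1 b0 b1 d0 d1 1 t - kp * dscl a0 a1 b0 b1 0 t = dscl b0 b1 d0 d1 1 t by exact: D1.
rewrite /hess_expr; cbv zeta; rewrite !e0 !e1 !f0' !f1' !e0 !e1.
exact: (lvec_rot k k1 k2 W1 W2 om c cs).
Qed.

End Scaling.

(** * The eigenfunction on the whole space *)

Section BlochField.
Context {R : realType} {n : nat}.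
Local Notation C := R[i].
Variables (k k1 k2 W W1 W2 : R -> R) (om c : R).
Hypothesis dk : forall s : R, is_derive s 1 k (k1 s).
Hypothesis dk1 : forall s : R, is_derive s 1 k1 (k2 s).
Hypothesis dW : forall s : R, is_derive s 1 W (W1 s).
Hypothesis dW1 : forall s : R, is_derive s 1 W1 (W2 s).
Hypothesis ck2 : continuous k2.
Hypothesis cW2 : continuous W2.
Variables (kx kp : R) (U : R -> 'cV[R]_2).
Hypothesis kx0 : 0 < kx.
Hypothesis perU : forall t, U (t + 1) = U t.
Variables (u0 u1 p0 p1 q0 q1 : R -> R).
Hypothesis UE : forall t i, U t i 0 = scl kx kp u0 u1 i t.
Hypothesis du0 : forall x : R, is_derive x 1 u0 (p0 x).
Hypothesis du1 : forall x : R, is_derive x 1 u1 (p1 x).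
Hypothesis dp0 : forall x : R, is_derive x 1 p0 (q0 x).
Hypothesis dp1 : forall x : R, is_derive x 1 p1 (q1 x).
Hypothesis su0 : forall m, Ck_on setT m u0.
Hypothesis su1 : forall m, Ck_on setT m u1.
(* [a + i b] is the amplitude of the mode; [a1], [a2] are the derivatives of [a],
   and [lr + i li] is the eigenvalue. *)
Variables (a b a1 b1 a2 b2 : 'I_2 -> R -> R) (e lr li K : R).
Hypothesis da : forall i (x : R), is_derive x 1 (a i) (a1 i x).
Hypothesis db : forall i (x : R), is_derive x 1 (b i) (b1 i x).
Hypothesis da1 : forall i (x : R), is_derive x 1 (a1 i) (a2 i x).
Hypothesis db1 : forall i (x : R), is_derive x 1 (b1 i) (b2 i x).
Hypothesis sa : forall i m, Ck_on setT m (a i).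
Hypothesis sb : forall i m, Ck_on setT m (b i).

Local Notation op f f1 f2 i x :=
  (lop k k1 k2 W1 W2 om c u0 u1 p0 p1 q0 q1 i x (f 0 x) (f 1 x) (f1 0 x) (f1 1 x) (f2 0 x) (f2 1 x)).
Local Notation ks x := (k (msq u0 u1 x)).
Definition reL (i : 'I_2) (x : R) : R := lr * a i x - li * b i x.
Definition imL (i : 'I_2) (x : R) : R := lr * b i x + li * a i x.
Hypothesis eqa : forall i x, op a a1 a2 i x = sel i (- reL 1 x) (reL 0 x) - ks x * e ^+ 2 * a i x.
Hypothesis eqb : forall i x, op b b1 b2 i x = sel i (- imL 1 x) (imL 0 x) - ks x * e ^+ 2 * b i x.
Hypothesis bda : forall i x, `|a i x| <= K.
Hypothesis bdb : forall i x, `|b i x| <= K.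
Hypothesis bda1 : forall i x, `|a1 i x| <= K.
Hypothesis bdb1 : forall i x, `|b1 i x| <= K.
Variable j0 : 'I_n.

Local Notation E := 'rV[R]_n.+1.
Local Notation pd j f := ('D_(delta_mx 0 j : E) f).
Local Notation A := (@scaled_density R n k W om c kx kp).
Local Notation T := (complexify (fun v x => Jmx *m Hess A (plane U) v x)).
Local Notation Sc f := (scl kx kp (f 0) (f 1)).
Local Notation dSc f f1 := (dscl kx kp (f 0) (f 1) (f1 0) (f1 1)).
Local Notation ddSc f f1 f2 := (ddscl kx kp (f 0) (f 1) (f1 0) (f1 1) (f2 0) (f2 1)).
Local Notation y x := (x 0 (lift ord0 j0)).

Let kxn : kx != 0. Proof. exact: lt0r_neq0. Qed.

Definition bfield (g h : R -> R) (x : E) : 'cV[R]_2 := \col_i sep j0 (Sc a i) (Sc b i) g h x.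

Let bfieldE g h i : (fun x => bfield g h x i 0) = sep j0 (Sc a i) (Sc b i) g h.
Proof. by apply/funext => x; rewrite mxE. Qed.

Lemma bfield_smooth g h : (forall m, Ck_on setT m g) -> (forall m, Ck_on setT m h) ->
  smooth_on setT (bfield g h).
Proof.
move=> sg sh; apply/smooth_entries => i m; rewrite bfieldE.
by apply: sep_smooth => //; apply: scl_smooth.
Qed.

Let UEf i : (fun t => U t i 0) = scl kx kp u0 u1 i.
Proof. by apply/funext => t; exact: UE. Qed.

Lemma profile_smooth m i : Ck_on setT m (fun t => U t i 0).
Proof. by rewrite UEf; exact: scl_smooth. Qed.

Let D1U i : 'D_1 (fun t => U t i 0) = dscl kx kp u0 u1 p0 p1 i.
Proof. by rewrite UEf; apply/funext => t; exact: (@derive_val _ _ _ _ _ _ _ (scl_derive kx kp i t du0 du1)). Qed.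

Let D2U i : 'D_1 ('D_1 (fun t => U t i 0)) = ddscl kx kp u0 u1 p0 p1 q0 q1 i.
Proof.
by rewrite D1U; apply/funext => t; exact: (@derive_val _ _ _ _ _ _ _ (dscl_derive kx kp i t du0 du1 dp0 dp1)).
Qed.

Let hcE i (f f1 f2 : 'I_2 -> R -> R) t :
  hc k k1 k2 W1 W2 om c kx kp U i t (Sc f 0 t) (Sc f 1 t) (dSc f f1 0 t) (dSc f f1 1 t)
    (ddSc f f1 f2 0 t) (ddSc f f1 f2 1 t) =
  scl kx kp (fun x => op f f1 f2 0 x) (fun x => op f f1 f2 1 x) i t.
Proof.
have cong v v' d d' h h' z z' r r' s s' w0 w1 c0 c1 d0 d1 : v = v' -> d = d' -> h = h' ->
    z = z' -> r = r' -> s = s' ->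
    hess_expr k k1 k2 W1 W2 om c kx kp i v d h z r s w0 w1 c0 c1 d0 d1 =
    hess_expr k k1 k2 W1 W2 om c kx kp i v' d' h' z' r' s' w0 w1 c0 c1 d0 d1.
  by move=> -> -> -> -> -> ->.
have ap (F G : R -> R) : F = G -> F t = G t by move=> ->.
apply: etrans (cong _ _ _ _ _ _ _ _ _ _ _ _ _ _ _ _ _ _ (UE t 0) (UE t 1) (ap _ _ (D1U 0))
  (ap _ _ (D1U 1)) (ap _ _ (D2U 0)) (ap _ _ (D2U 1))) _.
exact: (hess_expr_scl kp kxn).
Qed.

Let hc_lin2 i t (g h : R) (w v c0 c1 d0 d1 w' v' c0' c1' d0' d1' : R) :
  hc k k1 k2 W1 W2 om c kx kp U i t (g * w + h * w') (g * v + h * v') (g * c0 + h * c0')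
    (g * c1 + h * c1') (g * d0 + h * d0') (g * d1 + h * d1') =
  g * hc k k1 k2 W1 W2 om c kx kp U i t w v c0 c1 d0 d1
  + h * hc k k1 k2 W1 W2 om c kx kp U i t w' v' c0' c1' d0' d1'.
Proof.
rewrite /hc; move: ('D_1 _ t) ('D_1 _ t) ('D_1 _ t) ('D_1 _ t) => r s s' r'.
by case: (ord2P i) => ->; rewrite /hess_expr /lform /sel /=; ring.
Qed.

Let kmE t : km k U t = ks (t / kx).
Proof.
rewrite /km !UE -!expr2 scl_sqr /msq -!expr2; congr (k _).
Qed.

(** [g] and [h] satisfy [g'' = - e^2 g], so that the transverse Laplacian adds [k e^2] times the
    field, which cancels the last terms of [eqa] and [eqb]. *)
Lemma hess_bfield g h g1 h1 x i : (forall m, Ck_on setT m g) -> (forall m, Ck_on setT m h) ->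
  (forall t : R, is_derive t 1 g (g1 t)) -> (forall t : R, is_derive t 1 h (h1 t)) ->
  (forall t : R, is_derive t 1 g1 (- (e ^+ 2 * g t))) ->
  (forall t : R, is_derive t 1 h1 (- (e ^+ 2 * h t))) ->
  Hess A (plane U) (bfield g h) x i 0 =
  sel i (- sep j0 (Sc reL 1) (Sc imL 1) g h x) (sep j0 (Sc reL 0) (Sc imL 0) g h x).
Proof.
move=> sg sh dg dh dg1 dh1.
have dA j t := scl_derive kx kp j t (da 0) (da 1).
have dB j t := scl_derive kx kp j t (db 0) (db 1).
have ddA j t := dscl_derive kx kp j t (da 0) (da 1) (da1 0) (da1 1).
have ddB j t := dscl_derive kx kp j t (db 0) (db 1) (db1 0) (db1 1).
have F0 j : bfield g h x j 0 = sep j0 (Sc a j) (Sc b j) g h x by rewrite mxE.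
have F1 j : pd ord0 (fun x => bfield g h x j 0) x = sep j0 (dSc a a1 j) (dSc b b1 j) g h x.
  by rewrite bfieldE; exact: (congr1 (fun f => f x) (sep_derive0 j0 g h (dA j) (dB j))).
have F2 j : pd ord0 (pd ord0 (fun x => bfield g h x j 0)) x =
    sep j0 (ddSc a a1 a2 j) (ddSc b b1 b2 j) g h x.
  rewrite bfieldE (sep_derive0 j0 g h (dA j) (dB j)).
  exact: (congr1 (fun f => f x) (sep_derive0 j0 g h (ddA j) (ddB j))).
have F3 : \sum_(j < n) pd (lift ord0 j) (pd (lift ord0 j) (fun x => bfield g h x i 0)) x =
    - (e ^+ 2 * sep j0 (Sc a i) (Sc b i) g h x).
  rewrite bfieldE; apply: etrans (sep_laplacian _ _ _ _ dg dh dg1 dh1) _; rewrite /sep; ring.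
have C2 : Ck_on setT 2 (bfield g h) by exact: bfield_smooth.
apply: etrans (hessE' om c dk dk1 dW dW1 kx kp profile_smooth x i C2) _.
rewrite F3 !F2 !F1 !F0 /sep hc_lin2 !hcE kmE.
set t := x 0 ord0; set s := t / kx.
rewrite /scl !eqa !eqb -/s.
move: (ks s) (g _) (h _) => kk gg hh.
rewrite -[RHS]/(sel i _ _).
move: (a 0 s) (a 1 s) (b 0 s) (b 1 s) (reL 0 s) (reL 1 s) (imL 0 s) (imL 1 s) (cos _) (sin _) => *.
by case: (ord2P i) => ->; rewrite /rot /sel /=; ring.
Qed.

Variables (lo s1 s2 : R).
Hypothesis lo0 : 0 < lo.
Hypothesis s10 : 0 <= s1.
Hypothesis s12 : s1 < s2.
Hypothesis low : forall x, s1 <= x <= s2 ->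
  lo <= a 0 x ^+ 2 + a 1 x ^+ 2 + (b 0 x ^+ 2 + b 1 x ^+ 2).

Let ce t := cos (e * t).
Let se t := sin (e * t).

Let der_lin (t : R) : is_derive t 1 (fun t => e * t) e.
Proof. by apply: is_derive_eq (derM (der_cst e t 1) (der_id t)) _; rewrite mul0r add0r mulr1. Qed.

Let dce (t : R) : is_derive t 1 ce (- (e * se t)).
Proof.
by apply: is_derive_eq (der_comp (g := fun t => e * t) (is_derive_cos (e * t)) (der_lin t)) _; rewrite /se; ring.
Qed.

Let dse (t : R) : is_derive t 1 se (e * ce t).
Proof.
by apply: is_derive_eq (der_comp (g := fun t => e * t) (is_derive_sin (e * t)) (der_lin t)) _; rewrite /ce; ring.
Qed.

Let smooth_trig m : Ck_on setT m ce /\ Ck_on setT m se.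
Proof.
have o := @openT R; have [kc ks'] := cos_sin_smooth R m.
have cl : Ck_on setT m (fun t : R => e * t).
  by apply: Ck_onM => //; [exact: Ck_on_cst | exact: Ck_on_id].
by split; apply: Ck_on_comp.
Qed.

Let nse t := - se t.

Let trig_le1 t : [/\ `|ce t| <= 1, `|se t| <= 1 & `|nse t| <= 1].
Proof. by rewrite /nse normrN /ce /se !ler_norml cos_geN1 cos_le1 sin_geN1 sin_le1. Qed.

(** The factor [e^{i e y}] times the complex amplitude [a + i b], in real and imaginary parts. *)
Let psi : @cfield R n := fun x => \col_i Complex (bfield ce nse x i 0) (bfield se ce x i 0).

Let re_psi : re_field psi = bfield ce nse.
Proof. by apply/funext => x; apply/matrixP => i j; rewrite ord1 mxE /psi mxE. Qed.

Let im_psi : im_field psi = bfield se ce.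
Proof. by apply/funext => x; apply/matrixP => i j; rewrite ord1 mxE /psi mxE. Qed.

Let sep_bound (A B g h : R -> R) (N M : R) x : (forall t, `|A t| <= N) -> (forall t, `|B t| <= N) ->
  (forall t, `|g t| <= M) -> (forall t, `|h t| <= M) -> `|sep j0 A B g h x| <= M * N + M * N.
Proof.
by move=> hA hB hg hh; apply: le_trans (ler_normD _ _) _; rewrite !normrM; apply: lerD; apply: ler_pM.
Qed.

Let L := `|kx^-1| * (2 * K + `|kp| * (2 * K)).
Let Kge0 : 0 <= K. Proof. exact: le_trans (normr_ge0 _) (bda 0 0). Qed.
Let Lge0 : 0 <= L.
Proof. by apply: mulr_ge0 => //; apply: addr_ge0; apply: mulr_ge0 => //; apply: mulr_ge0. Qed.
(** Dominates three bounds: on the field, on its derivative in [x] and on its derivative in [y]. *)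
Let Bd := 4 * K + 2 * L + 4 * (`|e| * K).
Let eK : 0 <= `|e| * K. Proof. exact: mulr_ge0. Qed.

Lemma bfield_bounds g h g1 h1 : (forall t : R, is_derive t 1 g (g1 t)) ->
  (forall t : R, is_derive t 1 h (h1 t)) -> (forall t, `|g t| <= 1) -> (forall t, `|h t| <= 1) ->
  (forall t, `|g1 t| <= `|e|) -> (forall t, `|h1 t| <= `|e|) ->
  (forall x i, `|bfield g h x i 0| <= Bd) /\
  (forall x i j, `|pd j (fun x => bfield g h x i 0) x| <= Bd).
Proof.
move=> dg dh bg bh bg1 bh1.
have SA i t := scl_bound kx kp i t (bda 0) (bda 1).
have SB i t := scl_bound kx kp i t (bdb 0) (bdb 1).
have dA i t := dscl_bound kx kp i t (bda 0) (bda 1) (bda1 0) (bda1 1).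
have dB i t := dscl_bound kx kp i t (bdb 0) (bdb 1) (bdb1 0) (bdb1 1).
have K0 := Kge0; have L0 := Lge0; have eK0 := eK.
split=> [x i|x i j].
  rewrite mxE; apply: le_trans (sep_bound x (SA i) (SB i) bg bh) _.
  by rewrite /Bd; move: L (`|e| * K) L0 eK0 => *; lra.
rewrite bfieldE; case: (unliftP ord0 j) => [m ->|->].
  rewrite [X in `|X|](congr1 (fun f => f x) (sep_deriveS j0 (Sc a i) (Sc b i) (m : 'I_n) dg dh)) normrM.
  have h2 := sep_bound x (SA i) (SB i) bg1 bh1.
  apply: (@le_trans _ _ (1 * (`|e| * (2 * K) + `|e| * (2 * K)))).
    by apply: ler_pM => //; case: (m == j0); rewrite ?normr1 ?normr0.
  have -> : 1 * (`|e| * (2 * K) + `|e| * (2 * K)) = 4 * (`|e| * K) by ring.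
  by rewrite /Bd; move: L (`|e| * K) L0 eK0 => *; lra.
have dA' t := scl_derive kx kp i t (da 0) (da 1).
have dB' t := scl_derive kx kp i t (db 0) (db 1).
rewrite [X in `|X|](congr1 (fun f => f x) (sep_derive0 j0 g h dA' dB')); apply: le_trans (sep_bound x (dA i) (dB i) bg bh) _.
by rewrite /Bd -/L; move: L (`|e| * K) L0 eK0 => *; lra.
Qed.

Theorem bloch_spectrum : in_spectrum T (Complex lr li).
Proof.
have sc m := (smooth_trig m).1; have ss m := (smooth_trig m).2.
have sn m : Ck_on setT m nse by apply: Ck_onN => //; exact: openT.
have dn (t : R) : is_derive t 1 nse (- (e * ce t)) by exact: derN (dse t).
have der_scale (f : R -> R) d (t q : R) : is_derive t 1 f d -> is_derive t 1 (fun t => q * f t) (q * d).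
  by move=> h; apply: is_derive_eq (derM (der_cst q t 1) h) _; rewrite mul0r add0r.
have t1 t : `|ce t| <= 1 by case: (trig_le1 t).
have t2 t : `|se t| <= 1 by case: (trig_le1 t).
have t3 t : `|nse t| <= 1 by case: (trig_le1 t).
have be (f : R -> R) t : `|f t| <= 1 -> `|e * f t| <= `|e|.
  by move=> h; rewrite normrM -[leRHS]mulr1; apply: ler_wpM2l.
have beN (f : R -> R) t : `|f t| <= 1 -> `|- (e * f t)| <= `|e| by rewrite normrN; exact: be.
have [B1 B2] := bfield_bounds dce dn t1 t3 (fun t => beN _ _ (t2 t)) (fun t => beN _ _ (t1 t)).
have [B3 B4] := bfield_bounds dse dce t2 t1 (fun t => be _ _ (t1 t)) (fun t => beN _ _ (t2 t)).
have ddc (t : R) : is_derive t 1 (fun t => - (e * se t)) (- (e ^+ 2 * ce t)).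
  by apply: is_derive_eq (derN (der_scale _ _ t e (dse t))) _; ring.
have dds (t : R) : is_derive t 1 (fun t => e * ce t) (- (e ^+ 2 * se t)).
  by apply: is_derive_eq (der_scale _ _ t e (dce t)) _; ring.
have ddn (t : R) : is_derive t 1 (fun t => - (e * ce t)) (- (e ^+ 2 * nse t)).
  by apply: is_derive_eq (derN (der_scale _ _ t e (dce t))) _; rewrite /nse; ring.
have H1 x i := hess_bfield x i sc sn dce dn ddc ddn.
have H2 x i := hess_bfield x i ss sc dse dce dds ddc.
have JH (v : 'cV[R]_2) (P : 'I_2 -> R) : (forall i, v i 0 = sel i (- P 1) (P 0)) ->
    forall i, (Jmx *m v) i 0 = P i.
  by move=> h i; case: (ord2P i) => ->; rewrite ?JmxE0 ?JmxE1 h /sel /= ?opprK.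
have eig x : T psi x = Complex lr li *: psi x.
  apply/matrixP => i j; rewrite ord1 [RHS]mxE.
  have -> : T psi x i 0 = Complex (sep j0 (Sc reL i) (Sc imL i) ce nse x)
      (sep j0 (Sc reL i) (Sc imL i) se ce x).
    rewrite /complexify re_psi im_psi; apply: (etrans (mxE _ _ _ _)).
    have E1 := JH _ (fun i => sep j0 (Sc reL i) (Sc imL i) ce nse x) (H1 x) i.
    have E2 := JH _ (fun i => sep j0 (Sc reL i) (Sc imL i) se ce x) (H2 x) i.
    exact: (congr2 (@Complex R) E1 E2).
  rewrite /psi !mxE; apply: complexP; rewrite /= /sep /nse /scl /reL /imL;
    case: (ord2P i) => ->; rewrite /rot /sel /=; ring.
apply: (@eigenfunction_spectrum R n k k1 k2 W W1 W2 om c dk dk1 dW dW1 ck2 cW2 kx kp U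
  profile_smooth perU psi (Complex lr li) Bd lo (s1 * kx) (s2 * kx)).
- by rewrite re_psi; exact: bfield_smooth.
- by rewrite im_psi; exact: bfield_smooth.
- by rewrite re_psi.
- by rewrite im_psi.
- by rewrite re_psi.
- by rewrite im_psi.
- exact: eig.
- exact: lo0.
- by apply: mulr_ge0 => //; exact: ltW.
- by rewrite ltr_pM2r.
move=> x /andP[x1 x2].
(* The factor [e^{i e y}] has modulus 1 and rotations preserve norms, so that the size of [psi] is
   that of the amplitude at [x / kx]. *)
have hs : s1 <= x 0 ord0 / kx <= s2 by rewrite ler_pdivlMr // ler_pdivrMr // x1.
apply: le_trans (low hs) _; rewrite -!(scl_sqr kx kp) le_eqVlt; apply/orP; left; apply/eqP.
rewrite /sqm sum2 /psi !mxE /= /sep /nse -[LHS]mul1r -(cos2Dsin2 (e * y x)) -/(ce _) -/(se _).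
by move: (Sc a 0 _) (Sc a 1 _) (Sc b 0 _) (Sc b 1 _) => *; ring.
Qed.

End BlochField.

Ltac ckE := lazymatch goal with
  | |- Ck_on setT _ (fun x => (@?f x + @?g x)%R) => notypeclasses refine (Ck_onD (@openT _) _ _); ckE
  | |- Ck_on setT _ (fun x => (@?f x * @?g x)%R) => notypeclasses refine (Ck_onM (@openT _) _ _); ckE
  | |- Ck_on setT _ (fun x => (- @?f x)%R) => notypeclasses refine (Ck_onN (@openT _) _); ckE
  | _ => first [assumption | exact: (Ck_on_cst _ _ (@openT _))]
  end.

(** * Regularity and bounds for the amplitude of the mode *)

Section Amplitude.
Context {R : realType}.
Local Notation C := R[i].
Variables (k k1 k2 W1 W2 : R -> R) (om c : R).
Hypothesis sk : forall m, Ck_on setT m k.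
Hypothesis sk1 : forall m, Ck_on setT m k1.
Hypothesis sk2 : forall m, Ck_on setT m k2.
Hypothesis sW1 : forall m, Ck_on setT m W1.
Hypothesis sW2 : forall m, Ck_on setT m W2.
Variables (u0 u1 p0 p1 q0 q1 : R -> R).
Hypothesis su0 : forall m, Ck_on setT m u0.
Hypothesis su1 : forall m, Ck_on setT m u1.
Hypothesis du0 : forall x : R, is_derive x 1 u0 (p0 x).
Hypothesis du1 : forall x : R, is_derive x 1 u1 (p1 x).
Hypothesis dp0 : forall x : R, is_derive x 1 p0 (q0 x).
Hypothesis dp1 : forall x : R, is_derive x 1 p1 (q1 x).
Hypothesis k_gt0 : forall s, 0 <= s -> 0 < k s.

Local Notation M := (Mmx k k1 k2 W1 W2 om c u0 u1 p0 p1 q0 q1).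
Local Notation N := (Nmx k u0 u1).
Local Notation ks x := (k (msq u0 u1 x)).
Local Notation l0 i j x := (lop0 k k1 k2 W1 W2 om c u0 u1 p0 p1 q0 q1 i j x).

Let smooth_der (f g : R -> R) : (forall m, Ck_on setT m f) -> (forall x : R, is_derive x 1 f (g x)) ->
  forall m, Ck_on setT m g.
Proof.
move=> sf df m; have -> : g = 'D_1 f by apply/funext => x; rewrite (@derive_val _ _ _ _ _ _ _ (df x)).
exact: Ck_on_derive (sf m.+1).
Qed.

Let sp0 m : Ck_on setT m p0. Proof. exact: smooth_der su0 du0 m. Qed.
Let sp1 m : Ck_on setT m p1. Proof. exact: smooth_der su1 du1 m. Qed.
Let sq0 m : Ck_on setT m q0. Proof. exact: smooth_der sp0 dp0 m. Qed.
Let sq1 m : Ck_on setT m q1. Proof. exact: smooth_der sp1 dp1 m. Qed.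

Let smsq m : Ck_on setT m (msq u0 u1).
Proof. by have a := su0 m; have b := su1 m; rewrite /msq; ckE. Qed.

Let scomp (f : R -> R) : (forall m, Ck_on setT m f) -> forall m, Ck_on setT m (fun x => f (msq u0 u1 x)).
Proof. by move=> sf m; exact: (Ck_on_comp (@openT _) (sf m) (smsq m)). Qed.

Let ks_gt0 x : 0 < ks x.
Proof. by apply: k_gt0; rewrite /msq -!expr2 addr_ge0 // sqr_ge0. Qed.

Let skV m : Ck_on setT m (fun x => (ks x)^-1).
Proof. by apply: Ck_onV; [exact: openT | move=> x _; exact: lt0r_neq0 | exact: scomp]. Qed.

Lemma lop0_smooth i j m : Ck_on setT m (fun x => l0 i j x).
Proof.
have a0 := su0 m; have a1 := su1 m; have b0 := sp0 m; have b1 := sp1 m.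
have c0 := sq0 m; have c1 := sq1 m; have e0 := scomp sk m; have e1 := scomp sk1 m.
have e2 := scomp sk2 m; have f1 := scomp sW1 m; have f2 := scomp sW2 m.
by case: (ord2P i) => ->; rewrite /lop0 /lop /lform /sel /= -/(msq u0 u1); ckE.
Qed.

Lemma Mmx_smooth i j m : Ck_on setT m (M i j).
Proof.
case: i => -[|[|[|[|//]]]] hi; case: j => -[|[|[|[|//]]]] hj; rewrite /Mmx /ent /=;
  first [exact: (Ck_on_cst _ _ (@openT _))
        | apply: Ck_onM; [exact: openT | exact: lop0_smooth | exact: skV]].
Qed.

Lemma Nmx_smooth i j m : Ck_on setT m (N i j).
Proof.
have cV := skV m.
by case: i => -[|[|[|[|//]]]] hi; case: j => -[|[|[|[|//]]]] hj; rewrite /Nmx /ent /=; ckE.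
Qed.

Lemma Emx_smooth i j m : Ck_on setT m (@Emx R i j).
Proof.
by case: i => -[|[|[|[|//]]]] hi; case: j => -[|[|[|[|//]]]] hj; rewrite /Emx /ent /=; ckE.
Qed.

Variables (e : R) (z : C) (y : 'I_4 -> R -> C).
Hypothesis soly : is_sol M N (@Emx R) e z y.

Let Yr i x := complex.Re (y i x).
Let Yi i x := complex.Im (y i x).
Let P i m x := M i m x + e * complex.Re z * N i m x + e ^+ 2 * Emx i m x.
Let Q i m x := e * complex.Im z * N i m x.
Definition dre i x : R := \sum_m (P i m x * Yr m x - Q i m x * Yi m x).
Definition dim i x : R := \sum_m (P i m x * Yi m x + Q i m x * Yr m x).

Let sysE i m x : complex.Re (sys M N (@Emx R) e z i m x) = P i m x /\
  complex.Im (sys M N (@Emx R) e z i m x) = Q i m x.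
Proof.
rewrite /sys /P /Q; move: (M i m x) (N i m x) (Emx i m x) => a b d.
by case: z => zr zi /=; split; ring.
Qed.

Let Re_sum (F : 'I_4 -> C) : complex.Re (\sum_m F m) = \sum_m complex.Re (F m).
Proof. exact: raddf_sum. Qed.

Let Im_sum (F : 'I_4 -> C) : complex.Im (\sum_m F m) = \sum_m complex.Im (F m).
Proof. exact: raddf_sum. Qed.

Lemma sol_re i (x : R) : is_derive x 1 (Yr i) (dre i x).
Proof.
have [h _] := soly i x; apply: is_derive_eq h _; rewrite Re_sum; apply: eq_bigr => m _.
have [<- <-] := sysE i m x; rewrite /Yr /Yi.
by case: (sys _ _ _ _ _ _ _ _) (y m x) => a b [].
Qed.

Lemma sol_im i (x : R) : is_derive x 1 (Yi i) (dim i x).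
Proof.
have [_ h] := soly i x; apply: is_derive_eq h _; rewrite Im_sum; apply: eq_bigr => m _.
have [<- <-] := sysE i m x; rewrite /Yr /Yi.
by case: (sys _ _ _ _ _ _ _ _) (y m x) => a b [].
Qed.

(** Bootstrap: the right hand side of the system is as regular as the solution. *)
Lemma sol_smooth m : (forall i, Ck_on setT m (Yr i)) /\ (forall i, Ck_on setT m (Yi i)).
Proof.
have sP m' i j : Ck_on setT m' (P i j).
  by have h1 := Mmx_smooth i j m'; have h2 := Nmx_smooth i j m'; have h3 := @Emx_smooth i j m'; rewrite /P; ckE.
have sQ m' i j : Ck_on setT m' (Q i j).
  by have h2 := Nmx_smooth i j m'; rewrite /Q; ckE.
elim: m => [|m [IHr IHi]].
  by split=> i; split => // x _; [exact: is_derive1_continuous (sol_re i x) | exact: is_derive1_continuous (sol_im i x)].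
split=> i; [apply: (@Ck_on1_intro _ _ _ (dre i)) => //; first exact: sol_re
           |apply: (@Ck_on1_intro _ _ _ (dim i)) => //; first exact: sol_im].
  by apply: Ck_on_sum => [|j]; [exact: openT|]; have h1 := sP m i j; have h2 := sQ m i j;
    have h3 := IHr j; have h4 := IHi j; ckE.
by apply: Ck_on_sum => [|j]; [exact: openT|]; have h1 := sP m i j; have h2 := sQ m i j;
  have h3 := IHr j; have h4 := IHi j; ckE.
Qed.

(** The indices are written in the form produced by [big_ord_recl]. *)
Let o0 : 'I_4 := ord0.
Let o1 : 'I_4 := lift ord0 ord0.
Let o2 : 'I_4 := lift ord0 (lift ord0 ord0).
Let o3 : 'I_4 := lift ord0 (lift ord0 (lift ord0 ord0)).

Let oi (i : 'I_2) : 'I_4 := if i == 0 then o0 else o1.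
Let oi1 (i : 'I_2) : 'I_4 := if i == 0 then o2 else o3.

Definition amp_re i := Yr (oi i).
Definition amp_im i := Yi (oi i).
Definition amp_re1 i := Yr (oi1 i).
Definition amp_im1 i := Yi (oi1 i).
Definition amp_re2 i := dre (oi1 i).
Definition amp_im2 i := dim (oi1 i).

Lemma amp_derive i (x : R) : [/\ is_derive x 1 (amp_re i) (amp_re1 i x),
  is_derive x 1 (amp_im i) (amp_im1 i x), is_derive x 1 (amp_re1 i) (amp_re2 i x)
  & is_derive x 1 (amp_im1 i) (amp_im2 i x)].
Proof.
have e1 j : dre (oi j) x = amp_re1 j x.
  by case: (ord2P j) => ->; rewrite /dre !big_ord_recl big_ord0 /P /Q /Mmx /Nmx /Emx /ent /= /amp_re1 /oi1 /=;
    rewrite !mulr0 !mul0r !addr0 !subr0 ?mul0r ?add0r ?mul1r ?addr0.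
have e2 j : dim (oi j) x = amp_im1 j x.
  by case: (ord2P j) => ->; rewrite /dim !big_ord_recl big_ord0 /P /Q /Mmx /Nmx /Emx /ent /= /amp_im1 /oi1 /=;
    rewrite !mulr0 !mul0r !addr0 ?mul0r ?add0r ?mul1r ?addr0.
split.
- by apply: is_derive_eq (sol_re (oi i) x) _.
- by apply: is_derive_eq (sol_im (oi i) x) _.
- exact: sol_re.
- exact: sol_im.
Qed.

Local Notation op f f1 f2 i x :=
  (lop k k1 k2 W1 W2 om c u0 u1 p0 p1 q0 q1 i x (f 0 x) (f 1 x) (f1 0 x) (f1 1 x) (f2 0 x) (f2 1 x)).

Let lr := e * complex.Re z.
Let li := e * complex.Im z.

(** The reduction to first order is undone: multiplied by [k], the last two rows of the system are
    the second-order equation. *)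
Lemma amp_eq i x :
  op amp_re amp_re1 amp_re2 i x = sel i (- reL amp_re amp_im lr li 1 x) (reL amp_re amp_im lr li 0 x)
    - ks x * e ^+ 2 * amp_re i x /\
  op amp_im amp_im1 amp_im2 i x = sel i (- imL amp_re amp_im lr li 1 x) (imL amp_re amp_im lr li 0 x)
    - ks x * e ^+ 2 * amp_im i x.
Proof.
have kn : ks x != 0 by exact: lt0r_neq0.
rewrite !lop_lin /amp_re2 /amp_im2 /dre /dim /reL /imL /amp_re /amp_im /amp_re1 /amp_im1.
case: (ord2P i) => ->; rewrite /sel /= !big_ord_recl !big_ord0 /P /Q /Mmx /Nmx /Emx /ent /=
  /lr /li /oi /oi1 /= -/o0 -/o1 -/o2 -/o3.
  move: (l0 0 0 x) (l0 0 1 x) (l0 0 2 x) (l0 0 3 x) (ks x) kn (Yr o0 x) (Yr o1 x) (Yr o2 x) (Yr o3 x)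
    (Yi o0 x) (Yi o1 x) (Yi o2 x) (Yi o3 x) (complex.Re z) (complex.Im z) => ? ? ? ? kk kkn *.
  by split; field.
move: (l0 1 0 x) (l0 1 1 x) (l0 1 2 x) (l0 1 3 x) (ks x) kn (Yr o0 x) (Yr o1 x) (Yr o2 x) (Yr o3 x)
    (Yi o0 x) (Yi o1 x) (Yi o2 x) (Yi o3 x) (complex.Re z) (complex.Im z) => ? ? ? ? kk kkn *.
by split; field.
Qed.

Variables (X xi : R) (mu : C).
Hypothesis X0 : 0 < X.
Hypothesis mu1 : cabs mu = 1.
Hypothesis quasi : forall i x, y i (x + X) = mu * \sum_m (Rot (cos xi) (sin xi) i m)%:C%C * y m x.

Let rho i x := Yr i x ^+ 2 + Yi i x ^+ 2.

(** The multiplier has modulus 1, and the rotation acts orthogonally on [w] and on [w']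
    separately. *)
Lemma modulus_periodic x :
  rho o0 (x + X) + rho o1 (x + X) = rho o0 x + rho o1 x /\
  rho o2 (x + X) + rho o3 (x + X) = rho o2 x + rho o3 x.
Proof.
have cs := cos2Dsin2 xi; rewrite /rho /Yr /Yi !quasi !big_ord_recl !big_ord0 /Rot /ent /= -/o0 -/o1 -/o2 -/o3.
have mm : complex.Re mu ^+ 2 + complex.Im mu ^+ 2 = 1.
  have := mu1; rewrite /cabs; case: mu => [mr mi] /= h.
  by rewrite -[LHS]sqr_sqrtr ?addr_ge0 ?sqr_ge0 // h expr1n.
case: (y o0 x) (y o1 x) (y o2 x) (y o3 x) mm => [a a'] [b b'] [d d'] [f f'] /=.
case: mu => [mr mi] /= mm.
by split; rewrite -[RHS]mul1r -mm -[RHS]mul1r -cs; ring.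
Qed.

Lemma amp_bounded : exists K, forall i x,
  [/\ `|amp_re i x| <= K, `|amp_im i x| <= K, `|amp_re1 i x| <= K & `|amp_im1 i x| <= K].
Proof.
have cY i : continuous (Yr i) by move=> x; exact: is_derive1_continuous (sol_re i x).
have cZ i : continuous (Yi i) by move=> x; exact: is_derive1_continuous (sol_im i x).
pose S x := (rho o0 x + rho o1 x) + (rho o2 x + rho o3 x).
have cS : continuous S.
  have h0 := cY o0; have h1 := cY o1; have h2 := cY o2; have h3 := cY o3.
  have g0 := cZ o0; have g1 := cZ o1; have g2 := cZ o2; have g3 := cZ o3.
  have : continuous (fun x => Yr o0 x * Yr o0 x + Yi o0 x * Yi o0 x + (Yr o1 x * Yr o1 x + Yi o1 x * Yi o1 x)
    + (Yr o2 x * Yr o2 x + Yi o2 x * Yi o2 x + (Yr o3 x * Yr o3 x + Yi o3 x * Yi o3 x))) by contE.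
  by [].
have pS x : S (x + X) = S x by rewrite /S; have [-> ->] := modulus_periodic x.
have [K K0 hK] := periodic_bounded X0 cS pS.
(* From [t^2 <= K] follows [|t| <= K + 1], without square roots. *)
exists (K + 1).
have r0 i x : 0 <= rho i x by apply: addr_ge0; exact: sqr_ge0.
have rS i x : rho i x <= K.
  apply: le_trans (hK x); apply: le_trans (ler_norm _).
  have := r0 o0 x; have := r0 o1 x; have := r0 o2 x; have := r0 o3 x.
  have : i \in [:: o0; o1; o2; o3] by case: i => -[|[|[|[|//]]]] hi; rewrite !inE -!val_eqE.
  rewrite /S !inE => /or4P[] /eqP ->; move: (rho o0 x) (rho o1 x) (rho o2 x) (rho o3 x) => *; lra.
have b (t s : R) : t ^+ 2 <= K -> `|t| <= K + 1.
  move=> h; case: (leP `|t| 1) => h1; first by apply: le_trans h1 _; rewrite lerDr.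
  have : `|t| <= t ^+ 2 by rewrite -real_normK ?num_real // expr2 ler_peMl // ltW.
  by move=> h2; apply: le_trans h2 _; apply: le_trans h _; rewrite lerDl.
have br i x : `|Yr i x| <= K + 1.
  by apply: (b _ 0); apply: le_trans (rS i x); rewrite lerDl sqr_ge0.
have bi i x : `|Yi i x| <= K + 1.
  by apply: (b _ 0); apply: le_trans (rS i x); rewrite lerDr sqr_ge0.
by move=> i x; split; [exact: br | exact: bi | exact: br | exact: bi].
Qed.

Hypothesis y0 : exists i, y i 0 != 0.

(** If the first two components vanished identically, so would their derivatives, which are the
    other two, contrary to [y0]. Positivity at one point extends to an interval by continuity. *)
Lemma amp_lower : exists lo s1 s2, [/\ 0 < lo, 0 <= s1, s1 < s2 &
  forall x, s1 <= x <= s2 ->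
    lo <= amp_re 0 x ^+ 2 + amp_re 1 x ^+ 2 + (amp_im 0 x ^+ 2 + amp_im 1 x ^+ 2)].
Proof.
pose G x := rho o0 x + rho o1 x.
have GE x : amp_re 0 x ^+ 2 + amp_re 1 x ^+ 2 + (amp_im 0 x ^+ 2 + amp_im 1 x ^+ 2) = G x.
  by rewrite /G /rho /amp_re /amp_im /oi /=; move: (Yr _ x) (Yr _ x) (Yi _ x) (Yi _ x) => *; ring.
have G0 x : 0 <= G x by rewrite /G /rho; apply: addr_ge0; apply: addr_ge0; exact: sqr_ge0.
have [x0 Gx0] : exists x, 0 < G x.
  apply: contrapT => hn; have {}hn x : G x = 0.
    by apply/eqP; rewrite eq_le G0 andbT leNgt; apply/negP => h; apply: hn; exists x.
  have v0 i x : amp_re i x = 0 /\ amp_im i x = 0.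
    have := hn x; rewrite -GE => /eqP; rewrite !paddr_eq0 ?addr_ge0 ?sqr_ge0 // !sqrf_eq0.
    move=> /andP[/andP[/eqP h1 /eqP h2] /andP[/eqP h3 /eqP h4]].
    by case: (ord2P i) => ->.
  have v1 i x : amp_re1 i x = 0 /\ amp_im1 i x = 0.
    have [d1 d2 _ _] := amp_derive i x.
    split; [apply: is_derive_unique d1 _ | apply: is_derive_unique d2 _];
      apply: (is_derive_ext _ (der_cst 0 x 1)) => t; by have [] := v0 i t.
  have [i /eqP] := y0; apply; apply: complexP => /=.
    case: i => -[|[|[|[|//]]]] hi.
    - by have [h _] := v0 0 0; rewrite -[RHS]h /amp_re /oi /= /Yr; congr (complex.Re (y _ _)); exact/val_inj.
    - by have [h _] := v0 1 0; rewrite -[RHS]h /amp_re /oi /= /Yr; congr (complex.Re (y _ _)); exact/val_inj.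
    - by have [h _] := v1 0 0; rewrite -[RHS]h /amp_re1 /oi1 /= /Yr; congr (complex.Re (y _ _)); exact/val_inj.
    - by have [h _] := v1 1 0; rewrite -[RHS]h /amp_re1 /oi1 /= /Yr; congr (complex.Re (y _ _)); exact/val_inj.
  case: i => -[|[|[|[|//]]]] hi.
  - by have [_ h] := v0 0 0; rewrite -[RHS]h /amp_im /oi /= /Yi; congr (complex.Im (y _ _)); exact/val_inj.
  - by have [_ h] := v0 1 0; rewrite -[RHS]h /amp_im /oi /= /Yi; congr (complex.Im (y _ _)); exact/val_inj.
  - by have [_ h] := v1 0 0; rewrite -[RHS]h /amp_im1 /oi1 /= /Yi; congr (complex.Im (y _ _)); exact/val_inj.
  - by have [_ h] := v1 1 0; rewrite -[RHS]h /amp_im1 /oi1 /= /Yi; congr (complex.Im (y _ _)); exact/val_inj.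
have pG (m : nat) x : G (x + m%:R * X) = G x.
  elim: m x => [|m IH] x; first by rewrite mul0r addr0.
  by rewrite -natr1 mulrDl mul1r addrA -[RHS]IH /G; have [] := modulus_periodic (x + m%:R * X).
pose m := Num.bound (`|x0| / X).
have hm : `|x0| < m%:R * X.
  by rewrite -ltr_pdivrMr //; apply: archi_boundP; apply: divr_ge0 => //; exact: ltW.
(* Moved by periods to the right of 0, as the cutoff functions equal 1 only for nonnegative
   coordinates. *)
pose x1 := x0 + m%:R * X.
have x10 : 0 <= x1.
  have := ler_norm (- x0); rewrite normrN /x1; move: (m%:R * X) hm => h *; lra.
have Gx1 : 0 < G x1 by rewrite pG.
have cG : {for x1, continuous G}.
  have h0 := is_derive1_continuous (sol_re o0 x1); have h1 := is_derive1_continuous (sol_re o1 x1).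
  have g0 := is_derive1_continuous (sol_im o0 x1); have g1 := is_derive1_continuous (sol_im o1 x1).
  have : {for x1, continuous (fun x => Yr o0 x * Yr o0 x + Yi o0 x * Yi o0 x
      + (Yr o1 x * Yr o1 x + Yi o1 x * Yi o1 x))}.
    by apply: ctpD; apply: ctpD; apply: ctpM.
  by [].
have : \forall t \near x1, G x1 / 2 < G t.
  apply: (cvgr_gt (G x1) cG); by rewrite ltr_pdivrMr // mulr_natr mulr2n ltrDl.
move=> [d /= d0 hd]; exists (G x1 / 2), x1, (x1 + d / 2); split => //.
- exact: divr_gt0.
- by rewrite ltrDl divr_gt0.
move=> x /andP[h1 h2]; rewrite GE; apply: ltW; apply: hd => /=.
rewrite distrC ger0_norm ?subr_ge0 //; move: h2; lra.
Qed.

End Amplitude.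

Lemma scaled_density_extension (R : realType) n (kappa Wp k W : R -> R) om c kx kp :
  (forall s, 0 <= s -> kappa s = k s) -> (forall s, 0 <= s -> Wp s = W s) ->
  @scaled_density R n kappa Wp om c kx kp = @scaled_density R n k W om c kx kp.
Proof.
move=> kE WE; apply/funext => U; apply/funext => P.
by rewrite /scaled_density /H0 kE ?WE ?sqn_ge0.
Qed.

Section ScaledProfile.
Context {R : realType}.
Variables (V : R -> 'cV[R]_2) (X xi : R).
Hypothesis X0 : 0 < X.
Hypothesis VX : forall x, V (x + X) = expJ xi *m V x.

Lemma scaled_profileE (kx kp t : R) i :
  scaled_profile V kx kp t i 0 = scl kx kp (fun y => V y 0 0) (fun y => V y 1 0) i t.
Proof. by case: (ord2P i) => ->; [exact: expJ0 | exact: expJ1]. Qed.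

Lemma scaled_profile_periodic t :
  scaled_profile V X^-1 (xi / X) (t + 1) = scaled_profile V X^-1 (xi / X) t.
Proof.
have Xn : X != 0 by exact: lt0r_neq0.
have et : (t + 1) / X^-1 = t / X^-1 + X by rewrite invrK mulrDl mul1r.
have ep : phase X^-1 (xi / X) (t + 1) = phase X^-1 (xi / X) t - xi.
  by rewrite /phase et; field.
have cs := cos2Dsin2 xi.
apply/matrixP => i j; rewrite ord1 !scaled_profileE /scl ep et !VX !expJ0 !expJ1 cosB sinB.
by case: (ord2P i) => ->; rewrite /rot /sel /= -[RHS]mul1r -cs; ring.
Qed.

End ScaledProfile.

Theorem proposition5p5 (R : realType) (n : nat) (hd : (2 <= n.+1)%N)
  (kappa W : R -> R)
  (smooth_kappa : smooth_half_line kappa) (smooth_W : smooth_half_line W)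
  (kappa_pos : exists2 kappa0 : R, 0 < kappa0 &
                 forall s, 0 <= s -> kappa0 <= kappa s)
  (omega c muphi mux : R) (V : R -> 'cV[R]_2) (X xi : R)
  (profileV : is_profile kappa W omega c V X xi)
  (constantsV : has_constants kappa W omega c muphi mux V)
  (nonconstV : nonconstant_modulus V)
  (D : set 'rV[R]_4) (Vf : 'rV[R]_4 -> R -> 'cV[R]_2) (Xf xif : 'rV[R]_4 -> R)
  (family : smooth_profile_family kappa W D Vf Xf xif)
  (D_params : D (params omega c muphi mux))
  (Vf_params : Vf (params omega c muphi mux) = V)
  (delta : nat -> nat -> nat -> R)
  (delta_def : Delta0_coefficients
     (Sigma_t Vf Xf xif (params omega c muphi mux)) (Sigma_y kappa V X) delta)
  (delta400 : delta 4%N 0%N 0%N != 0)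
  (discr : delta 3%N 0%N 1%N ^+ 2 = 4 * delta 4%N 0%N 0%N * delta 2%N 0%N 2%N)
  (nondeg : delta 2%N 1%N 1%N * delta 4%N 0%N 0%N
            - 2^-1 * delta 3%N 1%N 0%N * delta 3%N 0%N 1%N != 0) :
  spectrally_unstable n kappa W omega c V X xi.
Proof.
have [k sk kE] := smooth_kappa; have [W0 sW WE] := smooth_W.
have [k1 sk1 dk] := smooth_derive1 sk; have [k2 sk2 dk1] := smooth_derive1 sk1.
have [W1 sW1 dW] := smooth_derive1 sW; have [W2 sW2 dW1] := smooth_derive1 sW1.
have ck2 : continuous k2 by move=> s; exact: (Ck_on_continuous (sk2 0%N) (I : setT s)).
have cW2 : continuous W2 by move=> s; exact: (Ck_on_continuous (sW2 0%N) (I : setT s)).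
have k_gt0 s : 0 <= s -> 0 < k s.
  by have [a a0 h] := kappa_pos; move=> s0; rewrite -kE //; apply: lt_le_trans a0 (h s s0).
have [p0 [p1 [q0 [q1 [du0 du1 dp0 dp1 [e [z [y [mu [e01 z0 soly y0 [mu1 quasi]]]]]]]]]]] :=
  profile_bloch_mode kE WE dk dk1 dW dW1 ck2 cW2 k_gt0 profileV nonconstV family D_params
    Vf_params delta_def delta400 discr nondeg.
have [sV _ X0 VX _] := profileV.
have su i m : Ck_on setT m (fun x => V x i 0).
  by have := sV m; rewrite Ck_on_mxP; [apply | exact: openT].
have [K hK] := amp_bounded soly X0 mu1 quasi.
have [lo [s1 [s2 [lo0 s10 s12 low]]]] := amp_lower soly X0 mu1 quasi y0.
have kx0 : 0 < X^-1 by rewrite invr_gt0.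
(* A transverse direction for the oscillation exists because the dimension is at least 2. *)
have j0 : 'I_n by exists 0%N; rewrite -ltnS.
exists (Complex (e * complex.Re z) (e * complex.Im z)); split.
  by rewrite /=; apply: mulr_gt0 => //; case/andP: e01.
rewrite /lin_op (scaled_density_extension n omega c _ _ kE WE).
have ad := amp_derive soly.
have aq := @amp_eq R k k1 k2 W1 W2 omega c (fun x => V x 0 0) (fun x => V x 1 0) p0 p1 q0 q1 k_gt0 e z y.
have sy m := sol_smooth sk sk1 sk2 sW1 sW2 (su 0) (su 1) du0 du1 dp0 dp1 k_gt0 soly m.
apply: (@bloch_spectrum R n k k1 k2 W0 W1 W2 omega c dk dk1 dW dW1 ck2 cW2 X^-1 (xi / X)
  (scaled_profile V X^-1 (xi / X)) kx0 (scaled_profile_periodic X0 VX)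
  (fun x => V x 0 0) (fun x => V x 1 0) p0 p1 q0 q1 (scaled_profileE V X^-1 (xi / X))
  du0 du1 dp0 dp1 (su 0) (su 1) (amp_re y) (amp_im y) (amp_re1 y) (amp_im1 y)
  _ _ e (e * complex.Re z) (e * complex.Im z) K
  (fun i x => let: And4 h _ _ _ := ad i x in h) (fun i x => let: And4 _ h _ _ := ad i x in h)
  (fun i x => let: And4 _ _ h _ := ad i x in h) (fun i x => let: And4 _ _ _ h := ad i x in h)
  (fun i m => (sy m).1 _) (fun i m => (sy m).2 _) (fun i x => (aq i x).1) (fun i x => (aq i x).2)
  _ _ _ _ j0 lo s1 s2 lo0 s10 s12 low) => i x; by have [] := hK i x.
Qed.
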